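(* Let $\mathbf{k}$ be an algebraically closed field of characteristic $p>2$. For $1\le k\le\frac{p-1}{2}$ let $S_k\in\mathrm{Ver}_p$ be the image of the spin representation of $\mathrm{Spin}(2k-1)$ under the fiber functor $\mathrm{Ver}_p(\mathrm{Spin}(2k-1))\to\mathrm{Ver}_p$ (if $k=1$, then $\mathrm{Spin}(2k-1)=1$ and $S_k=\mathbf{1}$). Then for each $1\le k\le\frac{p-1}{2}$ the Weyl algebra $A(L_{p-2k+1})=A_\psi(L_{2k-1})$ is isomorphic to the queer algebra $Q(S_k)$.
   Context: $\mathrm{Ver}_p$ is the Verlinde category, i.e. the semisimplification (quotient by negligible morphisms) of the category of tilting modules for $SL(2)$ over $\mathbf{k}$; it is a symmetric fusion category with simple objects $L_1=\mathbf{1},\dots,L_{p-1}$, where $L_i$ is the image of the $i$-dimensional simple module with highest weight $i-1$. Put $\psi=L_{p-1}$; it is invertible with $\psi\otimes\psi\cong\mathbf{1}$ (fix such an identification $\alpha$), $c_{\psi,\psi}=-\mathrm{id}$, and $L_i\otimes\psi\cong L_{p-i}$. Each $L_i$ carries a non-degenerate bilinear form, unique up to scaling, which is skew-symmetric for $i$ even and symmetric for $i$ odd. For a simply connected simple group $G$ (with Coxeter number less than $p$), $\mathrm{Ver}_p(G)$ is the semisimplification of the category of tilting modules for $G$, and the fiber functor $\mathrm{Ver}_p(G)\to\mathrm{Ver}_p$ is given by restriction along the principal homomorphism $SL(2)\to G$ followed by semisimplification. For an object $V$ with form $B:V\otimes V\to\mathbf{1}$, $A(V)$ is the quotient of the tensor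 algebra $T(V)$ by the two-sided ideal generated by the image of $(\mathrm{id}-c_{V,V})-B$ if $B$ is skew-symmetric (Weyl algebra), or of $(\mathrm{id}+c_{V,V})-B$ if $B$ is symmetric (Clifford algebra). Let $A(V)=A_+(V)\oplus A_-(V)$ be its decomposition into $\pm1$-eigenobjects of the automorphism induced by $-\mathrm{Id}_V$, and let $A_\psi(V)=A_+(V)\oplus A_-(V)\otimes\psi$, with multiplication induced by that of $A(V)$, the braiding and $\alpha$; one has $A(V\otimes\psi)\cong A_\psi(V)$, where $V\otimes\psi$ carries the form induced by $B$ and $\alpha$. The queer algebra $Q(V)$, $V\in\mathrm{Ver}_p$, is the image of the embedding $$\underline{\operatorname{End}}(V)\oplus\underline{\operatorname{Hom}}(V,V\otimes\psi)\hookrightarrow\underline{\operatorname{End}}(V\oplus V\otimes\psi)$$ given by the schematic formula $(A,C)\mapsto\begin{pmatrix}A&C\\C&A\end{pmatrix}$, where $C:V\to V\otimes\psi$ is also regarded as a map $V\otimes\psi\to V$ using $\alpha$. In particular $Q(\mathbf{1})=\mathbf{1}\oplus\psi$ and $Q(V)\cong\underline{\operatorname{End}}(V)\otimes Q(\mathbf{1})$. *)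

(* Defs.v *)
From HB Require Import structures.
From mathcomp Require Import all_boot all_order all_algebra.
From mathcomp Require Import mpoly mxtens.

Set Implicit Arguments.
Unset Strict Implicit.
Unset Printing Implicit Defensive.

Import GRing.Theory.
Local Open Scope ring_scope.

(* Matrices act on column vectors: the composite of f : X -> Y and then
   g : Y -> Z is g *m f.  The tensor product is the Kronecker product *t.
   Over an algebraically closed field the reduced group SL(2) is its group of
   points, the matrices of determinant 1. *)

Section Representations.
Variable K : closedFieldType.

Definition regular_fun (f : 'M[K]_2 -> K) : Prop :=
  exists P : {mpoly K[2 * 2]},
    forall g, \det g = 1 -> f g = P.@[fun l => mxvec g 0 l].

Definition rational n (rho : 'M[K]_2 -> 'M[K]_n) : Prop :=
  [/\ rho 1 = 1%:M,
      forall g h, \det g = 1 -> \det h = 1 -> rho (g * h) = rho g *m rho h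
    & forall i j, regular_fun (fun g => rho g i j)].

Record rep := Rep {
  rep_dim : nat;
  rep_act : 'M[K]_2 -> 'M[K]_rep_dim;
  actP : rational rep_act }.

Definition is_equivariant (X Y : rep) (f : 'M[K]_(rep_dim Y, rep_dim X)) : Prop :=
  forall g, \det g = 1 -> f *m rep_act X g = rep_act Y g *m f.

Record rep_hom (X Y : rep) := RepHom {
  hom_mx :> 'M[K]_(rep_dim Y, rep_dim X);
  homP : is_equivariant hom_mx }.

Lemma regular_ext f1 f2 :
  (forall g, \det g = 1 -> f1 g = f2 g) -> regular_fun f1 -> regular_fun f2.
Proof. by move=> E [P HP]; exists P => g dg; rewrite -E ?HP. Qed.

Lemma regular_cst c : regular_fun (fun => c).
Proof. by exists c%:MP => g _; rewrite mevalC. Qed.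

Lemma regularM f1 f2 :
  regular_fun f1 -> regular_fun f2 -> regular_fun (fun g => f1 g * f2 g).
Proof.
by case=> [P HP] [Q HQ]; exists (P * Q) => g dg; rewrite mevalM HP ?HQ.
Qed.

Lemma det2 (g : 'M[K]_2) : \det g = g 0 0 * g 1 1 - g 0 1 * g 1 0.
Proof.
rewrite (expand_det_row _ 0) !big_ord_recl big_ord0 addr0 /cofactor !det_mx11.
rewrite !mxE /= expr0 mul1r expr1 mulN1r mulrN.
by congr (_ * g _ _ - g _ _ * g _ _); apply: val_inj.
Qed.

Lemma det_invmx1 (g : 'M[K]_2) : \det g = 1 -> \det (invmx g) = 1.
Proof. by move=> dg; rewrite det_inv dg invr1. Qed.

Lemma regular_inv f : regular_fun f -> regular_fun (fun g => f (invmx g)).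
Proof.
have Hadj i j : regular_fun (fun g => invmx g i j).
  apply: (@regular_ext (fun g => \adj g i j)) => [g dg|].
    by rewrite /invmx unitmxE dg unitr1 invr1 scale1r.
  exists ((-1) ^+ (j + i) * 'X_(mxvec_index (lift j 0) (lift i 0))) => g _.
  rewrite mxE /cofactor det_mx11 !mxE mevalM mevalXU mxvecE.
  by congr (_ * _); rewrite rmorphXn /= rmorphN rmorph1.
case=> P HP.
have /fin_all_exists [F HF] : forall l : 'I_(2 * 2), exists Q : {mpoly K[2 * 2]},
    forall g : 'M[K]_2, \det g = 1 -> mxvec (invmx g) 0 l = Q.@[fun l => mxvec g 0 l].
  move=> l; case/mxvec_indexP: l => i j; case: (Hadj i j) => Q HQ.
  by exists Q => g dg; rewrite mxvecE HQ.
exists (P \mPo [tuple F l | l < 2 * 2]) => g dg.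
rewrite HP ?det_invmx1 // comp_mpoly_meval; apply: meval_eq => l.
by rewrite tnth_mktuple HF.
Qed.

Lemma unit_rational : rational (fun => 1%:M : 'M[K]_1).
Proof. by split=> [|*|i j]; rewrite ?mulmx1 //; apply: regular_cst. Qed.
Definition unit_rep := Rep unit_rational.

Lemma tens_rational X Y : rational (fun g => rep_act X g *t rep_act Y g).
Proof.
case: (actP X) (actP Y) => X1 XM XR [Y1 YM YR]; split=> [|g h dg dh|i j].
- apply/matrixP => i j; case: (mxtens_indexP i) => i0 i1.
  case: (mxtens_indexP j) => j0 j1; rewrite tensmxE X1 Y1 !mxE.
  by rewrite (can_eq (@mxtens_indexK _ _)) xpair_eqE -natrM mulnb.
- by rewrite XM ?YM // tensmx_mul.
case: (mxtens_indexP i) => i0 i1; case: (mxtens_indexP j) => j0 j1.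
apply: (@regular_ext (fun g => rep_act X g i0 j0 * rep_act Y g i1 j1)) => [g _|].
  by rewrite tensmxE.
exact: regularM.
Qed.
Definition rep_tens X Y := Rep (tens_rational X Y).

Lemma dual_rational X : rational (fun g => (rep_act X (invmx g))^T).
Proof.
case: (actP X) => X1 XM XR; split=> [|g h dg dh|i j].
- by rewrite invmx1 X1 trmx1.
- rewrite -trmx_mul -XM ?det_invmx1 //; congr (rep_act X _)^T.
  have gU : g \in unitmx by rewrite unitmxE dg unitr1.
  have hU : h \in unitmx by rewrite unitmxE dh unitr1.
  exact: (invrM gU hU).
apply: (@regular_ext (fun g => rep_act X (invmx g) j i)) => [g _|].
  by rewrite mxE.
exact: regular_inv (XR j i).
Qed.
Definition dual_rep X := Rep (dual_rational X).

Lemma dsum_rational X Y : rational (fun g => block_mx (rep_act X g) 0 0 (rep_act Y g)).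
Proof.
case: (actP X) (actP Y) => X1 XM XR [Y1 YM YR]; split=> [|g h dg dh|i j].
- by rewrite X1 Y1 -scalar_mx_block.
- by rewrite XM ?YM // mulmx_block !mulmx0 !mul0mx !addr0 !add0r.
have R0 := regular_cst 0.
rewrite -(splitK i) -(splitK j).
case: (split i) (split j) => a [] b /=.
- apply: regular_ext (XR a b) => g _.
  by rewrite block_mxEul.
- by apply: regular_ext R0 => g _; rewrite block_mxEur mxE.
- by apply: regular_ext R0 => g _; rewrite block_mxEdl mxE.
- by apply: regular_ext (YR a b) => g _; rewrite block_mxEdr.
Qed.
Definition dsum X Y := Rep (dsum_rational X Y).

(* The symmetric power S^n of the natural module K^2 = <x, y>, that is, the
   dual Weyl module of highest weight n.  On the basis x^(n-i) y^i with x
   replaced by 1 and y by 'X, the element g sends x to g00 + g10 'X and y to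
   g01 + g11 'X. *)
Definition sym_act n (g : 'M[K]_2) : 'M[K]_n.+1 :=
  \matrix_(i, j) (((g 0 0)%:P + g 1 0 *: 'X) ^+ (n - j)
                  * ((g 0 1)%:P + g 1 1 *: 'X) ^+ j)`_i.

Section SymAction.
Variables (R : comNzRingType) (u v : {poly R}).

Definition homogenize n (P : {poly R}) : {poly R} :=
  \sum_(i < n.+1) P`_i *: (u ^+ (n - i) * v ^+ i).

Lemma homogenizeM n (P : {poly R}) a b : (size P <= n.+1)%N ->
  homogenize n.+1 ((a%:P + b *: 'X) * P) = (a *: u + b *: v) * homogenize n P.
Proof.
move=> sP; rewrite /homogenize mulr_sumr.
transitivity (\sum_(i < n.+2) (a * P`_i) *: (u ^+ (n.+1 - i) * v ^+ i)
   + \sum_(i < n.+2) (b * ('X * P)`_i) *: (u ^+ (n.+1 - i) * v ^+ i)).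
  rewrite -big_split; apply: eq_bigr => i _ /=.
  by rewrite -scalerDl mulrDl coefD mul_polyC coefZ -scalerAl coefZ.
rewrite big_ord_recr /= nth_default // mulr0 scale0r addr0.
rewrite [X in _ + X]big_ord_recl coefXM mulr0 scale0r add0r.
rewrite -big_split; apply: eq_bigr => i _ /=.
rewrite /bump leq0n add1n coefXM /= subSS subSn ?leq_ord // !exprS.
rewrite mulrDl -!scalerAl -!scalerAr !scalerA !mulrA.
by rewrite [v * _]mulrC.
Qed.
End SymAction.

Lemma size_lin (R : comNzRingType) (a b : R) : (size (a%:P + b *: 'X)%R <= 2)%N.
Proof.
rewrite (leq_trans (size_polyD _ _)) // geq_max.
rewrite (leq_trans (size_polyC_leq1 _)) //.
by rewrite (leq_trans (size_scale_leq _ _)) // size_polyX.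
Qed.

Lemma size_lin_prod (R : comNzRingType) (a b c d : R) s t :
  (size ((a%:P + b *: 'X) ^+ s * (c%:P + d *: 'X) ^+ t)%R <= (s + t).+1)%N.
Proof.
elim: s => [|s IHs]; last first.
  rewrite exprS -mulrA (leq_trans (size_polyMleq _ _)) //.
  by have := leq_add (size_lin a b) IHs; case: (_ + _)%N.
rewrite expr0 mul1r; elim: t => [|t IHt]; first by rewrite expr0 size_poly1.
rewrite exprS (leq_trans (size_polyMleq _ _)) //.
by have := leq_add (size_lin c d) IHt; case: (_ + _)%N.
Qed.

Lemma homogenize_lin (R : comNzRingType) (u v : {poly R}) (a b c d : R) s t :
  homogenize u v (s + t) ((a%:P + b *: 'X) ^+ s * (c%:P + d *: 'X) ^+ t)
  = (a *: u + b *: v) ^+ s * (c *: u + d *: v) ^+ t.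
Proof.
elim: s => [|s IHs]; last first.
  by rewrite addSn !exprS -!mulrA homogenizeM ?IHs ?size_lin_prod.
rewrite add0n !expr0 !mul1r; elim: t => [|t IHt].
  by rewrite /homogenize big_ord1 subn0 !expr0 mulr1 coef1 scale1r.
have := size_lin_prod 1 0 c d 0 t; rewrite expr0 mul1r => sz.
by rewrite !exprS homogenizeM ?IHt.
Qed.

Lemma sym_rational n : rational (@sym_act n).
Proof.
split=> [|g h _ _|i j].
- apply/matrixP => i j; rewrite !mxE /= scale0r addr0 expr1n mul1r scale1r add0r.
  by rewrite coefXn.
- apply/matrixP => i j; rewrite [LHS]mxE [RHS]mxE.
  set u := (g 0 0)%:P + g 1 0 *: 'X; set v := (g 0 1)%:P + g 1 1 *: 'X.
  have E t : ((g * h) 0 t)%:P + (g * h) 1 t *: 'X = h 0 t *: u + h 1 t *: v.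
    rewrite /u /v !mxE !big_ord_recl !big_ord0 !addr0.
    have -> : lift 0 0 = 1 :> 'I_2 by apply: val_inj.
    rewrite !scalerDr !scale_polyC !scalerA addrACA -scalerDl -polyCD.
    by rewrite ![h _ _ * _]mulrC.
  have jn : (n - j + j = n)%N by rewrite subnK // -ltnS.
  rewrite !E -homogenize_lin jn /homogenize coef_sum; apply: eq_bigr => l _.
  by rewrite !mxE coefZ mulrC.
pose X a b : {mpoly K[2 * 2]} := 'X_(mxvec_index a b).
exists (((X 0 0)%:P + X 1 0 *: 'X) ^+ (n - j)
        * ((X 0 1)%:P + X 1 1 *: 'X) ^+ j)`_i => g _.
rewrite mxE; set w := fun l => _.
have -> : forall P : {poly {mpoly K[2 * 2]}}, (P`_i).@[w] = (map_poly (meval w) P)`_i.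
  by move=> P; rewrite coef_map_id0 ?meval0.
rewrite rmorphM !rmorphXn !rmorphD /= !map_polyC !map_polyZ !map_polyX /=.
by rewrite !mevalXU /w !mxvecE.
Qed.
Definition sym_rep n := Rep (sym_rational n).

Definition short_exact (Y X Z : rep) (i : rep_hom Y X) (q : rep_hom X Z) : Prop :=
  [/\ \rank i = rep_dim Y, \rank q = rep_dim Z, q *m i = 0
    & rep_dim X = (rep_dim Y + rep_dim Z)%N].

Inductive filtered (F : nat -> rep) : rep -> Prop :=
| filtered_zero X : rep_dim X = 0 -> filtered F X
| filtered_ext X Y n (i : rep_hom Y X) (q : rep_hom X (F n)) :
    filtered F Y -> short_exact i q -> filtered F X.

(* A filtration by dual Weyl modules and one by Weyl modules. *)
Definition tilting X : Prop :=
  filtered sym_rep X /\ filtered (fun n => dual_rep (sym_rep n)) X.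

Lemma hom_id_proof X : is_equivariant (X := X) (Y := X) 1%:M.
Proof. by move=> g _; rewrite mulmx1 mul1mx. Qed.
Definition hom_id X : rep_hom X X := RepHom (@hom_id_proof X).

Lemma hom_comp_proof X Y Z (g : rep_hom Y Z) (f : rep_hom X Y) :
  is_equivariant (X := X) (Y := Z) (g *m f).
Proof. by move=> h dh; rewrite -mulmxA homP // !mulmxA homP. Qed.
Definition hom_comp X Y Z (g : rep_hom Y Z) (f : rep_hom X Y) := RepHom (hom_comp_proof g f).

Lemma hom_zero_proof X Y : is_equivariant (X := X) (Y := Y) 0.
Proof. by move=> g _; rewrite mul0mx mulmx0. Qed.
Definition hom_zero X Y : rep_hom X Y := RepHom (@hom_zero_proof X Y).

Lemma hom_add_proof X Y (f g : rep_hom X Y) : is_equivariant (X := X) (Y := Y) (hom_mx f + hom_mx g).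
Proof. by move=> h dh; rewrite mulmxDl mulmxDr !homP. Qed.
Definition hom_add X Y (f g : rep_hom X Y) := RepHom (hom_add_proof f g).

Lemma hom_opp_proof X Y (f : rep_hom X Y) : is_equivariant (X := X) (Y := Y) (- hom_mx f).
Proof. by move=> h dh; rewrite mulNmx mulmxN homP. Qed.
Definition hom_opp X Y (f : rep_hom X Y) := RepHom (hom_opp_proof f).

Definition hom_sub X Y (f g : rep_hom X Y) := hom_add f (hom_opp g).

Definition hom_sum X Y I (s : seq I) (F : I -> rep_hom X Y) : rep_hom X Y :=
  foldr (fun i => hom_add (F i)) (hom_zero X Y) s.

Lemma hom_tens_proof X Y X' Y' (f : rep_hom X Y) (g : rep_hom X' Y') :
  is_equivariant (X := rep_tens X X') (Y := rep_tens Y Y') (f *t g).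
Proof. by move=> h dh; rewrite /= !tensmx_mul !homP. Qed.
Definition hom_tens X Y X' Y' (f : rep_hom X Y) (g : rep_hom X' Y') := RepHom (hom_tens_proof f g).

(* Structural isomorphisms are given by bijections of the standard bases. *)
Definition basis_mx m n (f : 'I_m -> 'I_n) : 'M[K]_(n, m) :=
  \matrix_(i, j) (i == f j)%:R.

Lemma basis_equivariant X Y (f : 'I_(rep_dim X) -> 'I_(rep_dim Y)) :
    bijective f -> (forall g i j, rep_act Y g (f i) (f j) = rep_act X g i j) ->
  is_equivariant (basis_mx f).
Proof.
case=> f' fK f'K Hf g _; apply/matrixP => i j; rewrite !mxE.
rewrite (bigD1 (f' i)) //= mxE f'K eqxx mul1r big1 => [|l lP]; last first.
  by rewrite mxE -{1}[i]f'K (can_eq fK) eq_sym (negPf lP) mul0r.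
rewrite (bigD1 (f j)) //= mxE eqxx mulr1 big1 => [|l lP]; last first.
  by rewrite mxE (negPf lP) mulr0.
by rewrite !addr0 -Hf f'K.
Qed.

Notation tidx := (@mxtens_index _ _).
Notation tunidx := (@mxtens_unindex _ _).

Definition assoc_idx m n q (i : 'I_(m * n * q)) : 'I_(m * (n * q)) :=
  tidx ((tunidx (tunidx i).1).1, tidx ((tunidx (tunidx i).1).2, (tunidx i).2)).
Definition assocV_idx m n q (i : 'I_(m * (n * q))) : 'I_(m * n * q) :=
  tidx (tidx ((tunidx i).1, (tunidx (tunidx i).2).1), (tunidx (tunidx i).2).2).
Definition braid_idx m n (i : 'I_(m * n)) : 'I_(n * m) :=
  tidx ((tunidx i).2, (tunidx i).1).
Definition lunit_idx n (i : 'I_(1 * n)) : 'I_n := (tunidx i).2.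
Definition lunitV_idx n (i : 'I_n) : 'I_(1 * n) := tidx (ord0, i).
Definition runit_idx n (i : 'I_(n * 1)) : 'I_n := (tunidx i).1.
Definition runitV_idx n (i : 'I_n) : 'I_(n * 1) := tidx (i, ord0).

Lemma assoc_idxK m n q : cancel (@assoc_idx m n q) (@assocV_idx m n q).
Proof.
move=> i; case: (mxtens_indexP i) => i' l; case: (mxtens_indexP i') => a b.
by rewrite /assocV_idx /assoc_idx !mxtens_indexK.
Qed.
Lemma assocV_idxK m n q : cancel (@assocV_idx m n q) (@assoc_idx m n q).
Proof.
move=> i; case: (mxtens_indexP i) => l i'; case: (mxtens_indexP i') => a b.
by rewrite /assocV_idx /assoc_idx !mxtens_indexK.
Qed.
Lemma braid_idxK m n : cancel (@braid_idx m n) (@braid_idx n m).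
Proof.
by move=> i; case: (mxtens_indexP i) => {}i l; rewrite /braid_idx !mxtens_indexK.
Qed.
Lemma lunit_idxK n : cancel (@lunit_idx n) (@lunitV_idx n).
Proof.
move=> i; case: (mxtens_indexP i) => {}i l.
by rewrite /lunitV_idx /lunit_idx mxtens_indexK [i]ord1.
Qed.
Lemma lunitV_idxK n : cancel (@lunitV_idx n) (@lunit_idx n).
Proof. by move=> i; rewrite /lunitV_idx /lunit_idx mxtens_indexK. Qed.
Lemma runit_idxK n : cancel (@runit_idx n) (@runitV_idx n).
Proof.
move=> i; case: (mxtens_indexP i) => {}i l.
by rewrite /runitV_idx /runit_idx mxtens_indexK [l]ord1.
Qed.
Lemma runitV_idxK n : cancel (@runitV_idx n) (@runit_idx n).
Proof. by move=> i; rewrite /runitV_idx /runit_idx mxtens_indexK. Qed.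

Lemma hom_assoc_proof X Y Z :
  is_equivariant (X := rep_tens (rep_tens X Y) Z) (Y := rep_tens X (rep_tens Y Z))
    (basis_mx (@assoc_idx (rep_dim X) (rep_dim Y) (rep_dim Z))).
Proof.
apply: basis_equivariant => [|g i j].
  exact: Bijective (@assoc_idxK _ _ _) (@assocV_idxK _ _ _).
case: (mxtens_indexP i) => i' i3; case: (mxtens_indexP i') => i1 i2.
case: (mxtens_indexP j) => j' j3; case: (mxtens_indexP j') => j1 j2.
by rewrite /assoc_idx !mxtens_indexK /= !tensmxE mulrA.
Qed.
Definition hom_assoc X Y Z : rep_hom (rep_tens (rep_tens X Y) Z) (rep_tens X (rep_tens Y Z)) :=
  RepHom (@hom_assoc_proof X Y Z).

Lemma hom_assocV_proof X Y Z :
  is_equivariant (X := rep_tens X (rep_tens Y Z)) (Y := rep_tens (rep_tens X Y) Z)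
    (basis_mx (@assocV_idx (rep_dim X) (rep_dim Y) (rep_dim Z))).
Proof.
apply: basis_equivariant => [|g i j].
  exact: Bijective (@assocV_idxK _ _ _) (@assoc_idxK _ _ _).
case: (mxtens_indexP i) => i1 i'; case: (mxtens_indexP i') => i2 i3.
case: (mxtens_indexP j) => j1 j'; case: (mxtens_indexP j') => j2 j3.
by rewrite /assocV_idx !mxtens_indexK /= !tensmxE mulrA.
Qed.
Definition hom_assocV X Y Z : rep_hom (rep_tens X (rep_tens Y Z)) (rep_tens (rep_tens X Y) Z) :=
  RepHom (@hom_assocV_proof X Y Z).

Lemma hom_braid_proof X Y :
  is_equivariant (X := rep_tens X Y) (Y := rep_tens Y X)
    (basis_mx (@braid_idx (rep_dim X) (rep_dim Y))).
Proof.
apply: basis_equivariant => [|g i j].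
  exact: Bijective (@braid_idxK _ _) (@braid_idxK _ _).
case: (mxtens_indexP i) => i1 i2; case: (mxtens_indexP j) => j1 j2.
by rewrite /braid_idx !mxtens_indexK /= !tensmxE mulrC.
Qed.
Definition hom_braid X Y : rep_hom (rep_tens X Y) (rep_tens Y X) := RepHom (@hom_braid_proof X Y).

Lemma hom_lunit_proof X :
  is_equivariant (X := rep_tens unit_rep X) (Y := X) (basis_mx (@lunit_idx (rep_dim X))).
Proof.
apply: basis_equivariant => [|g i j].
  exact: Bijective (@lunit_idxK _) (@lunitV_idxK _).
case: (mxtens_indexP i) => i1 i2; case: (mxtens_indexP j) => j1 j2.
by rewrite /lunit_idx !mxtens_indexK /= !tensmxE !ord1 mxE eqxx mul1r.
Qed.
Definition hom_lunit X : rep_hom (rep_tens unit_rep X) X := RepHom (@hom_lunit_proof X).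

Lemma hom_runit_proof X :
  is_equivariant (X := rep_tens X unit_rep) (Y := X) (basis_mx (@runit_idx (rep_dim X))).
Proof.
apply: basis_equivariant => [|g i j].
  exact: Bijective (@runit_idxK _) (@runitV_idxK _).
case: (mxtens_indexP i) => i1 i2; case: (mxtens_indexP j) => j1 j2.
by rewrite /runit_idx !mxtens_indexK /= !tensmxE !ord1 mxE eqxx mulr1.
Qed.
Definition hom_runit X : rep_hom (rep_tens X unit_rep) X := RepHom (@hom_runit_proof X).

Lemma hom_runitV_proof X :
  is_equivariant (X := X) (Y := rep_tens X unit_rep) (basis_mx (@runitV_idx (rep_dim X))).
Proof.
apply: basis_equivariant => [|g i j].
  exact: Bijective (@runitV_idxK _) (@runit_idxK _).
by rewrite /runitV_idx /= !tensmxE mxE eqxx mulr1.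
Qed.
Definition hom_runitV X : rep_hom X (rep_tens X unit_rep) := RepHom (@hom_runitV_proof X).

Lemma act_invmx X (g : 'M[K]_2) : \det g = 1 ->
  rep_act X (invmx g) *m rep_act X g = 1%:M /\ rep_act X g *m rep_act X (invmx g) = 1%:M.
Proof.
move=> dg; have gU : g \in unitmx by rewrite unitmxE dg unitr1.
have [X1 XM _] := actP X.
by rewrite -!XM ?det_invmx1 // -X1; split; congr (rep_act X _);
  [apply: mulVmx | apply: mulmxV].
Qed.

Lemma sum_tidx m n (F : 'I_(m * n) -> K) :
  \sum_l F l = \sum_a \sum_b F (tidx (a, b)).
Proof.
rewrite pair_bigA (reindex (fun ab : 'I_m * 'I_n => tidx ab)) /=.
  by apply: eq_bigr => -[].
exact: onW_bij (Bijective (@mxtens_indexK _ _) (@mxtens_unindexK _ _)).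
Qed.

Lemma hom_ev_proof X :
  is_equivariant (X := rep_tens (dual_rep X) X) (Y := unit_rep)
    (\matrix_(i, j) ((tunidx j).1 == (tunidx j).2)%:R).
Proof.
move=> g dg; rewrite mul1mx; apply/matrixP => i j; rewrite !mxE.
case: (mxtens_indexP j) => j1 j2; rewrite mxtens_indexK.
have := congr1 (fun A : 'M_(rep_dim X) => A j1 j2) (act_invmx X dg).1.
rewrite !mxE => <-; rewrite sum_tidx; apply: eq_bigr => a _.
rewrite (bigD1 a) // big1 => [|b ba].
  by rewrite [LHS]addr0 mxE mxtens_indexK eqxx mul1r tensmxE mxE.
by rewrite mxE mxtens_indexK eq_sym (negPf ba) mul0r.
Qed.
Definition hom_ev X : rep_hom (rep_tens (dual_rep X) X) unit_rep := RepHom (@hom_ev_proof X).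

Lemma hom_coev_proof X :
  is_equivariant (X := unit_rep) (Y := rep_tens X (dual_rep X))
    (\matrix_(i, j) ((tunidx i).1 == (tunidx i).2)%:R).
Proof.
move=> g dg; rewrite mulmx1; apply/matrixP => i j; rewrite !mxE.
case: (mxtens_indexP i) => i1 i2; rewrite mxtens_indexK.
have := congr1 (fun A : 'M_(rep_dim X) => A i1 i2) (act_invmx X dg).2.
rewrite !mxE => <-; rewrite sum_tidx; apply: eq_bigr => a _.
rewrite (bigD1 a) // big1 => [|b ba].
  by rewrite [RHS]addr0 [X in _ = _ * X]mxE mxtens_indexK eqxx mulr1 tensmxE !mxE.
by rewrite [X in _ * X]mxE mxtens_indexK eq_sym (negPf ba) mulr0.
Qed.
Definition hom_coev X : rep_hom unit_rep (rep_tens X (dual_rep X)) := RepHom (@hom_coev_proof X).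

Lemma hom_inl_proof X Y :
  is_equivariant (X := X) (Y := dsum X Y) (col_mx 1%:M 0).
Proof.
move=> g _; rewrite mul_col_mx mul_block_col.
by rewrite mul1mx !mul0mx !mulmx0 mulmx1 !addr0.
Qed.
Definition hom_inl X Y : rep_hom X (dsum X Y) := RepHom (@hom_inl_proof X Y).

Lemma hom_inr_proof X Y :
  is_equivariant (X := Y) (Y := dsum X Y) (col_mx 0 1%:M).
Proof.
move=> g _; rewrite mul_col_mx mul_block_col.
by rewrite mul1mx !mul0mx !mulmx0 mulmx1 !add0r.
Qed.
Definition hom_inr X Y : rep_hom Y (dsum X Y) := RepHom (@hom_inr_proof X Y).

Lemma hom_prl_proof X Y :
  is_equivariant (X := dsum X Y) (Y := X) (row_mx 1%:M 0).
Proof.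
move=> g _; rewrite mul_mx_row mul_row_block.
by rewrite mul1mx !mul0mx !mulmx0 mulmx1 !addr0.
Qed.
Definition hom_prl X Y : rep_hom (dsum X Y) X := RepHom (@hom_prl_proof X Y).

Lemma hom_prr_proof X Y :
  is_equivariant (X := dsum X Y) (Y := Y) (row_mx 0 1%:M).
Proof.
move=> g _; rewrite mul_mx_row mul_row_block.
by rewrite !mul1mx !mul0mx !mulmx0 mulmx1 !add0r.
Qed.
Definition hom_prr X Y : rep_hom (dsum X Y) Y := RepHom (@hom_prr_proof X Y).

(* The Verlinde category: the objects are the representations X with
   [tilting X], the morphisms X -> Y are the elements of [rep_hom X Y] modulo the
   negligible ones.  Equality of morphisms is [hom_eq]. *)

Definition negligible X Y (f : rep_hom X Y) : Prop :=
  forall g : rep_hom Y X, \tr (f *m g) = 0.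

Definition hom_eq X Y (f g : rep_hom X Y) : Prop := negligible (hom_sub f g).

Definition hom_iso X Y (f : rep_hom X Y) : Prop :=
  exists g : rep_hom Y X,
    hom_eq (hom_comp g f) (hom_id X) /\ hom_eq (hom_comp f g) (hom_id Y).

(* For i < p the simple module of highest weight i - 1 is S^(i - 1) K^2. *)
Definition simple_obj (i : nat) : rep := sym_rep i.-1.

Notation "g <o> f" := (hom_comp g f) (at level 50, left associativity).
Notation "f <x> g" := (hom_tens f g) (at level 40, left associativity).

Definition inner_hom (U W : rep) : rep := rep_tens W (dual_rep U).

Definition hom_eval U W : rep_hom (rep_tens (inner_hom U W) U) W :=
  hom_runit W <o> (hom_id W <x> hom_ev U) <o> hom_assoc W (dual_rep U) U.

Definition hom_curry X U W (f : rep_hom (rep_tens X U) W) : rep_hom X (inner_hom U W) :=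
  (f <x> hom_id (dual_rep U)) <o> hom_assocV X U (dual_rep U)
    <o> (hom_id X <x> hom_coev U) <o> hom_runitV X.

Definition end_unit W : rep_hom unit_rep (inner_hom W W) := hom_curry (hom_lunit W).

Definition end_mult W :
    rep_hom (rep_tens (inner_hom W W) (inner_hom W W)) (inner_hom W W) :=
  hom_curry (hom_eval W W <o> (hom_id _ <x> hom_eval W W) <o> hom_assoc _ _ _).

Definition nondegenerate_pairing V (B : rep_hom (rep_tens V V) unit_rep) : Prop :=
  hom_iso (hom_curry B).

Definition symmetric_pairing V (B : rep_hom (rep_tens V V) unit_rep) : Prop :=
  hom_eq (B <o> hom_braid V V) B.

Definition skew_pairing V (B : rep_hom (rep_tens V V) unit_rep) : Prop :=
  hom_eq (B <o> hom_braid V V) (hom_opp B).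

Section Queer.
Variables (psi : rep) (alpha : rep_hom (rep_tens psi psi) unit_rep) (V : rep).

Let Vpsi := rep_tens V psi.
Let W := dsum V Vpsi.

Definition queer_obj : rep := dsum (inner_hom V V) (inner_hom V Vpsi).

(* (A, C) acts on V + V * psi by (v, w) |-> (A v + C w, C v + A w). *)
Definition queer_act_even : rep_hom (rep_tens (inner_hom V V) W) W :=
  hom_add
    (hom_inl V Vpsi <o> hom_eval V V <o> (hom_id _ <x> hom_prl V Vpsi))
    (hom_inr V Vpsi <o> (hom_eval V V <x> hom_id psi)
       <o> hom_assocV (inner_hom V V) V psi <o> (hom_id _ <x> hom_prr V Vpsi)).

Definition queer_act_odd : rep_hom (rep_tens (inner_hom V Vpsi) W) W :=
  hom_add
    (hom_inr V Vpsi <o> hom_eval V Vpsi <o> (hom_id _ <x> hom_prl V Vpsi))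
    (hom_inl V Vpsi <o> hom_runit V <o> (hom_id V <x> alpha)
       <o> hom_assoc V psi psi <o> (hom_eval V Vpsi <x> hom_id psi)
       <o> hom_assocV (inner_hom V Vpsi) V psi <o> (hom_id _ <x> hom_prr V Vpsi)).

Definition queer_act : rep_hom (rep_tens queer_obj W) W :=
  hom_add (queer_act_even <o> (hom_prl _ _ <x> hom_id W))
          (queer_act_odd <o> (hom_prr _ _ <x> hom_id W)).

Definition queer_incl : rep_hom queer_obj (inner_hom W W) := hom_curry queer_act.

(* Reading off the first column (A, C) of a block matrix is a left inverse of
   [queer_incl], so the subalgebra structure of the image of [queer_incl] is
   given by the following unit and multiplication. *)
Definition queer_retr : rep_hom (inner_hom W W) queer_obj :=
  hom_add
    (hom_inl _ _ <o> hom_curry (hom_prl V Vpsi <o> hom_eval W W <o> (hom_id _ <x> hom_inl V Vpsi)))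
    (hom_inr _ _ <o> hom_curry (hom_prr V Vpsi <o> hom_eval W W <o> (hom_id _ <x> hom_inl V Vpsi))).

Definition queer_unit : rep_hom unit_rep queer_obj := queer_retr <o> end_unit W.

Definition queer_mult : rep_hom (rep_tens queer_obj queer_obj) queer_obj :=
  queer_retr <o> end_mult W <o> (queer_incl <x> queer_incl).

End Queer.

(* Ind-objects.  The Verlinde category is semisimple, so that every ind-object
   is a direct sum of a family of objects; a morphism out of a direct sum is
   then a matrix each of whose columns has finite support. *)

Record ind := Ind { idx : eqType; obj :> idx -> rep }.

Definition in_ver (X : ind) : Prop := forall i, tilting (X i).

Record mor (X Y : ind) := Mor {
  coef :> forall (i : idx X) (j : idx Y), rep_hom (X i) (Y j);
  supp : idx X -> seq (idx Y);
  suppP : forall i j, j \notin supp i -> coef i j = 0 :> 'M_(_, _) }.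

Definition mor_eq X Y (f g : mor X Y) : Prop := forall i j, hom_eq (f i j) (g i j).

Lemma hom_sum_eq0 X Y (I : eqType) (s : seq I) (F : I -> rep_hom X Y) :
  (forall i, i \in s -> F i = 0 :> 'M_(_, _)) -> hom_sum s F = 0 :> 'M_(_, _).
Proof.
elim: s => //= i s IHs F0; rewrite F0 ?mem_head // add0r IHs // => j js.
by rewrite F0 // inE js orbT.
Qed.

Definition mor_comp_coef X Y Z (g : mor Y Z) (f : mor X Y) i l : rep_hom (X i) (Z l) :=
  hom_sum (undup (supp f i)) (fun j => g j l <o> f i j).

Lemma mor_comp_supp X Y Z (g : mor Y Z) (f : mor X Y) i l :
  l \notin flatten [seq supp g j | j <- supp f i] ->
  mor_comp_coef g f i l = 0 :> 'M_(_, _).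
Proof.
move=> lN; apply: hom_sum_eq0 => j; rewrite mem_undup => js /=.
rewrite suppP ?mul0mx //; apply: contra lN => ls.
by apply/flatten_mapP; exists j.
Qed.

Definition mor_comp X Y Z (g : mor Y Z) (f : mor X Y) : mor X Z :=
  Mor (@mor_comp_supp X Y Z g f).

Lemma mor_add_supp X Y (f g : mor X Y) i j :
  j \notin supp f i ++ supp g i -> hom_add (f i j) (g i j) = 0 :> 'M_(_, _).
Proof.
by rewrite mem_cat negb_or => /andP[fN gN] /=; rewrite !suppP ?addr0.
Qed.
Definition mor_add X Y (f g : mor X Y) : mor X Y := Mor (@mor_add_supp X Y f g).

Lemma mor_opp_supp X Y (f : mor X Y) i j :
  j \notin supp f i -> hom_opp (f i j) = 0 :> 'M_(_, _).
Proof. by move=> fN /=; rewrite suppP ?oppr0. Qed.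
Definition mor_opp X Y (f : mor X Y) : mor X Y := Mor (@mor_opp_supp X Y f).

Lemma mor_zero_supp X Y (i : idx X) (j : idx Y) :
  j \notin [::] -> hom_zero (X i) (Y j) = 0 :> 'M_(_, _).
Proof. by []. Qed.
Definition mor_zero X Y : mor X Y := Mor (@mor_zero_supp X Y).

Definition mor_map_coef (X Y : ind) (u : idx X -> idx Y)
    (f : forall i, rep_hom (X i) (Y (u i))) i j : rep_hom (X i) (Y j) :=
  match u i =P j with
  | ReflectT e => ecast j (rep_hom (X i) (Y j)) e (f i)
  | ReflectF _ => hom_zero (X i) (Y j)
  end.

Lemma mor_map_supp X Y u f i j :
  j \notin [:: u i] -> @mor_map_coef X Y u f i j = 0 :> 'M_(_, _).
Proof.
rewrite inE eq_sym /mor_map_coef => /eqP uj.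
by case: eqP => // e; case: uj.
Qed.
Definition mor_map X Y u f : mor X Y := Mor (@mor_map_supp X Y u f).

Definition mor_id X : mor X X := mor_map (u := id) (fun i => hom_id (X i)).

Definition ind_tens (X Y : ind) : ind := Ind (fun ij => rep_tens (X ij.1) (Y ij.2)).

Lemma mor_tens_supp X Y X' Y' (f : mor X Y) (g : mor X' Y')
    (i : idx X * idx X') (j : idx Y * idx Y') :
  j \notin [seq (a, b) | a <- supp f i.1, b <- supp g i.2] ->
  (f i.1 j.1 <x> g i.2 j.2) = 0 :> 'M_(_, _).
Proof.
case: j => a b abN /=; have [aS|aN] := boolP (a \in supp f i.1); last first.
  by rewrite (suppP aN) tens0mx.
have [bS|bN] := boolP (b \in supp g i.2); last by rewrite (suppP bN) tensmx0.
by case/negP: abN; apply: allpairs_f.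
Qed.
Definition mor_tens X Y X' Y' (f : mor X Y) (g : mor X' Y') :
    mor (ind_tens X X') (ind_tens Y Y') :=
  Mor (X := ind_tens X X') (Y := ind_tens Y Y') (@mor_tens_supp X Y X' Y' f g).

Definition ind_of (X : rep) : ind := Ind (fun _ : unit => X).
Definition mor_of X Y (f : rep_hom X Y) : mor (ind_of X) (ind_of Y) :=
  mor_map (X := ind_of X) (Y := ind_of Y) (u := id) (fun=> f).
Definition ind_unit := ind_of unit_rep.

Definition mor_assoc X Y Z :
    mor (ind_tens (ind_tens X Y) Z) (ind_tens X (ind_tens Y Z)) :=
  mor_map (X := ind_tens (ind_tens X Y) Z) (Y := ind_tens X (ind_tens Y Z))
    (u := fun i => (i.1.1, (i.1.2, i.2))) (fun i => hom_assoc _ _ _).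
Definition mor_assocV X Y Z :
    mor (ind_tens X (ind_tens Y Z)) (ind_tens (ind_tens X Y) Z) :=
  mor_map (X := ind_tens X (ind_tens Y Z)) (Y := ind_tens (ind_tens X Y) Z)
    (u := fun i => ((i.1, i.2.1), i.2.2)) (fun i => hom_assocV _ _ _).
Definition mor_braid X Y : mor (ind_tens X Y) (ind_tens Y X) :=
  mor_map (X := ind_tens X Y) (Y := ind_tens Y X)
    (u := fun i => (i.2, i.1)) (fun i => hom_braid _ _).
Definition mor_runit X : mor (ind_tens X ind_unit) X :=
  mor_map (X := ind_tens X ind_unit) (Y := X) (u := fst) (fun i => hom_runit _).

Definition sum_obj (X Y : ind) (a : idx X + idx Y) : rep :=
  match a with inl i => X i | inr j => Y j end.
Definition ind_sum (X Y : ind) : ind := Ind (@sum_obj X Y).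

Definition mor_inl X Y : mor X (ind_sum X Y) :=
  mor_map (X := X) (Y := ind_sum X Y) (u := inl) (fun i => hom_id (X i)).
Definition mor_inr X Y : mor Y (ind_sum X Y) :=
  mor_map (X := Y) (Y := ind_sum X Y) (u := inr) (fun i => hom_id (Y i)).

Definition mor_copair_coef X Y Z (f : mor X Z) (g : mor Y Z) (a : idx X + idx Y) l :
    rep_hom (ind_sum X Y a) (Z l) :=
  match a with inl i => f i l | inr j => g j l end.
Definition copair_supp X Y Z (f : mor X Z) (g : mor Y Z) (a : idx X + idx Y) :=
  match a with inl i => supp f i | inr j => supp g j end.
Lemma mor_copair_supp X Y Z (f : mor X Z) (g : mor Y Z) a l :
  l \notin copair_supp f g a -> mor_copair_coef f g a l = 0 :> 'M_(_, _).
Proof. by case: a => i /=; apply: suppP. Qed.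
Definition mor_copair X Y Z (f : mor X Z) (g : mor Y Z) : mor (ind_sum X Y) Z :=
  Mor (X := ind_sum X Y) (@mor_copair_supp X Y Z f g).

Definition mor_prl X Y : mor (ind_sum X Y) X := mor_copair (mor_id X) (mor_zero Y X).
Definition mor_prr X Y : mor (ind_sum X Y) Y := mor_copair (mor_zero X Y) (mor_id Y).

Definition mor_iso X Y (f : mor X Y) : Prop :=
  exists g : mor Y X,
    mor_eq (mor_comp g f) (mor_id X) /\ mor_eq (mor_comp f g) (mor_id Y).

Notation "g <oo> f" := (mor_comp g f) (at level 50, left associativity).
Notation "f <xx> g" := (mor_tens f g) (at level 40, left associativity).
Notation "f =m g" := (mor_eq f g) (at level 70).

(* The data of an algebra; associativity and unitality hold for all the
   algebras considered below. *)
Record alg := Alg {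
  carrier :> ind;
  alg_unit : mor ind_unit carrier;
  alg_mult : mor (ind_tens carrier carrier) carrier }.

Definition alg_morphism (A B : alg) (f : mor A B) : Prop :=
  f <oo> alg_unit A =m alg_unit B /\ f <oo> alg_mult A =m alg_mult B <oo> (f <xx> f).

Definition alg_isomorphic (A B : alg) : Prop :=
  exists f : mor A B, alg_morphism f /\ mor_iso f.

Definition queer_algebra psi (alpha : rep_hom (rep_tens psi psi) unit_rep) V : alg :=
  @Alg (ind_of (queer_obj psi V)) (mor_of (queer_unit psi V))
    (mor_map (X := ind_tens (ind_of (queer_obj psi V)) (ind_of (queer_obj psi V)))
       (Y := ind_of (queer_obj psi V)) (u := fun=> tt) (fun=> queer_mult alpha V)).

Section TensorAlgebra.
Variable V : rep.

Fixpoint tens_pow n : rep :=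
  if n is n'.+1 then rep_tens V (tens_pow n') else unit_rep.

Fixpoint tens_pow_mult m n : rep_hom (rep_tens (tens_pow m) (tens_pow n)) (tens_pow (m + n)) :=
  match m with
  | 0 => hom_lunit (tens_pow n)
  | m'.+1 => (hom_id V <x> tens_pow_mult m' n) <o> hom_assoc V (tens_pow m') (tens_pow n)
  end.

Fixpoint tens_pow_hom (f : rep_hom V V) n : rep_hom (tens_pow n) (tens_pow n) :=
  match n with
  | 0 => hom_id unit_rep
  | n'.+1 => f <x> tens_pow_hom f n'
  end.

Definition tens_ind : ind := Ind tens_pow.

Definition tens_incl n : mor (ind_of (tens_pow n)) tens_ind :=
  mor_map (X := ind_of (tens_pow n)) (Y := tens_ind) (u := fun=> n)
    (fun=> hom_id (tens_pow n)).

Definition tens_alg : alg := @Alg tens_ind (tens_incl 0)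
  (mor_map (X := ind_tens tens_ind tens_ind) (Y := tens_ind)
     (u := fun mn => (mn.1 + mn.2)%N) (fun mn => tens_pow_mult mn.1 mn.2)).

Definition tens_alg_map (f : rep_hom V V) : mor tens_alg tens_alg :=
  mor_map (X := tens_ind) (Y := tens_ind) (u := id) (tens_pow_hom f).

(* The two-sided ideal generated by the image of R : Z -> T(V) is the image of
   T(V) * (Z * T(V)) -> T(V), a * (z * b) |-> a R(z) b. *)
Definition ideal_gen Z (R : mor Z tens_alg) :
    mor (ind_tens tens_alg (ind_tens Z tens_alg)) tens_alg :=
  alg_mult tens_alg
    <oo> (mor_id tens_alg <xx> (alg_mult tens_alg <oo> (R <xx> mor_id tens_alg))).

(* The quotient of T(V) by the two-sided ideal generated by the image of R,
   formed in the ind-completion of the Verlinde category. *)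
Record quotient_algebra Z (R : mor Z tens_alg) := QuotientAlgebra {
  quot_alg :> alg;
  quot_ver : in_ver quot_alg;
  quot_proj : mor tens_alg quot_alg;
  quot_proj_morphism : alg_morphism quot_proj;
  quot_proj_ideal : quot_proj <oo> ideal_gen R =m mor_zero _ _;
  quot_universal : forall (Y : ind) (f : mor tens_alg Y), in_ver Y ->
    f <oo> ideal_gen R =m mor_zero _ _ ->
    exists h : mor quot_alg Y, h <oo> quot_proj =m f /\
      forall h' : mor quot_alg Y, h' <oo> quot_proj =m f -> h' =m h }.

Definition form_relation (r : rep_hom (rep_tens V V) (rep_tens V V)) (B : rep_hom (rep_tens V V) unit_rep) :
    mor (ind_of (rep_tens V V)) tens_alg :=
  mor_add (tens_incl 2 <oo> mor_of ((hom_id V <x> hom_runitV V) <o> r))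
          (mor_opp (tens_incl 0 <oo> mor_of B)).

Definition weyl_algebra (B : rep_hom (rep_tens V V) unit_rep) : Type :=
  quotient_algebra (form_relation (hom_sub (hom_id _) (hom_braid V V)) B).

Definition clifford_algebra (B : rep_hom (rep_tens V V) unit_rep) : Type :=
  quotient_algebra (form_relation (hom_add (hom_id _) (hom_braid V V)) B).

(* The eigenobjects of the automorphism of A(V) induced by - id_V. *)
Record parity_decomposition Z (R : mor Z tens_alg) (A : quotient_algebra R) :=
ParityDecomposition {
  parity_aut : mor A A;
  parity_autP :
    parity_aut <oo> quot_proj A =m quot_proj A <oo> tens_alg_map (hom_opp (hom_id V));
  even_part : ind;
  odd_part : ind;
  even_ver : in_ver even_part;
  odd_ver : in_ver odd_part;
  even_incl : mor even_part A;
  odd_incl : mor odd_part A;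
  even_proj : mor A even_part;
  odd_proj : mor A odd_part;
  even_eigen : parity_aut <oo> even_incl =m even_incl;
  odd_eigen : parity_aut <oo> odd_incl =m mor_opp odd_incl;
  even_inclK : even_proj <oo> even_incl =m mor_id even_part;
  odd_inclK : odd_proj <oo> odd_incl =m mor_id odd_part;
  parity_sum :
    mor_add (even_incl <oo> even_proj) (odd_incl <oo> odd_proj) =m mor_id A }.

End TensorAlgebra.

Section Twist.
Variables (psi : rep) (alpha : rep_hom (rep_tens psi psi) unit_rep).
Variables (V : rep) (Z : ind) (R : mor Z (tens_alg V)).
Variables (A : quotient_algebra R) (D : parity_decomposition A).

Let Psi := ind_of psi.
Let Ap := even_part D.
Let Am := odd_part D.
Let Am_psi := ind_tens Am Psi.

Definition twist_obj : ind := ind_sum Ap Am_psi.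

Let mult_pp : mor (ind_tens Ap Ap) Ap :=
  even_proj D <oo> alg_mult A <oo> (even_incl D <xx> even_incl D).
Let mult_pm : mor (ind_tens Ap Am) Am :=
  odd_proj D <oo> alg_mult A <oo> (even_incl D <xx> odd_incl D).
Let mult_mp : mor (ind_tens Am Ap) Am :=
  odd_proj D <oo> alg_mult A <oo> (odd_incl D <xx> even_incl D).
Let mult_mm : mor (ind_tens Am Am) Ap :=
  even_proj D <oo> alg_mult A <oo> (odd_incl D <xx> odd_incl D).

Let mor_alpha : mor (ind_tens Psi Psi) ind_unit :=
  mor_map (X := ind_tens Psi Psi) (Y := ind_unit) (u := fun=> tt) (fun=> alpha).

Let twist_pm : mor (ind_tens Ap Am_psi) Am_psi :=
  (mult_pm <xx> mor_id Psi) <oo> mor_assocV Ap Am Psi.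

Let twist_mp : mor (ind_tens Am_psi Ap) Am_psi :=
  (mult_mp <xx> mor_id Psi) <oo> mor_assocV Am Ap Psi
    <oo> (mor_id Am <xx> mor_braid Psi Ap) <oo> mor_assoc Am Psi Ap.

(* (a * s) (b * t) |-> (a * b) * (s * t) |-> alpha (s, t) ab *)
Let twist_mm : mor (ind_tens Am_psi Am_psi) Ap :=
  mult_mm <oo> mor_runit (ind_tens Am Am) <oo> (mor_id (ind_tens Am Am) <xx> mor_alpha)
    <oo> mor_assocV Am Am (ind_tens Psi Psi)
    <oo> (mor_id Am <xx> (mor_assoc Am Psi Psi
                          <oo> (mor_braid Psi Am <xx> mor_id Psi)
                          <oo> mor_assocV Psi Am Psi))
    <oo> mor_assoc Am Psi Am_psi.

Let prp := mor_prl Ap Am_psi.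
Let prm := mor_prr Ap Am_psi.

Definition twist_mult : mor (ind_tens twist_obj twist_obj) twist_obj :=
  mor_add
    (mor_inl Ap Am_psi
       <oo> mor_add (mult_pp <oo> (prp <xx> prp)) (twist_mm <oo> (prm <xx> prm)))
    (mor_inr Ap Am_psi
       <oo> mor_add (twist_pm <oo> (prp <xx> prm)) (twist_mp <oo> (prm <xx> prp))).

Definition twist_algebra : alg :=
  @Alg twist_obj (mor_inl Ap Am_psi <oo> even_proj D <oo> alg_unit A) twist_mult.

End Twist.

Section Spin.
Variable m : nat.

(* The basis e_0, ..., e_(m-1), z, f_(m-1), ..., f_0 of K^(2m+1), with
   q (sum x_i e_i + y_i f_i + t z) = sum x_i y_i + t^2. *)
Definition quad_form (v : 'cV[K]_(m.*2.+1)) : K :=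
  \sum_(i < m) v (inord i) 0 * v (inord (m.*2 - i)) 0 + v (inord m) 0 ^+ 2.

(* The spin module is the exterior algebra of <e_0, ..., e_(m-1)>, with its
   basis indexed by the subsets of 'I_m: e_i acts by exterior multiplication,
   f_i by contraction, z by the parity; then v acts with square q v. *)
Definition spin_dim := #|{set 'I_m}|.
Definition spin_idx (a : 'I_spin_dim) : {set 'I_m} := enum_val a.

Definition creation (i : 'I_m) : 'M[K]_spin_dim :=
  \matrix_(a, b)
    let J := spin_idx b in
    if (i \notin J) && (spin_idx a == i |: J)
    then (-1) ^+ #|[set j in J | (j < i)%N]| else 0.

Definition parity_op : 'M[K]_spin_dim :=
  diag_mx (\row_a (-1) ^+ #|spin_idx a|).

Definition gamma (v : 'cV[K]_(m.*2.+1)) : 'M[K]_spin_dim :=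
  \sum_(i < m) (v (inord i) 0 *: creation i
                + v (inord (m.*2 - i)) 0 *: (creation i)^T)
  + v (inord m) 0 *: parity_op.

(* The products of an even number of vectors with q = 1.  Since the dimension
   is odd, the even Clifford algebra acts faithfully on the spin module, and
   Spin(2m+1) is identified with its image under the spin representation. *)
Definition spin_group (s : 'M[K]_spin_dim) : Prop :=
  exists vs : seq 'cV[K]_(m.*2.+1),
    [/\ all (fun v => quad_form v == 1) vs, ~~ odd (size vs)
      & s = foldr (fun v M => gamma v *m M) 1%:M vs].

(* The sum of the root vectors of so(2m+1) for the simple roots
   eps_i - eps_(i+1) and eps_(m-1). *)
Definition principal_e : 'M[K]_(m.*2.+1) :=
  \matrix_(i, j) if j == i.+1 :> nat then
      if (i.+1 < m)%N then 1 else if i.+1 == m then 2%:R else -1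
    else 0.

(* The principal sl(2)-triple is (e, h, f) with h = 2 rho^vee, that is,
   h = diag (2m, 2m - 2, ..., - 2m). *)
Definition principal_f : 'M[K]_(m.*2.+1) :=
  \matrix_(i, j) if i == j.+1 :> nat then
      (j.+1 * (m.*2 - j))%:R / principal_e j i
    else 0.

Definition principal_torus (t : K) : 'M[K]_(m.*2.+1) :=
  diag_mx (\row_i t ^ (m.*2%:Z - i.*2%:Z)).

(* The exponential of N, provided that N is nilpotent and 2m < char K. *)
Definition nilp_exp (N : 'M[K]_(m.*2.+1)) : 'M[K]_(m.*2.+1) :=
  \sum_(r < m.*2.+1) (r`!%:R)^-1 *: N ^+ r.

Definition mx2 (a b c d : K) : 'M[K]_2 :=
  \matrix_(i, j) if i == 0 then if j == 0 then a else b
                 else if j == 0 then c else d.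

(* s in Spin(2m+1) lies above g in SO(2m+1). *)
Definition spin_lifts (s : 'M[K]_spin_dim) (g : 'M[K]_(m.*2.+1)) : Prop :=
  forall v, s *m gamma v = gamma (g *m v) *m s.

(* The principal homomorphism SL(2) -> Spin(2m+1), composed with the spin
   representation. *)
Record principal_hom := PrincipalHom {
  principal_map :> 'M[K]_2 -> 'M[K]_spin_dim;
  principal_rational : rational principal_map;
  principal_spin : forall g, \det g = 1 -> spin_group (principal_map g);
  principal_upper : forall a,
    spin_lifts (principal_map (mx2 1 a 0 1)) (nilp_exp (a *: principal_e));
  principal_lower : forall a,
    spin_lifts (principal_map (mx2 1 0 a 1)) (nilp_exp (a *: principal_f));
  principal_diag : forall t, t != 0 ->
    spin_lifts (principal_map (mx2 t 0 0 t^-1)) (principal_torus t) }.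

Definition spin_obj (phi : principal_hom) : rep := Rep (principal_rational phi).

End Spin.

End Representations.

(* Main.v *)
From HB Require Import structures.
Require Import Defs.
From mathcomp Require Import all_boot all_order all_algebra.
From mathcomp Require Import mpoly mxtens ring zify.
From Stdlib Require Import Setoid Morphisms.

(** Put m = k - 1, N = 2m + 1, and let V be the N-dimensional orthogonal
    representation of SL(2) through which the principal homomorphism acts on
    the gamma matrices, so that V is isomorphic to L_N and the Clifford
    relations give equivariant maps pi_n from the n-th tensor power of V to
    E = End(S).  Averaging traces of products of gammas against
    antisymmetrizers produces equivariant sections s_j of pi_j, and the sum of
    pi_j s_j over j <= N of a fixed parity is the identity of E, because the
    words of that parity in the gammas span E (N is odd).

    Conversely, a family (F_n) of maps on the tensor powers that kills the
    Clifford relations is equal, up to negligible maps, to the sum over j of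
    F_j s_j pi_n: F_n only sees antisymmetric tensors, up to contractions, and
    antisymmetric tensors of degree greater than N vanish.  This is an identity
    between maps, so no exactness of the semisimplification is needed.

    Both identities transport along an isomorphism of L with chi (x) V, where
    chi squares to the unit with braiding eps = +1 or -1: the algebra with
    relations 1 + eps c - B is then isomorphic to the queer algebra built on
    chi.  For chi = psi and eps = -1 this is the Weyl algebra; its line
    psi (x) V is obtained from the multiplication
    Sym^M (x) Sym^n -> Sym^(M + n).  For chi = 1 and eps = 1 this is the
    Clifford algebra, whose parity twist replaces the unit by psi in the odd
    summand of the queer algebra. *)

Set Implicit Arguments.
Unset Strict Implicit.
Unset Printing Implicit Defensive.

Import GRing.Theory.
Local Open Scope ring_scope.

(** Identities in the Clifford algebra of V hold for matrices; what concerns the line (psi (x) psi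
    is the unit, L is psi (x) V) holds only up to negligible maps. The ideal is never described:
    once a morphism killing it factors through the queer algebra, the universal property of A alone
    inverts the induced map. The integers to be inverted lie below p (in particular N + 1 = 2k < p)
    or are powers of 2, such as dim S. That L is psi (x) V rests on two scalars. Since the line is
    invertible, endomorphisms of psi (x) V are scalars up to negligible maps, so an idempotent with
    nonzero trace is the identity; and the composite L -> psi (x) V -> L is seen to be nonzero from
    a single entry of a partial trace. The universal property asks for tilting targets, so the
    tensor powers of Sym^n must be shown to be tilting. This follows from the short exact sequences
    Sym^m (x) Sym^n -> Sym^(m+1) (x) Sym^(n+1) -> Sym^(m+n+2) and, since n < p, from
    self-duality. *)

Definition tv (K : closedFieldType) m n (x : 'cV[K]_m) (y : 'cV[K]_n) : 'cV[K]_(m * n) :=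
  \col_l (x (mxtens_unindex l).1 0 * y (mxtens_unindex l).2 0).

Notation "x *# y" := (tv x y) (at level 40, left associativity).
Notation "g <o> f" := (hom_comp g f) (at level 50, left associativity).
Notation "f <x> g" := (hom_tens f g) (at level 40, left associativity).
Notation ev i := (delta_mx i 0).

(** * Structural morphisms evaluated on pure tensors *)

Section Elements.
Variable K : closedFieldType.
Implicit Types X Y Z W : rep K.

Lemma cV_ext m n (A A' : 'M[K]_(m, n)) :
  (forall x : 'cV_n, A *m x = A' *m x) -> A = A'.
Proof.
move=> E; apply/matrixP => i j.
by have := E (delta_mx j 0); rewrite -!colE => /colP/(_ i); rewrite !mxE.
Qed.

Lemma tv_delta m n (a : 'I_m) (b : 'I_n) :
  ev a *# ev b = ev (mxtens_index (a, b)) :> 'cV[K]_(m * n).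
Proof.
apply/colP => l; case: (mxtens_indexP l) => i j; rewrite !mxE mxtens_indexK /= !andbT.
by rewrite (can_eq (@mxtens_indexK _ _)) xpair_eqE -natrM mulnb.
Qed.

Lemma tv_ext m n q (A A' : 'M[K]_(q, m * n)) :
  (forall x y, A *m (x *# y) = A' *m (x *# y)) -> A = A'.
Proof.
move=> E; apply/matrixP => i l; case: (mxtens_indexP l) => a b.
have := E (ev a) (ev b); rewrite tv_delta -!colE.
by move/colP/(_ i); rewrite !mxE.
Qed.

Lemma tvDl m n (x x' : 'cV[K]_m) (y : 'cV[K]_n) : (x + x') *# y = x *# y + x' *# y.
Proof. by apply/colP => l; rewrite !mxE mulrDl. Qed.
Lemma tvDr m n (x : 'cV[K]_m) (y y' : 'cV[K]_n) : x *# (y + y') = x *# y + x *# y'.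
Proof. by apply/colP => l; rewrite !mxE mulrDr. Qed.
Lemma tvZl m n c (x : 'cV[K]_m) (y : 'cV[K]_n) : (c *: x) *# y = c *: (x *# y).
Proof. by apply/colP => l; rewrite !mxE mulrA. Qed.
Lemma tvZr m n c (x : 'cV[K]_m) (y : 'cV[K]_n) : x *# (c *: y) = c *: (x *# y).
Proof. by apply/colP => l; rewrite !mxE mulrCA. Qed.
Lemma tvNl m n (x : 'cV[K]_m) (y : 'cV[K]_n) : (- x) *# y = - (x *# y).
Proof. by apply/colP => l; rewrite !mxE mulNr. Qed.
Lemma tvNr m n (x : 'cV[K]_m) (y : 'cV[K]_n) : x *# (- y) = - (x *# y).
Proof. by apply/colP => l; rewrite !mxE mulrN. Qed.
Lemma tv0l m n (y : 'cV[K]_n) : 0 *# y = 0 :> 'cV_(m * n).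
Proof. by apply/colP => l; rewrite !mxE mul0r. Qed.
Lemma tv0r m n (x : 'cV[K]_m) : x *# 0 = 0 :> 'cV_(m * n).
Proof. by apply/colP => l; rewrite !mxE mulr0. Qed.
Lemma tv_suml m n I (s : seq I) P (F : I -> 'cV[K]_m) (y : 'cV[K]_n) :
  (\sum_(i <- s | P i) F i) *# y = \sum_(i <- s | P i) F i *# y.
Proof. by elim/big_rec2: _ => [|i u v _ <-]; rewrite ?tv0l ?tvDl. Qed.
Lemma tv_sumr m n I (s : seq I) P (F : I -> 'cV[K]_n) (x : 'cV[K]_m) :
  x *# (\sum_(i <- s | P i) F i) = \sum_(i <- s | P i) x *# F i.
Proof. by elim/big_rec2: _ => [|i u v _ <-]; rewrite ?tv0r ?tvDr. Qed.

Lemma mul_tens_tv m n p q (A : 'M[K]_(m, n)) (B : 'M[K]_(p, q)) x y :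
  (A *t B) *m (x *# y) = (A *m x) *# (B *m y).
Proof.
apply/colP => l; case: (mxtens_indexP l) => i j; rewrite !mxE mxtens_indexK /=.
rewrite sum_tidx mulr_sumr exchange_big; apply: eq_bigr => b _ /=.
rewrite mulr_suml; apply: eq_bigr => a _.
by rewrite tensmxE !mxE mxtens_indexK /= mulrACA.
Qed.

Lemma cV1E (c : 'cV[K]_1) : c = c 0 0 *: 1%:M.
Proof. by apply/colP => i; rewrite !mxE !ord1 eqxx mulr1. Qed.

Lemma cV_sum_delta n (x : 'cV[K]_n) : x = \sum_i x i 0 *: ev i.
Proof. by rewrite {1}[x]matrix_sum_delta; apply: eq_bigr => i _; rewrite big_ord1. Qed.

Lemma basis_mxE m n (f : 'I_m -> 'I_n) (x : 'cV[K]_m) (y : 'cV[K]_n) : bijective f ->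
  (forall j, y (f j) 0 = x j 0) -> basis_mx K f *m x = y.
Proof.
case=> g fK gK E; apply/colP => i; rewrite -[i]gK E !mxE.
rewrite (bigD1 (g i)) //= mxE eqxx mul1r big1 ?addr0 // => l /negPf li.
by rewrite mxE (can_eq fK) eq_sym li mul0r.
Qed.

Lemma assocE X Y Z x y z : hom_assoc X Y Z *m ((x *# y) *# z) = x *# (y *# z).
Proof.
apply: basis_mxE => [|j]; first exact: Bijective (@assoc_idxK _ _ _) (@assocV_idxK _ _ _).
case: (mxtens_indexP j) => j' c; case: (mxtens_indexP j') => a b.
by rewrite /assoc_idx !mxE !mxtens_indexK /= mulrA.
Qed.
Lemma assocVE X Y Z x y z : hom_assocV X Y Z *m (x *# (y *# z)) = (x *# y) *# z.
Proof.
apply: basis_mxE => [|j]; first exact: Bijective (@assocV_idxK _ _ _) (@assoc_idxK _ _ _).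
case: (mxtens_indexP j) => a j'; case: (mxtens_indexP j') => b c.
by rewrite /assocV_idx !mxE !mxtens_indexK /= mulrA.
Qed.
Lemma braidE X Y x y : hom_braid X Y *m (x *# y) = y *# x.
Proof.
apply: basis_mxE => [|j]; first exact: Bijective (@braid_idxK _ _) (@braid_idxK _ _).
case: (mxtens_indexP j) => a b.
by rewrite /braid_idx !mxE !mxtens_indexK /= mulrC.
Qed.
Lemma lunitE X c x : hom_lunit X *m (c *# x) = c 0 0 *: x.
Proof.
apply: basis_mxE => [|j]; first exact: Bijective (@lunit_idxK _) (@lunitV_idxK _).
by case: (mxtens_indexP j) => a b; rewrite /lunit_idx !mxE !mxtens_indexK /= ord1.
Qed.
Lemma runitE X c x : hom_runit X *m (x *# c) = c 0 0 *: x.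
Proof.
apply: basis_mxE => [|j]; first exact: Bijective (@runit_idxK _) (@runitV_idxK _).
by case: (mxtens_indexP j) => a b; rewrite /runit_idx !mxE !mxtens_indexK /= ord1 mulrC.
Qed.
Lemma runitVE X x : hom_runitV X *m x = x *# 1%:M.
Proof.
apply: basis_mxE => [|j]; first exact: Bijective (@runitV_idxK _) (@runit_idxK _).
by rewrite /runitV_idx !mxE !mxtens_indexK /= mulr1.
Qed.
Lemma homev_E X (d x : 'cV[K]_(rep_dim X)) : hom_ev X *m (d *# x) = (\sum_a d a 0 * x a 0) *: 1%:M.
Proof.
rewrite [LHS]cV1E; congr (_ *: _); rewrite mxE sum_tidx; apply: eq_bigr => a _.
rewrite (bigD1 a) // big1 => [|b ba]; rewrite mxE mxtens_indexK.
  by rewrite eqxx mul1r [LHS]addr0 mxE mxtens_indexK.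
by rewrite eq_sym (negPf ba) mul0r.
Qed.
Lemma homcoev_E X (c : 'cV[K]_1) :
  hom_coev X *m c = c 0 0 *: \sum_(a < rep_dim X) ev a *# ev a.
Proof.
apply/colP => l; case: (mxtens_indexP l) => i j; rewrite !mxE big_ord1 mxE mxtens_indexK /=.
rewrite mulrC summxE (bigD1 i) //= big1 ?addr0 => [|a /negPf ai].
  by rewrite !mxE mxtens_indexK /= !eqxx mul1r andbT [j == i]eq_sym.
by rewrite !mxE mxtens_indexK /= eq_sym ai mul0r.
Qed.

Lemma hom_tensE X Y X' Y' (f : rep_hom X Y) (g : rep_hom X' Y') x y :
  (f <x> g) *m (x *# y) = (f *m x) *# (g *m y).
Proof. exact: mul_tens_tv. Qed.
Lemma hom_compE X Y Z (g : rep_hom Y Z) (f : rep_hom X Y) (x : 'cV_(rep_dim X)) :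
  (g <o> f) *m x = g *m (f *m x).
Proof. by rewrite mulmxA. Qed.
Lemma hom_addE X Y (f g : rep_hom X Y) n (x : 'M_(rep_dim X, n)) : hom_add f g *m x = f *m x + g *m x.
Proof. exact: mulmxDl. Qed.
Lemma hom_oppE X Y (f : rep_hom X Y) n (x : 'M_(rep_dim X, n)) : hom_opp f *m x = - (f *m x).
Proof. exact: mulNmx. Qed.
Lemma hom_idE X n (x : 'M_(rep_dim X, n)) : hom_id X *m x = x.
Proof. exact: mul1mx. Qed.
Lemma hom_zeroE X Y n (x : 'M_(rep_dim X, n)) : hom_zero X Y *m x = 0.
Proof. exact: mul0mx. Qed.

Definition elE := (hom_compE, hom_tensE, hom_addE, hom_oppE, hom_idE, hom_zeroE,
  assocE, assocVE, braidE, lunitE, runitE, runitVE, homev_E, homcoev_E).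

Lemma hom_evalE U W w (d u : 'cV[K]_(rep_dim U)) :
  hom_eval U W *m ((w *# d) *# u) = (\sum_a d a 0 * u a 0) *: w.
Proof. by rewrite !elE !mxE eqxx mulr1. Qed.

Lemma hom_curryE X U W (f : rep_hom (rep_tens X U) W) (x : 'cV_(rep_dim X)) :
  hom_curry f *m x = \sum_a (f *m (x *# ev a)) *# ev a.
Proof.
rewrite !elE !mxE eqxx scale1r tv_sumr mulmx_sumr mulmx_sumr.
by apply: eq_bigr => a _; rewrite !elE.
Qed.

(** Tensoring with a fixed vector, as a matrix: it peels one factor off a nested tensor, so that an
    equality on pure tensors can be proved one factor at a time. *)
Definition tml m n (x : 'cV[K]_m) : 'M[K]_(m * n, n) :=
  \matrix_(l, j) (x (mxtens_unindex l).1 0 * ((mxtens_unindex l).2 == j)%:R).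
Definition tmr m n (y : 'cV[K]_n) : 'M[K]_(m * n, m) :=
  \matrix_(l, i) (((mxtens_unindex l).1 == i)%:R * y (mxtens_unindex l).2 0).

Lemma tmlE m n (x : 'cV[K]_m) (y : 'cV[K]_n) : x *# y = tml n x *m y.
Proof.
apply/colP => l; rewrite !mxE (bigD1 (mxtens_unindex l).2) //= big1 => [|j jl].
  by rewrite mxE eqxx mulr1 [RHS]addr0.
by rewrite mxE eq_sym (negPf jl) mulr0 mul0r.
Qed.
Lemma tmrE m n (x : 'cV[K]_m) (y : 'cV[K]_n) : x *# y = tmr m y *m x.
Proof.
apply/colP => l; rewrite !mxE (bigD1 (mxtens_unindex l).1) //= big1 => [|j jl].
  by rewrite mxE eqxx mul1r [RHS]addr0 mulrC.
by rewrite mxE eq_sym (negPf jl) !mul0r.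
Qed.

Lemma tens_ext X Y q (A A' : 'M[K]_(q, rep_dim (rep_tens X Y))) :
  (forall x y, A *m (x *# y) = A' *m (x *# y)) -> A = A'.
Proof. exact: tv_ext. Qed.

(** A scalar multiple of a pure tensor is again pure, so closure under sums is enough. *)
Lemma tens_elim X Y (P : 'cV[K]_(rep_dim (rep_tens X Y)) -> Prop) :
  (forall u u', P u -> P u' -> P (u + u')) -> (forall x y, P (x *# y)) -> forall u, P u.
Proof.
move=> PD Pt u; rewrite [u]cV_sum_delta.
elim/big_rec: _ => [|l v _ Pv]; first by have := Pt 0 0; rewrite tv0l.
by apply: PD => //; case: (mxtens_indexP l) => i j; rewrite -tv_delta -tvZl.
Qed.

Lemma tens_extl X Y Z q (A A' : 'M[K]_(q, rep_dim (rep_tens (rep_tens X Y) Z))) :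
  (forall x y z, A *m (x *# y *# z) = A' *m (x *# y *# z)) -> A = A'.
Proof.
move=> E; apply: tens_ext => w z; rewrite tmrE !mulmxA; congr (_ *m w).
by apply: tv_ext => x y; rewrite -!mulmxA -tmrE.
Qed.
Lemma tens_extr X Y Z q (A A' : 'M[K]_(q, rep_dim (rep_tens X (rep_tens Y Z)))) :
  (forall x y z, A *m (x *# (y *# z)) = A' *m (x *# (y *# z))) -> A = A'.
Proof.
move=> E; apply: tens_ext => x w; rewrite tmlE !mulmxA; congr (_ *m w).
by apply: tv_ext => y z; rewrite -!mulmxA -tmlE.
Qed.
Lemma tens_extrr X Y Z W q
    (A A' : 'M[K]_(q, rep_dim (rep_tens X (rep_tens Y (rep_tens Z W))))) :
  (forall x y z w, A *m (x *# (y *# (z *# w))) = A' *m (x *# (y *# (z *# w)))) -> A = A'.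
Proof.
move=> E; apply: tens_extr => x y t; rewrite (tmlE x) (tmlE y) !mulmxA; congr (_ *m t).
by apply: tv_ext => z w; rewrite -!mulmxA -!tmlE.
Qed.
Lemma tens_ext22 X Y Z W q
    (A A' : 'M[K]_(q, rep_dim (rep_tens (rep_tens X Y) (rep_tens Z W)))) :
  (forall x y z w, A *m (x *# y *# (z *# w)) = A' *m (x *# y *# (z *# w))) -> A = A'.
Proof.
move=> E; apply: tens_extl => x y t; rewrite tmlE !mulmxA; congr (_ *m t).
by apply: tv_ext => z w; rewrite -!mulmxA -tmlE.
Qed.

End Elements.

Notation "f === g" := (hom_eq f g) (at level 70).

(** * Negligible morphisms form a tensor ideal *)

Section Negligible.
Variable K : closedFieldType.
Implicit Types X Y Z W : rep K.

Lemma hom_scale_proof X Y c (f : rep_hom X Y) :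
  is_equivariant (X := X) (Y := Y) (c *: hom_mx f).
Proof. by move=> h dh; rewrite -scalemxAl -scalemxAr homP. Qed.
Definition hom_scale X Y c (f : rep_hom X Y) := RepHom (hom_scale_proof c f).

Lemma hom_scaleE X Y c (f : rep_hom X Y) n (x : 'M_(rep_dim X, n)) :
  hom_scale c f *m x = c *: (f *m x).
Proof. by rewrite /= -scalemxAl. Qed.

Lemma heq_mx X Y (f g : rep_hom X Y) : f = g :> 'M_(_, _) -> f === g.
Proof. by move=> e h; rewrite /= e subrr mul0mx mxtrace0. Qed.

Lemma heq_refl X Y (f : rep_hom X Y) : f === f.
Proof. exact: heq_mx. Qed.
#[local] Hint Resolve heq_refl : core.

Lemma heq_tr X Y (f g : rep_hom X Y) :
  f === g <-> forall h : rep_hom Y X, \tr (f *m h) = \tr (g *m h).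
Proof.
split=> E h; have := E h; rewrite /= mulmxBl raddfB /=; first by move/eqP; rewrite subr_eq0 => /eqP.
by move=> ->; rewrite subrr.
Qed.

Lemma heq_sym X Y (f g : rep_hom X Y) : f === g -> g === f.
Proof. by rewrite !heq_tr => E h. Qed.
Lemma heq_trans X Y (f g h : rep_hom X Y) : f === g -> g === h -> f === h.
Proof. by rewrite !heq_tr => E F k; rewrite E. Qed.

#[export] Instance heq_equiv X Y : Equivalence (@hom_eq K X Y).
Proof.
split=> [f|f g|f g h]; [exact: heq_mx | exact: heq_sym | exact: heq_trans].
Qed.

#[export] Instance heq_comp X Y Z :
  Proper (@hom_eq K Y Z ==> @hom_eq K X Y ==> @hom_eq K X Z) (@hom_comp K X Y Z).
Proof.
move=> g g' /heq_tr Eg f f' /heq_tr Ef; apply/heq_tr => h.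
have := Eg (f <o> h); rewrite /= !mulmxA => ->.
rewrite -!mulmxA !(mxtrace_mulC g') -!mulmxA; exact: Ef (h <o> g').
Qed.

#[export] Instance heq_add X Y :
  Proper (@hom_eq K X Y ==> @hom_eq K X Y ==> @hom_eq K X Y) (@hom_add K X Y).
Proof.
move=> g g' /heq_tr Eg f f' /heq_tr Ef; apply/heq_tr => h /=.
by rewrite !mulmxDl !raddfD /= Eg Ef.
Qed.
#[export] Instance heq_opp X Y :
  Proper (@hom_eq K X Y ==> @hom_eq K X Y) (@hom_opp K X Y).
Proof.
by move=> g g' /heq_tr Eg; apply/heq_tr => h /=; rewrite !mulNmx !raddfN /= Eg.
Qed.
#[export] Instance heq_scale X Y c :
  Proper (@hom_eq K X Y ==> @hom_eq K X Y) (@hom_scale X Y c).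
Proof.
by move=> g g' /heq_tr Eg; apply/heq_tr => h; rewrite !hom_scaleE !linearZ /= Eg.
Qed.

Definition ptrace m n q (h : 'M[K]_(m * q, n * q)) : 'M[K]_(m, n) :=
  \matrix_(i, j) \sum_a h (mxtens_index (i, a)) (mxtens_index (j, a)).

Lemma ptrace_mull m m' n q (A : 'M[K]_(m', m)) (h : 'M[K]_(m * q, n * q)) :
  ptrace ((A *t 1%:M) *m h) = A *m ptrace h.
Proof.
apply/matrixP => i j; rewrite !mxE; under [RHS]eq_bigr do rewrite mxE mulr_sumr.
rewrite exchange_big; apply: eq_bigr => a _; rewrite mxE sum_tidx.
apply: eq_bigr => l _; rewrite (bigD1 a) //= big1 => [|b ba].
  by rewrite addr0 tensmxE mxE eqxx mulr1.
by rewrite tensmxE !mxE eq_sym (negPf ba) mulr0 mul0r.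
Qed.
Lemma ptrace_mulr m n n' q (A : 'M[K]_(n, n')) (h : 'M[K]_(m * q, n * q)) :
  ptrace (h *m (A *t 1%:M)) = ptrace h *m A.
Proof.
apply/matrixP => i j; rewrite !mxE; under [RHS]eq_bigr do rewrite mxE mulr_suml.
rewrite exchange_big; apply: eq_bigr => a _; rewrite mxE sum_tidx.
apply: eq_bigr => l _; rewrite (bigD1 a) //= big1 => [|b ba].
  by rewrite addr0 tensmxE mxE eqxx mulr1.
by rewrite tensmxE !mxE (negPf ba) mulr0 mulr0.
Qed.
Lemma ptrace_mulC m n q q' (B : 'M[K]_(q, q')) (h : 'M[K]_(m * q', n * q)) :
  ptrace ((1%:M *t B) *m h) = ptrace (h *m (1%:M *t B)).
Proof.
apply/matrixP => i j; rewrite !mxE.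
transitivity (\sum_a \sum_b B a b * h (mxtens_index (i, b)) (mxtens_index (j, a))).
  apply: eq_bigr => a _; rewrite mxE sum_tidx (bigD1 i) //=.
  rewrite [X in _ + X]big1 ?[LHS]addr0 => [|l li].
    by apply: eq_bigr => b _; rewrite tensmxE mxE eqxx mul1r.
  by apply: big1 => b _; rewrite tensmxE mxE eq_sym (negPf li) !mul0r.
rewrite exchange_big; apply: eq_bigr => b _; rewrite mxE sum_tidx [RHS](bigD1 j) //=.
rewrite [X in _ + X]big1 ?[RHS]addr0 => [|l lj].
  by apply: eq_bigr => a _; rewrite tensmxE mxE eqxx mul1r mulrC.
by apply: big1 => a _; rewrite tensmxE mxE (negPf lj) mul0r mulr0.
Qed.
Lemma trace_ptrace m q (h : 'M[K]_(m * q)) : \tr h = \tr (ptrace h).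
Proof. by rewrite /mxtrace sum_tidx; apply: eq_bigr => i _; rewrite mxE. Qed.

(** Write g (x) 1 as (g (x) g)(1 (x) g^-1). The last factor acts on the space that is traced out,
    hence can be moved to the other side of h by cyclicity. *)
Lemma hom_ptrace_proof X Y Z (h : rep_hom (rep_tens X Z) (rep_tens Y Z)) :
  is_equivariant (X := X) (Y := Y) (ptrace h).
Proof.
move=> g dg; have [_ E1] := act_invmx Z dg.
rewrite -ptrace_mulr -ptrace_mull.
have -> : rep_act X g *t 1%:M = rep_act (rep_tens X Z) g *m (1%:M *t rep_act Z (invmx g)).
  by rewrite /= tensmx_mul mulmx1 E1.
have -> : rep_act Y g *t 1%:M = (1%:M *t rep_act Z (invmx g)) *m rep_act (rep_tens Y Z) g.
  by rewrite /= tensmx_mul mul1mx (act_invmx Z dg).1.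
by rewrite mulmxA (homP h dg) -ptrace_mulC mulmxA.
Qed.
Definition hom_ptrace X Y Z (h : rep_hom (rep_tens X Z) (rep_tens Y Z)) : rep_hom X Y :=
  RepHom (hom_ptrace_proof h).

(** The trace of (f (x) id) h is the trace of f against the partial trace of h, which is again
    equivariant. *)
Lemma heq_tens_id X Y Z (f f' : rep_hom X Y) :
  f === f' -> f <x> hom_id Z === f' <x> hom_id Z.
Proof.
rewrite !heq_tr => E h; rewrite /= trace_ptrace [RHS]trace_ptrace !ptrace_mull.
exact: E (hom_ptrace h).
Qed.

Lemma tensmx11 m n : (1%:M : 'M[K]_m) *t (1%:M : 'M[K]_n) = 1%:M.
Proof. by apply: tv_ext => x y; rewrite mul_tens_tv !mul1mx. Qed.

Lemma heq_id_tens X Y Z (f f' : rep_hom X Y) :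
  f === f' -> hom_id Z <x> f === hom_id Z <x> f'.
Proof.
move=> E; have H (g : rep_hom X Y) :
    hom_id Z <x> g === hom_braid _ _ <o> (g <x> hom_id Z) <o> hom_braid _ _.
  by apply: heq_mx; apply: tens_ext => x y; rewrite !elE.
by rewrite !H (heq_tens_id (Z := Z) E).
Qed.

#[export] Instance heq_tens X Y X' Y' :
  Proper (@hom_eq K X Y ==> @hom_eq K X' Y' ==> @hom_eq K (rep_tens X X') (rep_tens Y Y'))
    (@hom_tens K X Y X' Y').
Proof.
move=> f f' Ef g g' Eg.
have H (a : rep_hom X Y) (b : rep_hom X' Y') :
    a <x> b === (a <x> hom_id _) <o> (hom_id _ <x> b).
  by apply: heq_mx; apply: tens_ext => x y; rewrite !elE.
by rewrite !H (heq_tens_id Ef) (heq_id_tens Eg).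
Qed.

Lemma hom_tensmx X Y X' Y' (f : rep_hom X Y) (g : rep_hom X' Y') :
  (f <x> g : 'M_(_, _)) = f *t g.
Proof. by []. Qed.

(** An endomorphism of the unit is its own trace, so no nonzero one is negligible. This is what
    makes [alpha] composed with its inverse an equality of matrices. *)
Lemma heq_unit (f g : rep_hom (unit_rep K) (unit_rep K)) : f === g -> f = g :> 'M_(_,_).
Proof.
move/heq_tr/(_ (hom_id _)); rewrite !mulmx1 /mxtrace !big_ord1 => E.
by apply/matrixP => i j; rewrite !ord1.
Qed.

Lemma heq_sum X Y I (s : seq I) (F G : I -> rep_hom X Y) :
  (forall i, F i === G i) -> hom_sum s F === hom_sum s G.
Proof. by move=> E; elim: s => //= i s IHs; rewrite E IHs. Qed.

Lemma hom_sumE X Y I (s : seq I) (F : I -> rep_hom X Y) :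
  hom_sum s F = \sum_(i <- s) hom_mx (F i) :> 'M_(_, _).
Proof. by elim: s => [|i s IHs]; rewrite ?big_nil ?big_cons //= IHs. Qed.

Lemma hom_sum_el X Y I (s : seq I) (F : I -> rep_hom X Y) n (x : 'M_(_, n)) :
  hom_sum s F *m x = \sum_(i <- s) F i *m x.
Proof. by rewrite hom_sumE mulmx_suml. Qed.

End Negligible.
#[export] Hint Resolve heq_refl : core.

Notation "g <oo> f" := (mor_comp g f) (at level 50, left associativity).
Notation "f <xx> g" := (mor_tens f g) (at level 40, left associativity).
Notation "f =m g" := (mor_eq f g) (at level 70).

(** * Calculus of morphisms between ind-objects *)

Section IndObjects.
Variable K : closedFieldType.
Implicit Types X Y Z W : ind K.

Lemma meq_refl X Y (f : mor X Y) : f =m f. Proof. by move=> i j. Qed.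
#[local] Hint Resolve meq_refl : core.
Lemma meq_sym X Y (f g : mor X Y) : f =m g -> g =m f.
Proof. by move=> E i j; apply: heq_sym. Qed.
Lemma meq_trans X Y (f g h : mor X Y) : f =m g -> g =m h -> f =m h.
Proof. by move=> E F i j; apply: heq_trans (E i j) (F i j). Qed.

#[export] Instance meq_equiv X Y : Equivalence (@mor_eq K X Y).
Proof.
split=> [f|f g|f g h]; [exact: meq_refl | exact: meq_sym | exact: meq_trans].
Qed.

Lemma meq_mx X Y (f g : mor X Y) : (forall i j, f i j = g i j :> 'M_(_, _)) -> f =m g.
Proof. by move=> E i j; apply: heq_mx. Qed.

(** The sum defining a composite may run over any duplicate-free list that contains the support;
    composites with different supports are compared over a common list. *)
Lemma mor_comp_sum X Y Z (g : mor Y Z) (f : mor X Y) i l (S : seq (idx Y)) :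
  uniq S -> {subset supp f i <= S} ->
  (g <oo> f) i l = hom_sum S (fun j => g j l <o> f i j) :> 'M_(_, _).
Proof.
move=> uS sS; rewrite /= /mor_comp_coef !hom_sumE.
rewrite [RHS](bigID (mem (supp f i)) _ (fun j => hom_mx (g j l <o> f i j))) /=.
rewrite [X in _ = _ + X]big1 ?[RHS]addr0 => [|j jN]; last by rewrite /= (suppP jN) mulmx0.
rewrite -[RHS]big_filter; apply: perm_big; apply: uniq_perm; rewrite ?undup_uniq ?filter_uniq //.
by move=> j; rewrite mem_undup mem_filter /=; case: (boolP (j \in supp f i)) => // /sS ->.
Qed.

Lemma comp_monoR X Y Z (g : mor Y Z) (f : mor X Y) i l j0 :
  (forall j, j != j0 -> f i j = 0 :> 'M_(_, _)) -> (g <oo> f) i l = g j0 l *m f i j0 :> 'M_(_, _).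
Proof.
move=> f0; rewrite (@mor_comp_sum _ _ _ _ _ _ _ (undup (j0 :: supp f i))) ?undup_uniq //.
  rewrite hom_sumE (bigD1_seq j0) ?undup_uniq ?mem_undup ?mem_head //=.
  by rewrite big1 ?addr0 // => j /f0 ->; rewrite mulmx0.
by move=> j js; rewrite mem_undup inE js orbT.
Qed.
Lemma comp_monoL X Y Z (g : mor Y Z) (f : mor X Y) i l j0 :
  (forall j, j != j0 -> g j l = 0 :> 'M_(_, _)) -> (g <oo> f) i l = g j0 l *m f i j0 :> 'M_(_, _).
Proof.
move=> f0; rewrite (@mor_comp_sum _ _ _ _ _ _ _ (undup (j0 :: supp f i))) ?undup_uniq //.
  rewrite hom_sumE (bigD1_seq j0) ?undup_uniq ?mem_undup ?mem_head //=.
  by rewrite big1 ?addr0 // => j /f0 ->; rewrite mul0mx.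
by move=> j js; rewrite mem_undup inE js orbT.
Qed.

(** The cast along an equality of an index with itself is trivial, because equality of indices is
    decidable. *)
Lemma mor_mapE X Y (u : idx X -> idx Y) (f : forall i, rep_hom (X i) (Y (u i))) i :
  mor_map f i (u i) = f i.
Proof. by rewrite /= /mor_map_coef; case: eqP => // e; rewrite (eq_axiomK e). Qed.
Lemma mor_map0 X Y (u : idx X -> idx Y) (f : forall i, rep_hom (X i) (Y (u i))) i j :
  j != u i -> mor_map f i j = 0 :> 'M_(_, _).
Proof. by rewrite /= /mor_map_coef => ne; case: eqP => // e; rewrite e eqxx in ne. Qed.
Lemma comp_mapR X Y Z (u : idx X -> idx Y) (f : forall i, rep_hom (X i) (Y (u i))) (g : mor Y Z) i l :
  (g <oo> mor_map f) i l = g (u i) l *m f i :> 'M_(_, _).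
Proof. by rewrite (@comp_monoR _ _ _ _ _ _ _ (u i)) ?mor_mapE // => j; apply: mor_map0. Qed.
Lemma mor_idE X i : mor_id X i i = 1%:M :> 'M_(_, _).
Proof. by rewrite (@mor_mapE X X id). Qed.
Lemma mor_id0 X i j : j != i -> mor_id X i j = 0 :> 'M_(_, _).
Proof. exact: (@mor_map0 X X id). Qed.

Lemma mor_compfId X Y (f : mor X Y) : f <oo> mor_id X =m f.
Proof. by apply: meq_mx => i j; rewrite (comp_mapR (X := X) (Y := X) (u := id)) mulmx1. Qed.
Lemma mor_compIdf X Y (f : mor X Y) : mor_id Y <oo> f =m f.
Proof.
apply: meq_mx => i j; rewrite (@comp_monoL _ _ _ _ _ _ _ j) ?mor_idE ?mul1mx // => l.
by rewrite eq_sym; apply: mor_id0.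
Qed.

Lemma mor_compA X Y Z W (h : mor Z W) (g : mor Y Z) (f : mor X Y) :
  h <oo> (g <oo> f) =m (h <oo> g) <oo> f.
Proof.
apply: meq_mx => i l; set S := undup (supp f i).
set T := undup (flatten [seq supp g j | j <- supp f i]).
rewrite (@mor_comp_sum _ _ _ _ _ _ _ T) ?undup_uniq //; last by move=> k; rewrite mem_undup.
rewrite (@mor_comp_sum _ _ _ _ _ _ _ S) ?undup_uniq //; last by move=> k; rewrite mem_undup.
rewrite !hom_sumE.
transitivity (\sum_(k <- T) \sum_(j <- S) h k l *m (g j k *m f i j)).
  by apply: eq_bigr => k _; rewrite /= [hom_mx (mor_comp_coef g f i k)](hom_sumE S (fun j => g j k <o> f i j)) mulmx_sumr.
rewrite exchange_big; apply: eq_big_seq => j js /=.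
have -> : hom_mx (mor_comp_coef h g j l) = hom_sum T (fun k => h k l <o> g j k).
  apply: (@mor_comp_sum _ _ _ h g); rewrite ?undup_uniq // => k kj.
  by rewrite mem_undup; apply/flatten_mapP; exists j; rewrite // -mem_undup.
by rewrite hom_sumE mulmx_suml; apply: eq_bigr => k _; rewrite mulmxA.
Qed.

#[export] Instance meq_comp X Y Z :
  Proper (@mor_eq K Y Z ==> @mor_eq K X Y ==> @mor_eq K X Z) (@mor_comp K X Y Z).
Proof.
move=> g g' Eg f f' Ef i l; set S := undup (supp f i ++ supp f' i).
apply: heq_trans (heq_mx (@mor_comp_sum _ _ _ g f i l S _ _)) _; rewrite ?undup_uniq //.
  by move=> j js; rewrite mem_undup mem_cat js.
apply: heq_trans _ (heq_sym (heq_mx (@mor_comp_sum _ _ _ g' f' i l S _ _))); rewrite ?undup_uniq //.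
  by apply: heq_sum => j; rewrite (Eg j l) (Ef i j).
by move=> j js; rewrite mem_undup mem_cat js orbT.
Qed.
#[export] Instance meq_tens X Y X' Y' :
  Proper (@mor_eq K X Y ==> @mor_eq K X' Y' ==> @mor_eq K (ind_tens X X') (ind_tens Y Y'))
    (@mor_tens K X Y X' Y').
Proof. by move=> f f' Ef g g' Eg i j /=; rewrite (Ef _ _) (Eg _ _). Qed.
#[export] Instance meq_add X Y :
  Proper (@mor_eq K X Y ==> @mor_eq K X Y ==> @mor_eq K X Y) (@mor_add K X Y).
Proof. by move=> f f' Ef g g' Eg i j /=; rewrite (Ef _ _) (Eg _ _). Qed.
#[export] Instance meq_opp X Y :
  Proper (@mor_eq K X Y ==> @mor_eq K X Y) (@mor_opp K X Y).
Proof. by move=> f f' Ef i j /=; rewrite (Ef _ _). Qed.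
#[export] Instance meq_copair X Y Z :
  Proper (@mor_eq K X Z ==> @mor_eq K Y Z ==> @mor_eq K (ind_sum X Y) Z) (@mor_copair K X Y Z).
Proof. by move=> f f' Ef g g' Eg [i|i] j /=; rewrite ?(Ef _ _) ?(Eg _ _). Qed.

Lemma mor_tens_comp X Y Z X' Y' Z' (g : mor Y Z) (f : mor X Y) (g' : mor Y' Z') (f' : mor X' Y') :
  (g <oo> f) <xx> (g' <oo> f') =m (g <xx> g') <oo> (f <xx> f').
Proof.
apply: meq_mx => -[i i'] [l l'].
set S := undup (supp f i); set S' := undup (supp f' i').
rewrite (@mor_comp_sum _ _ _ (g <xx> g') (f <xx> f') _ _ (allpairs pair S S')); last 2 first.
- by apply: allpairs_uniq; rewrite ?undup_uniq // => -[a b] [c d].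
- move=> [a b] /allpairsP[[c d] /= [cs ds [-> ->]]].
  by apply/allpairsP; exists (c, d); rewrite !mem_undup.
rewrite hom_sumE big_allpairs_dep /=.
rewrite [X in X *t _]hom_sumE [X in _ *t X]hom_sumE.
apply/matrixP => a b; case: (mxtens_indexP a) => a1 a2; case: (mxtens_indexP b) => b1 b2.
rewrite tensmxE !summxE mulr_suml; apply: eq_bigr => j _; rewrite summxE mulr_sumr.
by apply: eq_bigr => j' _; rewrite -tensmxE -tensmx_mul.
Qed.

Lemma mor_tens_id X Y : mor_id X <xx> mor_id Y =m mor_id (ind_tens X Y).
Proof.
apply: meq_mx => -[i i'] [l l'] /=.
have [/eqP[-> ->]|ne] := boolP ((l, l') == (i, i')).
  rewrite (@mor_idE (ind_tens X Y)) [X in X *t _]mor_idE [X in _ *t X]mor_idE.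
  by rewrite tensmx11.
rewrite (@mor_id0 (ind_tens X Y)) //; move: ne; rewrite xpair_eqE negb_and => /orP[ne|ne].
  by rewrite [X in X *t _](mor_id0 ne) tens0mx.
by rewrite [X in _ *t X](mor_id0 ne) tensmx0.
Qed.

Lemma mor_addl X Y Z (g g' : mor Y Z) (f : mor X Y) :
  mor_add g g' <oo> f =m mor_add (g <oo> f) (g' <oo> f).
Proof.
apply: meq_mx => i l; rewrite /= /mor_comp_coef !hom_sumE -big_split.
by apply: eq_bigr => j _; rewrite /= mulmxDl.
Qed.
Lemma mor_addr X Y Z (g : mor Y Z) (f f' : mor X Y) :
  g <oo> mor_add f f' =m mor_add (g <oo> f) (g <oo> f').
Proof.
apply: meq_mx => i l; set S := undup (supp f i ++ supp f' i).
have uS : uniq S by apply: undup_uniq.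
have s1 : {subset supp f i <= S} by move=> j js; rewrite mem_undup mem_cat js.
have s2 : {subset supp f' i <= S} by move=> j js; rewrite mem_undup mem_cat js orbT.
have s3 : {subset supp (mor_add f f') i <= S} by move=> j; rewrite mem_undup.
rewrite (mor_comp_sum _ _ uS s3) hom_sumE.
transitivity (hom_mx ((g <oo> f) i l) + hom_mx ((g <oo> f') i l)); last by [].
rewrite (mor_comp_sum g l uS s1) (mor_comp_sum g l uS s2) !hom_sumE -big_split.
by apply: eq_bigr => j _; rewrite /= mulmxDr.
Qed.
Lemma mor_oppl X Y Z (g : mor Y Z) (f : mor X Y) :
  mor_opp g <oo> f =m mor_opp (g <oo> f).
Proof.
apply: meq_mx => i l; rewrite /= /mor_comp_coef !hom_sumE -sumrN.
by apply: eq_bigr => j _; rewrite /= mulNmx.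
Qed.
Lemma mor_oppr X Y Z (g : mor Y Z) (f : mor X Y) :
  g <oo> mor_opp f =m mor_opp (g <oo> f).
Proof.
apply: meq_mx => i l; rewrite /= /mor_comp_coef !hom_sumE -sumrN.
by apply: eq_bigr => j _; rewrite /= mulmxN.
Qed.
Lemma mor_zerol X Y Z (f : mor X Y) : mor_zero Y Z <oo> f =m mor_zero X Z.
Proof.
apply: meq_mx => i l; rewrite /= /mor_comp_coef !hom_sumE big1 //= => j _.
by rewrite mul0mx.
Qed.
Lemma mor_zeror X Y Z (g : mor Y Z) : g <oo> mor_zero X Y =m mor_zero X Z.
Proof. exact: meq_mx. Qed.
Lemma mor_tens0 X Y X' Y' (f : mor X Y) : f <xx> mor_zero X' Y' =m mor_zero _ _.
Proof. by apply: meq_mx => -[i i'] [j j'] /=; rewrite tensmx0. Qed.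
Lemma mor_0tens X Y X' Y' (f : mor X Y) : mor_zero X' Y' <xx> f =m mor_zero _ _.
Proof. by apply: meq_mx => -[i i'] [j j'] /=; rewrite tens0mx. Qed.

Lemma mor_ofE (A B : rep K) (f : rep_hom A B) i j : mor_of f i j = f :> 'M_(_, _).
Proof.
by case: i j => [] []; rewrite (mor_mapE (X := ind_of A) (Y := ind_of B) (u := id) (fun=> f) tt).
Qed.
Lemma mor_of_comp (A B C : rep K) (g : rep_hom B C) (f : rep_hom A B) :
  mor_of g <oo> mor_of f =m mor_of (g <o> f).
Proof.
apply: meq_mx => -[] []; rewrite (comp_mapR (X := ind_of A) (Y := ind_of B) (u := id)).
by rewrite !mor_ofE.
Qed.

End IndObjects.
#[export] Hint Resolve meq_refl : core.

(** * Exchanges of adjacent factors, antisymmetrizers and alternating tensors *)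

Section AlternatingTensors.
Variables (K : closedFieldType) (U : rep K).
Local Notation T := (tens_pow U).

Definition swap_front n : rep_hom (rep_tens U (rep_tens U (T n))) (rep_tens U (rep_tens U (T n))) :=
  hom_assoc U U (T n) <o> (hom_braid U U <x> hom_id (T n)) <o> hom_assocV U U (T n).

(** Exchange of the factors of index l and l + 1, counted from 0; the identity when there are no
    such factors. *)
Fixpoint sw l n : rep_hom (T n) (T n) :=
  match l, n return rep_hom (T n) (T n) with
  | 0, n'.+2 => swap_front n'
  | l'.+1, n'.+1 => hom_id U <x> sw l' n'
  | _, n => hom_id (T n)
  end.

Variable b : rep_hom (rep_tens U U) (unit_rep K).
Definition contract_front n : rep_hom (rep_tens U (rep_tens U (T n))) (T n) :=
  hom_lunit (T n) <o> (b <x> hom_id (T n)) <o> hom_assocV U U (T n).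

(** Contraction of the factors of index l and l + 1 by [b]; the value is 0 when l > n. *)
Fixpoint ct l n : rep_hom (T n.+2) (T n) :=
  match l, n return rep_hom (T n.+2) (T n) with
  | 0, n => contract_front n
  | l'.+1, n'.+1 => hom_id U <x> ct l' n'
  | _, n => hom_zero _ _
  end.

(** The product s_(l-1) ... s_0 of adjacent exchanges: it moves the first factor past the next l
    ones. *)
Fixpoint cyc l n : rep_hom (T n) (T n) :=
  if l is l'.+1 then sw l' n <o> cyc l' n else hom_id (T n).

Lemma sw0E n x y t : sw 0 n.+2 *m (x *# (y *# t)) = y *# (x *# t).
Proof. by rewrite !elE. Qed.
Lemma swSE l n x t : sw l.+1 n.+1 *m (x *# t) = x *# (sw l n *m t).
Proof. by rewrite !elE. Qed.
Lemma ct0E n x y t : ct 0 n *m (x *# (y *# t)) = (b *m (x *# y)) 0 0 *: t.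
Proof. by rewrite !elE. Qed.
Lemma ctSE l n x t : ct l.+1 n.+1 *m (x *# t) = x *# (ct l n *m t).
Proof. by rewrite !elE. Qed.

Lemma sw0K n : sw 0 n.+2 *m sw 0 n.+2 = 1%:M.
Proof. by apply: tens_extr => x y t; rewrite -mulmxA !sw0E mul1mx. Qed.

Lemma sw_braid n :
  sw 0 n.+3 *m (sw 1 n.+3 *m sw 0 n.+3) = sw 1 n.+3 *m (sw 0 n.+3 *m sw 1 n.+3).
Proof.
apply: tens_extrr => x y z t.
rewrite -(mulmxA (sw 0 n.+3)) -(mulmxA (sw 1 n.+3)) -(mulmxA (sw 1 n.+3)) -(mulmxA (sw 0 n.+3)).
by rewrite !(sw0E, swSE).
Qed.

Lemma sw0_nat n (A : 'M_(rep_dim (T n))) :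
  sw 0 n.+2 *m (1%:M *t (1%:M *t A)) = (1%:M *t (1%:M *t A)) *m sw 0 n.+2.
Proof.
apply: (@tens_extr _ U U (T n)) => x y t.
rewrite -(mulmxA (sw 0 n.+2)) -(mulmxA _ (sw 0 n.+2)) sw0E !mul_tens_tv !mul1mx.
by rewrite sw0E.
Qed.

Lemma cycS l n : cyc l.+1 n.+2 = (1%:M *t cyc l n.+1) *m sw 0 n.+2 :> 'M_(_, _).
Proof.
elim: l => [|l IHl]; first by rewrite [LHS]mulmx1 tensmx11 mul1mx.
change (sw l.+1 n.+2 *m cyc l.+1 n.+2 = (1%:M *t (sw l n.+1 *m cyc l n.+1)) *m sw 0 n.+2).
by rewrite IHl mulmxA /= tensmx_mul mul1mx.
Qed.

(** The component along the basis vector a of the first factor. Slicing lowers the number of tensor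
    factors by one, which is how statements on alternating tensors are proved by induction. *)
Definition slice m n q (a : 'I_m) (M : 'M[K]_(m * n, q)) : 'M[K]_(n, q) :=
  \matrix_(i, j) M (mxtens_index (a, i)) j.

Lemma slice_tens m n n' q (A : 'M[K]_(n', n)) a (M : 'M[K]_(m * n, q)) :
  slice a ((1%:M *t A) *m M) = A *m slice a M.
Proof.
apply/matrixP => i j; rewrite !mxE sum_tidx (bigD1 a) //= [X in _ + X]big1 ?[LHS]addr0.
  by apply: eq_bigr => l _; rewrite tensmxE !mxE eqxx mul1r.
by move=> c ca; rewrite big1 // => l _; rewrite tensmxE mxE eq_sym (negPf ca) !mul0r.
Qed.
Lemma slice_ext m n q (M M' : 'M[K]_(m * n, q)) :
  (forall a, slice a M = slice a M') -> M = M'.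
Proof.
move=> E; apply/matrixP => i j; case: (mxtens_indexP i) => a l.
by have /matrixP/(_ l j) := E a; rewrite !mxE.
Qed.
Lemma sliceN m n q a (M : 'M[K]_(m * n, q)) : slice a (- M) = - slice a M.
Proof. by apply/matrixP => i j; rewrite !mxE. Qed.
Lemma sliceZ m n q a c (M : 'M[K]_(m * n, q)) : slice a (c *: M) = c *: slice a M.
Proof. by apply/matrixP => i j; rewrite !mxE. Qed.

(* The columns of M are alternating tensors; those of [alt_tail] are
   alternating in all the factors but the first one. *)
Definition alternating n q (M : 'M[K]_(rep_dim (T n), q)) :=
  forall l, (l.+1 < n)%N -> sw l n *m M = - M.
Definition alt_tail n q (M : 'M[K]_(rep_dim (T n), q)) :=
  forall l, (l.+2 < n)%N -> sw l.+1 n *m M = - M.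

Lemma alt_slice n q (M : 'M_(rep_dim (T n.+1), q)) :
  alt_tail M <-> forall a, alternating (slice a M).
Proof.
split=> [altM a l ln|altM l ln].
  by rewrite -slice_tens -sliceN; congr slice; apply: altM.
by apply: slice_ext => a; rewrite sliceN -(altM a l ln) -slice_tens.
Qed.
Lemma alt_tailW n q (M : 'M_(rep_dim (T n), q)) : alternating M -> alt_tail M.
Proof. by move=> altM l; apply: altM. Qed.

Lemma alt_tail_tens n q (A : 'M_(rep_dim (T n), q)) :
  alternating A -> alt_tail ((1%:M : 'M_(rep_dim U)) *t A : 'M_(rep_dim (T n.+1), _)).
Proof.
move=> altA l ln; rewrite /= tensmx_mul mul1mx (altA l ln).
by apply: tv_ext => x y; rewrite mulNmx !mul_tens_tv mulNmx tvNr.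
Qed.

Lemma alt_tail_sw0 n q (M : 'M_(rep_dim (T n.+2), q)) a :
  alt_tail M -> @alt_tail n.+1 q (slice a (sw 0 n.+2 *m M)).
Proof.
case: n M => [|n] M altM //; apply/alt_slice => c l ln.
have -> : sw l n.+1 *m slice c (slice a (sw 0 n.+3 *m M)) =
    slice c (slice a ((1%:M *t (1%:M *t sw l n.+1)) *m (sw 0 n.+3 *m M))).
  by rewrite !slice_tens.
rewrite (mulmxA _ (sw 0 n.+3)) -sw0_nat -(mulmxA (sw 0 n.+3)).
have -> : (1%:M *t (1%:M *t sw l n.+1)) *m M = - M by exact: (altM l.+1).
by rewrite mulmxN !sliceN.
Qed.

(* The alternating sum of the insertions of the first factor at all places. *)
Definition shuffle n : rep_hom (T n.+1) (T n.+1) :=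
  hom_sum (iota 0 n.+1) (fun i => hom_scale ((-1) ^+ i) (cyc i n.+1)).

Lemma shuffleE n : shuffle n = \sum_(0 <= i < n.+1) (-1) ^+ i *: hom_mx (cyc i n.+1) :> 'M_(_, _).
Proof. by rewrite hom_sumE /index_iota subn0. Qed.

Lemma tensmxDr m n p q (A : 'M[K]_(m, n)) (B B' : 'M[K]_(p, q)) : A *t (B + B') = A *t B + A *t B'.
Proof. by apply: tv_ext => x y; rewrite mulmxDl !mul_tens_tv mulmxDl tvDr. Qed.
Lemma tensmxZr m n p q c (A : 'M[K]_(m, n)) (B : 'M[K]_(p, q)) : A *t (c *: B) = c *: (A *t B).
Proof. by apply: tv_ext => x y; rewrite -scalemxAl !mul_tens_tv -scalemxAl tvZr. Qed.
Lemma tensmxNr m n p q (A : 'M[K]_(m, n)) (B : 'M[K]_(p, q)) : A *t (- B) = - (A *t B).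
Proof. by rewrite -scaleN1r tensmxZr scaleN1r. Qed.
Lemma tensmx_sumr m n p q I (s : seq I) P (A : 'M[K]_(m, n)) (F : I -> 'M[K]_(p, q)) :
  A *t (\sum_(i <- s | P i) F i) = \sum_(i <- s | P i) A *t F i.
Proof.
by elim/big_rec2: _ => [|i u v _ <-]; rewrite ?tensmx0 ?tensmxDr.
Qed.

(** Either the first factor stays in place, or it is exchanged with the second one and then inserted
    among the remaining ones. *)
Lemma shuffleS n :
  shuffle n.+1 = 1%:M - (1%:M *t shuffle n) *m sw 0 n.+2 :> 'M_(_, _).
Proof.
rewrite !shuffleE big_nat_recl // expr0 scale1r; congr (_ + _).
rewrite tensmx_sumr mulmx_suml -sumrN; apply: eq_bigr => i _.
by rewrite (cycS i n) tensmxZr -scalemxAl exprS mulN1r scaleNr.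
Qed.

(** Put N = (1 - A s1) s0. The braid relation and s1 M = - M give s0 N M = M + A s1 s0 M, whence s0
    (1 - N) M = - (1 - N) M. With A the shuffle on the later factors this is the exchange of the
    first two factors in [shuffle_alt]. *)
Lemma antisym_braid d q (s0 s1 A : 'M[K]_d) (M : 'M_(d, q)) :
  s0 *m s0 = 1%:M -> s0 *m (s1 *m s0) = s1 *m (s0 *m s1) -> s0 *m A = A *m s0 -> s1 *m M = - M ->
  s0 *m ((1%:M - (1%:M - A *m s1) *m s0) *m M) = - ((1%:M - (1%:M - A *m s1) *m s0) *m M).
Proof.
move=> K0 br cA sM; set N := _ *m s0.
have E1 : s0 *m (N *m M) = M + A *m (s1 *m (s0 *m M)).
  rewrite /N mulmxBl mul1mx mulmxBl mulmxBr mulmxA K0 mul1mx -!mulmxA (mulmxA s0 A) cA.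
  by rewrite -mulmxA (mulmxA s1) (mulmxA s0) br -!mulmxA sM !mulmxN opprK.
rewrite mulmxBl mulmxBr mul1mx E1 /N mulmxBl mul1mx mulmxBl -!mulmxA.
by rewrite opprB opprD addrA addrAC.
Qed.

(** In the recursion [shuffleS], exchanges beyond the first factor are controlled by induction on
    the slices; the exchange of the first two factors needs two steps of the recursion and the braid
    relation. *)
Lemma shuffle_alt n q (M : 'M_(rep_dim (T n.+1), q)) : alt_tail M -> alternating (shuffle n *m M).
Proof.
elim: n q M => [|n IHn] q M altM l // ln.
have altQ : alt_tail ((1%:M *t shuffle n) *m (sw 0 n.+2 *m M) : 'M_(rep_dim (T n.+2), q)).
  by apply/alt_slice => a; rewrite slice_tens; apply: IHn; apply: alt_tail_sw0.
rewrite shuffleS mulmxBl mul1mx -mulmxA; case: l ln => [_|l ln]; last first.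
  by rewrite mulmxBr altQ // altM // opprB opprK addrC.
case: n {IHn altQ} M altM => [|n] M altM.
  rewrite shuffleE big_nat1 expr0 scale1r tensmx11 mul1mx.
  by rewrite mulmxBr mulmxA sw0K mul1mx opprB.
have E : sw 1 n.+3 *m M = - M by apply: altM.
rewrite shuffleS; set Q := hom_mx (shuffle n).
have -> : 1%:M *t (1%:M - (1%:M *t Q) *m sw 0 n.+2)
    = 1%:M - (1%:M *t (1%:M *t Q)) *m sw 1 n.+3 :> 'M_(rep_dim (T n.+3)).
  by rewrite tensmxDr tensmxNr tensmx11 -[X in X *t (_ *m _)]mulmx1 -tensmx_mul.
by have := antisym_braid (sw0K _) (sw_braid _) (sw0_nat Q) E; rewrite mulmxBl mul1mx -mulmxA.
Qed.

Lemma trmxZ m n c (A : 'M[K]_(m, n)) : (c *: A)^T = c *: A^T.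
Proof. by apply/matrixP => i j; rewrite !mxE. Qed.
Lemma trmx_sum m n I (s : seq I) P (F : I -> 'M[K]_(m, n)) :
  (\sum_(i <- s | P i) F i)^T = \sum_(i <- s | P i) (F i)^T.
Proof. exact: raddf_sum. Qed.

(** The antisymmetrizer, 1/n! times the signed sum over all permutations, built by inserting one
    factor at a time so that only divisions by single integers occur. *)
Fixpoint antisym n : rep_hom (T n) (T n) :=
  match n return rep_hom (T n) (T n) with
  | 0 => hom_id _
  | n'.+1 => hom_scale (n'.+1%:R^-1) (shuffle n' <o> (hom_id U <x> antisym n'))
  end.

Lemma antisymS n : antisym n.+1 = n.+1%:R^-1 *: (shuffle n *m (1%:M *t antisym n)) :> 'M_(_, _).
Proof. by []. Qed.

Lemma antisym_alt n : alternating (antisym n).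
Proof.
elim: n => [|n IHn] // l ln; rewrite antisymS -scalemxAr -scalerN; congr (_ *: _).
by apply: shuffle_alt ln; apply: alt_tail_tens.
Qed.

Lemma altM n q r (M : 'M_(rep_dim (T n), q)) (A : 'M_(q, r)) : alternating M -> alternating (M *m A).
Proof. by move=> aM l ln; rewrite mulmxA aM // mulNmx. Qed.

Lemma cyc_alt n q (M : 'M_(rep_dim (T n), q)) l : alternating M -> (l < n)%N ->
  cyc l n *m M = (-1) ^+ l *: M.
Proof.
move=> aM; elim: l => [|l IHl] ln; first by rewrite mul1mx scale1r.
by rewrite /= -mulmxA IHl 1?ltnW // -scalemxAr aM // exprS mulN1r scaleNr scalerN.
Qed.

Lemma swT l n : (sw l n)^T = sw l n.
Proof.
elim: l n => [|l IHl] n; last first.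
  case: n => [|n]; first exact: trmx1.
  by have := trmx_tens (1%:M : 'M[K]_(rep_dim U)) (sw l n); rewrite trmx1 IHl.
case: n => [|[|n]]; rewrite ?trmx1 //.
apply/matrixP => i j; rewrite mxE.
have E (k k' : 'I_(rep_dim (T n.+2))) :
    swap_front n k k' = (k == mxtens_index ((mxtens_unindex (mxtens_unindex k').2).1,
      mxtens_index ((mxtens_unindex k').1, (mxtens_unindex (mxtens_unindex k').2).2)))%:R.
  case: (mxtens_indexP k') => c k2; case: (mxtens_indexP k2) => d e.
  have := sw0E (ev c) (ev d) (ev e : 'cV_(rep_dim (T n))); rewrite !tv_delta -colE => /colP/(_ k).
  by rewrite !mxE !mxtens_indexK eqxx andbT.
rewrite !E; case: (mxtens_indexP i) => c k2; case: (mxtens_indexP k2) => d e.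
case: (mxtens_indexP j) => c' k2'; case: (mxtens_indexP k2') => d' e'.
rewrite !mxtens_indexK /= !(can_eq (@mxtens_indexK _ _)) !xpair_eqE !(can_eq (@mxtens_indexK _ _)) !xpair_eqE.
by rewrite ![c' == _]eq_sym [d' == _]eq_sym [e' == _]eq_sym andbCA.
Qed.

Lemma cycT_alt n q (M : 'M_(rep_dim (T n), q)) l : alternating M -> (l < n)%N ->
  (cyc l n)^T *m M = (-1) ^+ l *: M.
Proof.
move=> aM; elim: l => [|l IHl] ln; first by rewrite trmx1 mul1mx scale1r.
by rewrite /= trmx_mul swT -mulmxA aM // mulmxN IHl 1?ltnW // exprS mulN1r scaleNr.
Qed.

Hypothesis charK : forall i : nat, (0 < i <= (rep_dim U).+1)%N -> i%:R != 0 :> K.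

Lemma sum_alt n q (M : 'M[K]_(rep_dim (T n.+1), q)) : 
  \sum_(0 <= i < n.+1) (-1) ^+ i *: ((-1) ^+ i *: M) = n.+1%:R *: M.
Proof.
under eq_bigr do rewrite scalerA -expr2 sqrr_sign scale1r.
by rewrite big_const_nat subn0 iter_addr_0 scaler_nat.
Qed.

Lemma antisym_id n q (M : 'M_(rep_dim (T n), q)) : (n <= (rep_dim U).+1)%N ->
  alternating M -> antisym n *m M = M.
Proof.
elim: n q M => [|n IHn] q M nU aM; first by rewrite mul1mx.
rewrite antisymS -scalemxAl -mulmxA.
have -> : (1%:M *t antisym n) *m M = M.
  by apply: slice_ext => a; rewrite slice_tens (IHn _ _ (ltnW nU) ((alt_slice M).1 (alt_tailW aM) a)).
rewrite shuffleE mulmx_suml.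
rewrite (eq_big_nat _ _ (F2 := fun i => (-1) ^+ i *: ((-1) ^+ i *: M))); last first.
  by move=> i /andP[_ iln]; rewrite -scalemxAl cyc_alt.
by rewrite sum_alt scalerA mulVf ?scale1r // charK.
Qed.
Lemma antisymT_id n q (M : 'M_(rep_dim (T n), q)) : (n <= (rep_dim U).+1)%N ->
  alternating M -> (antisym n)^T *m M = M.
Proof.
elim: n q M => [|n IHn] q M nU aM; first by rewrite trmx1 mul1mx.
rewrite antisymS shuffleE trmxZ trmx_mul trmx_sum -scalemxAl -mulmxA mulmx_suml.
rewrite (eq_big_nat _ _ (F2 := fun i => (-1) ^+ i *: ((-1) ^+ i *: M))); last first.
  by move=> i /andP[_ iln]; rewrite trmxZ -scalemxAl (cycT_alt aM iln).
rewrite sum_alt trmx_tens trmx1 -scalemxAr scalerA mulVf ?charK // scale1r.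
by apply: slice_ext => a; rewrite slice_tens (IHn _ _ (ltnW nU) ((alt_slice M).1 (alt_tailW aM) a)).
Qed.
(** Let P be the antisymmetrizer. Its transpose fixes alternating tensors, in particular the columns
    of P, so P = P^T P is symmetric. *)
Lemma antisymT n : (n <= (rep_dim U).+1)%N -> (antisym n)^T = antisym n.
Proof.
move=> nU; have E := antisymT_id nU (@antisym_alt n).
by rewrite -{1}E trmx_mul trmxK.
Qed.

Fixpoint word (w : seq 'I_(rep_dim U)) : 'I_(rep_dim (T (size w))) :=
  match w return 'I_(rep_dim (T (size w))) with
  | [::] => ord0
  | a :: w' => mxtens_index (a, word w')
  end.

(** Basis indices of the n-th tensor power are words of length n. The cast is there because the
    length of a word equals n only propositionally. *)
Lemma wordP n (P : 'I_(rep_dim (T n)) -> Prop) :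
  (forall w (e : size w = n), P (ecast n 'I_(rep_dim (T n)) e (word w))) -> forall i, P i.
Proof.
elim: n P => [|n IHn] P H i; first by have := H [::] erefl; rewrite [i]ord1.
case: (mxtens_indexP i) => a; apply: (IHn (fun j => P (mxtens_index (a, j)))) => w e.
by move: {IHn} P i H; case: _ / e => P i H; exact: H (a :: w) erefl.
Qed.

Lemma sw0_row n q (M : 'M[K]_(rep_dim (T n.+2), q)) a c (i : 'I_(rep_dim (T n))) j :
  (sw 0 n.+2 *m M) (mxtens_index (c, mxtens_index (a, i))) j
  = M (mxtens_index (a, mxtens_index (c, i))) j.
Proof.
set k := mxtens_index (c, _); set k' := mxtens_index (a, _).
have E : delta_mx (0 : 'I_1) k *m sw 0 n.+2 = delta_mx 0 k'.
  apply: (@tens_extr _ U U (T n)) => x y t; rewrite -(mulmxA _ (sw 0 n.+2)) sw0E -!rowE.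
  by apply/rowP => l; rewrite !mxE /k /k' !mxtens_indexK /= mulrCA.
transitivity ((delta_mx 0 k *m (sw 0 n.+2 *m M)) (0 : 'I_1) j); first by rewrite -(rowE k (sw 0 n.+2 *m M)) [RHS]mxE.
by rewrite mulmxA E -rowE [LHS]mxE.
Qed.

(** If the repetition lies in the tail, pass to a slice. Otherwise the first letter recurs in the
    tail: exchanging it with the second letter changes the sign and moves the repetition into the
    tail, unless the two letters are equal, when the coefficient is its own opposite. *)
Lemma alt_word_eq0 w q (M : 'M_(rep_dim (T (size w)), q)) j : 2%:R != 0 :> K ->
  alternating M -> ~~ uniq w -> M (word w) j = 0.
Proof.
move=> K2; have [n] := ubnP (size w); elim: n w q M j => // n IHn [|a w] q M j //= wn aM nu.
have altS c : alternating (slice c M) := (alt_slice M).1 (alt_tailW aM) c.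
have [uw|nuw] := boolP (uniq w); last by have := IHn _ _ _ j wn (altS a) nuw; rewrite mxE.
move: nu; rewrite uw andbT negbK => aw.
case: w uw aw wn M aM altS => [|c w] // uw aw wn M aM altS.
have E : M (word (a :: c :: w)) j = - M (word (c :: a :: w)) j.
  have aM0 := aM 0%N isT; have := sw0_row M a c (word w) j.
  by rewrite aM0 mxE => /(canRL (@opprK _)) ->; rewrite opprK.
have [ac|ac] := eqVneq a c.
  move: E; rewrite ac => /eqP; rewrite -addr_eq0 -mulr2n -mulr_natl mulf_eq0 (negPf K2).
  by move/eqP.
have nu : ~~ uniq (a :: w).
  by move: aw; rewrite inE (negPf ac) /= => ->.
rewrite [LHS]E; have := IHn (a :: w) _ _ j wn (altS c) nu; rewrite mxE => ->.
by rewrite oppr0.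
Qed.
End AlternatingTensors.

(** * Families of maps on tensor powers that satisfy a Clifford relation *)

Section TensorFamily.
Variables (K : closedFieldType) (U : rep K) (b : rep_hom (rep_tens U U) (unit_rep K)).
Local Notation T := (tens_pow U).
Local Notation ct := (ct b).
Local Notation sw := (sw U).
Local Notation cyc := (cyc U).

Lemma contract_swap n : (1%:M *t ct 0 n) *m sw 0 n.+3 = ct 0 n.+1 *m sw 1 n.+3
  :> 'M_(rep_dim (T n.+1), rep_dim (T n.+3)).
Proof.
apply: (@tens_extrr _ U U U (T n)) => x y z t.
rewrite -(mulmxA _ (sw 0 n.+3)) -(mulmxA _ (sw 1 n.+3)) sw0E swSE sw0E mul_tens_tv mul1mx.
by rewrite !ct0E tvZr.
Qed.

(** Contracting the moved factor with its new neighbour amounts, up to the sign (-1)^l, to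
    contracting it at the front, since the other factors are alternating. *)
Lemma contract_cyc l n q (M : 'M[K]_(rep_dim (T n.+2), q)) : (l <= n)%N -> alt_tail M ->
  ct l n *m (cyc l n.+2 *m M) = (-1) ^+ l *: (ct 0 n *m M).
Proof.
elim: l n q M => [|l IHl] n q M; first by rewrite mul1mx expr0 scale1r.
case: n M => [|n] M // ln aM; rewrite cycS -mulmxA.
rewrite [ct l.+1 _ *m _](_ : _ = (1%:M *t ct l n) *m
   ((1%:M *t cyc l n.+2) *m (sw 0 n.+3 *m M))) //.
have -> : (1%:M *t ct l n) *m ((1%:M *t cyc l n.+2) *m (sw 0 n.+3 *m M))
    = (-1) ^+ l *: ((1%:M *t ct 0 n) *m (sw 0 n.+3 *m M)).
  apply: slice_ext => a; rewrite sliceZ !slice_tens IHl //; exact: alt_tail_sw0.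
rewrite mulmxA contract_swap -mulmxA aM // mulmxN scalerN exprS mulN1r scaleNr.
by [].
Qed.

(** An abstract notion of equality of maps. It is instantiated both by equality of matrices, for the
    traces and products of gammas, and by [hom_eq], for the families that kill the ideal. *)
Variable R : forall X Y : rep K, rep_hom X Y -> rep_hom X Y -> Prop.
Hypothesis Req : forall X Y, Equivalence (@R X Y).
Hypothesis Rcomp : forall X Y Z (f g : rep_hom Y Z) (h : rep_hom X Y), R f g -> R (f <o> h) (g <o> h).
Hypothesis Radd : forall X Y (f g f' g' : rep_hom X Y), R f g -> R f' g' -> R (hom_add f f') (hom_add g g').
Hypothesis Rscale : forall X Y c (f g : rep_hom X Y), R f g -> R (hom_scale c f) (hom_scale c g).
Hypothesis Rmx : forall X Y (f g : rep_hom X Y), f = g :> 'M_(_, _) -> R f g.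

(** [W] is an object of parameters: in the induction of [family_factor] it absorbs the vectors that
    have already been split off. *)
Variables (W Y : rep K) (F : forall n, rep_hom (rep_tens W (T n)) Y).
Hypothesis Frel : forall l n, (l <= n)%N ->
  R (F n.+2 <o> (hom_id W <x> hom_add (hom_id _) (sw l n.+2))) (F n <o> (hom_id W <x> ct l n)).

(** Each exchange costs a sign and a contraction, and by [contract_cyc] the l contractions agree up
    to sign; hence the coefficient l. *)
Lemma family_cyc n q (y : rep_hom q (T n.+2)) l : alt_tail y -> (l <= n.+1)%N ->
  R (F n.+2 <o> (hom_id W <x> (cyc l n.+2 <o> y)))
    (hom_scale ((-1) ^+ l) (hom_add (F n.+2 <o> (hom_id W <x> y))
       (hom_scale (- l%:R) (F n <o> (hom_id W <x> (ct 0 n <o> y)))))).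
Proof.
move=> ay; elim: l => [|l IHl] ln.
  by apply: Rmx; apply: tens_ext => w t; rewrite hom_scaleE hom_addE hom_scaleE oppr0 scale0r addr0 scale1r !elE.
have E1 : R (F n.+2 <o> (hom_id W <x> (cyc l.+1 n.+2 <o> y)))
   (hom_add (F n.+2 <o> (hom_id W <x> hom_add (hom_id _) (sw l n.+2)) <o> (hom_id W <x> (cyc l n.+2 <o> y)))
     (hom_scale (-1) (F n.+2 <o> (hom_id W <x> (cyc l n.+2 <o> y))))).
  apply: Rmx; apply: tens_ext => w t; rewrite !elE !hom_scaleE !elE.
  by rewrite tvDr mulmxDr scaleN1r [X in X - _]addrC addrK.
apply: (Equivalence_Transitive _ _ _ E1).
have E2 := Radd (Rcomp (hom_id W <x> (cyc l n.+2 <o> y)) (Frel (l := l) (n := n) ln)) (Rscale (-1) (IHl (ltnW ln))).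
apply: (Equivalence_Transitive _ _ _ E2); apply: Rmx; apply: tens_ext => w t.
have cz : ct l n *m (cyc l n.+2 *m (y *m t)) = (-1) ^+ l *: (ct 0 n *m (y *m t)).
  transitivity ((ct l n *m (cyc l n.+2 *m y)) *m t); first by rewrite -(mulmxA (ct l n)) -(mulmxA (cyc l n.+2)).
  by rewrite (@contract_cyc l n _ y ln ay) -scalemxAl -(mulmxA (ct 0 n)).
move: (ct 0 n) cz => c0 cz.
rewrite !elE !hom_scaleE !elE !hom_scaleE !elE cz tvZr -scalemxAr exprS mulN1r mulrS.
by apply/matrixP => i j; rewrite !mxE; ring.
Qed.

(** Sum of [family_cyc] over the n + 2 places: the signs cancel, and the contractions are counted by
    0 + 1 + ... + (n + 1), which is the binomial coefficient. *)
Lemma family_antisym n q (y : rep_hom q (T n.+2)) : alt_tail y ->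
  R (F n.+2 <o> (hom_id W <x> (shuffle U n.+1 <o> y)))
    (hom_add (hom_scale n.+2%:R (F n.+2 <o> (hom_id W <x> y)))
       (hom_scale (- 'C(n.+2, 2)%:R) (F n <o> (hom_id W <x> (ct 0 n <o> y))))).
Proof.
move=> ay.
pose G m := hom_sum (iota 0 m) (fun i => hom_scale ((-1) ^+ i) (F n.+2 <o> (hom_id W <x> (cyc i n.+2 <o> y)))).
have EG : R (F n.+2 <o> (hom_id W <x> (shuffle U n.+1 <o> y))) (G n.+2).
  apply: Rmx; rewrite hom_sumE; apply: tens_ext => w t.
  rewrite hom_compE hom_tensE hom_idE hom_compE shuffleE /index_iota subn0 mulmx_suml tv_sumr mulmx_sumr mulmx_suml; apply: eq_bigr => i _.
  by rewrite hom_scaleE !elE -scalemxAl tvZr -scalemxAr.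
apply: (Equivalence_Transitive _ _ _ EG).
suff H m : (m <= n.+2)%N -> R (G m) (hom_add (hom_scale m%:R (F n.+2 <o> (hom_id W <x> y)))
       (hom_scale (- 'C(m, 2)%:R) (F n <o> (hom_id W <x> (ct 0 n <o> y))))) by exact: H.
elim: m => [|m IHm] mn.
  apply: Rmx; apply: tens_ext => w t; rewrite hom_addE !hom_scaleE [LHS]hom_zeroE bin0n.
  by rewrite oppr0 !scale0r addr0.
have E1 : R (G m.+1) (hom_add (G m) (hom_scale ((-1) ^+ m) (F n.+2 <o> (hom_id W <x> (cyc m n.+2 <o> y))))).
  have e : iota 0 m.+1 = iota 0 m ++ [:: m] by rewrite -addn1 iotaD add0n.
  by apply: Rmx; rewrite /G e [LHS]hom_sumE big_cat big_seq1 -hom_sumE.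
apply: (Equivalence_Transitive _ _ _ E1).
have E2 := Radd (IHm (ltnW mn)) (Rscale ((-1) ^+ m) (family_cyc ay mn)).
apply: (Equivalence_Transitive _ _ _ E2); apply: Rmx; apply: tens_ext => w t.
move: (ct 0 n) => c0.
rewrite !elE !hom_scaleE !elE !hom_scaleE !elE scalerA -expr2 sqrr_sign scale1r.
rewrite binS bin1 natrD mulrS.
by apply/matrixP => i j; rewrite !mxE; ring.
Qed.
End TensorFamily.

(** * Sections of the Clifford multiplication, obtained from traces *)

Section Clifford.
Variables (K : closedFieldType) (V S : rep K) (gam : rep_hom (rep_tens V S) S).
Local Notation N := (rep_dim V).
Local Notation T := (tens_pow V).
Local Notation E := (inner_hom S S).
Local Notation antisym := (antisym V).
Local Notation shuffle := (shuffle V).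

Definition dotv (v w : 'cV[K]_N) : K := (v^T *m w) 0 0.

Hypothesis orth : forall g, \det g = 1 -> (rep_act V g)^T *m rep_act V g = 1%:M.
Hypothesis cliff : forall v w x,
  gam *m (v *# (gam *m (w *# x))) + gam *m (w *# (gam *m (v *# x))) = (2%:R * dotv v w) *: x.

Definition dot_mx : 'M[K]_(1, N * N) :=
  \matrix_(i, l) ((mxtens_unindex l).1 == (mxtens_unindex l).2)%:R.

Lemma dot_mxE v w : dot_mx *m (v *# w) = (dotv v w)%:M.
Proof.
apply/matrixP => i j; rewrite !ord1 [RHS]mxE eqxx mulr1n /dotv !mxE sum_tidx; apply: eq_bigr => a _.
rewrite (bigD1 a) //= [X in _ + X]big1 ?[LHS]addr0 => [|c ca].
  by rewrite mxE mxtens_indexK eqxx mul1r mxE mxtens_indexK mxE.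
by rewrite mxE mxtens_indexK eq_sym (negPf ca) mul0r.
Qed.

Lemma dot_proof : is_equivariant (X := rep_tens V V) (Y := unit_rep K) dot_mx.
Proof.
move=> g dg; rewrite mul1mx; apply: tens_ext => v w.
rewrite -mulmxA mul_tens_tv !dot_mxE /dotv trmx_mul mulmxA -(mulmxA _ _ (rep_act V g)).
by rewrite orth // mulmx1.
Qed.
Definition dot_hom : rep_hom (rep_tens V V) (unit_rep K) := RepHom dot_proof.
Definition cliff_form := hom_scale 2%:R dot_hom.
Local Notation ct := (ct cliff_form).

Lemma cliff_formE v w : cliff_form *m (v *# w) = (2%:R * dotv v w)%:M.
Proof. by rewrite hom_scaleE dot_mxE scale_scalar_mx. Qed.

Definition actE : rep_hom (rep_tens V E) E :=
  (gam <x> hom_id (dual_rep S)) <o> hom_assocV V S (dual_rep S).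

Lemma actEE v (x d : 'cV_(rep_dim S)) : actE *m (v *# (x *# d)) = (gam *m (v *# x)) *# d.
Proof. by rewrite !elE. Qed.

Lemma cliff_actE v w q :
  actE *m (v *# (actE *m (w *# q))) + actE *m (w *# (actE *m (v *# q))) = (2%:R * dotv v w) *: q.
Proof.
elim/tens_elim: q => [q q' Hq Hq'|x d].
  by rewrite !(tvDr, mulmxDr) addrACA Hq Hq' scalerDr.
by rewrite !actEE -tvDl cliff tvZl.
Qed.

(** The trace on End(S). The maps [trD] send q and v_1, ..., v_n to the trace of gamma(v_n) ...
    gamma(v_1) q; the order is reversed because a product of distinct orthonormal gammas has the
    reversed product as its inverse. *)
Definition trE : rep_hom E (unit_rep K) := hom_ev S <o> hom_braid S (dual_rep S).

Fixpoint trD n : rep_hom (rep_tens E (T n)) (unit_rep K) :=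
  match n return rep_hom (rep_tens E (T n)) (unit_rep K) with
  | 0 => trE <o> hom_runit E
  | n'.+1 => trD n' <o> ((actE <o> hom_braid E V) <x> hom_id (T n')) <o> hom_assocV E V (T n')
  end.

Fixpoint gam_prod n : rep_hom (T n) E :=
  match n return rep_hom (T n) E with
  | 0 => hom_coev S
  | n'.+1 => actE <o> (hom_id V <x> gam_prod n')
  end.

Lemma trDS n q v (t : 'cV_(rep_dim (T n))) :
  trD n.+1 *m (q *# (v *# t)) = trD n *m ((actE *m (v *# q)) *# t).
Proof.
rewrite [trD n.+1](_ : _ = trD n <o> ((actE <o> hom_braid E V) <x> hom_id (T n)) <o> hom_assocV E V (T n)) //.
by rewrite 2!hom_compE assocVE hom_tensE hom_idE hom_compE braidE.
Qed.
Lemma gam_prodS n v t : gam_prod n.+1 *m (v *# t) = actE *m (v *# (gam_prod n *m t)).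
Proof.
rewrite [gam_prod n.+1](_ : _ = actE <o> (hom_id V <x> gam_prod n)) //.
by rewrite hom_compE hom_tensE hom_idE.
Qed.

Lemma trD_rel l n q t : (l <= n)%N ->
  trD n.+2 *m (q *# (t + sw V l n.+2 *m t)) = trD n *m (q *# (ct l n *m t)).
Proof.
elim: l n q t => [|l IHl] n q t.
  move=> _; elim/tens_elim: t => [t t' Ht Ht'|v t].
    by rewrite mulmxDr addrACA tvDr mulmxDr Ht Ht' [in RHS]mulmxDr tvDr mulmxDr.
  elim/tens_elim: t => [t t' Ht Ht'|w t].
    by rewrite tvDr mulmxDr addrACA tvDr mulmxDr Ht Ht' [in RHS]mulmxDr tvDr mulmxDr.
  rewrite sw0E ct0E cliff_formE mxE eqxx mulr1n tvDr mulmxDr !trDS -mulmxDr -tvDl.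
  by rewrite [X in X *# t]addrC cliff_actE tvZl tvZr.
case: n t => [|n] t // ln; elim/tens_elim: t => [t t' Ht Ht'|v t].
  by rewrite mulmxDr addrACA tvDr mulmxDr Ht Ht' [in RHS]mulmxDr tvDr mulmxDr.
by rewrite swSE ctSE -tvDr !trDS IHl.
Qed.

Lemma orthT n g : \det g = 1 -> (rep_act (T n) g)^T *m rep_act (T n) g = 1%:M.
Proof.
move=> dg; elim: n => [|n IHn]; first by rewrite mulmx1 trmx1.
by rewrite /= trmx_tens tensmx_mul orth // IHn tensmx11.
Qed.

Hypothesis charK : forall i : nat, (0 < i <= N.+1)%N -> i%:R != 0 :> K.
Hypothesis oddN : odd N.
Hypothesis dimS : (rep_dim S)%:R != 0 :> K.

Lemma fact_neq0 j : (j <= N.+1)%N -> j`!%:R != 0 :> K.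
Proof.
elim: j => [|j IHj] jN; first by rewrite fact0 oner_neq0.
by rewrite factS natrM mulf_neq0 //; [apply: charK | apply: IHj (ltnW jN)].
Qed.
Lemma two_neq0 : 2%:R != 0 :> K.
Proof. by apply: charK; case: N oddN. Qed.

(** On a product q of j distinct orthonormal gammas, the traces against the j! reorderings of its
    letters are dim S up to sign; this is the factor that makes [sec_mx] a section. *)
Definition sec_coef j : K := ((rep_dim S)%:R * j`!%:R)^-1.
Definition trD_mx j : 'M[K]_(rep_dim (T j), rep_dim E) :=
  \matrix_(i, e) trD j 0 (mxtens_index (e, i)).
Definition sec_mx j := sec_coef j *: (antisym j *m trD_mx j).

Lemma sec_coef_neq0 j : (j <= N.+1)%N -> sec_coef j != 0.
Proof. by move=> jN; rewrite invr_eq0 mulf_neq0 ?fact_neq0. Qed.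

Lemma trD_mxE j y q : (y^T *m (trD_mx j *m q)) = trD j *m (q *# y).
Proof.
apply/matrixP => a b; rewrite !ord1 !mxE sum_tidx exchange_big; apply: eq_bigr => i _ /=.
rewrite !mxE mulr_sumr; apply: eq_bigr => e _.
by rewrite !mxE mxtens_indexK /= mulrC -mulrA.
Qed.

Lemma sec_mxE j x q : (j <= N.+1)%N ->
  x^T *m (sec_mx j *m q) = sec_coef j *: (trD j *m (q *# (antisym j *m x))).
Proof.
move=> jN; rewrite -trD_mxE trmx_mul (antisymT charK jN) /sec_mx -scalemxAl -scalemxAr.
by rewrite -!mulmxA.
Qed.

Lemma vec_eq n (u u' : 'cV[K]_n) : (forall x : 'cV_n, x^T *m u = x^T *m u') -> u = u'.
Proof.
move=> E; apply/colP => i; have := E (ev i); rewrite trmx_delta -!rowE.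
by move/matrixP/(_ 0 0); rewrite !mxE.
Qed.

Lemma antisym_act j g (x : 'cV_(rep_dim (T j))) : \det g = 1 -> antisym j *m (rep_act (T j) g *m x) = rep_act (T j) g *m (antisym j *m x).
Proof. by move=> dg; rewrite !mulmxA homP. Qed.

(** Tested against a vector x, the map is [trD] on q and the antisymmetrized x; both [trD] and the
    antisymmetrizer are equivariant, and the tensor powers of V are orthogonal, so the transposed
    action is the inverse one. *)
Lemma sec_proof j : (j <= N.+1)%N -> is_equivariant (X := E) (Y := T j) (sec_mx j).
Proof.
move=> jN g dg; apply: cV_ext => q; rewrite -!mulmxA; apply: vec_eq => x.
have oT := orthT j dg; have oT' := mulmx1C oT.
rewrite (sec_mxE _ _ jN) mulmxA -[in RHS](trmxK (rep_act (T j) g)) -trmx_mul (sec_mxE _ _ jN).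
rewrite -{1}[x]mul1mx -oT' -mulmxA antisym_act //.
have -> : (rep_act E g *m q) *# (rep_act (T j) g *m (antisym j *m ((rep_act (T j) g)^T *m x))) =
    rep_act (rep_tens E (T j)) g *m (q *# (antisym j *m ((rep_act (T j) g)^T *m x))).
  by rewrite mul_tens_tv.
by rewrite [in LHS]mulmxA homP // mul1mx.
Qed.

(** For j <= N + 1 the factorial j! is invertible and [sec_mx] is equivariant; outside this range
    the value is set to 0. *)
Definition sec j : rep_hom E (T j) :=
  if leqP j N.+1 is LeqNotGtn jN then RepHom (sec_proof jN) else hom_zero _ _.

Lemma secE j : (j <= N.+1)%N -> sec j = sec_mx j :> 'M_(_, _).
Proof. by rewrite /sec; case: leqP. Qed.

Definition strict_eq X Y (f g : rep_hom X Y) : Prop := f = g :> 'M[K]_(_, _).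

Lemma strict_equiv X Y : Equivalence (@strict_eq X Y).
Proof. by split=> [f|f g|f g h]; rewrite /strict_eq // => -> . Qed.
Lemma strict_comp X Y Z (f g : rep_hom Y Z) (h : rep_hom X Y) :
  strict_eq f g -> strict_eq (f <o> h) (g <o> h).
Proof. by rewrite /strict_eq /= => ->. Qed.
Lemma strict_add X Y (f g f' g' : rep_hom X Y) :
  strict_eq f g -> strict_eq f' g' -> strict_eq (hom_add f f') (hom_add g g').
Proof. by rewrite /strict_eq /= => -> ->. Qed.
Lemma strict_scale X Y c (f g : rep_hom X Y) : strict_eq f g -> strict_eq (hom_scale c f) (hom_scale c g).
Proof. by rewrite /strict_eq /= => ->. Qed.

(** The traces satisfy the Clifford relation exactly, so [family_antisym] applies with equality of
    matrices. *)
Lemma trD_shuffle j q v (x : 'cV_(rep_dim (T j.+1))) :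
  trD j.+2 *m (q *# (shuffle j.+1 *m (v *# (antisym j.+1 *m x)))) =
  j.+2%:R *: (trD j.+2 *m (q *# (v *# (antisym j.+1 *m x))))
  - 'C(j.+2, 2)%:R *: (trD j *m (q *# (ct 0 j *m (v *# (antisym j.+1 *m x))))).
Proof.
have rel l n : (l <= n)%N -> strict_eq (trD n.+2 <o> (hom_id E <x> hom_add (hom_id _) (sw V l n.+2)))
    (trD n <o> (hom_id E <x> ct l n)).
  move=> ln; apply: tens_ext => q' t.
  rewrite hom_compE hom_tensE hom_addE !hom_idE (trD_rel _ _ ln).
  by rewrite [RHS]hom_compE hom_tensE hom_idE.
have := family_antisym strict_equiv strict_comp strict_add strict_scale
  (fun X Y f g e => e) rel (alt_tail_tens (@antisym_alt _ V j.+1)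
     : alt_tail (hom_id V <x> antisym j.+1 : rep_hom (T j.+2) (T j.+2))).
move/(congr1 (fun A : 'M_(_, rep_dim (rep_tens E (T j.+2))) => A *m (q *# (v *# x)))).
move: (shuffle j.+1) (ct 0 j) (trD j.+2) (trD j) (antisym j.+1) => sh c0 d2 d0 P.
by rewrite hom_addE !hom_scaleE !hom_compE !hom_tensE !hom_idE !hom_compE !hom_tensE hom_idE scaleNr.
Qed.

Lemma sec_alt j : alternating (sec_mx j).
Proof. by move=> l lj; rewrite -scalemxAr altM //; [rewrite scalerN | apply: antisym_alt]. Qed.

Lemma antisym_sec j (q : 'cV_(rep_dim E)) : (j <= N.+1)%N -> antisym j *m (sec_mx j *m q) = sec_mx j *m q.
Proof. by move=> jN; rewrite mulmxA (antisym_id charK jN (@sec_alt j)). Qed.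

Lemma ct_sw l n : ct 0 n *m sw V l.+2 n.+2 = sw V l n *m ct 0 n.
Proof.
apply: (@tens_extr _ V V (T n)) => x y t; rewrite -(mulmxA _ (sw V l.+2 n.+2)) -(mulmxA (sw V l n)).
by rewrite !swSE !ct0E scalemxAr.
Qed.
Lemma ct_alt n q v (M : 'M_(rep_dim (T n.+1), q)) : alternating M ->
  alternating (ct 0 n *m (tml (rep_dim (T n.+1)) v *m M)).
Proof.
move=> aM l ln; rewrite mulmxA -ct_sw -mulmxA -mulmxN; congr (_ *m _).
apply: cV_ext => x; rewrite -(mulmxA _ _ x) -(mulmxA _ M) -tmlE swSE mulmxA aM //.
by rewrite !mulNmx tvNr -(mulmxA _ M) -tmlE.
Qed.

Lemma dotvC v w : dotv v w = dotv w v.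
Proof. by rewrite /dotv !mxE; apply: eq_bigr => i _; rewrite !mxE mulrC. Qed.

Lemma tv_trmx m n (x x' : 'cV[K]_m) (y y' : 'cV[K]_n) :
  (x *# y)^T *m (x' *# y') = (x^T *m x') 0 0 *: (y^T *m y').
Proof.
apply/matrixP => a b; rewrite !ord1 !mxE sum_tidx mulr_suml; apply: eq_bigr => i _.
by rewrite mulr_sumr; apply: eq_bigr => j _; rewrite !mxE !mxtens_indexK /= mulrACA.
Qed.

Lemma ct_adj n v (x : 'cV_(rep_dim (T n))) (u : 'cV_(rep_dim (T n.+1))) :
  x^T *m (ct 0 n *m (v *# u)) = 2%:R *: ((v *# x)^T *m u).
Proof.
elim/tens_elim: u => [u u' Hu Hu'|w u]; first by rewrite tvDr !mulmxDr Hu Hu' scalerDr.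
rewrite (@ct0E _ _ cliff_form n v w u) cliff_formE mxE eqxx mulr1n -scalemxAr.
by rewrite tv_trmx scalerA.
Qed.
Lemma ct_adj' n v (y : 'cV_(rep_dim (T n.+1))) u :
  (ct 0 n *m (v *# y))^T *m u = 2%:R *: (y^T *m (v *# u)).
Proof.
elim/tens_elim: y => [y y' Hy Hy'|w y].
  by rewrite tvDr !mulmxDr !linearD /= !mulmxDl Hy Hy' scalerDr.
rewrite (@ct0E _ _ cliff_form n v w y) cliff_formE mxE eqxx mulr1n linearZ /= -scalemxAl.
by rewrite tv_trmx scalerA -/(dotv w v) dotvC.
Qed.

Lemma antisym_tv n v (x : 'cV_(rep_dim (T n))) :
  antisym n.+1 *m (v *# x) = n.+1%:R^-1 *: (shuffle n *m (v *# (antisym n *m x))).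
Proof.
by rewrite (antisymS V n) -scalemxAl -(mulmxA (shuffle n)) mul_tens_tv mul1mx.
Qed.

(** Clifford multiplication by v becomes exterior multiplication plus contraction, the classical
    action on the exterior algebra. Here 1/(j+1) normalizes the shuffle; in (j+2)/2 the numerator is
    the ratio of the normalizations in degrees j + 1 and j + 2, and the 2 comes from the form 2<v,
    w>. *)
Lemma sec_act j v (q : 'cV_(rep_dim E)) : (j.+2 <= N.+1)%N ->
  sec_mx j.+1 *m (actE *m (v *# q)) =
  j.+1%:R^-1 *: (shuffle j *m (v *# (sec_mx j *m q)))
  + (j.+2%:R / 2%:R) *: (ct 0 j.+1 *m (v *# (sec_mx j.+2 *m q))).
Proof.
move=> jN; have jN1 := ltnW jN; have jN0 := ltnW jN1.
apply: vec_eq => x; rewrite (sec_mxE _ _ jN1) -trDS.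
have j2 : j.+2%:R != 0 :> K by apply: charK.
have j1 : j.+1%:R != 0 :> K by apply: charK.
have nS := dimS; have n2 := two_neq0; have nf := fact_neq0 jN0.
(* Replace v (x) x by its antisymmetrization; the error is a contraction, with coefficient C(j+2,
   2)/(j+2) = (j+1)/2. *)
have -> : trD j.+2 *m (q *# (v *# (antisym j.+1 *m x))) =
    trD j.+2 *m (q *# (antisym j.+2 *m (v *# x)))
    + (j.+1%:R / 2%:R) *: (trD j *m (q *# (ct 0 j *m (v *# (antisym j.+1 *m x))))).
rewrite antisym_tv tvZr -scalemxAr.
  rewrite trD_shuffle scalerBr !scalerA mulVf // scale1r.
  have -> : j.+2%:R^-1 * 'C(j.+2, 2)%:R = j.+1%:R / 2%:R :> K.
    have := mul_bin_diag j.+2 1; rewrite bin1 => /(congr1 (fun n => n%:R : K)).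
    rewrite !natrM => e; apply: (mulfI j2); apply: (mulIf n2).
    by rewrite !mulrA divff // mul1r divfK // mulrC -e.
  by rewrite subrK.
have -> : trD j *m (q *# (ct 0 j *m (v *# (antisym j.+1 *m x)))) =
   (sec_coef j)^-1 *: (2%:R *: (x^T *m (j.+1%:R^-1 *: (shuffle j *m (v *# (sec_mx j *m q)))))).
  have aP : alternating (ct 0 j *m (v *# (antisym j.+1 *m x))).
    by rewrite tmlE; apply: ct_alt; apply: altM; apply: antisym_alt.
  rewrite -[ct 0 j *m _](antisym_id charK jN0 aP).
  rewrite -[trD j *m _](scalerK (sec_coef_neq0 jN0)) -sec_mxE // ct_adj'; congr (_ *: (_ *: _)).
  by rewrite trmx_mul (antisymT charK jN1) -mulmxA antisym_tv antisym_sec.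
rewrite -[trD j.+2 *m _](scalerK (sec_coef_neq0 jN)) -sec_mxE // mulmxDr -!scalemxAr ct_adj.
rewrite addrC !scalerDr !scalerA; congr (_ *: _ + _ *: _).
  rewrite /sec_coef factS natrM; field.
  by rewrite nat1r j1 nS nf n2 oner_neq0.
rewrite /sec_coef !factS !natrM; field.
by rewrite -natrD nat1r j1 nS nf n2 oner_neq0 j2.
Qed.

Lemma sec_act0 v (q : 'cV_(rep_dim E)) :
  sec_mx 0 *m (actE *m (v *# q)) = 2%:R^-1 *: (ct 0 0 *m (v *# (sec_mx 1 *m q))).
Proof.
apply: vec_eq => x; rewrite sec_mxE // -trDS mul1mx.
have -> : v *# x = antisym 1 *m (v *# x).
  by rewrite antisym_tv shuffleE big_nat1 expr0 scale1r !mul1mx invr1 scale1r.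
have N1 : (1 <= N.+1)%N by [].
rewrite -[trD 1 *m _](scalerK (sec_coef_neq0 N1)) -sec_mxE // -scalemxAr ct_adj !scalerA mulVf ?two_neq0 // scale1r.
by rewrite /sec_coef mulfV ?scale1r // invr_eq0 mulf_neq0 // fact_neq0.
Qed.

(** A word with more than N letters in an alphabet of N letters has a repeated letter. *)
Lemma alt_top n q (A : 'M[K]_(rep_dim (T n), q)) : alternating A -> (N < n)%N -> A = 0.
Proof.
move=> aA Nn; apply/matrixP => i j; rewrite [RHS]mxE; move: i q A j aA.
apply: wordP => w e; case: _ / e Nn => Nw q A j aA; apply: alt_word_eq0 aA _ => //.
  exact: two_neq0.
by apply: contraL Nw => uw; rewrite -leqNgt -(card_uniqP uw) -[X in (_ <= X)%N]card_ord max_card.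
Qed.

Lemma antisym_top : antisym N.+1 = 0 :> 'M_(_, _).
Proof. exact: alt_top (@antisym_alt K V N.+1) _. Qed.

Lemma sec_top : sec_mx N.+1 = 0.
Proof. by rewrite /sec_mx antisym_top mul0mx scaler0. Qed.

Definition gam_mx (a : 'I_N) : 'M[K]_(rep_dim S) := \matrix_(i, j) (gam *m (ev a *# ev j)) i 0.
Definition mx_of (q : 'cV[K]_(rep_dim E)) : 'M[K]_(rep_dim S) :=
  \matrix_(i, j) q (mxtens_index (i, j)) 0.

Lemma gam_mxE a x : gam_mx a *m x = gam *m (ev a *# x).
Proof.
rewrite [x in RHS]cV_sum_delta tv_sumr mulmx_sumr; apply/colP => i.
rewrite mxE summxE; apply: eq_bigr => j _.
by rewrite tvZr -scalemxAr [RHS]mxE mxE mulrC.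
Qed.
Lemma mx_of_tv x d : mx_of (x *# d) = x *m d^T.
Proof. by apply/matrixP => i j; rewrite !mxE mxtens_indexK big_ord1 !mxE. Qed.
Lemma mx_ofD q q' : mx_of (q + q') = mx_of q + mx_of q'.
Proof. by apply/matrixP => i j; rewrite !mxE. Qed.
Lemma mx_of_act a q : mx_of (actE *m (ev a *# q)) = gam_mx a *m mx_of q.
Proof.
elim/tens_elim: q => [q q' Hq Hq'|x d]; first by rewrite tvDr !mulmxDr !mx_ofD mulmxDr Hq Hq'.
by rewrite actEE !mx_of_tv -gam_mxE mulmxA.
Qed.
Lemma trE_E q : trE *m q = (\tr (mx_of q))%:M.
Proof.
elim/tens_elim: q => [q q' Hq Hq'|x d].
  by rewrite mulmxDr Hq Hq' mx_ofD mxtraceD raddfD.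
rewrite /trE !elE mx_of_tv mxtrace_mulC; apply/matrixP => i j; rewrite !ord1 !mxE /mxtrace big_ord1.
by rewrite mxE mulr1 mulr1n; apply: eq_bigr => a _; rewrite !mxE.
Qed.
Lemma mx_of_unit c : mx_of (hom_coev S *m c) = (c 0 0)%:M.
Proof.
rewrite homcoev_E; apply/matrixP => i j; rewrite !mxE summxE (bigD1 i) //= [X in _ + X]big1.
  by rewrite addr0 tv_delta !mxE (can_eq (@mxtens_indexK _ _)) xpair_eqE eqxx andbT mulr_natr eq_sym.
move=> a /negPf ai; rewrite tv_delta mxE (can_eq (@mxtens_indexK _ _)) xpair_eqE.
by rewrite [i == a]eq_sym ai.
Qed.

Fixpoint word_mx (w : seq 'I_N) : 'M[K]_(rep_dim S) :=
  if w is a :: w' then word_mx w' *m gam_mx a else 1%:M.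

Lemma trD_word w q : trD (size w) *m (q *# ev (word w)) = (\tr (word_mx w *m mx_of q))%:M.
Proof.
elim: w q => [|a w IHw] q.
  by rewrite hom_compE runitE mxE eqxx scale1r trE_E mul1mx.
rewrite -tv_delta trDS IHw mx_of_act /= mulmxA; congr (\tr _)%:M.
Qed.

Lemma gam_anti a c : a != c -> gam_mx a *m gam_mx c = - (gam_mx c *m gam_mx a).
Proof.
move=> ac; apply: cV_ext => x; apply/eqP; rewrite mulNmx -subr_eq0 opprK -!mulmxA !gam_mxE cliff.
rewrite /dotv trmx_delta -rowE [X in 2%:R * X]mxE mxE (negPf ac) mulr0 scale0r //.
Qed.

Lemma gam_word a w : a \notin w -> gam_mx a *m word_mx w = (-1) ^+ size w *: (word_mx w *m gam_mx a).
Proof.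
elim: w => [|c w IHw]; first by rewrite mulmx1 mul1mx scale1r.
rewrite inE negb_or => /andP[ac aw] /=; rewrite mulmxA IHw // -scalemxAl -!mulmxA gam_anti //.
by rewrite mulmxN scalerN exprS mulN1r scaleNr.
Qed.

(** The letter a anticommutes with the product of the odd number of other letters, so cyclicity
    makes the trace its own opposite. *)
Lemma tr_word w : uniq w -> w != [::] -> ~~ odd (size w) -> \tr (word_mx w) = 0.
Proof.
case: w => // a w /= /andP[aw _] _; rewrite negbK => ow.
have E : \tr (word_mx w *m gam_mx a) = - \tr (word_mx w *m gam_mx a).
  rewrite {1}mxtrace_mulC gam_word // -signr_odd ow expr1 scaleN1r.
  by rewrite raddfN.
by move/eqP: E; rewrite -addr_eq0 -mulr2n -mulr_natl mulf_eq0 (negPf two_neq0) => /eqP.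
Qed.

(** The coefficients of an alternating tensor live on words with distinct letters, and for these the
    trace vanishes by [tr_word]. *)
Lemma sec_unit j (c : 'cV[K]_1) : (j <= N.+1)%N -> ~~ odd j -> j != 0%N -> sec_mx j *m (hom_coev S *m c) = 0.
Proof.
move=> jN oj j0; apply: vec_eq => x; rewrite (sec_mxE _ _ jN) mulmx0.
suff -> : trD j *m ((hom_coev S *m c) *# (antisym j *m x)) = 0 by rewrite scaler0.
have aP := @altM _ _ _ _ _ _ x (@antisym_alt _ V j).
rewrite [antisym j *m x]cV_sum_delta tv_sumr mulmx_sumr big1 // => i _.
rewrite tvZr -scalemxAr; move: (antisym j *m x) aP => y ay; move: i y ay.
apply: wordP => w e; case: _ / e jN oj j0 => _ ow w0 y ay.
have [uw|nuw] := boolP (uniq w); last by rewrite (alt_word_eq0 _ two_neq0 ay nuw) scale0r.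
rewrite trD_word mx_of_unit scalar_mxC mul_scalar_mx linearZ /= tr_word ?mulr0 ?raddf0 ?scaler0 //.
by case: w w0 {ow y ay uw}.
Qed.

Lemma sec0_unit (c : 'cV[K]_1) : sec_mx 0 *m (hom_coev S *m c) = c.
Proof.
apply: vec_eq => x; rewrite (sec_mxE _ _ (leq0n _)) mul1mx hom_compE runitE -scalemxAr trE_E mx_of_unit.
rewrite mxtrace_scalar /sec_coef fact0 mulr1; apply/matrixP => i l; rewrite !ord1 !mxE big_ord1 mxE mulr1n.
by rewrite -[c 0 0 *+ _]mulr_natr [x 0 0 * _]mulrA mulrC mulfK.
Qed.
End Clifford.

(** * A family killing the Clifford relations factors through the sections *)

Section CliffordFamily.
Variables (K : closedFieldType) (V S : rep K) (gam : rep_hom (rep_tens V S) S).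
Local Notation N := (rep_dim V).
Local Notation T := (tens_pow V).
Local Notation E := (inner_hom S S).
Local Notation antisym := (antisym V).
Local Notation shuffle := (shuffle V).
Hypothesis orth : forall g, \det g = 1 -> (rep_act V g)^T *m rep_act V g = 1%:M.
Hypothesis cliff : forall v w x,
  gam *m (v *# (gam *m (w *# x))) + gam *m (w *# (gam *m (v *# x))) = (2%:R * dotv v w) *: x.
Hypothesis charK : forall i : nat, (0 < i <= N.+1)%N -> i%:R != 0 :> K.
Hypothesis oddN : odd N.
Hypothesis dimS : (rep_dim S)%:R != 0 :> K.
Local Notation ct := (ct (cliff_form orth)).
Local Notation sec := (sec gam orth charK).

Variable R : forall X Y : rep K, rep_hom X Y -> rep_hom X Y -> Prop.
Hypothesis Req : forall X Y, Equivalence (@R X Y).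
Hypothesis Rcomp : forall X Y Z (f g : rep_hom Y Z) (h : rep_hom X Y), R f g -> R (f <o> h) (g <o> h).
Hypothesis Radd : forall X Y (f g f' g' : rep_hom X Y), R f g -> R f' g' -> R (hom_add f f') (hom_add g g').
Hypothesis Rscale : forall X Y c (f g : rep_hom X Y), R f g -> R (hom_scale c f) (hom_scale c g).
Hypothesis Rmx : forall X Y (f g : rep_hom X Y), f = g :> 'M_(_, _) -> R f g.

Lemma R_sum X Y I (s : seq I) (F G : I -> rep_hom X Y) (P : pred I) :
  all P s -> (forall i, P i -> R (F i) (G i)) -> R (hom_sum s F) (hom_sum s G).
Proof.
move=> sP E; elim: s sP => [_|i s IHs /andP[Pi Ps]] /=; first exact: Rmx.
by apply: Radd; [apply: E | apply: IHs].
Qed.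

Definition parity_seq n := [seq j <- iota 0 N.+1 | odd j == odd n].

Section Step.
Variables (W Y : rep K) (F : forall n, rep_hom (rep_tens W (T n)) Y).
Hypothesis Frel : forall l n, (l <= n)%N ->
  R (F n.+2 <o> (hom_id W <x> hom_add (hom_id _) (sw V l n.+2))) (F n <o> (hom_id W <x> ct l n)).
Variables (X : rep K) (f : rep_hom X E).
(* The wedge and the contraction part of F (w, v, s_j q). *)
Definition wedge_part j : rep_hom (rep_tens W (rep_tens V X)) Y :=
  hom_scale (j.+1%:R^-1) (F j.+1 <o> (hom_id W <x> (shuffle j <o> (hom_id V <x> (sec j <o> f))))).
Definition contract_part j : rep_hom (rep_tens W (rep_tens V X)) Y :=
  if j is j'.+1 then
    hom_scale (j'.+1%:R / 2%:R) (F j' <o> (hom_id W <x> (ct 0 j' <o> (hom_id V <x> (sec j'.+1 <o> f)))))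
  else hom_zero _ _.

(** The tensor v (x) s_j q is alternating in all factors but v, so [family_antisym], divided by the
    number of places of v, splits its image into an antisymmetrized and a contracted part. *)
Lemma family_sec j : (j <= N)%N ->
  R (F j.+1 <o> (hom_id W <x> (hom_id V <x> (sec j <o> f)))) (hom_add (wedge_part j) (contract_part j)).
Proof.
case: j => [|j] jN.
  apply: Rmx; apply: tens_ext => w t.
  rewrite hom_addE hom_zeroE addr0 hom_scaleE invr1 scale1r !hom_compE !hom_tensE !hom_idE.
  by rewrite hom_compE shuffleE big_nat1 expr0 scale1r mul1mx.
pose y : rep_hom (rep_tens V X) (T j.+2) := hom_id V <x> (sec j.+1 <o> f).
have ay : alt_tail y.
  apply: alt_tail_tens; apply: altM; rewrite secE 1?ltnW //; exact: sec_alt.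
have E := family_antisym Req Rcomp Radd Rscale Rmx Frel ay.
have Es := Radd (Rscale (j.+2%:R^-1) E) (Rmx (erefl (hom_mx (contract_part j.+1)))).
apply: Equivalence_Symmetric; apply: Equivalence_Transitive Es _; apply: Rmx.
rewrite /contract_part -/y; move: (ct 0 j) => c0.
apply: tens_ext => w t; rewrite hom_addE !hom_scaleE hom_addE !hom_scaleE.
have j2 : j.+2%:R != 0 :> K by apply: charK.
have n2 := two_neq0 charK oddN.
have eC : j.+2%:R^-1 * 'C(j.+2, 2)%:R = j.+1%:R / 2%:R :> K.
  have := mul_bin_diag j.+2 1; rewrite bin1 => /(congr1 (fun n => n%:R : K)).
  rewrite !natrM => e; apply: (mulfI j2); apply: (mulIf n2).
  by rewrite !mulrA divff // mul1r divfK // mulrC -e.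
by rewrite scalerDr !scalerA mulVf // scale1r mulrN eC -addrA -scalerDl addNr scale0r addr0.
Qed.

Lemma contract_part_top : contract_part N.+1 = 0 :> 'M_(_, _).
Proof.
have s0 : sec N.+1 <o> f = 0 :> 'M_(_, _) by rewrite /= secE // (sec_top _ charK oddN) mul0mx.
apply: tens_ext => w t; rewrite mul0mx /contract_part hom_scaleE; move: (ct 0 N) => c0.
rewrite hom_compE hom_tensE hom_compE hom_tensmx s0 tensmx0 mul0mx mulmx0 tv0r mulmx0.
by rewrite scaler0.
Qed.

(** Up to the invertible factor 1/(N + 1), the shuffled tensor is antisymmetrized in degree N + 1,
    hence 0. Together with [contract_part_top] this removes the boundary terms of the reindexing in
    [parity_shift]. *)
Lemma wedge_part_top : wedge_part N = 0 :> 'M_(_, _).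
Proof.
apply: tens_extr => w v x; rewrite mul0mx /wedge_part hom_scaleE.
rewrite !hom_compE !hom_tensE !hom_idE !hom_compE !hom_tensE !hom_idE !hom_compE secE //.
suff -> : shuffle N *m (v *# (sec_mx gam N *m (f *m x))) = 0 by rewrite tv0r mulmx0 scaler0.
have := antisym_tv v (sec_mx gam N *m (f *m x)); rewrite (antisym_top charK oddN) mul0mx (antisym_sec _ charK) //.
by move/esym/eqP; rewrite scaler_eq0 invr_eq0 (negPf (charK _)) ?ltnS ?leqnn //= => /eqP.
Qed.

Lemma sec_act_hom i : (i <= N)%N ->
  F i <o> (hom_id W <x> (sec i <o> (actE gam <o> (hom_id V <x> f)))) =
  (if i is i'.+1 then hom_mx (wedge_part i') else 0) + contract_part i.+1 :> 'M_(_, _).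
Proof.
move=> iN; apply: tens_extr => w v x.
have act_f : (actE gam <o> (hom_id V <x> f)) *m (v *# x) = actE gam *m (v *# (f *m x)).
  by rewrite hom_compE hom_tensE hom_idE.
rewrite hom_compE hom_tensE hom_idE hom_compE act_f secE 1?leqW //.
case: i iN => [|i] iN.
  rewrite add0r (sec_act0 _ orth charK oddN dimS) /contract_part hom_scaleE.
  move: (ct 0 0) => c0; rewrite !hom_compE !hom_tensE !hom_idE.
  by rewrite hom_compE hom_tensE hom_idE hom_compE secE // tvZr -scalemxAr mul1r.
rewrite mulmxDl (sec_act orth cliff charK oddN dimS) // tvDr mulmxDr /wedge_part /contract_part !hom_scaleE.
move: (ct 0 i.+1) => c0; rewrite !hom_compE !hom_tensE !hom_idE !hom_compE !hom_tensE !hom_idE !hom_compE.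
have h1 : (i <= N.+1)%N := leqW (ltnW iN).
by rewrite (secE _ _ _ h1) (secE _ _ _ (iN : (i.+2 <= N.+1)%N)) !tvZr -!scalemxAr.
Qed.

(** Wedging raises the degree by one and contracting lowers it by one; sorted by source the terms
    have one parity, sorted by target the other. *)
Lemma parity_shift (M : zmodType) (n : nat) (p : bool) (w k : nat -> M) :
  k 0%N = 0 -> k n.+1 = 0 -> w n = 0 ->
  \sum_(0 <= i < n.+1 | odd i == ~~ p) ((if i is i'.+1 then w i' else 0) + k i.+1)
  = \sum_(0 <= j < n.+1 | odd j == p) (w j + k j).
Proof.
move=> k0 kn wn; rewrite !big_split /=; congr (_ + _).
  rewrite big_mkcond big_nat_recl // [RHS]big_mkcond big_nat_recr //= wn.
  rewrite if_same add0r if_same addr0; apply: eq_bigr => i _.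
  by case: (odd i) p => [] [].
rewrite [RHS]big_mkcond big_nat_recl //= k0 if_same add0r big_mkcond big_nat_recr //= kn if_same addr0.
by apply: eq_bigr => i _; case: (odd i) p => [] [].
Qed.

Lemma family_step n :
  R (hom_sum (parity_seq n) (fun j => F j.+1 <o> (hom_id W <x> (hom_id V <x> (sec j <o> f)))))
    (hom_sum (parity_seq n.+1)
       (fun i => F i <o> (hom_id W <x> (sec i <o> (actE gam <o> (hom_id V <x> f)))))).
Proof.
apply: (Equivalence_Transitive _ _ _ (R_sum (P := fun j => (j <= N)%N) _ family_sec)).
  by apply/allP => j; rewrite mem_filter mem_iota ltnS => /andP[_].
apply: Rmx; rewrite !hom_sumE !big_filter.
have E m : iota 0 m = index_iota 0 m by rewrite /index_iota subn0.
rewrite E -parity_shift ?contract_part_top ?wedge_part_top //; apply: congr_big_nat => // i /andP[_].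
by move=> /andP[_ iN]; rewrite sec_act_hom.
Qed.
End Step.

(** Induction on n, with the first vector v of the tensor moved into the parameter object. The
    induction hypothesis yields terms F_(j+1)(w, v, s_j q), and [family_step] rewrites their sum as
    the sum of F_i(w, s_i(gamma(v) q)) over the opposite parity. For n = 0 only j = 0 contributes,
    by [sec_unit]. *)
Lemma family_factor n W Y (F : forall n, rep_hom (rep_tens W (T n)) Y) :
  (forall l n, (l <= n)%N ->
     R (F n.+2 <o> (hom_id W <x> hom_add (hom_id _) (sw V l n.+2))) (F n <o> (hom_id W <x> ct l n))) ->
  R (F n) (hom_sum (parity_seq n) (fun j => F j <o> (hom_id W <x> (sec j <o> gam_prod gam n)))).
Proof.
elim: n W Y F => [|n IHn] W Y F Frel.
  apply: Rmx; rewrite hom_sumE big_filter; apply: tens_ext => w t.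
  have -> : iota 0 N.+1 = 0%N :: iota 1 N by [].
  rewrite big_cons eqxx mulmxDl big_seq_cond mulmx_suml big1 ?addr0 => [|j].
    rewrite !hom_compE !hom_tensE !hom_idE !hom_compE secE // sec0_unit //.
  rewrite mem_iota => /andP[/andP[j0 jN] /eqP oj].
  rewrite !hom_compE !hom_tensE !hom_idE !hom_compE secE 1?ltnW // (sec_unit cliff charK oddN) ?oj //.
    by rewrite tv0r mulmx0.
    exact: ltnW.
  by rewrite -lt0n.
pose F' m : rep_hom (rep_tens (rep_tens W V) (T m)) Y := F m.+1 <o> hom_assoc W V (T m).
have rel' l m : (l <= m)%N ->
    R (F' m.+2 <o> (hom_id _ <x> hom_add (hom_id _) (sw V l m.+2))) (F' m <o> (hom_id _ <x> ct l m)).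
  move=> lm; have := Rcomp (hom_assoc W V (T m.+2)) (Frel l.+1 m.+1 lm).
  have e1 : F' m.+2 <o> (hom_id _ <x> hom_add (hom_id _) (sw V l m.+2)) =
     F m.+3 <o> (hom_id W <x> hom_add (hom_id _) (sw V l.+1 m.+3)) <o> hom_assoc W V (T m.+2) :> 'M_(_, _).
    apply: (@tens_extl _ W V (T m.+2)) => w v t; rewrite !hom_compE assocE !hom_tensE !hom_idE.
    by rewrite assocE !hom_addE !hom_idE swSE tvDr.
  have e2 : F' m <o> (hom_id _ <x> ct l m) =
     F m.+1 <o> (hom_id W <x> ct l.+1 m.+1) <o> hom_assoc W V (T m.+2) :> 'M_(_, _).
    apply: (@tens_extl _ W V (T m.+2)) => w v t; rewrite !hom_compE assocE !hom_tensE !hom_idE.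
    by rewrite assocE.
  by move=> h; apply: Equivalence_Transitive (Rmx e1) _; apply: Equivalence_Transitive h (Rmx (esym e2)).
have E1 := Rcomp (hom_assocV W V (T n)) (IHn _ _ F' rel').
have E2 := family_step Frel (gam_prod gam n) n.
apply: Equivalence_Transitive (Equivalence_Transitive _ _ _ E1 (Equivalence_Transitive _ _ _ _ E2)).
  apply: Rmx; apply: tens_extr => w v t; rewrite hom_compE assocVE.
  by rewrite /F' hom_compE assocE.
apply: Rmx; apply: tens_extr => w v t; rewrite hom_compE assocVE !hom_sum_el.
by apply: eq_bigr => j _; rewrite !hom_compE !hom_tensE !hom_idE !hom_compE assocE.
Qed.
End CliffordFamily.

(** * The sections split the Clifford multiplication *)

Section CliffordSection.
Variables (K : closedFieldType) (V S : rep K) (gam : rep_hom (rep_tens V S) S).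
Local Notation N := (rep_dim V).
Local Notation T := (tens_pow V).
Local Notation E := (inner_hom S S).
Hypothesis orth : forall g, \det g = 1 -> (rep_act V g)^T *m rep_act V g = 1%:M.
Hypothesis cliff : forall v w x,
  gam *m (v *# (gam *m (w *# x))) + gam *m (w *# (gam *m (v *# x))) = (2%:R * dotv v w) *: x.
Hypothesis charK : forall i : nat, (0 < i <= N.+1)%N -> i%:R != 0 :> K.
Hypothesis oddN : odd N.
Hypothesis dimS : (rep_dim S)%:R != 0 :> K.
Hypothesis gen : forall P : 'cV_(rep_dim E) -> Prop,
  (forall c, P (hom_coev S *m c)) -> (forall q q', P q -> P q' -> P (q + q')) ->
  (forall v w q, P q -> P (actE gam *m (v *# (actE gam *m (w *# q))))) -> forall q, P q.
Local Notation ct := (ct (cliff_form orth)).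
Local Notation sec := (sec gam orth charK).

Lemma gam_prod_rel l n (t : 'cV_(rep_dim (T n.+2))) : (l <= n)%N ->
  gam_prod gam n.+2 *m (t + sw V l n.+2 *m t) = gam_prod gam n *m (ct l n *m t).
Proof.
elim: l n t => [|l IHl] n t.
  move=> _; elim/tens_elim: t => [t t' Ht Ht'|v t].
    by rewrite [sw V _ _ *m _]mulmxDr addrACA mulmxDr Ht Ht' [in RHS]mulmxDr mulmxDr.
  elim/tens_elim: t => [t t' Ht Ht'|w t].
    by rewrite tvDr [sw V _ _ *m _]mulmxDr addrACA mulmxDr Ht Ht' [in RHS]mulmxDr mulmxDr.
  rewrite sw0E ct0E cliff_formE mxE eqxx mulr1n mulmxDr !gam_prodS.
  by rewrite cliff_actE // -scalemxAr.
case: n t => [|n] t // ln; elim/tens_elim: t => [t t' Ht Ht'|v t].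
  by rewrite [sw V _ _ *m _]mulmxDr addrACA mulmxDr Ht Ht' [in RHS]mulmxDr mulmxDr.
by rewrite swSE ctSE -tvDr !gam_prodS IHl.
Qed.

(** [family_factor] applied to the products of gammas themselves, with the unit as object of
    parameters. *)
Lemma gam_prod_sec n (t : 'cV_(rep_dim (T n))) :
  hom_sum (parity_seq V n) (fun j => gam_prod gam j <o> sec j) *m (gam_prod gam n *m t)
  = gam_prod gam n *m t.
Proof.
pose F m := gam_prod gam m <o> hom_lunit (T m).
have rel l m : (l <= m)%N ->
    strict_eq (F m.+2 <o> (hom_id _ <x> hom_add (hom_id _) (sw V l m.+2))) (F m <o> (hom_id _ <x> ct l m)).
  move=> lm; apply: tens_ext => c x; rewrite /F hom_compE hom_tensE hom_idE (hom_compE (gam_prod gam m.+2)) lunitE hom_addE hom_idE.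
  by rewrite -scalemxAr gam_prod_rel // hom_compE hom_tensE hom_idE hom_compE lunitE -scalemxAr.
have := family_factor cliff charK oddN dimS (@strict_equiv K) (@strict_comp K) (@strict_add K) (@strict_scale K)
  (fun X Y f g e => e) n rel.
move/(congr1 (fun A : 'M_(_, rep_dim (rep_tens (unit_rep K) (T n))) => A *m ((1%:M : 'cV_1) *# t))).
rewrite /F hom_compE lunitE mxE eqxx scale1r => E1.
rewrite [RHS]E1 !hom_sum_el; apply: eq_bigr => j _.
rewrite [RHS]hom_compE hom_tensE hom_idE [RHS]hom_compE lunitE mxE eqxx scale1r.
by rewrite hom_compE [X in _ = _ *m X]hom_compE.
Qed.

Inductive gam_span (p : bool) : 'cV[K]_(rep_dim E) -> Prop :=
| gam_span_prod n (t : 'cV_(rep_dim (T n))) : odd n = p -> gam_span p (gam_prod gam n *m t)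
| gam_spanD q q' : gam_span p q -> gam_span p q' -> gam_span p (q + q').

Lemma gam_span_act p v q : gam_span p q -> gam_span (~~ p) (actE gam *m (v *# q)).
Proof.
elim=> {q} [n t <-|q q' _ Hq _ Hq']; last by rewrite tvDr mulmxDr; apply: gam_spanD.
by rewrite -gam_prodS; apply: gam_span_prod.
Qed.

Lemma gam_span_all p q : gam_span p q.
Proof.
have even q' : gam_span false q'.
  elim/gen: q' => [c|q1 q2 H1 H2|v w q1 H1]; last exact: (gam_span_act _ (gam_span_act _ H1)).
    exact: (gam_span_prod (n := 0)).
  exact: gam_spanD.
(* The odd words also span: q = gamma(e) (gamma(e) q) for a unit vector e, and gamma(e) q lies in
   the even span. *)
case: p => //; have i0 : 'I_N by apply: (@Ordinal _ 0); case: N oddN.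
have /eqP := cliff_actE cliff (ev i0) (ev i0) q.
rewrite -mulr2n -scaler_nat -subr_eq0 -scalerA -scalerBr scaler_eq0 (negPf (two_neq0 charK oddN)) /=.
rewrite /dotv trmx_delta mul_delta_mx mxE !eqxx scale1r subr_eq0 => /eqP <-.
exact: (@gam_span_act false _ _ (even _)).
Qed.

Lemma gam_prod_secK p :
  hom_sum (parity_seq V p) (fun j => gam_prod gam j <o> sec j) = 1%:M :> 'M_(_, _).
Proof.
apply: cV_ext => q; rewrite mul1mx; elim: {q}(gam_span_all (odd p) q) => [n t on|q q' _ Hq _ Hq'].
  have e : parity_seq V n = parity_seq V p by rewrite /parity_seq on.
  by rewrite -e gam_prod_sec.
by rewrite mulmxDr Hq Hq'.
Qed.
End CliffordSection.

(** * Interchange of middle factors and bookkeeping for [hom_eq] *)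

Section Exchange.
Variable K : closedFieldType.
Implicit Types X Y Z W : rep K.

(** The construction is kept opaque, so that the interchange of the two middle factors is known only
    by its values on pure tensors. *)
Lemma hom_mid_subproof X Y Z W :
  {h : rep_hom (rep_tens (rep_tens X Y) (rep_tens Z W)) (rep_tens (rep_tens X Z) (rep_tens Y W)) |
    forall x y z w, h *m ((x *# y) *# (z *# w)) = (x *# z) *# (y *# w)}.
Proof.
exists (hom_assocV X Z (rep_tens Y W)
    <o> (hom_id X <x> (hom_assoc Z Y W <o> (hom_braid Y Z <x> hom_id W) <o> hom_assocV Y Z W))
    <o> hom_assoc X Y (rep_tens Z W)) => x y z w.
by rewrite !elE.
Qed.
Definition hom_mid X Y Z W := sval (hom_mid_subproof X Y Z W).

Lemma midE X Y Z W x y z w : hom_mid X Y Z W *m ((x *# y) *# (z *# w)) = (x *# z) *# (y *# w).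
Proof. by rewrite /hom_mid; case: hom_mid_subproof => h /= ->. Qed.

Lemma mid_mid X Y Z W : hom_mid X Z Y W <o> hom_mid X Y Z W = 1%:M :> 'M_(_, _).
Proof. by apply: tens_ext22 => x y z w; rewrite hom_compE !midE mul1mx. Qed.

Lemma hom_compA X Y Z W (h : rep_hom Z W) (g : rep_hom Y Z) (f : rep_hom X Y) :
  h <o> (g <o> f) = (h <o> g) <o> f :> 'M_(_, _).
Proof. exact: mulmxA. Qed.
Lemma heq_compA X Y Z W (h : rep_hom Z W) (g : rep_hom Y Z) (f : rep_hom X Y) :
  h <o> (g <o> f) === (h <o> g) <o> f.
Proof. by apply: heq_mx; rewrite hom_compA. Qed.
Lemma heq_id_comp X Y (f : rep_hom X Y) : hom_id Y <o> f === f.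
Proof. by apply: heq_mx; rewrite /= mul1mx. Qed.
Lemma heq_comp_id X Y (f : rep_hom X Y) : f <o> hom_id X === f.
Proof. by apply: heq_mx; rewrite /= mulmx1. Qed.
Lemma heq_tens_comp X Y Z X' Y' Z' (g : rep_hom Y Z) (f : rep_hom X Y) (g' : rep_hom Y' Z') (f' : rep_hom X' Y') :
  (g <o> f) <x> (g' <o> f') === (g <x> g') <o> (f <x> f').
Proof. by apply: heq_mx; rewrite /= tensmx_mul. Qed.
Lemma heq_tens_id_id X Y : hom_id X <x> hom_id Y === hom_id (rep_tens X Y).
Proof. by apply: heq_mx; rewrite /= tensmx11. Qed.
End Exchange.

(** * A line whose square is the unit *)

Section Line.
Variables (K : closedFieldType) (chi : rep K).
Variables (alpha : rep_hom (rep_tens chi chi) (unit_rep K)) (alpha' : rep_hom (unit_rep K) (rep_tens chi chi)).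
Hypothesis alphaK : alpha *m alpha' = 1%:M.
Hypothesis alpha'K : alpha' <o> alpha === hom_id _.
Variable eps : K.
Hypothesis eps2 : eps * eps = 1.
Hypothesis alphaC : alpha <o> hom_braid chi chi = eps *: hom_mx alpha :> 'M_(_, _).

(** Insert the identity alpha' alpha, valid up to negligible maps: alpha only sees the braiding as
    the scalar eps. *)
Lemma braid_line : hom_braid chi chi === hom_scale eps (hom_id _).
Proof.
rewrite -(heq_id_comp (hom_braid _ _)) -alpha'K.
apply: (heq_trans (g := hom_scale eps (alpha' <o> alpha))); last by rewrite alpha'K.
by apply: heq_mx; rewrite -hom_compA; have /= -> := alphaC; rewrite -scalemxAr.
Qed.

Lemma alphaCE x y : alpha *m (x *# y) = eps *: (alpha *m (y *# x)).
Proof. by rewrite scalemxAl -alphaC hom_compE braidE. Qed.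

(* alpha (x, y) z = x alpha (y, z) *)
Lemma alpha_assoc :
  hom_lunit chi <o> (alpha <x> hom_id chi)
  === hom_runit chi <o> (hom_id chi <x> alpha) <o> hom_assoc chi chi chi.
Proof.
symmetry; pose c := hom_braid chi chi; pose i := hom_id chi.
pose L := hom_lunit chi <o> (alpha <x> hom_id chi).
have E : hom_runit chi <o> (hom_id chi <x> alpha) <o> hom_assoc chi chi chi ===
    L <o> hom_assocV chi chi chi <o> (i <x> c) <o> hom_assoc chi chi chi <o> (c <x> i).
  apply: heq_mx; apply: (@tens_extl _ chi chi chi) => x y z.
  rewrite /L /i /c !(hom_compE, hom_tensE, hom_idE, assocE, assocVE, braidE) runitE.
  by rewrite lunitE.
rewrite E /c /L /i braid_line; apply: heq_mx; apply: (@tens_extl _ chi chi chi) => x y z.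
rewrite !(hom_compE, hom_tensE, hom_idE, hom_scaleE, tvZl) -!scalemxAr assocE.
rewrite !(hom_tensE, hom_idE, hom_scaleE, tvZr) -!scalemxAr assocVE !(hom_tensE, hom_idE).
by rewrite scalerA eps2 scale1r.
Qed.

(** The power of chi with exponent b, read modulo 2. [muchi] multiplies by one more factor chi and
    [dechi] splits one off. *)
Definition chib (b : bool) : rep K := if b then chi else unit_rep K.
Definition muchi b : rep_hom (rep_tens chi (chib (~~ b))) (chib b) :=
  if b is true then hom_runit chi else alpha.
Definition dechi b : rep_hom (chib b) (rep_tens chi (chib (~~ b))) :=
  if b is true then hom_runitV chi else alpha'.

Lemma muchiK b : muchi b <o> dechi b = 1%:M :> 'M_(_, _).
Proof.
case: b; last exact: alphaK.
by apply: cV_ext => x; rewrite hom_compE runitVE runitE mxE eqxx scale1r mul1mx.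
Qed.
Lemma dechiK b : dechi b <o> muchi b === hom_id _.
Proof.
case: b; last exact: alpha'K.
apply: heq_mx; apply: (@tens_ext _ chi (unit_rep K)) => x c.
by rewrite hom_compE runitE hom_idE runitVE [c in RHS]cV1E tvZl tvZr.
Qed.
End Line.

(** * Tensor powers of U = chi (x) V compared with those of V *)

Section Transport.
Variables (K : closedFieldType) (chi : rep K).
Variables (alpha : rep_hom (rep_tens chi chi) (unit_rep K)) (alpha' : rep_hom (unit_rep K) (rep_tens chi chi)).
Hypothesis alphaK : alpha *m alpha' = 1%:M.
Hypothesis alpha'K : alpha' <o> alpha === hom_id _.
Variable eps : K.
Hypothesis eps2 : eps * eps = 1.
Hypothesis alphaC : alpha <o> hom_braid chi chi = eps *: hom_mx alpha :> 'M_(_, _).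
Variables (V U : rep K) (bV : rep_hom (rep_tens V V) (unit_rep K)) (B : rep_hom (rep_tens U U) (unit_rep K)).
Variables (r : rep_hom (rep_tens chi V) U) (i : rep_hom U (rep_tens chi V)).
Hypothesis ri : r <o> i = 1%:M :> 'M_(_, _).
Hypothesis ir : i <o> r === hom_id _.
Hypothesis formB : B <o> (r <x> r) ===
  hom_lunit (unit_rep K) <o> (alpha <x> bV) <o> hom_mid chi V chi V.
Local Notation TV := (tens_pow V).
Local Notation TU := (tens_pow U).
Local Notation chib := (chib chi).
Local Notation mu := (muchi alpha).
Local Notation de := (dechi alpha').

(** The n-th power of chi (x) V is chi^n (x) V^n, and chi^n is [chib b] with b the parity of n. Each
    step splits one chi off [chib b] and joins it to a factor V by [r]; for the wrong parity the
    recursion ends in the zero map. *)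
Definition iotaS b n (f : rep_hom (rep_tens (chib (~~ b)) (TV n)) (TU n)) :
    rep_hom (rep_tens (chib b) (TV n.+1)) (TU n.+1) :=
  (r <x> f) <o> hom_mid chi (chib (~~ b)) V (TV n) <o> (de b <x> hom_id (TV n.+1)).
Fixpoint iota_pow b n : rep_hom (rep_tens (chib b) (TV n)) (TU n) :=
  match n return rep_hom (rep_tens (chib b) (TV n)) (TU n) with
  | 0 => if b return rep_hom (rep_tens (chib b) (unit_rep K)) (unit_rep K)
         then hom_zero _ _ else hom_lunit (unit_rep K)
  | n'.+1 => iotaS (iota_pow (~~ b) n')
  end.

Definition kappaS b n (f : rep_hom (TU n) (rep_tens (chib (~~ b)) (TV n))) :
    rep_hom (TU n.+1) (rep_tens (chib b) (TV n.+1)) :=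
  (mu b <x> hom_id (TV n.+1)) <o> hom_mid chi V (chib (~~ b)) (TV n) <o> (i <x> f).
Fixpoint kappa_pow b n : rep_hom (TU n) (rep_tens (chib b) (TV n)) :=
  match n return rep_hom (TU n) (rep_tens (chib b) (TV n)) with
  | 0 => if b return rep_hom (unit_rep K) (rep_tens (chib b) (unit_rep K))
         then hom_zero _ _ else hom_runitV (unit_rep K)
  | n'.+1 => kappaS (kappa_pow (~~ b) n')
  end.

Lemma iota_pow0 b n : odd n != b -> iota_pow b n = 0 :> 'M_(_, _).
Proof.
elim: n b => [|n IHn] [] //= on.
  by rewrite IHn ?tensmx0 ?mul0mx //; case: (odd n) on.
by rewrite IHn ?tensmx0 ?mul0mx //; case: (odd n) on.
Qed.
Lemma kappa_pow0 b n : odd n != b -> kappa_pow b n = 0 :> 'M_(_, _).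
Proof.
elim: n b => [|n IHn] [] //= on.
  by rewrite IHn ?tensmx0 ?mulmx0 //; case: (odd n) on.
by rewrite IHn ?tensmx0 ?mulmx0 //; case: (odd n) on.
Qed.

Lemma heq_mid (X Y Z W : rep K) : hom_mid X Z Y W <o> hom_mid X Y Z W === hom_id _.
Proof. by apply: heq_mx; rewrite mid_mid. Qed.

Lemma iota_kappaS b n (f : rep_hom _ (TU n)) g :
  iotaS f <o> kappaS (b := b) g === hom_id U <x> (f <o> g).
Proof.
rewrite /iotaS /kappaS -!heq_compA (heq_compA (de b <x> _)) -heq_tens_comp dechiK // heq_id_comp.
rewrite heq_tens_id_id heq_id_comp. rewrite (heq_compA (hom_mid _ _ _ _)) heq_mid heq_id_comp -heq_tens_comp.
by rewrite (_ : r <o> i === hom_id U) //; apply: heq_mx.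
Qed.
Lemma kappa_iotaS b n (f : rep_hom _ (TU n)) g :
  g <o> f === hom_id _ -> kappaS (b := b) g <o> iotaS f === hom_id _.
Proof.
move=> gf; rewrite /iotaS /kappaS -!heq_compA (heq_compA (i <x> g)) -heq_tens_comp ir gf.
rewrite heq_tens_id_id heq_id_comp (heq_compA (hom_mid _ _ _ _)) heq_mid heq_id_comp -heq_tens_comp.
rewrite (_ : mu b <o> de b === hom_id _); last by apply: heq_mx; rewrite muchiK.
by rewrite heq_id_comp heq_tens_id_id.
Qed.

(** Only the summand with the parity of n is nonzero; writing both keeps that parity out of the
    types. *)
Lemma iota_kappa n :
  hom_add (iota_pow false n <o> kappa_pow false n) (iota_pow true n <o> kappa_pow true n)
  === hom_id (TU n).
Proof.
elim: n => [|n IHn].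
  apply: heq_mx; apply: cV_ext => c; rewrite hom_addE !hom_compE !hom_zeroE addr0.
  by rewrite runitVE lunitE hom_idE -cV1E.
rewrite -[iota_pow false n.+1]/(@iotaS false n (iota_pow true n)) -[kappa_pow false n.+1]/(@kappaS false n (kappa_pow true n)).
rewrite -[iota_pow true n.+1]/(@iotaS true n (iota_pow false n)) -[kappa_pow true n.+1]/(@kappaS true n (kappa_pow false n)).
rewrite !iota_kappaS; apply: heq_trans (heq_tens_id_id (X := U) (Y := TU n)).
apply: (heq_trans _ (heq_id_tens IHn)); apply: heq_mx.
by rewrite /= addrC tensmxDr.
Qed.
Lemma kappa_iota b n : odd n = b -> kappa_pow b n <o> iota_pow b n === hom_id _.
Proof.
elim: n b => [|n IHn] b on.
  case: b on => // _; apply: heq_mx; apply: (@tens_ext _ (unit_rep K) (unit_rep K)) => c d.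
  by rewrite hom_compE lunitE runitVE hom_idE [c in RHS]cV1E !tvZl [d]cV1E tvZl tvZr.
by apply: (@kappa_iotaS b n); apply: IHn; rewrite -on negbK.
Qed.

Local Notation swU := (sw U).
Local Notation swV := (sw V).

Definition de2 b : rep_hom (chib b) (rep_tens chi (rep_tens chi (chib (~~ ~~ b)))) :=
  (hom_id chi <x> de (~~ b)) <o> de b.

(* x (y c) (v (w t)) is sent to r(x v) (r(y w) f(c t)). *)
Definition iotaSS (C : rep K) n m (f : rep_hom (rep_tens C (TV n)) (TU m)) :
    rep_hom (rep_tens (rep_tens chi (rep_tens chi C)) (TV n.+2)) (TU m.+2) :=
  (r <x> ((r <x> f) <o> hom_mid chi C V (TV n))) <o> hom_mid chi (rep_tens chi C) V (TV n.+1).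

Lemma iotaSSE C n m (f : rep_hom (rep_tens C (TV n)) (TU m)) x y c v w t :
  iotaSS f *m (x *# (y *# c) *# (v *# (w *# t))) = (r *m (x *# v)) *# ((r *m (y *# w)) *# (f *m (c *# t))).
Proof. by rewrite hom_compE midE !(hom_tensE, hom_compE) midE hom_tensE. Qed.

Lemma iotaSE b n f c (t : 'cV_(rep_dim (TV n.+1))) :
  @iotaS b n f *m (c *# t) = (r <x> f) *m (hom_mid _ _ _ _ *m ((de b *m c) *# t)).
Proof. by rewrite /iotaS !hom_compE hom_tensE hom_idE. Qed.

Lemma iota_powSS b n :
  iota_pow b n.+2 = iotaSS (iota_pow (~~ ~~ b) n) <o> (de2 b <x> hom_id (TV n.+2)) :> 'M_(_, _).
Proof.
rewrite -[iota_pow b n.+2]/(iotaS (@iotaS (~~ b) n (iota_pow (~~ ~~ b) n))).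
move: (iota_pow _ n) => f; apply: tens_extrr => c v w t.
rewrite iotaSE [RHS]hom_compE hom_tensE hom_idE /de2 hom_compE.
elim/tens_elim: (de b *m c) => [u u' Hu Hu'|x y]; first by rewrite !(tvDl, tvDr, mulmxDr) Hu Hu'.
rewrite hom_tensE hom_idE midE hom_tensE iotaSE.
elim/tens_elim: (de (~~ b) *m y) => [u u' Hu Hu'|z d].
  by rewrite !(tvDl, tvDr, mulmxDr) Hu Hu'.
by rewrite midE hom_tensE iotaSSE.
Qed.

Definition braid2 (C : rep K) : rep_hom (rep_tens chi (rep_tens chi C)) (rep_tens chi (rep_tens chi C)) :=
  hom_assoc chi chi C <o> (hom_braid chi chi <x> hom_id C) <o> hom_assocV chi chi C.
Lemma braid2E C x y c : braid2 C *m (x *# (y *# c)) = y *# (x *# c).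
Proof. by rewrite !elE. Qed.
Lemma braid2_line C : braid2 C === hom_scale eps (hom_id _).
Proof.
rewrite /braid2 (braid_line alpha'K alphaC); apply: heq_mx; apply: (@tens_extr _ chi chi C) => x y c.
by rewrite !(hom_compE, hom_tensE, hom_idE, hom_scaleE, assocVE) tvZl -scalemxAr assocE.
Qed.

Lemma tens_ext33 (X Y Z X' Y' Z' : rep K) q
    (A A' : 'M[K]_(q, rep_dim (rep_tens (rep_tens X (rep_tens Y Z)) (rep_tens X' (rep_tens Y' Z'))))) :
  (forall x y z x' y' z', A *m (x *# (y *# z) *# (x' *# (y' *# z')))
     = A' *m (x *# (y *# z) *# (x' *# (y' *# z')))) -> A = A'.
Proof.
move=> H; apply: tens_ext => u u'.
elim/tens_elim: u => [u1 u2 H1 H2|x u]; first by rewrite tvDl !mulmxDr H1 H2.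
elim/tens_elim: u => [u1 u2 H1 H2|y z]; first by rewrite tvDr tvDl !mulmxDr H1 H2.
elim/tens_elim: u' => [u1 u2 H1 H2|x' u']; first by rewrite tvDr !mulmxDr H1 H2.
elim/tens_elim: u' => [u1 u2 H1 H2|y' z']; first by rewrite !tvDr !mulmxDr H1 H2.
exact: H.
Qed.

(** Exchanging two factors chi (x) V exchanges two factors V and braids two lines, and the latter is
    the scalar eps. *)
Lemma iota_sw b n l : (l <= n)%N ->
  swU l n.+2 <o> iota_pow b n.+2 === hom_scale eps (iota_pow b n.+2 <o> (hom_id _ <x> swV l n.+2)).
Proof.
elim: l n b => [|l IHl] n b ln.
  pose J := iotaSS (iota_pow (~~ ~~ b) n).
  have E1 : swU 0 n.+2 <o> J = J <o> (braid2 _ <x> swV 0 n.+2) :> 'M_(_, _).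
    apply: tens_ext33 => x y c v w t.
    rewrite hom_compE /J iotaSSE sw0E [RHS]hom_compE hom_tensE braid2E sw0E.
    by rewrite iotaSSE.
  have E2 : swU 0 n.+2 <o> iota_pow b n.+2 === swU 0 n.+2 <o> J <o> (de2 b <x> hom_id _).
    by apply: heq_mx; rewrite -hom_compA; congr (_ *m _); apply: iota_powSS.
  rewrite {}E2 (heq_mx E1) braid2_line; apply: heq_mx; apply: tens_ext => c t.
  rewrite hom_compE hom_tensE hom_idE hom_compE hom_tensE !hom_scaleE hom_idE [RHS in _ = _ *: RHS]hom_compE.
  by rewrite tvZl -scalemxAr [in RHS]hom_tensE hom_idE iota_powSS hom_compE hom_tensE hom_idE.
case: n ln => // n ln.
have E1 : swU l.+1 n.+3 <o> iota_pow b n.+3 ===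
   (r <x> (swU l n.+2 <o> iota_pow (~~ b) n.+2)) <o> hom_mid _ _ _ _ <o> (de b <x> hom_id (TV n.+3)).
  apply: heq_mx; apply: (@tens_ext _ _ (TV n.+3)) => c t; rewrite hom_compE.
  rewrite -[iota_pow b n.+3]/(iotaS (iota_pow (~~ b) n.+2)) iotaSE !hom_compE hom_tensE hom_idE.
  move: (hom_mid _ _ _ _ *m _) => u; elim/tens_elim: u => [u u' Hu Hu'|x y]; first by rewrite !mulmxDr Hu Hu'.
  by rewrite (hom_tensE r (iota_pow (~~ b) n.+2)) swSE (hom_tensE r) (hom_compE (swU l n.+2)).
rewrite {}E1 IHl //; apply: heq_mx; apply: (@tens_ext _ _ (TV n.+3)) => c t.
rewrite hom_scaleE (hom_compE (iota_pow b n.+3)) [in RHS]hom_tensE hom_idE.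
rewrite -[iota_pow b n.+3]/(iotaS (iota_pow (~~ b) n.+2)) iotaSE 2!hom_compE hom_tensE hom_idE.
elim/tens_elim: (de b *m c) => [u u' Hu Hu'|x y]; first by rewrite !(tvDl, tvDr, mulmxDr, scalerDr) Hu Hu'.
elim/tens_elim: t => [u u' Hu Hu'|v t]; first by rewrite !(tvDl, tvDr, mulmxDr, scalerDr) Hu Hu'.
by rewrite swSE !midE !hom_tensE hom_scaleE hom_compE hom_tensE hom_idE tvZr.
Qed.

Definition pair_off (C : rep K) : rep_hom (rep_tens chi (rep_tens chi C)) C :=
  hom_lunit C <o> (alpha <x> hom_id C) <o> hom_assocV chi chi C.
Lemma pair_offE C x y c : pair_off C *m (x *# (y *# c)) = (alpha *m (x *# y)) 0 0 *: c.
Proof. by rewrite !elE. Qed.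

Lemma iotaSS_ct C n (f : rep_hom (rep_tens C (TV n)) (TU n)) :
  ct B 0 n <o> iotaSS f === f <o> (pair_off C <x> ct bV 0 n).
Proof.
pose G := hom_assocV (rep_tens chi V) (rep_tens chi V) (rep_tens C (TV n))
  <o> (hom_id _ <x> hom_mid chi C V (TV n)) <o> hom_mid chi (rep_tens chi C) V (TV n.+1).
have GE x y c v w t : G *m (x *# (y *# c) *# (v *# (w *# t))) = x *# v *# (y *# w) *# (c *# t).
  by rewrite /G !hom_compE midE hom_tensE hom_idE midE assocVE.
have E1 : ct B 0 n <o> iotaSS f === hom_lunit (TU n) <o> ((B <o> (r <x> r)) <x> f) <o> G.
  apply: heq_mx; apply: tens_ext33 => x y c v w t.
  rewrite hom_compE iotaSSE ct0E [RHS]hom_compE GE [RHS]hom_compE (hom_tensE (B <o> _)) lunitE.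
  by rewrite hom_compE hom_tensE.
rewrite E1 formB; apply: heq_mx; apply: tens_ext33 => x y c v w t.
rewrite hom_compE GE [LHS]hom_compE (hom_tensE (_ <o> _ <o> _) f) lunitE [RHS]hom_compE (hom_tensE (pair_off C)).
rewrite pair_offE ct0E tvZl tvZr -!scalemxAr scalerA; congr (_ *: _).
by rewrite 2!hom_compE midE hom_tensE lunitE [X in _ *: X]cV1E scalerA !mxE eqxx mulr1.
Qed.

(** The line x is sent to x followed by alpha'(1), and the first two of the three lines are paired.
    By [alpha_assoc] the last two may be paired instead, which gives alpha alpha' = 1. *)
Lemma pair_off_de2_true : pair_off chi <o> de2 true === hom_id chi.
Proof.
have E1 : pair_off chi === hom_runit chi <o> (hom_id chi <x> alpha).
  rewrite /pair_off (alpha_assoc alpha'K eps2 alphaC); apply: heq_mx.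
  apply: (@tens_extr _ chi chi chi) => x y z.
  by rewrite hom_compE assocVE hom_compE assocE.
rewrite /de2 E1; apply: heq_mx; apply: cV_ext => x.
rewrite !hom_compE; have -> : de true *m x = x *# 1%:M by exact: runitVE.
rewrite !hom_tensE [alpha *m _]mulmxA alphaK.
by rewrite runitE !hom_idE mxE eqxx scale1r.
Qed.
Lemma pair_off_de2_false : pair_off (unit_rep K) <o> de2 false === hom_id (unit_rep K).
Proof.
apply: heq_mx; apply: cV_ext => c.
rewrite hom_compE [de2 false *m c]hom_compE hom_idE.
transitivity (alpha *m (alpha' *m c)); last by rewrite mulmxA alphaK mul1mx.
have -> : de false *m c = alpha' *m c by [].
elim/tens_elim: (alpha' *m c) => [u u' Hu Hu'|x y].
  by rewrite !mulmxDr Hu Hu'.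
rewrite hom_tensE hom_idE; have -> : de (~~ false) *m y = y *# 1%:M by exact: runitVE.
rewrite pair_offE.
by rewrite [RHS]cV1E.
Qed.

(** By [formB], contracting two factors of U contracts two factors of V and pairs off the two lines
    joined to them. *)
Lemma iota_ct b n l : (l <= n)%N ->
  ct B l n <o> iota_pow b n.+2 === iota_pow b n <o> (hom_id _ <x> ct bV l n).
Proof.
elim: l n b => [|l IHl] n b ln.
  have E2 : ct B 0 n <o> iota_pow b n.+2 ===
      ct B 0 n <o> iotaSS (iota_pow (~~ ~~ b) n) <o> (de2 b <x> hom_id _).
    by apply: heq_mx; rewrite -hom_compA; congr (_ *m _); apply: iota_powSS.
  rewrite {}E2 iotaSS_ct -heq_compA -heq_tens_comp heq_comp_id.
  by case: b => /=; rewrite ?pair_off_de2_true ?pair_off_de2_false.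
case: n ln => // n ln.
have E1 : ct B l.+1 n.+1 <o> iota_pow b n.+3 ===
   (r <x> (ct B l n <o> iota_pow (~~ b) n.+2)) <o> hom_mid _ _ _ _ <o> (de b <x> hom_id (TV n.+3)).
  apply: heq_mx; apply: (@tens_ext _ _ (TV n.+3)) => c t; rewrite hom_compE.
  rewrite -[iota_pow b n.+3]/(iotaS (iota_pow (~~ b) n.+2)) iotaSE !hom_compE hom_tensE hom_idE.
  move: (hom_mid _ _ _ _ *m _) => u; elim/tens_elim: u => [u u' Hu Hu'|x y]; first by rewrite !mulmxDr Hu Hu'.
  by rewrite (hom_tensE r (iota_pow (~~ b) n.+2)) ctSE (hom_tensE r) (hom_compE (ct B l n)).
rewrite {}E1 IHl //; apply: heq_mx; apply: (@tens_ext _ _ (TV n.+3)) => c t.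
rewrite (hom_compE (iota_pow b n.+1)) [in RHS]hom_tensE hom_idE.
rewrite -[iota_pow b n.+1]/(iotaS (iota_pow (~~ b) n)) iotaSE 2!hom_compE hom_tensE hom_idE.
elim/tens_elim: (de b *m c) => [u u' Hu Hu'|x y]; first by rewrite !(tvDl, tvDr, mulmxDr) Hu Hu'.
elim/tens_elim: t => [u u' Hu Hu'|v t]; first by rewrite !(tvDl, tvDr, mulmxDr) Hu Hu'.
by rewrite ctSE !midE !hom_tensE hom_compE hom_tensE hom_idE.
Qed.
End Transport.

(** * The multiplication of the queer algebra on elements *)

Section QueerProduct.
Variables (K : closedFieldType) (chi S : rep K) (alpha : rep_hom (rep_tens chi chi) (unit_rep K)).
Local Notation E := (inner_hom S S).
Local Notation Ec := (inner_hom S (rep_tens S chi)).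
Local Notation Q := (queer_obj chi S).
Local Notation W := (dsum S (rep_tens S chi)).
Local Notation mQ := (queer_mult alpha S).

Implicit Types (x d v : 'cV[K]_(rep_dim S)) (s t : 'cV[K]_(rep_dim chi)).

Definition pairing n (d x : 'cV[K]_n) : K := \sum_a d a 0 * x a 0.

Lemma prl_inl (X Y : rep K) (x : 'cV_(rep_dim X)) : hom_prl X Y *m (hom_inl X Y *m x) = x.
Proof. by rewrite mulmxA mul_row_col mulmx1 mul0mx addr0 mul1mx. Qed.
Lemma prl_inr (X Y : rep K) (y : 'cV_(rep_dim Y)) : hom_prl X Y *m (hom_inr X Y *m y) = 0.
Proof. by rewrite mulmxA mul_row_col mulmx0 mul0mx addr0 mul0mx. Qed.
Lemma prr_inr (X Y : rep K) (y : 'cV_(rep_dim Y)) : hom_prr X Y *m (hom_inr X Y *m y) = y.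
Proof. by rewrite mulmxA mul_row_col mulmx1 mul0mx add0r mul1mx. Qed.
Lemma prr_inl (X Y : rep K) (x : 'cV_(rep_dim X)) : hom_prr X Y *m (hom_inl X Y *m x) = 0.
Proof. by rewrite mulmxA mul_row_col mulmx0 mul0mx addr0 mul0mx. Qed.

Lemma eval_curry (X U Y : rep K) (f : rep_hom (rep_tens X U) Y) (x : 'cV_(rep_dim X)) (u : 'cV_(rep_dim U)) :
  hom_eval U Y *m ((hom_curry f *m x) *# u) = f *m (x *# u).
Proof.
rewrite hom_curryE tv_suml mulmx_sumr [u in RHS]cV_sum_delta tv_sumr mulmx_sumr.
apply: eq_bigr => a _; rewrite hom_evalE tvZr -scalemxAr; congr (_ *: _).
rewrite (bigD1 a) //= mxE !eqxx mul1r big1 ?addr0 // => c /negPf ca.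
by rewrite mxE ca mul0r.
Qed.

Lemma queer_act_ee x d v :
  queer_act alpha S *m ((hom_inl E Ec *m (x *# d)) *# (hom_inl S (rep_tens S chi) *m v))
  = pairing d v *: (hom_inl S (rep_tens S chi) *m x).
Proof.
rewrite /queer_act hom_addE !(hom_compE (queer_act_even chi S)) (hom_compE (queer_act_odd alpha S)).
rewrite !hom_tensE prl_inl prr_inl tv0l mulmx0 addr0 hom_idE /queer_act_even.
have := @hom_evalE _ S S; move: (hom_eval S S) => e He; rewrite hom_addE.
rewrite !hom_compE !hom_tensE prl_inl prr_inl tv0r !mulmx0 addr0 hom_idE He.
by rewrite -scalemxAr.
Qed.
Lemma queer_act_eo x d v s :
  queer_act alpha S *m ((hom_inl E Ec *m (x *# d)) *# (hom_inr S (rep_tens S chi) *m (v *# s)))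
  = pairing d v *: (hom_inr S (rep_tens S chi) *m (x *# s)).
Proof.
rewrite /queer_act hom_addE !(hom_compE (queer_act_even chi S)) (hom_compE (queer_act_odd alpha S)).
rewrite !hom_tensE prl_inl prr_inl tv0l mulmx0 addr0 hom_idE /queer_act_even.
have := @hom_evalE _ S S; move: (hom_eval S S) => e He; rewrite hom_addE.
rewrite !hom_compE !hom_tensE prr_inr prl_inr tv0r !mulmx0 add0r hom_idE assocVE hom_tensE He.
by rewrite hom_idE tvZl -scalemxAr.
Qed.
Lemma queer_act_oe x t d v :
  queer_act alpha S *m ((hom_inr E Ec *m (x *# t *# d)) *# (hom_inl S (rep_tens S chi) *m v))
  = pairing d v *: (hom_inr S (rep_tens S chi) *m (x *# t)).
Proof.
rewrite /queer_act hom_addE !(hom_compE (queer_act_even chi S)) (hom_compE (queer_act_odd alpha S)).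
rewrite !hom_tensE prr_inr prl_inr tv0l mulmx0 add0r hom_idE /queer_act_odd.
have := @hom_evalE _ S (rep_tens S chi); move: (hom_eval S (rep_tens S chi)) => e He; rewrite hom_addE.
rewrite !hom_compE !hom_tensE prl_inl prr_inl tv0r !mulmx0 addr0 hom_idE He.
by rewrite -scalemxAr.
Qed.
Lemma queer_act_oo x t d v s :
  queer_act alpha S *m ((hom_inr E Ec *m (x *# t *# d)) *# (hom_inr S (rep_tens S chi) *m (v *# s)))
  = (pairing d v * (alpha *m (t *# s)) 0 0) *: (hom_inl S (rep_tens S chi) *m x).
Proof.
rewrite /queer_act hom_addE !(hom_compE (queer_act_even chi S)) (hom_compE (queer_act_odd alpha S)).
rewrite !hom_tensE prr_inr prl_inr tv0l mulmx0 add0r hom_idE /queer_act_odd.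
have := @hom_evalE _ S (rep_tens S chi); move: (hom_eval S (rep_tens S chi)) => e He; rewrite hom_addE.
rewrite !hom_compE !hom_tensE prr_inr prl_inr tv0r !mulmx0 add0r hom_idE assocVE hom_tensE He.
rewrite hom_idE tvZl -!scalemxAr assocE hom_tensE hom_idE runitE -scalemxAr scalerA.
by [].
Qed.

(** Since the retraction reads off the first column, the product is determined by its action on the
    summand S of S + S (x) chi. *)
Lemma queer_multE (a b : 'cV_(rep_dim Q)) :
  mQ *m (a *# b) =
  hom_inl E Ec *m (\sum_v (hom_prl S (rep_tens S chi) *m (queer_act alpha S *m (a *#
     (queer_act alpha S *m (b *# (hom_inl S (rep_tens S chi) *m ev v)))))) *# ev v)
  + hom_inr E Ec *m (\sum_v (hom_prr S (rep_tens S chi) *m (queer_act alpha S *m (a *#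
     (queer_act alpha S *m (b *# (hom_inl S (rep_tens S chi) *m ev v)))))) *# ev v).
Proof.
rewrite /queer_mult (hom_compE (queer_retr chi S <o> end_mult W)) (hom_compE (queer_retr chi S)).
rewrite (hom_tensE (queer_incl alpha S)); set y := end_mult W *m _.
have act w : hom_eval W W *m (y *# w) = queer_act alpha S *m (a *# (queer_act alpha S *m (b *# w))).
  rewrite /y /end_mult eval_curry /queer_incl.
  rewrite (hom_compE _ (hom_assoc _ _ _)) assocE (hom_compE (hom_eval W W)) hom_tensE hom_idE.
  by rewrite !eval_curry.
move: y act => y act; rewrite /queer_retr hom_addE (hom_compE (hom_inl _ _)) (hom_compE (hom_inr _ _)).
rewrite ![hom_curry _ *m _]hom_curryE.
congr (_ + _); congr (hom_mx _ *m _); apply: eq_bigr => v _; congr (_ *# _).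
  by rewrite (hom_compE (hom_prl _ _ <o> _)) hom_tensE hom_idE (hom_compE (hom_prl _ _)) act.
by rewrite (hom_compE (hom_prr _ _ <o> _)) hom_tensE hom_idE (hom_compE (hom_prr _ _)) act.
Qed.

Lemma sum_pairing n (d : 'cV[K]_n) m (x : 'cV[K]_m) c :
  \sum_v ((pairing d (ev v) * c) *: x) *# ev v = c *: (x *# d).
Proof.
rewrite [d in RHS]cV_sum_delta tv_sumr scaler_sumr; apply: eq_bigr => v _.
rewrite tvZl tvZr scalerA [in LHS]mulrC; congr ((_ * _) *: _).
rewrite /pairing (bigD1 v) //= big1 ?addr0 => [|a /negPf av]; rewrite !mxE ?eqxx ?mulr1 //.
by rewrite av mulr0.
Qed.
Lemma sum_pairing0 n m : \sum_(v < n) (0 : 'cV[K]_m) *# ev v = 0.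
Proof. by rewrite big1 // => v _; rewrite tv0l. Qed.

Lemma queer_ee x d x' d' :
  mQ *m ((hom_inl E Ec *m (x *# d)) *# (hom_inl E Ec *m (x' *# d')))
  = pairing d x' *: (hom_inl E Ec *m (x *# d')).
Proof.
rewrite queer_multE; under eq_bigr do rewrite queer_act_ee tvZr -scalemxAr queer_act_ee scalerA -scalemxAr prl_inl.
under [X in _ + _ *m X]eq_bigr do rewrite queer_act_ee tvZr -scalemxAr queer_act_ee scalerA -scalemxAr prr_inl scaler0.
by rewrite sum_pairing sum_pairing0 mulmx0 addr0 -scalemxAr.
Qed.
Lemma queer_eo x d x' t d' :
  mQ *m ((hom_inl E Ec *m (x *# d)) *# (hom_inr E Ec *m (x' *# t *# d')))
  = pairing d x' *: (hom_inr E Ec *m (x *# t *# d')).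
Proof.
rewrite queer_multE; under eq_bigr do rewrite queer_act_oe tvZr -scalemxAr queer_act_eo scalerA -scalemxAr prl_inr scaler0.
under [X in _ + _ *m X]eq_bigr do rewrite queer_act_oe tvZr -scalemxAr queer_act_eo scalerA -scalemxAr prr_inr.
by rewrite sum_pairing sum_pairing0 mulmx0 add0r -scalemxAr.
Qed.
Lemma queer_oe x t d x' d' :
  mQ *m ((hom_inr E Ec *m (x *# t *# d)) *# (hom_inl E Ec *m (x' *# d')))
  = pairing d x' *: (hom_inr E Ec *m (x *# t *# d')).
Proof.
rewrite queer_multE; under eq_bigr do rewrite queer_act_ee tvZr -scalemxAr queer_act_oe scalerA -scalemxAr prl_inr scaler0.
under [X in _ + _ *m X]eq_bigr do rewrite queer_act_ee tvZr -scalemxAr queer_act_oe scalerA -scalemxAr prr_inr.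
by rewrite sum_pairing sum_pairing0 mulmx0 add0r -scalemxAr.
Qed.
Lemma queer_oo x t d x' t' d' :
  mQ *m ((hom_inr E Ec *m (x *# t *# d)) *# (hom_inr E Ec *m (x' *# t' *# d')))
  = (pairing d x' * (alpha *m (t *# t')) 0 0) *: (hom_inl E Ec *m (x *# d')).
Proof.
rewrite queer_multE; under eq_bigr do rewrite queer_act_oe tvZr -scalemxAr queer_act_oo scalerA -scalemxAr prl_inl.
under [X in _ + _ *m X]eq_bigr do rewrite queer_act_oe tvZr -scalemxAr queer_act_oo scalerA -scalemxAr prr_inl scaler0.
by rewrite sum_pairing sum_pairing0 mulmx0 addr0 -scalemxAr.
Qed.

Lemma queer_unitE (c : 'cV_1) : queer_unit chi S *m c = hom_inl E Ec *m (hom_coev S *m c).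
Proof.
rewrite /queer_unit (hom_compE (queer_retr chi S)); set y := end_unit W *m c.
have act w : hom_eval W W *m (y *# w) = c 0 0 *: w by rewrite /y /end_unit eval_curry lunitE.
move: y act => y act; rewrite /queer_retr hom_addE (hom_compE (hom_inl _ _)) (hom_compE (hom_inr _ _)).
rewrite ![hom_curry _ *m _]hom_curryE [X in _ + _ *m X]big1 ?mulmx0 ?addr0 => [|v _].
  congr (hom_mx _ *m _); rewrite homcoev_E scaler_sumr; apply: eq_bigr => v _; rewrite -tvZl; congr (_ *# _).
  rewrite (hom_compE (hom_prl _ _ <o> _)) hom_tensE hom_idE (hom_compE (hom_prl _ _)) act.
  by rewrite -scalemxAr prl_inl.
rewrite (hom_compE (hom_prr _ _ <o> _)) hom_tensE hom_idE (hom_compE (hom_prr _ _)) act.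
by rewrite -scalemxAr prr_inl scaler0 tv0l.
Qed.
End QueerProduct.

(** * The queer algebra as End(S) tensored with the algebra on 1 + chi *)

Section QueerGraded.
Variables (K : closedFieldType) (chi S : rep K) (alpha : rep_hom (rep_tens chi chi) (unit_rep K)).
Local Notation E := (inner_hom S S).
Local Notation Ec := (inner_hom S (rep_tens S chi)).
Local Notation Q := (queer_obj chi S).
Local Notation mQ := (queer_mult alpha S).
Local Notation chib := (chib chi).
Implicit Types (x d v : 'cV[K]_(rep_dim S)) (s t : 'cV[K]_(rep_dim chi)).

Definition line_end : rep_hom (rep_tens chi E) Ec :=
  (hom_braid chi S <x> hom_id (dual_rep S)) <o> hom_assocV chi S (dual_rep S).
Definition end_line : rep_hom Ec (rep_tens chi E) :=
  hom_assoc chi S (dual_rep S) <o> (hom_braid S chi <x> hom_id (dual_rep S)).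
Lemma line_endE s x d : line_end *m (s *# (x *# d)) = x *# s *# d.
Proof. by rewrite !elE. Qed.
Lemma end_lineE s x d : end_line *m (x *# s *# d) = s *# (x *# d).
Proof. by rewrite !elE. Qed.

Definition lunitV X : rep_hom X (rep_tens (unit_rep K) X) := hom_braid X (unit_rep K) <o> hom_runitV X.
Lemma lunitVE (X : rep K) (x : 'cV_(rep_dim X)) : lunitV X *m x = 1%:M *# x.
Proof. by rewrite !elE. Qed.

(** Inclusions and projections of Q as the sum over b of [chib b] (x) End(S). The line is put in
    front, as in the tensor powers of chi (x) V. *)
Definition qin b : rep_hom (rep_tens (chib b) E) Q :=
  if b is true then hom_inr E Ec <o> line_end else hom_inl E Ec <o> hom_lunit E.
Definition qpr b : rep_hom Q (rep_tens (chib b) E) :=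
  if b is true then end_line <o> hom_prr E Ec else lunitV E <o> hom_prl E Ec.

Lemma qinE1 s x d : qin true *m (s *# (x *# d)) = hom_inr E Ec *m (x *# s *# d).
Proof. by rewrite hom_compE line_endE. Qed.
Lemma qinE0 c q : qin false *m (c *# q) = c 0 0 *: (hom_inl E Ec *m q).
Proof. by rewrite hom_compE lunitE -scalemxAr. Qed.

Lemma qpr_qin b : qpr b <o> qin b = 1%:M :> 'M_(_, _).
Proof.
case: b.
  apply: (@tens_extr _ chi S (dual_rep S)) => s x d.
  by rewrite hom_compE qinE1 hom_compE prr_inr end_lineE mul1mx.
apply: (@tens_ext _ (unit_rep K) E) => c q.
by rewrite hom_compE qinE0 -scalemxAr hom_compE prl_inl lunitVE -tvZl -cV1E mul1mx.
Qed.
Lemma qpr_qin0 b b' : b != b' -> qpr b <o> qin b' = 0 :> 'M_(_, _).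
Proof.
case: b b' => [] [] // _.
  apply: (@tens_ext _ (unit_rep K) E) => c q.
  by rewrite hom_compE qinE0 -scalemxAr hom_compE prr_inl mulmx0 scaler0 mul0mx.
apply: (@tens_extr _ chi S (dual_rep S)) => s x d.
by rewrite hom_compE qinE1 hom_compE prl_inr mulmx0 mul0mx.
Qed.

Lemma hom_dsum (X Y : rep K) (z : 'cV_(rep_dim (dsum X Y))) :
  hom_inl X Y *m (hom_prl X Y *m z) + hom_inr X Y *m (hom_prr X Y *m z) = z.
Proof.
rewrite !mulmxA -mulmxDl -[RHS]mul1mx; congr (_ *m z).
rewrite /= !mul_col_mx !mul0mx !mul1mx add_col_mx addr0 add0r.
by rewrite -block_mxEv -scalar_mx_block.
Qed.

Lemma qin_qpr : hom_add (qin false <o> qpr false) (qin true <o> qpr true) = 1%:M :> 'M_(_, _).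
Proof.
apply: cV_ext => z; rewrite hom_addE !(hom_compE (qin _)) mul1mx -[RHS]hom_dsum; congr (_ + _).
  by rewrite [qpr false *m z]hom_compE lunitVE qinE0 mxE eqxx scale1r.
rewrite [qpr true *m z]hom_compE; elim/(@tens_elim _ (rep_tens S chi) (dual_rep S)): (hom_prr E Ec *m z) => [u u' Hu Hu'|w d].
  by rewrite !mulmxDr Hu Hu'.
elim/tens_elim: w => [u u' Hu Hu'|x s]; first by rewrite !(tvDl, mulmxDr) Hu Hu'.
by rewrite end_lineE qinE1.
Qed.

Definition mu2 b b' : rep_hom (rep_tens (chib b) (chib b')) (chib (b (+) b')) :=
  match b, b' return rep_hom (rep_tens (chib b) (chib b')) (chib (b (+) b')) with
  | false, b' => hom_lunit (chib b')
  | true, false => hom_runit chi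
  | true, true => alpha
  end.

Definition end_comp : rep_hom (rep_tens E E) E :=
  (hom_eval S S <x> hom_id (dual_rep S)) <o> hom_assocV E S (dual_rep S).
Lemma end_compE x d x' d' : end_comp *m (x *# d *# (x' *# d')) = pairing d x' *: (x *# d').
Proof. by rewrite hom_compE assocVE hom_tensE hom_evalE hom_idE tvZl. Qed.

(** This is Q(S) = End(S) (x) Q(1): the lines are multiplied by [mu2] and the endomorphisms are
    composed. It is the only form in which the product of Q enters the comparison with A. *)
Lemma queer_mult_qin b b' :
  mQ <o> (qin b <x> qin b') =
  qin (b (+) b') <o> (mu2 b b' <x> end_comp) <o> hom_mid (chib b) E (chib b') E :> 'M_(_, _).
Proof.
apply: tens_ext22 => c q c' q'.
rewrite [LHS]hom_compE hom_tensE [RHS]hom_compE midE [RHS]hom_compE (hom_tensE (mu2 b b')).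
elim/(@tens_elim _ S (dual_rep S)): q => [u u' Hu Hu'|x d].
  by rewrite !(tvDl, tvDr, mulmxDr) Hu Hu'.
elim/(@tens_elim _ S (dual_rep S)): q' => [u u' Hu Hu'|x' d'].
  by rewrite !(tvDl, tvDr, mulmxDr) Hu Hu'.
rewrite end_compE; case: b b' c c' => [] [] c c'.
- by rewrite !qinE1 queer_oo qinE0 -scalemxAr scalerA mulrC.
- rewrite qinE1 qinE0 tvZr -scalemxAr queer_oe scalerA (runitE c' c) tvZl tvZr -!scalemxAr qinE1.
  by rewrite !scalerA mulrC.
- rewrite qinE1 qinE0 tvZl -scalemxAr queer_eo scalerA (lunitE c c') tvZl tvZr -!scalemxAr qinE1.
  by rewrite !scalerA mulrC.
rewrite (lunitE c c') tvZl tvZr -!scalemxAr !qinE0 tvZl tvZr -!scalemxAr queer_ee !scalerA.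
by congr (_ *: _); ring.
Qed.

Definition qpart b : rep K := if b then Ec else E.
Definition jn b : rep_hom (qpart b) Q := if b is true then hom_inr E Ec else hom_inl E Ec.
Definition jpr b : rep_hom Q (qpart b) := if b is true then hom_prr E Ec else hom_prl E Ec.
Lemma jn_sum (z : 'cV_(rep_dim Q)) : \sum_(b <- [:: false; true]) jn b *m (jpr b *m z) = z.
Proof. by rewrite big_cons big_seq1 hom_dsum. Qed.

Lemma queer_ext3 Y (f g : rep_hom (rep_tens (rep_tens Q Q) Q) Y) :
  (forall a b c, f <o> ((jn a <x> jn b) <x> jn c) === g <o> ((jn a <x> jn b) <x> jn c)) -> f === g.
Proof.
move=> E1; pose s := [:: false; true].
have H (h : rep_hom (rep_tens (rep_tens Q Q) Q) Y) : h ===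
    hom_sum s (fun a => hom_sum s (fun b => hom_sum s (fun c =>
      h <o> ((jn a <x> jn b) <x> jn c) <o> ((jpr a <x> jpr b) <x> jpr c)))).
  apply: heq_mx; apply: (@tens_extl _ Q Q Q) => x y z.
  rewrite -{1}[x]jn_sum -{1}[y]jn_sum -{1}[z]jn_sum. rewrite !tv_suml mulmx_sumr hom_sum_el; apply: eq_bigr => a _.
  rewrite [X in X *# _]tv_sumr tv_suml mulmx_sumr hom_sum_el; apply: eq_bigr => b _.
  rewrite tv_sumr mulmx_sumr hom_sum_el; apply: eq_bigr => c _.
  by rewrite !hom_compE !hom_tensE.
rewrite (H f) (H g); apply: heq_sum => a; apply: heq_sum => b; apply: heq_sum => c.
by rewrite E1.
Qed.

Hypothesis assoc_alpha : hom_lunit chi <o> (alpha <x> hom_id chi)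
  === hom_runit chi <o> (hom_id chi <x> alpha) <o> hom_assoc chi chi chi.

Lemma jn0_ind (P : 'cV_(rep_dim (qpart false)) -> Prop) :
  (forall u u', P u -> P u' -> P (u + u')) -> (forall x d, P (x *# d)) -> forall u, P u.
Proof. exact: (@tens_elim _ S (dual_rep S)). Qed.
Lemma jn1_ind (P : 'cV_(rep_dim (qpart true)) -> Prop) :
  (forall u u', P u -> P u' -> P (u + u')) -> (forall x s d, P (x *# s *# d)) -> forall u, P u.
Proof.
move=> PD Pt; apply: (@tens_elim _ (rep_tens S chi) (dual_rep S)) => // w d.
by elim/tens_elim: w => [u u' Hu Hu'|x s]; rewrite ?tvDl; auto.
Qed.

Ltac part u :=
  first [elim/jn1_ind: u => [? ?|? ? ?] | elim/jn0_ind: u => [? ?|? ?]];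
  first by rewrite !(tvDl, tvDr, mulmxDr) => -> ->.

(** If some factor is even, both sides are equal as matrices. Three odd factors give alpha(s, s')
    s'' on one side and s alpha(s', s'') on the other, which agree only up to negligible maps. *)
Lemma queer_assoc : mQ <o> (mQ <x> hom_id Q) === mQ <o> (hom_id Q <x> mQ) <o> hom_assoc Q Q Q.
Proof.
apply: queer_ext3 => a b c; have [abc|] := boolP [&& a, b & c].
  case: a b c abc => [] [] [] // _.
  (* [G] collects the three lines in front and composes the three endomorphisms; both sides become a
     fixed expression in one of the two maps of [assoc_alpha]. *)
  pose G : rep_hom (rep_tens (rep_tens Ec Ec) Ec) (rep_tens (rep_tens (rep_tens chi chi) chi) E) :=
    (hom_id _ <x> end_comp) <o> (hom_id _ <x> (end_comp <x> hom_id E)) <o> hom_mid (rep_tens chi chi) (rep_tens E E) chi E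
    <o> (hom_mid chi E chi E <x> hom_id _) <o> ((end_line <x> end_line) <x> end_line).
  have GE x s d x' s' d' x2 s2 d2 : G *m (x *# s *# d *# (x' *# s' *# d') *# (x2 *# s2 *# d2)) =
      (pairing d x' * pairing d' x2) *: (s *# s' *# s2 *# (x *# d2)).
    rewrite /G (hom_compE _ ((end_line <x> end_line) <x> end_line)) !hom_tensE !end_lineE.
    rewrite (hom_compE _ (hom_mid chi E chi E <x> hom_id _)) hom_tensE midE hom_idE.
    rewrite (hom_compE _ (hom_mid (rep_tens chi chi) (rep_tens E E) chi E)) midE.
    rewrite (hom_compE (hom_id _ <x> end_comp)) !hom_tensE !hom_idE end_compE tvZl -scalemxAr end_compE.
    by rewrite !tvZr scalerA.
  pose H (h : rep_hom (rep_tens (rep_tens chi chi) chi) chi) := hom_inr E Ec <o> line_end <o> (h <x> hom_id E) <o> G.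
  have EL : mQ <o> (mQ <x> hom_id Q) <o> ((jn true <x> jn true) <x> jn true) ===
     H (hom_lunit chi <o> (alpha <x> hom_id chi)).
    apply: heq_mx; apply: (@tens_extl _ Ec Ec Ec) => u u' u2.
    elim/jn1_ind: u => [p q Hp Hq|x s d]; first by rewrite !tvDl !mulmxDr Hp Hq.
    elim/jn1_ind: u' => [p q Hp Hq|x' s' d']; first by rewrite tvDr tvDl !mulmxDr Hp Hq.
    elim/jn1_ind: u2 => [p q Hp Hq|x2 s2 d2]; first by rewrite tvDr !mulmxDr Hp Hq.
    rewrite /H (hom_compE _ G) GE -scalemxAr (hom_compE (hom_inr E Ec <o> line_end)) (hom_tensE _ (hom_id E)).
    rewrite (hom_compE (hom_lunit chi)) hom_tensE !hom_idE lunitE (hom_compE (hom_inr E Ec)) tvZl -!scalemxAr line_endE.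
    rewrite (hom_compE _ ((_ <x> _) <x> _)) !hom_tensE (hom_compE mQ) hom_tensE hom_idE queer_oo tvZl -scalemxAr queer_eo.
    by rewrite !scalerA; congr (_ *: _); ring.
  have ER : mQ <o> (hom_id Q <x> mQ) <o> hom_assoc Q Q Q <o> ((jn true <x> jn true) <x> jn true) ===
     H (hom_runit chi <o> (hom_id chi <x> alpha) <o> hom_assoc chi chi chi).
    apply: heq_mx; apply: (@tens_extl _ Ec Ec Ec) => u u' u2.
    elim/jn1_ind: u => [p q Hp Hq|x s d]; first by rewrite !tvDl !mulmxDr Hp Hq.
    elim/jn1_ind: u' => [p q Hp Hq|x' s' d']; first by rewrite tvDr tvDl !mulmxDr Hp Hq.
    elim/jn1_ind: u2 => [p q Hp Hq|x2 s2 d2]; first by rewrite tvDr !mulmxDr Hp Hq.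
    rewrite /H (hom_compE _ G) GE -scalemxAr (hom_compE (hom_inr E Ec <o> line_end)) (hom_tensE _ (hom_id E)).
    rewrite (hom_compE _ (hom_assoc chi chi chi)) assocE (hom_compE (hom_runit chi)) hom_tensE !hom_idE runitE.
    rewrite (hom_compE (hom_inr E Ec)) tvZl -!scalemxAr line_endE.
    rewrite (hom_compE _ ((_ <x> _) <x> _)) !hom_tensE (hom_compE _ (hom_assoc Q Q Q)) assocE (hom_compE mQ) hom_tensE hom_idE.
    rewrite queer_oo tvZr -scalemxAr queer_oe.
    by rewrite !scalerA; congr (_ *: _); ring.
  by rewrite EL ER /H assoc_alpha.
move=> abc; apply: heq_mx; apply: (@tens_extl _ (qpart a) (qpart b) (qpart c)) => u u' u2.
rewrite !(hom_compE _ ((_ <x> _) <x> _)) !hom_tensE (hom_compE _ (hom_assoc Q Q Q)) assocE !(hom_compE mQ) !hom_tensE !hom_idE.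
case: a b c abc u u' u2 => [] [] [] // _ u u' u2; part u; part u'; part u2; rewrite /jn;
  do 3! rewrite ?(queer_ee, queer_eo, queer_oe, queer_oo) ?tvZl ?tvZr -?scalemxAr; rewrite ?scalerA;
  by congr (_ *: _); ring.
Qed.
End QueerGraded.

(** * Multiplication and section maps between tensor powers of U and Q *)

Section TwistedClifford.
Variables (K : closedFieldType) (chi : rep K).
Variables (alpha : rep_hom (rep_tens chi chi) (unit_rep K)) (alpha' : rep_hom (unit_rep K) (rep_tens chi chi)).
Hypothesis alphaK : alpha *m alpha' = 1%:M.
Hypothesis alpha'K : alpha' <o> alpha === hom_id _.
Variable eps : K.
Hypothesis eps2 : eps * eps = 1.
Hypothesis alphaC : alpha <o> hom_braid chi chi = eps *: hom_mx alpha :> 'M_(_, _).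

Variables (V S : rep K) (gam : rep_hom (rep_tens V S) S).
Local Notation N := (rep_dim V).
Local Notation E := (inner_hom S S).
Hypothesis orth : forall g, \det g = 1 -> (rep_act V g)^T *m rep_act V g = 1%:M.
Hypothesis cliff : forall v w x,
  gam *m (v *# (gam *m (w *# x))) + gam *m (w *# (gam *m (v *# x))) = (2%:R * dotv v w) *: x.
Hypothesis charK : forall i : nat, (0 < i <= N.+1)%N -> i%:R != 0 :> K.
Hypothesis oddN : odd N.
Hypothesis dimS : (rep_dim S)%:R != 0 :> K.
Hypothesis gen : forall P : 'cV_(rep_dim E) -> Prop,
  (forall c, P (hom_coev S *m c)) -> (forall q q', P q -> P q' -> P (q + q')) ->
  (forall v w q, P q -> P (actE gam *m (v *# (actE gam *m (w *# q))))) -> forall q, P q.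

Variables (U : rep K) (B : rep_hom (rep_tens U U) (unit_rep K)).
Variables (r : rep_hom (rep_tens chi V) U) (i : rep_hom U (rep_tens chi V)).
Hypothesis ri : r <o> i = 1%:M :> 'M_(_, _).
Hypothesis ir : i <o> r === hom_id _.
Hypothesis formB : B <o> (r <x> r) ===
  hom_lunit (unit_rep K) <o> (alpha <x> cliff_form orth) <o> hom_mid chi V chi V.
Variable rel : rep_hom (rep_tens U U) (rep_tens U U).
Hypothesis relE : hom_mx rel = 1%:M + eps *: hom_mx (hom_braid U U).

Local Notation TV := (tens_pow V).
Local Notation TU := (tens_pow U).
Local Notation chib := (chib chi).
Local Notation Q := (queer_obj chi S).
Local Notation mQ := (queer_mult alpha S).
Local Notation gpi := (gam_prod gam).
Local Notation iota_pow := (iota_pow alpha' r).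
Local Notation kappa_pow := (kappa_pow alpha i).
Local Notation sec := (sec gam orth charK).

(** The n-fold products of gammas, carried from V to U along [kappa_pow], with the line [chib b]
    kept as a tensor factor; [secb] does the same for the sections, along [iota_pow]. *)
Definition pib b n : rep_hom (TU n) Q := qin chi S b <o> (hom_id (chib b) <x> gpi n) <o> kappa_pow b n.
Definition piU n : rep_hom (TU n) Q := hom_add (pib false n) (pib true n).
Definition secb b j : rep_hom Q (TU j) := iota_pow b j <o> (hom_id (chib b) <x> sec j) <o> qpr chi S b.
Definition secU j : rep_hom Q (TU j) := hom_add (secb false j) (secb true j).

Definition gvec : rep_hom V E := actE gam <o> (hom_id V <x> hom_coev S) <o> hom_runitV V.
Definition pi1 : rep_hom U Q := qin chi S true <o> (hom_id chi <x> gvec) <o> i.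

Lemma gvecE v : gvec *m v = actE gam *m (v *# (hom_coev S *m 1%:M)).
Proof. by rewrite /gvec hom_compE runitVE (hom_compE (actE gam)) hom_tensE hom_idE. Qed.

Lemma end_comp_act v q : end_comp S *m ((gvec *m v) *# q) = actE gam *m (v *# q).
Proof.
rewrite gvecE homcoev_E mxE eqxx scale1r tv_sumr mulmx_sumr tv_suml mulmx_sumr.
elim/(@tens_elim _ S (dual_rep S)): q => [u u' Hu Hu'|x d].
  by rewrite tvDr mulmxDr -Hu -Hu' -big_split; apply: eq_bigr => a _; rewrite tvDr mulmxDr.
rewrite [in RHS]actEE [x in RHS]cV_sum_delta tv_sumr mulmx_sumr tv_suml; apply: eq_bigr => a _.
rewrite [actE gam *m _]actEE end_compE tvZr -scalemxAr tvZl; congr (_ *: _).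
rewrite /pairing (bigD1 a) //= mxE !eqxx mul1r big1 ?addr0 // => c /negPf ca.
by rewrite mxE ca mul0r.
Qed.

Lemma pib_step b n :
  pib b n.+1 = mQ <o> (pi1 <x> pib (~~ b) n) :> 'M_(_, _).
Proof.
apply: (@tens_ext _ U (TU n)) => u t.
rewrite [RHS]hom_compE hom_tensE /pi1 /pib.
rewrite (hom_compE _ i) (hom_compE (_ <o> _) (kappa_pow (~~ b) n)).
rewrite -[kappa_pow b n.+1]/(@kappaS _ _ alpha V U i b n (kappa_pow (~~ b) n)) /kappaS.
rewrite (hom_compE _ (_ <o> _)) (hom_compE _ (i <x> _)) hom_tensE.
move: (i *m u) (kappa_pow (~~ b) n *m t) => {}u {}t.
elim/(@tens_elim _ chi V): u => [u u' Hu Hu'|s v]; first by rewrite !(tvDl, tvDr, mulmxDr) Hu Hu'.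
elim/(@tens_elim _ (chib (~~ b)) (TV n)): t => [u u' Hu Hu'|c t]; first by rewrite !(tvDl, tvDr, mulmxDr) Hu Hu'.
rewrite (hom_compE (muchi alpha b <x> _)) midE hom_tensE hom_idE.
rewrite (hom_compE (qin chi S b)) hom_tensE gam_prodS hom_idE.
rewrite (hom_compE (qin chi S true)) (hom_compE (qin chi S (~~ b))) !hom_tensE !hom_idE.
have := congr1 (fun A : 'M_(_, rep_dim (rep_tens (rep_tens (chib true) E) (rep_tens (chib (~~ b)) E))) =>
  A *m ((s *# (gvec *m v)) *# (c *# (gpi n *m t)))) (queer_mult_qin S alpha true (~~ b)).
rewrite (hom_compE mQ) hom_tensE => ->.
rewrite (hom_compE _ (hom_mid _ _ _ _)) midE (hom_compE (qin _ _ _)) hom_tensE end_comp_act.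
by case: b c.
Qed.

Lemma piS n : piU n.+1 = mQ <o> (pi1 <x> piU n) :> 'M_(_, _).
Proof.
apply: (@tens_ext _ U (TU n)) => u t.
rewrite [RHS]hom_compE hom_tensE /piU !hom_addE tvDr mulmxDr addrC.
by congr (_ + _); rewrite pib_step [LHS]hom_compE hom_tensE.
Qed.

Lemma pi0 (c : 'cV_(rep_dim (unit_rep K))) : piU 0 *m c = queer_unit chi S *m c.
Proof.
rewrite queer_unitE /piU hom_addE /pib [X in _ + X]hom_compE hom_zeroE mulmx0 addr0.
rewrite hom_compE [kappa_pow false 0 *m c]runitVE hom_compE hom_tensE hom_idE qinE0.
by rewrite [in RHS](cV1E c) -!scalemxAr.
Qed.

Lemma pairing_ev n (a : 'I_n) (x : 'cV[K]_n) : pairing (ev a) x = x a 0.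
Proof.
rewrite /pairing (bigD1 a) //= mxE !eqxx mul1r big1 ?addr0 // => c /negPf ca.
by rewrite mxE ca mul0r.
Qed.

Lemma queer_mul1q (c : 'cV_(rep_dim (unit_rep K))) (q : 'cV_(rep_dim Q)) :
  mQ *m ((queer_unit chi S *m c) *# q) = c 0 0 *: q.
Proof.
rewrite queer_unitE homcoev_E -!scalemxAr tvZl -scalemxAr; congr (_ *: _).
rewrite mulmx_sumr tv_suml mulmx_sumr -[RHS]hom_dsum -[q in LHS]hom_dsum.
under eq_bigr do rewrite tvDr mulmxDr.
rewrite big_split; congr (_ + _).
  elim/(@tens_elim _ S (dual_rep S)): (hom_prl _ _ *m q) => [u u' Hu Hu'|x d].
    by rewrite mulmxDr -[X in _ = X + _]Hu -[X in _ = _ + X]Hu' -big_split; apply: eq_bigr => a _; rewrite tvDr mulmxDr.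
  rewrite [x in RHS]cV_sum_delta tv_suml mulmx_sumr; apply: eq_bigr => a _.
  by rewrite queer_ee pairing_ev tvZl -scalemxAr.
elim/(@tens_elim _ (rep_tens S chi) (dual_rep S)): (hom_prr _ _ *m q) => [u u' Hu Hu'|w d].
  by rewrite mulmxDr -[X in _ = X + _]Hu -[X in _ = _ + X]Hu' -big_split; apply: eq_bigr => a _; rewrite tvDr mulmxDr.
elim/(@tens_elim _ S chi): w => [u u' Hu Hu'|x s].
  by rewrite tvDl mulmxDr -[X in _ = X + _]Hu -[X in _ = _ + X]Hu' -big_split; apply: eq_bigr => a _; rewrite tvDr mulmxDr.
rewrite [x in RHS]cV_sum_delta !tv_suml mulmx_sumr; apply: eq_bigr => a _.
by rewrite queer_eo pairing_ev !tvZl -scalemxAr.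
Qed.

(** Multiplying on the left by one generator is the recursion [piS]; the general case follows by
    associativity of Q, hence only up to negligible maps. *)
Lemma pi_mult m n : piU (m + n) <o> tens_pow_mult U m n === mQ <o> (piU m <x> piU n).
Proof.
elim: m => [|m IHm].
  apply: heq_mx; apply: (@tens_ext _ (unit_rep K) (TU n)) => c t.
  by rewrite hom_compE lunitE -scalemxAr (hom_compE mQ) hom_tensE pi0 queer_mul1q.
have E1 : piU (m.+1 + n) <o> tens_pow_mult U m.+1 n ===
   mQ <o> (pi1 <x> (piU (m + n) <o> tens_pow_mult U m n)) <o> hom_assoc U (TU m) (TU n).
  apply: heq_mx; apply: (@tens_extl _ U (TU m) (TU n)) => u t t'.
  have step : tens_pow_mult U m.+1 n *m (u *# t *# t') = u *# (tens_pow_mult U m n *m (t *# t')).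
    by rewrite [LHS]hom_compE assocE hom_tensE hom_idE.
  rewrite hom_compE step [hom_mx (piU (m.+1 + n))](piS (m + n)) [RHS]hom_compE assocE.
  by rewrite !(hom_compE mQ) !hom_tensE hom_compE.
rewrite {}E1 IHm.
have E2 : mQ <o> (pi1 <x> (mQ <o> (piU m <x> piU n))) <o> hom_assoc U (TU m) (TU n) ===
    mQ <o> (hom_id Q <x> mQ) <o> hom_assoc Q Q Q <o> ((pi1 <x> piU m) <x> piU n).
  apply: heq_mx; apply: (@tens_extl _ U (TU m) (TU n)) => u t t'.
  rewrite [LHS]hom_compE assocE [RHS]hom_compE !(hom_tensE _ (piU n)) hom_tensE [RHS]hom_compE assocE.
  by rewrite !(hom_compE mQ) !hom_tensE hom_idE (hom_compE mQ) hom_tensE.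
rewrite {}E2 -(queer_assoc (alpha_assoc alpha'K eps2 alphaC)); apply: heq_mx.
apply: (@tens_extl _ U (TU m) (TU n)) => u t t'.
rewrite [LHS]hom_compE !(hom_tensE _ (piU n)) (hom_tensE pi1) (hom_compE mQ) (hom_tensE mQ) hom_idE.
by rewrite [RHS](hom_compE mQ) (hom_tensE (piU m.+1)) piS (hom_compE mQ) hom_tensE.
Qed.

Lemma queer_odd1 (w : 'cV_(rep_dim (inner_hom S (rep_tens S chi)))) (c : 'cV_(rep_dim (unit_rep K))) : mQ *m ((hom_inr E (inner_hom S (rep_tens S chi)) *m w) *# (queer_unit chi S *m c))
  = c 0 0 *: (hom_inr E (inner_hom S (rep_tens S chi)) *m w).
Proof.
rewrite queer_unitE homcoev_E -!scalemxAr tvZr -scalemxAr; congr (_ *: _).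
rewrite mulmx_sumr tv_sumr mulmx_sumr.
elim/(@tens_elim _ (rep_tens S chi) (dual_rep S)): w => [u u' Hu Hu'|w d].
  by rewrite mulmxDr -[X in _ = X + _]Hu -[X in _ = _ + X]Hu' -big_split; apply: eq_bigr => a _; rewrite tvDl mulmxDr.
elim/(@tens_elim _ S chi): w => [u u' Hu Hu'|x s].
  by rewrite tvDl mulmxDr -[X in _ = X + _]Hu -[X in _ = _ + X]Hu' -big_split; apply: eq_bigr => a _; rewrite tvDl mulmxDr.
rewrite [d in RHS]cV_sum_delta !tv_sumr mulmx_sumr; apply: eq_bigr => a _.
rewrite queer_oe !tvZr -scalemxAr; congr (_ *: _).
by rewrite -pairing_ev /pairing; apply: eq_bigr => c' _; rewrite mulrC.
Qed.

Lemma pi1E (u : 'cV_(rep_dim U)) : pi1 *m u = hom_inr E (inner_hom S (rep_tens S chi)) *m (line_end chi S *m ((hom_id chi <x> gvec) *m (i *m u))).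
Proof. by rewrite /pi1 (hom_compE _ i) (hom_compE (qin chi S true)) [in RHS]mulmxA. Qed.

Lemma pi2 (u u' : 'cV_(rep_dim U)) : piU 2 *m (u *# (u' *# 1%:M)) = mQ *m ((pi1 *m u) *# (pi1 *m u')).
Proof.
rewrite piS (hom_compE mQ) hom_tensE piS (hom_compE mQ) hom_tensE pi0 [pi1 *m u']pi1E queer_odd1.
by rewrite mxE eqxx scale1r -pi1E.
Qed.

(** Exchanging two odd generators exchanges their lines, which by skewness or symmetry of alpha
    yields eps. It cancels the eps of the relation, and what remains is the Clifford relation of the
    gammas. *)
Lemma pi_rel : piU 2 <o> ((hom_id U <x> hom_runitV U) <o> rel) === piU 0 <o> B.
Proof.
have eB : B === hom_lunit (unit_rep K) <o> (alpha <x> cliff_form orth) <o> hom_mid chi V chi V <o> (i <x> i).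
  rewrite -formB -heq_compA -heq_tens_comp (_ : r <o> i === hom_id U); last exact: heq_mx.
  by rewrite heq_tens_id_id heq_comp_id.
rewrite eB; apply: heq_mx; apply: (@tens_ext _ U U) => u u'.
rewrite [LHS]hom_compE (hom_compE _ rel) relE mulmxDl mul1mx -scalemxAl braidE.
rewrite [(hom_id U <x> _) *m _]mulmxDr -scalemxAr !hom_tensE !hom_idE !runitVE mulmxDr -scalemxAr !pi2 !pi1E.
rewrite [RHS]hom_compE (hom_compE _ (i <x> i)) hom_tensE.
have qinE w : hom_inr E (inner_hom S (rep_tens S chi)) *m (line_end chi S *m w) = qin chi S true *m w.
  by rewrite [LHS]mulmxA.
rewrite !qinE; move: (i *m u) (i *m u') => {}u {}u'.
have qq a a' : mQ *m ((qin chi S true *m a) *# (qin chi S true *m a')) =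
    qin chi S false *m ((alpha <x> end_comp S) *m (hom_mid chi E chi E *m (a *# a'))).
  have := congr1 (fun A : 'M_(_, rep_dim (rep_tens (rep_tens (chib true) E) (rep_tens (chib true) E))) =>
    A *m (a *# a')) (queer_mult_qin S alpha true true).
  rewrite (hom_compE mQ) hom_tensE => ->.
  by rewrite (hom_compE _ (hom_mid _ _ _ _)) (hom_compE (qin _ _ _)).
rewrite !{}qq.
elim/(@tens_elim _ chi V): u => [a b Ha Hb|s v]; first by rewrite !(tvDl, tvDr, mulmxDr, scalerDr) addrACA Ha Hb.
elim/(@tens_elim _ chi V): u' => [a b Ha Hb|t w]; first by rewrite !(tvDl, tvDr, mulmxDr, scalerDr) addrACA Ha Hb.
rewrite !hom_tensE !hom_idE !midE !hom_tensE !end_comp_act !gvecE (hom_compE _ (hom_mid _ _ _ _)) midE.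
rewrite (hom_compE (hom_lunit _)) hom_tensE lunitE !qinE0 pi0 queer_unitE cliff_formE.
rewrite (alphaCE alphaC t s) !mxE scalerA mulrA eps2 mul1r -scalerDr -mulmxDr cliff_actE //.
by rewrite -[(2%:R * _)%:M]scalemx1 -!scalemxAr.
Qed.

Lemma pib_secb b b' j : pib b j <o> secb b' j ===
  if (b == b') && (odd j == b) then qin chi S b <o> (hom_id _ <x> (gpi j <o> sec j)) <o> qpr chi S b
  else hom_zero _ _.
Proof.
have [bb|bb] := eqVneq b b'; last first.
  apply: heq_mx; have [oj|oj] := eqVneq (odd j) b.
    by rewrite /secb /= iota_pow0 ?mul0mx ?mulmx0 // oj.
  by rewrite /pib /= kappa_pow0 ?mulmx0 ?mul0mx.
rewrite -bb; have [oj|oj] /= := eqVneq (odd j) b; last first.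
  by apply: heq_mx; rewrite /pib /= kappa_pow0 ?mulmx0 ?mul0mx.
rewrite /pib /secb -!heq_compA (heq_compA (kappa_pow b j)) kappa_iota // heq_id_comp.
by rewrite (heq_compA (hom_id _ <x> gpi j)) -heq_tens_comp heq_id_comp.
Qed.

Lemma pi_sec : hom_sum (iota 0 N.+1) (fun j => piU j <o> secU j) === hom_id Q.
Proof.
pose D b j := if odd j == b then qin chi S b <o> (hom_id _ <x> (gpi j <o> sec j)) <o> qpr chi S b
  else hom_zero _ _.
have E1 j : piU j <o> secU j === hom_add (D false j) (D true j).
  rewrite /piU /secU.
  have -> : hom_add (pib false j) (pib true j) <o> hom_add (secb false j) (secb true j) ===
    hom_add (hom_add (pib false j <o> secb false j) (pib false j <o> secb true j))
            (hom_add (pib true j <o> secb false j) (pib true j <o> secb true j)).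
    by apply: heq_mx; rewrite /= !mulmxDl !mulmxDr.
  by rewrite !pib_secb; apply: heq_mx; rewrite /= addr0 add0r.
rewrite (heq_sum _ E1).
have Db b : \sum_(j <- iota 0 N.+1) hom_mx (D b j) = qin chi S b <o> qpr chi S b.
  have -> : hom_mx (qin chi S b <o> qpr chi S b) =
      qin chi S b *m ((1%:M : 'M_(rep_dim (chib b))) *t (1%:M : 'M_(rep_dim E))) *m qpr chi S b.
    by rewrite tensmx11 mulmx1.
  rewrite -(gam_prod_secK orth cliff charK oddN dimS gen (nat_of_bool b)) hom_sumE tensmx_sumr mulmx_sumr mulmx_suml.
  rewrite big_filter [RHS]big_mkcond; apply: eq_bigr => j _; rewrite /D.
  by case: b => /=; case: (odd j) => //=; rewrite mulmxA.
apply: heq_mx; rewrite hom_sumE.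
transitivity (hom_mx (qin chi S false <o> qpr chi S false) + hom_mx (qin chi S true <o> qpr chi S true)).
  by rewrite -!Db -big_split; apply: eq_bigr.
exact: qin_qpr.
Qed.

Variables (Y : rep K) (f : forall n, rep_hom (TU n) Y).
Hypothesis frel : forall l n, (l <= n)%N ->
  f n.+2 <o> hom_add (hom_id _) (hom_scale eps (sw U l n.+2)) === f n <o> ct B l n.

Lemma secU_piU j n : secU j <o> piU n =
  \sum_b iota_pow b j *m (hom_id (chib b) <x> (sec j <o> gpi n)) *m kappa_pow b n :> 'M_(_, _).
Proof.
have E1 b b' : hom_mx (secb b j <o> pib b' n) = if b == b' then
    iota_pow b j *m (hom_id (chib b) <x> (sec j <o> gpi n)) *m kappa_pow b n else 0.
  have [<-|bb] := eqVneq b b'; last first.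
    have := qpr_qin0 chi S bb; rewrite /secb /pib /= !mulmxA => e.
    by rewrite -(mulmxA _ (hom_mx (qpr chi S b))) e mulmx0 !mul0mx.
  have := qpr_qin chi S b; rewrite /secb /pib /= !mulmxA => e.
  rewrite -(mulmxA _ (hom_mx (qpr chi S b))) e mulmx1 -(mulmxA _ (_ *t _) (_ *t _)).
  by rewrite tensmx_mul mulmx1.
rewrite -big_enum /= big_enum big_bool /=.
transitivity (hom_mx (secb false j <o> pib false n) + hom_mx (secb false j <o> pib true n)
  + (hom_mx (secb true j <o> pib false n) + hom_mx (secb true j <o> pib true n))).
  by rewrite /= mulmxDl !mulmxDr.
by rewrite !E1 /= addr0 add0r addrC.
Qed.

(** Composed with [iota_pow b], the family on U becomes a family on V that satisfies the Clifford
    relation: the eps of [iota_sw] cancels the one in [frel]. [family_factor] then applies for each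
    b, and [iota_kappa] reassembles the two parities. *)
Lemma twisted_factor n : f n === hom_sum (iota 0 N.+1) (fun j => f j <o> secU j <o> piU n).
Proof.
pose F b m := f m <o> iota_pow b m.
have Frel b l m : (l <= m)%N -> F b m.+2 <o> (hom_id _ <x> hom_add (hom_id _) (sw V l m.+2)) ===
    F b m <o> (hom_id _ <x> ct (cliff_form orth) l m).
  move=> lm; rewrite /F -heq_compA.
  have -> : iota_pow b m.+2 <o> (hom_id (chib b) <x> hom_add (hom_id (TV m.+2)) (sw V l m.+2)) ===
      hom_add (hom_id _) (hom_scale eps (sw U l m.+2)) <o> iota_pow b m.+2.
    have E1 := iota_sw alpha'K alphaC r (b := b) lm.
    have -> : hom_add (hom_id _) (hom_scale eps (sw U l m.+2)) <o> iota_pow b m.+2 ===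
       hom_add (iota_pow b m.+2) (hom_scale eps (sw U l m.+2 <o> iota_pow b m.+2)).
      by apply: heq_mx; rewrite /= mulmxDl mul1mx -scalemxAl.
    rewrite E1; apply: heq_mx; apply: (@tens_ext _ (chib b) (TV m.+2)) => c t.
    rewrite hom_compE hom_tensE hom_idE hom_addE hom_idE tvDr mulmxDr hom_addE !hom_scaleE.
    by rewrite scalerA eps2 scale1r (hom_compE (iota_pow b m.+2)) hom_tensE hom_idE.
  rewrite heq_compA (frel lm) -!heq_compA (iota_ct alphaK alpha'K eps2 alphaC formB) //.
have FF b := family_factor cliff charK oddN dimS (@heq_equiv K)
  (fun X Y Z f g h e => heq_comp e (heq_refl h)) (fun X Y f g f' g' e e' => heq_add e e')
  (fun X Y c f g e => heq_scale c e) (@heq_mx K) n (Frel b).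
have E0 : f n === hom_add (F false n <o> kappa_pow false n) (F true n <o> kappa_pow true n).
  rewrite -{1}(heq_comp_id (f n)) -(iota_kappa alpha'K ri (n := n)).
  by apply: heq_mx; rewrite /= mulmxDr !mulmxA.
rewrite {1}E0 (FF false) (FF true); apply: heq_mx.
have step j : hom_mx (f j <o> secU j <o> piU n) = f j *m hom_mx (secU j <o> piU n) by rewrite mulmxA.
rewrite [RHS]hom_sumE; under [RHS]eq_bigr => j _ do rewrite step secU_piU mulmx_sumr.
rewrite exchange_big big_bool /= addrC; congr (_ + _); rewrite hom_sumE big_filter mulmx_suml big_mkcond.
  apply: eq_bigr => j _; have [oj|oj] := eqVneq (odd j) (odd n); first by rewrite /= !mulmxA.
  have [ob|ob] := eqVneq (odd n) false; last by rewrite (kappa_pow0 _ _ ob) !mulmx0.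
  by rewrite (iota_pow0 _ _ (b := false)) ?mul0mx ?mulmx0 // -ob.
apply: eq_bigr => j _; have [oj|oj] := eqVneq (odd j) (odd n); first by rewrite /= !mulmxA.
have [ob|ob] := eqVneq (odd n) true; last by rewrite (kappa_pow0 _ _ ob) !mulmx0.
by rewrite (iota_pow0 _ _ (b := true)) ?mul0mx ?mulmx0 // -ob.
Qed.
End TwistedClifford.

(** * Morphisms that map a summand into a single summand *)

Section SingleTarget.
Variable K : closedFieldType.
Implicit Types X Y Z W : ind K.

Definition one_target X Y (F : mor X Y) i j0 := forall j, j != j0 -> F i j = 0 :> 'M_(_, _).

Lemma one_target_map X Y (u : idx X -> idx Y) (f : forall i, rep_hom (X i) (Y (u i))) i :
  one_target (mor_map f) i (u i).
Proof. by move=> j; apply: mor_map0. Qed.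
Lemma one_target_comp X Y Z (g : mor Y Z) (f : mor X Y) i j0 k0 :
  one_target f i j0 -> one_target g j0 k0 -> one_target (g <oo> f) i k0.
Proof. by move=> Hf Hg k /Hg gk; rewrite (comp_monoR _ _ Hf) gk mul0mx. Qed.
Lemma one_target_tens X Y X' Y' (f : mor X Y) (g : mor X' Y') i j0 i' j0' :
  one_target f i j0 -> one_target g i' j0' -> one_target (f <xx> g) (i, i') (j0, j0').
Proof.
move=> Hf Hg [j j']; rewrite xpair_eqE negb_and => /orP[/Hf|/Hg] e /=; rewrite e ?tens0mx ?tensmx0 //.
Qed.

Lemma mor_tens_addl X Y X' Y' (f f' : mor X Y) (g : mor X' Y') :
  mor_add f f' <xx> g =m mor_add (f <xx> g) (f' <xx> g).
Proof.
by apply: meq_mx => -[i i'] [j j'] /=; apply: tv_ext => x y; rewrite mulmxDl !mul_tens_tv mulmxDl tvDl.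
Qed.
Lemma mor_tens_oppl X Y X' Y' (f : mor X Y) (g : mor X' Y') :
  mor_opp f <xx> g =m mor_opp (f <xx> g).
Proof.
by apply: meq_mx => -[i i'] [j j'] /=; apply: tv_ext => x y; rewrite mulNmx !mul_tens_tv mulNmx tvNl.
Qed.
Lemma mor_tens_addr X Y X' Y' (f : mor X Y) (g g' : mor X' Y') :
  f <xx> mor_add g g' =m mor_add (f <xx> g) (f <xx> g').
Proof. by apply: meq_mx => -[i i'] [j j'] /=; rewrite tensmxDr. Qed.
Lemma mor_tens_oppr X Y X' Y' (f : mor X Y) (g : mor X' Y') :
  f <xx> mor_opp g =m mor_opp (f <xx> g).
Proof. by apply: meq_mx => -[i i'] [j j'] /=; rewrite tensmxNr. Qed.
End SingleTarget.

(** * Components of the ideal generated by the relations *)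

Section IdealCoef.
Variables (K : closedFieldType) (U : rep K).
Local Notation TU := (tens_pow U).
Local Notation T := (tens_alg U).

Lemma ideal_gen_add Z (R R' : mor Z T) : ideal_gen (mor_add R R') =m mor_add (ideal_gen R) (ideal_gen R').
Proof. by rewrite /ideal_gen mor_tens_addl mor_addr mor_tens_addr mor_addr. Qed.
Lemma ideal_gen_opp Z (R : mor Z T) : ideal_gen (mor_opp R) =m mor_opp (ideal_gen R).
Proof. by rewrite /ideal_gen mor_tens_oppl mor_oppr mor_tens_oppr mor_oppr. Qed.

Lemma ideal_gen_coef Z (R : mor Z T) z j Y (f : mor T Y) l b y : one_target R z j ->
  (f <oo> ideal_gen R) (l, (z, b)) y =
  f (l + (j + b))%N y *m (tens_pow_mult U l (j + b) *m
    (1%:M *t (tens_pow_mult U j b *m (R z j *t 1%:M)))) :> 'M_(_, _).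
Proof.
move=> HR.
have Hmult m n : one_target (alg_mult T) (m, n) (m + n)%N.
  exact: (@one_target_map K (ind_tens T T) T (fun mn => (mn.1 + mn.2)%N) _ (m, n)).
have Hid n : one_target (mor_id T) n n by move=> n'; apply: mor_id0.
have HG := one_target_comp (one_target_tens HR (Hid b)) (Hmult j b).
have HH := one_target_tens (Hid l) HG.
have multE m n : alg_mult T (m, n) (m + n)%N = tens_pow_mult U m n.
  exact: (@mor_mapE K (ind_tens T T) T (fun mn => (mn.1 + mn.2)%N) _ (m, n)).
rewrite (comp_monoR _ _ (one_target_comp HH (Hmult l (j + b)%N))); congr (_ *m _).
rewrite (comp_monoR _ _ HH) multE; congr (_ *m _).
transitivity (hom_mx (mor_id T l l) *t
   hom_mx ((alg_mult T <oo> (R <xx> mor_id T)) (z, b) (j + b)%N)); first by [].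
rewrite mor_idE (comp_monoR _ _ (one_target_tens HR (Hid b))) multE; congr (_ *t (_ *m _)).
transitivity (hom_mx (R z j) *t hom_mx (mor_id T b b)); first by [].
by rewrite mor_idE.
Qed.

Fixpoint tpmV m n : rep_hom (TU (m + n)) (rep_tens (TU m) (TU n)) :=
  match m return rep_hom (TU (m + n)) (rep_tens (TU m) (TU n)) with
  | 0 => lunitV (TU n)
  | m'.+1 => hom_assocV U (TU m') (TU n) <o> (hom_id U <x> tpmV m' n)
  end.

(** Applies k to the last n factors and leaves the first l alone. *)
Definition ins l n n' (k : rep_hom (TU n) (TU n')) : rep_hom (TU (l + n)) (TU (l + n')) :=
  tens_pow_mult U l n' <o> (hom_id (TU l) <x> k) <o> tpmV l n.

Lemma ins0 n n' (k : rep_hom (TU n) (TU n')) : ins 0 k = k :> 'M_(_, _).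
Proof.
apply: cV_ext => t; rewrite /ins hom_compE [tpmV 0 n *m t]lunitVE hom_compE hom_tensE lunitE.
by rewrite mul1mx mxE eqxx scale1r.
Qed.
Lemma insS l n n' (k : rep_hom (TU n) (TU n')) : ins l.+1 k = 1%:M *t hom_mx (ins l k) :> 'M_(_, _).
Proof.
transitivity (hom_mx (hom_id U <x> ins l k)); last by [].
apply: (@tens_ext _ U (TU (l + n))) => u t.
rewrite hom_tensE hom_idE /ins hom_compE (hom_compE (hom_assocV _ _ _)) hom_tensE hom_idE.
rewrite [in RHS]hom_compE; move: (tpmV l n *m t) => w.
elim/(@tens_elim _ (TU l) (TU n)): w => [w w' Hw Hw'|p q]; first by rewrite !(tvDr, mulmxDr) Hw Hw'.
by rewrite assocVE hom_compE hom_tensE hom_idE (hom_compE _ (hom_assoc _ _ _)) assocE hom_tensE hom_idE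
  hom_compE hom_tensE hom_idE.
Qed.
Lemma ins_sw l n : ins l (sw U 0 n) = sw U l (l + n) :> 'M_(_, _).
Proof. by elim: l => [|l IHl]; rewrite ?ins0 // insS IHl. Qed.
Lemma tpmVK l n : tens_pow_mult U l n <o> tpmV l n = 1%:M :> 'M_(_, _).
Proof.
have e : ins l (hom_id (TU n)) = 1%:M :> 'M_(_, _).
  by elim: l => [|l IHl]; rewrite ?ins0 // insS IHl tensmx11.
by rewrite -[RHS]e /ins /= tensmx11 mulmx1.
Qed.

(** Identity map along an equality of degrees; it is needed because l + (n + 2) and (l + n) + 2 are
    equal but not convertible. *)
Definition castT n n' (e : n = n') : rep_hom (TU n) (TU n') := ecast m (rep_hom (TU n) (TU m)) e (hom_id (TU n)).
Lemma castT_id n (e : n = n) : castT e = 1%:M :> 'M_(_, _).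
Proof. by rewrite (eq_axiomK e). Qed.
Lemma castTS n n' (e : n = n') (e' : n.+1 = n'.+1) : castT e' = 1%:M *t hom_mx (castT e) :> 'M_(_, _).
Proof. by case: n' / e e' => e'; rewrite castT_id /= tensmx11. Qed.
Lemma castTK n n' (e : n = n') : castT e <o> castT (esym e) = 1%:M :> 'M_(_, _).
Proof. by case: n' / e; rewrite /= mul1mx. Qed.
Lemma castT_family Y (f : forall n, rep_hom (TU n) Y) n n' (e : n = n') : f n' <o> castT e = f n :> 'M_(_, _).
Proof. by case: n' / e; rewrite /= mulmx1. Qed.
Lemma castT_nat (f : forall n, rep_hom (TU n) (TU n)) n n' (e : n = n') : f n' <o> castT e = castT e <o> f n :> 'M_(_, _).
Proof. by case: n' / e; rewrite /= mulmx1 mul1mx. Qed.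
Lemma ins_ct (B : rep_hom (rep_tens U U) (unit_rep K)) l n (e : (l + n.+2)%N = (l + n).+2) :
  ins l (ct B 0 n) = ct B l (l + n) <o> castT e :> 'M_(_, _).
Proof.
elim: l e => [|l IHl] e; first by rewrite ins0 [RHS]/= castT_id mulmx1.
have e' : (l + n.+2)%N = (l + n).+2 by apply: succn_inj.
rewrite insS (IHl e') [RHS]/= (castTS e') /=.
by rewrite tensmx_mul mulmx1.
Qed.

Variables (rel : rep_hom (rep_tens U U) (rep_tens U U)) (B : rep_hom (rep_tens U U) (unit_rep K)).
Variable eps : K.
Hypothesis relE : hom_mx rel = 1%:M + eps *: hom_mx (hom_braid U U).

(** The ideal contains each generating relation multiplied by l factors on the left and by b on the
    right. That f kills this component is the relation between the exchange and the contraction at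
    place l. *)
Lemma killed_family Y (f : mor T Y) :
  f <oo> ideal_gen (form_relation rel B) =m mor_zero _ _ ->
  forall y l n, (l <= n)%N ->
  f n.+2 y <o> hom_add (hom_id _) (hom_scale eps (sw U l n.+2)) === f n y <o> ct B l n.
Proof.
(* Write n = l + b, with b factors to the right of the relation. *)
move=> kill y l n ln; have -> : n = (l + (n - l))%N by rewrite subnKC.
move: (n - l)%N => {ln}b; have e : (l + b.+2)%N = (l + b).+2 by rewrite !addnS.
pose a := (hom_id U <x> hom_runitV U) <o> rel.
pose F2 := tens_incl U 2 <oo> mor_of a; pose F0 := tens_incl U 0 <oo> mor_of B.
have tt0 (X Y' : rep K) (F : mor (ind_of X) (ind_of Y')) : one_target F tt tt by case.
have H2 : one_target F2 tt 2%N.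
  exact: (one_target_comp (tt0 _ _ (mor_of a)) (@one_target_map K (ind_of (TU 2)) (tens_ind U) (fun=> 2%N) _ tt)).
have H0 : one_target F0 tt 0%N.
  exact: (one_target_comp (tt0 _ _ (mor_of B)) (@one_target_map K (ind_of (TU 0)) (tens_ind U) (fun=> 0%N) _ tt)).
have F2E : F2 tt 2 = a :> 'M_(_, _).
  rewrite (comp_monoR _ _ (tt0 _ _ (mor_of a))) mor_ofE.
  by rewrite (mor_mapE (X := ind_of _) (Y := tens_ind U) (u := fun=> 2%N) (fun=> hom_id _) tt) mul1mx.
have F0E : F0 tt 0 = B :> 'M_(_, _).
  rewrite (comp_monoR _ _ (tt0 _ _ (mor_of B))) mor_ofE.
  by rewrite (mor_mapE (X := ind_of _) (Y := tens_ind U) (u := fun=> 0%N) (fun=> hom_id _) tt) mul1mx.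
have k2 : f <oo> ideal_gen F2 =m f <oo> ideal_gen F0.
  have k : mor_add (f <oo> ideal_gen F2) (mor_opp (f <oo> ideal_gen F0)) =m mor_zero _ _.
    by rewrite -mor_oppr -ideal_gen_opp -mor_addr -ideal_gen_add.
  move=> i j; have := k i j; rewrite !heq_tr => E h.
  by have := E h; rewrite /= mulmxDl mulNmx mul0mx mxtrace0 raddfB /= => /eqP; rewrite subr_eq0 => /eqP.
have {k2} := k2 (l, (tt, b)) y; rewrite -/(hom_eq _ _) => k2.
pose d := hom_assocV U U (TU b).
pose J2 := tens_pow_mult U 2 b <o> (a <x> hom_id (TU b)).
pose J0 := tens_pow_mult U 0 b <o> (B <x> hom_id (TU b)).
pose Jd2 : rep_hom (TU b.+2) (TU b.+2) := J2 <o> d.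
pose Jd0 : rep_hom (TU b.+2) (TU b) := J0 <o> d.
(* Precomposing with the inverse [tpmV] of the concatenation of tensors turns the components of the
   ideal into endomorphisms of tensor powers. *)
have {}k2 : f (l + b.+2)%N y <o> ins l Jd2 === f (l + b)%N y <o> ins l Jd0.
  have E j (F : mor (ind_of (rep_tens U U)) T) (J : rep_hom (rep_tens (rep_tens U U) (TU b)) (TU (j + b))) (Jd : rep_hom (TU b.+2) (TU (j + b))) : one_target F tt j -> hom_mx Jd = J *m d ->
      hom_mx J = tens_pow_mult U j b *m (F tt j *t 1%:M) ->
      f (l + (j + b))%N y <o> ins l Jd ===
      (f <oo> ideal_gen F) (l, (tt, b)) y <o> ((hom_id (TU l) <x> d) <o> tpmV l b.+2).
    move=> HF EJd EJ; apply: heq_mx; rewrite [X in _ = X *m _](ideal_gen_coef _ _ _ _ HF) -EJ /ins /= EJd.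
    by rewrite -{1}(mulmx1 (1%:M : 'M_(rep_dim (TU l)))) -tensmx_mul !mulmxA.
  rewrite (E 2%N F2 J2 Jd2 H2 erefl); last by rewrite F2E.
  rewrite (E 0%N F0 J0 Jd0 H0 erefl); last by rewrite F0E.
  by rewrite k2.
have aE u u' : a *m (u *# u') = u *# (u' *# 1%:M) + eps *: (u' *# (u *# 1%:M)).
  rewrite /a (hom_compE (hom_id U <x> hom_runitV U)) relE mulmxDl mul1mx -scalemxAl braidE mulmxDr -scalemxAr.
  by rewrite !hom_tensE !hom_idE !runitVE.
have J2E : J2 <o> d = 1%:M + eps *: hom_mx (sw U 0 b.+2) :> 'M_(_, _).
  apply: tens_extr => x x' s; rewrite /J2 /d hom_compE assocVE hom_compE hom_tensE hom_idE aE.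
  rewrite mulmxDl mul1mx -scalemxAl sw0E.
  have E u u' : tens_pow_mult U 2 b *m (u *# (u' *# 1%:M) *# s) = u *# (u' *# s).
    rewrite (hom_compE _ (hom_assoc _ _ _)) assocE hom_tensE hom_idE hom_compE assocE hom_tensE hom_idE.
    by rewrite lunitE mxE eqxx scale1r.
  by rewrite tvDl tvZl mulmxDr -scalemxAr !E.
have J0E : J0 <o> d = ct B 0 b :> 'M_(_, _).
  apply: tens_extr => x x' s; rewrite [RHS]ct0E [LHS](hom_compE J0) assocVE (hom_compE (tens_pow_mult U 0 b)).
  by rewrite hom_tensE hom_idE [LHS]lunitE.
have insD n1 n2 (k1 k3 k4 : rep_hom (TU n1) (TU n2)) : hom_mx k1 = hom_mx k3 + hom_mx k4 ->
   ins l k1 = hom_mx (ins l k3) + hom_mx (ins l k4) :> 'M_(_, _).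
  by move=> e1; rewrite /ins /= e1 tensmxDr mulmxDr mulmxDl.
have i2 : ins l Jd2 === hom_add (hom_id _) (hom_scale eps (sw U l (l + b.+2))).
  apply: heq_mx; rewrite (insD _ _ _ (hom_id _) (hom_scale eps (sw U 0 b.+2))) //.
  congr (_ + _); first by rewrite /ins /= tensmx11 mulmx1; apply: tpmVK.
  by rewrite /= -ins_sw /ins /= tensmxZr -scalemxAr -scalemxAl.
have i0 : ins l Jd0 === ct B l (l + b) <o> castT e.
  have insE n1 n2 (k1 k3 : rep_hom (TU n1) (TU n2)) : hom_mx k1 = k3 -> ins l k1 = ins l k3 :> 'M_(_, _).
    by move=> e1; rewrite /ins /= e1.
  by apply: heq_mx; rewrite -ins_ct; apply: insE.
have nat_e : hom_add (hom_id _) (hom_scale eps (sw U l (l + b).+2)) <o> castT e ===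
    castT e <o> hom_add (hom_id _) (hom_scale eps (sw U l (l + b.+2))).
  exact: heq_mx (castT_nat (fun n => hom_add (hom_id (TU n)) (hom_scale eps (sw U l n))) e).
have fam_e : f (l + b).+2 y <o> castT e === f (l + b.+2)%N y.
  exact: heq_mx (castT_family (fun n => f n y) e).
have castK : castT e <o> castT (esym e) === hom_id _ by apply: heq_mx; apply: castTK.
set g := hom_add _ _; set c := ct B l (l + b).
have chain : f (l + b).+2 y <o> g <o> castT e === f (l + b)%N y <o> c <o> castT e.
  by rewrite -(heq_compA _ g) nat_e heq_compA fam_e -i2 k2 i0 heq_compA.
rewrite -(heq_comp_id (_ <o> c)) -(heq_comp_id (_ <o> g)) -castK.
by rewrite (heq_compA _ (castT e)) chain -heq_compA.
Qed.
End IdealCoef.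

(** * Single-target morphisms together with their one nonzero entry *)

Section MapsTo.
Variable K : closedFieldType.
Implicit Types X Y Z W : ind K.
Definition maps_to X Y (F : mor X Y) i j (h : 'M_(rep_dim (Y j), rep_dim (X i))) :=
  one_target F i j /\ F i j = h :> 'M_(_, _).

Lemma maps_to_map X Y (u : idx X -> idx Y) (f : forall i, rep_hom (X i) (Y (u i))) i :
  maps_to (mor_map f) (f i).
Proof. by split; [exact: one_target_map | rewrite mor_mapE]. Qed.
Lemma maps_to_id X i : maps_to (mor_id X) (i := i) (j := i) 1%:M.
Proof. by split; [move=> j; apply: mor_id0 | rewrite mor_idE]. Qed.
Lemma maps_to_comp X Y Z (g : mor Y Z) (f : mor X Y) i j k h h' :
  maps_to f (i := i) (j := j) h -> maps_to g (i := j) (j := k) h' -> maps_to (g <oo> f) (i := i) (j := k) (h' *m h).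
Proof.
case=> Hf Ef [Hg Eg]; split; first exact: one_target_comp Hf Hg.
by rewrite (comp_monoR _ _ Hf) Ef Eg.
Qed.
Lemma maps_to_tens X Y X' Y' (f : mor X Y) (g : mor X' Y') i j i' j' h h' :
  maps_to f (i := i) (j := j) h -> maps_to g (i := i') (j := j') h' ->
  maps_to (f <xx> g) (i := (i, i')) (j := (j, j')) (h *t h').
Proof.
case=> Hf Ef [Hg Eg]; split; first exact: one_target_tens Hf Hg.
by rewrite -Ef -Eg.
Qed.
Lemma comp_maps_to X Y Z (g : mor Y Z) (f : mor X Y) i j k h :
  maps_to f (i := i) (j := j) h -> (g <oo> f) i k = g j k *m h :> 'M_(_, _).
Proof. by case=> Hf <-; rewrite (comp_monoR _ _ Hf). Qed.
End MapsTo.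

(** * The quotient of the tensor algebra is isomorphic to the queer algebra *)

Section TwistedIso.
Variables (K : closedFieldType) (chi : rep K).
Variables (alpha : rep_hom (rep_tens chi chi) (unit_rep K)) (alpha' : rep_hom (unit_rep K) (rep_tens chi chi)).
Hypothesis alphaK : alpha *m alpha' = 1%:M.
Hypothesis alpha'K : alpha' <o> alpha === hom_id _.
Variable eps : K.
Hypothesis eps2 : eps * eps = 1.
Hypothesis alphaC : alpha <o> hom_braid chi chi = eps *: hom_mx alpha :> 'M_(_, _).
Variables (V S : rep K) (gam : rep_hom (rep_tens V S) S).
Local Notation N := (rep_dim V).
Local Notation E := (inner_hom S S).
Hypothesis orth : forall g, \det g = 1 -> (rep_act V g)^T *m rep_act V g = 1%:M.
Hypothesis cliff : forall v w x,
  gam *m (v *# (gam *m (w *# x))) + gam *m (w *# (gam *m (v *# x))) = (2%:R * dotv v w) *: x.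
Hypothesis charK : forall i : nat, (0 < i <= N.+1)%N -> i%:R != 0 :> K.
Hypothesis oddN : odd N.
Hypothesis dimS : (rep_dim S)%:R != 0 :> K.
Hypothesis gen : forall P : 'cV_(rep_dim E) -> Prop,
  (forall c, P (hom_coev S *m c)) -> (forall q q', P q -> P q' -> P (q + q')) ->
  (forall v w q, P q -> P (actE gam *m (v *# (actE gam *m (w *# q))))) -> forall q, P q.
Variables (U : rep K) (B : rep_hom (rep_tens U U) (unit_rep K)).
Variables (r : rep_hom (rep_tens chi V) U) (i : rep_hom U (rep_tens chi V)).
Hypothesis ri : r <o> i = 1%:M :> 'M_(_, _).
Hypothesis ir : i <o> r === hom_id _.
Hypothesis formB : B <o> (r <x> r) ===
  hom_lunit (unit_rep K) <o> (alpha <x> cliff_form orth) <o> hom_mid chi V chi V.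
Variable rel : rep_hom (rep_tens U U) (rep_tens U U).
Hypothesis relE : hom_mx rel = 1%:M + eps *: hom_mx (hom_braid U U).

Local Notation TU := (tens_pow U).
Local Notation T := (tens_alg U).
Local Notation Q := (queer_obj chi S).
Local Notation QA := (queer_algebra alpha S).
Local Notation piU := (piU alpha gam i).
Local Notation secU := (secU alpha' gam orth charK r).

Definition piM : mor T QA := mor_map (X := tens_ind U) (Y := ind_of Q) (u := fun=> tt) piU.

(** The cut at degree N gives [secM] finite support, as a morphism into an infinite direct sum
    requires. *)
Definition secM_coef (t : unit) j : rep_hom Q (TU j) :=
  if j \in iota 0 N.+1 then secU j else hom_zero _ _.
Lemma secM_supp (t : idx (ind_of Q)) (j : idx (tens_ind U)) :
  j \notin iota 0 N.+1 -> secM_coef t j = 0 :> 'M_(_, _).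
Proof. by rewrite /secM_coef => /negPf ->. Qed.
Definition secM : mor QA T := Mor (X := ind_of Q) (Y := tens_ind U) secM_supp.

Lemma piME n : piM n tt = piU n.
Proof. exact: (mor_mapE (X := tens_ind U) (Y := ind_of Q) (u := fun=> tt) piU). Qed.
Lemma piM_to n : maps_to piM (i := n) (j := tt) (piU n).
Proof. exact: (@maps_to_map K (tens_ind U) (ind_of Q) (fun=> tt) piU n). Qed.

Lemma comp_secM (Y : ind K) (f : mor T Y) y :
  (f <oo> secM) tt y = hom_sum (iota 0 N.+1) (fun j => f j y <o> secU j) :> 'M_(_, _).
Proof.
rewrite (@mor_comp_sum _ _ _ _ f secM tt y (iota 0 N.+1)) ?iota_uniq // !hom_sumE.
by apply: eq_big_seq => j js; rewrite /= /secM_coef js.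
Qed.

Lemma piM_secM : piM <oo> secM =m mor_id QA.
Proof.
case=> -[]; apply: heq_trans (heq_mx (comp_secM _ _)) _.
have E j : piM j tt <o> secU j === piU j <o> secU j by rewrite piME.
rewrite (heq_sum _ E) (pi_sec alphaK orth cliff charK oddN dimS gen ir).
by apply: heq_mx; rewrite mor_idE.
Qed.

Lemma twisted_factorM (Y : ind K) (f : mor T Y) :
  f <oo> ideal_gen (form_relation rel B) =m mor_zero _ _ -> f =m f <oo> secM <oo> piM.
Proof.
move=> kill n y.
have := twisted_factor alphaK alpha'K eps2 alphaC cliff charK oddN dimS ri formB (killed_family relE kill (y := y)) (n := n).
move=> E1; apply: heq_trans E1 _; apply: heq_mx; rewrite (comp_maps_to _ _ (piM_to n)) comp_secM !hom_sumE mulmx_suml.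
by apply: eq_bigr.
Qed.

Lemma piM_unit : piM <oo> alg_unit T =m alg_unit QA.
Proof.
case=> -[]; apply: heq_mx.
rewrite (comp_maps_to _ _ (@maps_to_map K (ind_of (TU 0)) (tens_ind U) (fun=> 0%N) _ tt)) piME mulmx1.
by rewrite mor_ofE; apply: cV_ext => c; rewrite pi0.
Qed.

Lemma piM_mult : piM <oo> alg_mult T =m alg_mult QA <oo> (piM <xx> piM).
Proof.
case=> m n [].
have Hm := @maps_to_map K (ind_tens T T) T (fun mn => (mn.1 + mn.2)%N) (fun mn => tens_pow_mult U mn.1 mn.2) (m, n).
have Hq := @maps_to_map K (ind_tens (ind_of Q) (ind_of Q)) (ind_of Q) (fun=> tt) (fun=> queer_mult alpha S) (tt, tt).
apply: (@heq_trans _ _ _ _ (piU (m + n) <o> tens_pow_mult U m n)).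
  by apply: heq_mx; rewrite (comp_maps_to _ _ Hm) piME.
rewrite (pi_mult alpha'K eps2 alphaC gam i); apply: heq_mx; apply/esym.
rewrite (comp_maps_to _ _ (maps_to_tens (piM_to m) (piM_to n))); congr (_ *m _).
by have [] := Hq.
Qed.

Lemma piM_rel : piM <oo> form_relation rel B =m mor_zero _ _.
Proof.
case=> -[].
have tt0 (X Y' : rep K) (F : rep_hom X Y') : maps_to (mor_of F) (i := tt) (j := tt) F.
  by split; [case | rewrite mor_ofE].
have inc n := @maps_to_map K (ind_of (TU n)) (tens_ind U) (fun=> n) (fun=> hom_id (TU n)) tt.
pose a : rep_hom (rep_tens U U) (TU 2) := (hom_id U <x> hom_runitV U) <o> rel.
have H2 := maps_to_comp (tt0 _ _ a) (inc 2%N).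
have H0 := maps_to_comp (tt0 _ _ B) (inc 0%N).
have E1 : piM <oo> form_relation rel B =m
   mor_add (piM <oo> (tens_incl U 2 <oo> mor_of a)) (mor_opp (piM <oo> (tens_incl U 0 <oo> mor_of B))).
  by rewrite mor_addr mor_oppr.
apply: heq_trans (E1 tt tt) _.
have e2 : (piM <oo> (tens_incl U 2 <oo> mor_of a)) tt tt === piU 2 <o> a.
  by apply: heq_mx; rewrite (comp_maps_to _ _ H2) piME mul1mx.
have e0 : (piM <oo> (tens_incl U 0 <oo> mor_of B)) tt tt === piU 0 <o> B.
  by apply: heq_mx; rewrite (comp_maps_to _ _ H0) piME mul1mx.
have -> : mor_add (piM <oo> (tens_incl U 2 <oo> mor_of a))
   (mor_opp (piM <oo> (tens_incl U 0 <oo> mor_of B))) tt tt =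
  hom_add ((piM <oo> (tens_incl U 2 <oo> mor_of a)) tt tt)
    (hom_opp ((piM <oo> (tens_incl U 0 <oo> mor_of B)) tt tt)) by [].
rewrite e2 e0 /a (pi_rel eps2 alphaC cliff ri formB relE).
by apply: heq_mx; rewrite /= subrr.
Qed.

(** A multiplicative map that vanishes on the generators of an ideal vanishes on the ideal. *)
Lemma piM_kill : piM <oo> ideal_gen (form_relation rel B) =m mor_zero _ _.
Proof.
rewrite /ideal_gen mor_compA piM_mult -mor_compA -mor_tens_comp mor_compA piM_mult.
rewrite -(mor_compA (alg_mult QA) (piM <xx> piM)) -mor_tens_comp piM_rel mor_0tens mor_zeror mor_tens0.
exact: mor_zeror.
Qed.

Variable A : quotient_algebra (form_relation rel B).
Hypothesis verU : in_ver (tens_ind U).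

(** The endomorphism [secM] o [piM] of T(U) kills the ideal and so factors as h after the
    projection. By [twisted_factorM], the projection after h is the identity of A, so [piM] o h and
    the projection after [secM] are mutually inverse. *)
Lemma twisted_iso : exists2 eta : mor A QA,
  alg_morphism eta /\ eta <oo> quot_proj A =m piM &
  mor_comp (quot_proj A <oo> secM) eta =m mor_id A /\ mor_comp eta (quot_proj A <oo> secM) =m mor_id QA.
Proof.
have sp_kill : (secM <oo> piM) <oo> ideal_gen (form_relation rel B) =m mor_zero _ _.
  by rewrite -mor_compA piM_kill mor_zeror.
(* The universal property is used with target T(U) itself, which is why the tensor powers of U have
   to be tilting. *)
have [h [hp _]] := @quot_universal _ _ _ _ A _ _ verU sp_kill.
have projE := twisted_factorM (@quot_proj_ideal _ _ _ _ A).
have ph : quot_proj A <oo> h =m mor_id A.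
  have [h0 [_ uni]] := @quot_universal _ _ _ _ A _ _ (@quot_ver _ _ _ _ A) (@quot_proj_ideal _ _ _ _ A).
  rewrite (uni (quot_proj A <oo> h)); last by rewrite -mor_compA hp mor_compA -projE.
  by rewrite (uni (mor_id A)) // mor_compIdf.
pose eta := piM <oo> h.
have ep : eta <oo> quot_proj A =m piM.
  by rewrite /eta -mor_compA hp mor_compA piM_secM mor_compIdf.
have pse : (quot_proj A <oo> secM) <oo> eta =m mor_id A.
  by rewrite /eta mor_compA -projE ph.
have eps' : eta <oo> (quot_proj A <oo> secM) =m mor_id QA by rewrite mor_compA ep piM_secM.
exists eta => //; split=> //; have [pu pm] := quot_proj_morphism A; split.
  by rewrite -pu mor_compA ep piM_unit.
(* Products in A are computed by lifting both factors to T(U); multiplicativity of [piM] then passes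
   to A. *)
have E1 : alg_mult A =m quot_proj A <oo> alg_mult T <oo> ((secM <oo> eta) <xx> (secM <oo> eta)).
  by rewrite pm -mor_compA -mor_tens_comp mor_compA pse mor_tens_id mor_compfId.
rewrite {1}E1 !mor_compA ep piM_mult -!mor_compA -mor_tens_comp mor_compA piM_secM.
by rewrite mor_compIdf.
Qed.
End TwistedIso.

(** * Good filtrations: kernels, extensions, duals and tensor products *)

Section Filtrations.
Variable K : closedFieldType.
Implicit Types X Y Z W : rep K.
Implicit Types F : nat -> rep K.

Lemma regularD (f1 f2 : 'M[K]_2 -> K) :
  regular_fun f1 -> regular_fun f2 -> regular_fun (fun g => f1 g + f2 g).
Proof.
by case=> [P HP] [Q HQ]; exists (P + Q) => g dg; rewrite mevalD HP ?HQ.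
Qed.
Lemma regular_sum (I : finType) (f : I -> 'M[K]_2 -> K) :
  (forall a, regular_fun (f a)) -> regular_fun (fun g => \sum_a f a g).
Proof.
move=> Hf; have : forall s : seq I, regular_fun (fun g => \sum_(a <- s) f a g).
  elim=> [|a s IHs]; first by apply: regular_ext (regular_cst 0) => g _; rewrite big_nil.
  by apply: regular_ext (regularD (Hf a) IHs) => g _; rewrite big_cons.
by move/(_ (index_enum I)).
Qed.
Lemma regular_mulmx m n q (A : 'M[K]_2 -> 'M[K]_(m, n)) (B : 'M[K]_2 -> 'M[K]_(n, q)) :
  (forall i j, regular_fun (fun g => A g i j)) -> (forall i j, regular_fun (fun g => B g i j)) ->
  forall i j, regular_fun (fun g => (A g *m B g) i j).
Proof.
move=> RA RB i j; apply: (@regular_ext _ (fun g => \sum_k A g i k * B g k j)) => [g _|].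
  by rewrite mxE.
by apply: regular_sum => k; apply: regularM.
Qed.

Lemma rank_linv m n (A : 'M[K]_(m, n)) B : B *m A = 1%:M -> \rank A = n.
Proof.
move=> BA; apply/eqP; rewrite eqn_leq rank_leq_col /=.
by have := mxrankM_maxr B A; rewrite BA mxrank1.
Qed.
Lemma rank_rinv m n (A : 'M[K]_(m, n)) B : A *m B = 1%:M -> \rank A = m.
Proof.
move=> AB; apply/eqP; rewrite eqn_leq rank_leq_row /=.
by have := mxrankM_maxl A B; rewrite AB mxrank1.
Qed.
Lemma linv_rank m n (A : 'M[K]_(m, n)) : \rank A = n -> exists B, B *m A = 1%:M.
Proof.
move=> rA; exists (pinvmx A^T)^T.
by rewrite -{2}[A]trmxK -trmx_mul mulmxVp ?trmx1 // /row_free mxrank_tr rA.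
Qed.
Lemma rinv_rank m n (A : 'M[K]_(m, n)) : \rank A = m -> exists B, A *m B = 1%:M.
Proof. by move=> rA; exists (pinvmx A); rewrite mulmxVp // /row_free rA. Qed.

Lemma hom_inverse X Y (i : rep_hom Y X) : \rank i = rep_dim Y -> rep_dim X = rep_dim Y ->
  exists j : rep_hom X Y, j *m i = 1%:M /\ i *m j = 1%:M.
Proof.
move=> ri dXY; have [L Li] := linv_rank ri.
have [R iR] : exists R, i *m R = 1%:M by apply: rinv_rank; rewrite ri dXY.
have iL : i *m L = 1%:M by rewrite -[L]mulmx1 -iR (mulmxA L) Li mul1mx.
have HL : is_equivariant (X := X) (Y := Y) L.
  move=> g dg; rewrite -[LHS]mulmx1 -iL -!mulmxA (mulmxA (rep_act X g)) -(homP i dg) !mulmxA Li.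
  by rewrite mul1mx.
by exists (RepHom HL).
Qed.

Lemma filtered_iso F X Y (i : rep_hom Y X) : \rank i = rep_dim Y -> rep_dim X = rep_dim Y ->
  filtered F Y -> filtered F X.
Proof.
move=> ri dXY; have [j [ji ij]] := hom_inverse ri dXY.
move=> fY; case: Y / fY i j ri dXY ji ij => [Y dY|Y Y' n i' q' fY' [ri' rq' qi dY]] i j ri dXY ji ij.
  by apply: filtered_zero; rewrite dXY.
apply: (filtered_ext (i := hom_comp i i') (q := hom_comp q' j) fY'); split=> /=.
- have [L' Li'] := linv_rank ri'; apply: (rank_linv (B := L' *m j)).
  by rewrite -mulmxA (mulmxA (hom_mx j)) ji mul1mx.
- have [R' qR'] := rinv_rank rq'; apply: (rank_rinv (B := i *m R')).
  by rewrite -mulmxA (mulmxA (hom_mx j)) ji mul1mx.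
- by rewrite -mulmxA (mulmxA (hom_mx j)) ji mul1mx.
by rewrite dXY dY.
Qed.

Section Kernel.
Variables (X W : rep K) (q : rep_hom X W).
(** Kernels of matrices are computed on rows, whereas morphisms act on columns; hence the
    transposes. *)
Let M := row_base (kermx (hom_mx q)^T).
Definition ker_dim := \rank (kermx (hom_mx q)^T).
Definition ker_in : 'M[K]_(rep_dim X, ker_dim) := M^T.
Definition ker_out : 'M[K]_(ker_dim, rep_dim X) := (pinvmx M)^T.

Lemma ker_outK : ker_out *m ker_in = 1%:M.
Proof. by rewrite -trmx_mul mulmxVp ?row_base_free // trmx1. Qed.
Lemma ker_in0 : q *m ker_in = 0.
Proof.
rewrite -[hom_mx q]trmxK -trmx_mul; apply/eqP; rewrite trmx_eq0; apply/eqP.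
by apply/sub_kermxP; rewrite eq_row_base.
Qed.
Lemma ker_inK n (y : 'M_(rep_dim X, n)) : q *m y = 0 -> ker_in *m (ker_out *m y) = y.
Proof.
move=> qy; apply: trmx_inj; rewrite !trmx_mul !trmxK mulmxKpV // eq_row_base.
by apply/sub_kermxP; rewrite -trmx_mul qy trmx0.
Qed.

Lemma ker_rational : rational (fun g => ker_out *m rep_act X g *m ker_in).
Proof.
have [X1 XM XR] := actP X; split=> [|g h dg dh|].
- by rewrite X1 mulmx1 ker_outK.
- rewrite XM // -!mulmxA; congr (_ *m (_ *m _)).
  by rewrite [RHS]ker_inK // mulmxA (homP q dh) -mulmxA ker_in0 mulmx0.
have Rc m n (A : 'M[K]_(m, n)) i j : regular_fun (fun=> A i j) by exact: regular_cst.
by do !apply: regular_mulmx => //; apply: Rc.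
Qed.
Definition ker_rep : rep K := Rep ker_rational.

Lemma ker_hom_proof : is_equivariant (X := ker_rep) (Y := X) ker_in.
Proof.
move=> g dg /=; rewrite -!mulmxA ker_inK //.
by rewrite mulmxA (homP q dg) -mulmxA ker_in0 mulmx0.
Qed.
Definition ker_hom : rep_hom ker_rep X := RepHom ker_hom_proof.

Lemma ker_short_exact : \rank q = rep_dim W -> short_exact ker_hom q.
Proof.
move=> rq; split=> //; first exact: rank_linv ker_outK.
  exact: ker_in0.
rewrite /= /ker_dim mxrank_ker mxrank_tr rq subnK // -rq; exact: rank_leq_col.
Qed.
End Kernel.

Lemma filtered_single F n : filtered F (F n).
Proof.
apply: (filtered_ext (i := ker_hom (hom_id (F n))) (q := hom_id (F n))).
  by apply: filtered_zero; rewrite /= /ker_dim mxrank_ker mxrank_tr mxrank1 subnn.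
by apply: ker_short_exact; rewrite mxrank1.
Qed.

(** The image of i lies in the kernel of q, and by the dimension formula in [short_exact] the two
    have the same rank. *)
Lemma short_exact_lift Y X Z (i : rep_hom Y X) (q : rep_hom X Z) L n (y : 'M_(rep_dim X, n)) :
  short_exact i q -> L *m i = 1%:M -> q *m y = 0 -> i *m (L *m y) = y.
Proof.
case=> ri rq qi dX Li qy.
have sub : ((hom_mx i)^T <= kermx (hom_mx q)^T)%MS by apply/sub_kermxP; rewrite -trmx_mul qi trmx0.
have : (kermx (hom_mx q)^T <= (hom_mx i)^T)%MS.
  by rewrite -(geq_leqif (mxrank_leqif_sup sub)) mxrank_ker !mxrank_tr rq ri dX addnK.
have sy : (y^T <= kermx (hom_mx q)^T)%MS by apply/sub_kermxP; rewrite -trmx_mul qy trmx0.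
move=> /(submx_trans sy) /submxP[D Dy].
have -> : y = i *m D^T by rewrite -[LHS]trmxK Dy trmx_mul trmxK.
by rewrite (mulmxA L) Li mul1mx.
Qed.

(** Induction on the filtration of Z. If Z has quotient F n with kernel Z', then the kernel of X ->
    Z -> F n is an extension of Z' by Y. *)
Lemma filtered_extension F Y X Z (i : rep_hom Y X) (q : rep_hom X Z) :
  filtered F Y -> filtered F Z -> short_exact i q -> filtered F X.
Proof.
move=> fY fZ; elim: fZ X Y i q fY => [{}Z dZ|{}Z Z' n iZ qZ fZ' IH seZ] X Y i q fY se; have [ri rq qi dX] := se.
  by apply: (filtered_iso (i := i)) => //; rewrite dX dZ addn0.
have [rZ rqZ qiZ dZ] := seZ.
have [L LiZ] := linv_rank rZ; have [Rq qRq] := rinv_rank rq; have [RZ qRZ] := rinv_rank rqZ.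
pose q2 := hom_comp qZ q.
have rq2 : \rank q2 = rep_dim (F n).
  by apply: (rank_rinv (B := Rq *m RZ)); rewrite /= -mulmxA (mulmxA (hom_mx q)) qRq mul1mx.
have se2 := ker_short_exact rq2; apply: (filtered_ext _ se2).
have q2i : q2 *m i = 0 by rewrite /= -mulmxA qi mulmx0.
have q2in : qZ *m (q *m ker_in q2) = 0 by rewrite mulmxA; apply: ker_in0.
have ioi : ker_in q2 *m (ker_out q2 *m i) = i by apply: ker_inK.
have H1 : is_equivariant (X := Y) (Y := ker_rep q2) (ker_out q2 *m i).
  by move=> g dg; rewrite /= -!mulmxA ioi (homP i dg).
have H2 : is_equivariant (X := ker_rep q2) (Y := Z') (L *m (q *m ker_in q2)).
  move=> g dg; have e := short_exact_lift seZ LiZ q2in.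
  have e0 : ker_in q2 *m rep_act (ker_rep q2) g = rep_act X g *m ker_in q2 := homP (ker_hom q2) dg.
  rewrite -!mulmxA e0 (mulmxA (hom_mx q)) (homP q dg) -mulmxA -{1}e.
  by rewrite (mulmxA (rep_act Z g)) -(homP iZ dg) -mulmxA (mulmxA L) LiZ mul1mx.
apply: (IH _ Y (RepHom H1) (RepHom H2) fY); split=> /=.
- have [Li Lii] := linv_rank ri; apply: (rank_linv (B := Li *m ker_in q2)).
  by rewrite -mulmxA ioi.
- apply: (rank_rinv (B := ker_out q2 *m (Rq *m iZ))).
  have e : ker_in q2 *m (ker_out q2 *m (Rq *m iZ)) = Rq *m iZ.
    by apply: ker_inK; rewrite /= -mulmxA (mulmxA (hom_mx q)) qRq mul1mx.
  by rewrite -!mulmxA e (mulmxA (hom_mx q)) qRq mul1mx.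
- by rewrite -!mulmxA ioi qi mulmx0.
have [_ _ _ d2] := se2; apply/eqP; rewrite -(eqn_add2r (rep_dim (F n))) -d2 dX dZ addnA.
exact: eqxx.
Qed.

Lemma hom_dual_proof X Z (q : rep_hom X Z) :
  is_equivariant (X := dual_rep Z) (Y := dual_rep X) (hom_mx q)^T.
Proof. by move=> g dg /=; rewrite -!trmx_mul (homP q (det_invmx1 dg)). Qed.
Definition hom_dual X Z (q : rep_hom X Z) := RepHom (hom_dual_proof q).

(** Dualizing exchanges sub and quotient, so the new layer appears at the bottom of the filtration;
    this is what [filtered_extension] allows. *)
Lemma filtered_dual F X : filtered F X -> filtered (fun n => dual_rep (F n)) (dual_rep X).
Proof.
elim=> [{}X dX|{}X Y n i q fY IH [ri rq qi dX]]; first exact: filtered_zero.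
apply: (filtered_extension (i := hom_dual q) (q := hom_dual i) _ IH).
  exact: (filtered_single (fun n => dual_rep (F n))).
by split; rewrite /= ?mxrank_tr // -?trmx_mul ?qi ?trmx0 // dX addnC.
Qed.

Lemma filtered_tens F X W : (forall n, filtered F (rep_tens W (F n))) -> filtered F X ->
  filtered F (rep_tens W X).
Proof.
move=> FW; elim=> [{}X dX|{}X Y n i q fY IH [ri rq qi dX]].
  by apply: filtered_zero; rewrite /= dX muln0.
apply: (filtered_extension (i := hom_tens (hom_id W) i) (q := hom_tens (hom_id W) q) IH (FW n)).
have [L Li] := linv_rank ri; have [R qR] := rinv_rank rq; split=> /=.
- by apply: (rank_linv (B := 1%:M *t L)); rewrite tensmx_mul Li mulmx1 tensmx11.
- by apply: (rank_rinv (B := 1%:M *t R)); rewrite tensmx_mul qR mulmx1 tensmx11.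
- by rewrite tensmx_mul qi tensmx0.
by rewrite dX mulnDr.
Qed.

Lemma dual_tens_proof X Y (f : rep_hom (dual_rep X) X) (g : rep_hom (dual_rep Y) Y) :
  is_equivariant (X := dual_rep (rep_tens X Y)) (Y := rep_tens X Y) (f *t g).
Proof. by move=> h dh /=; rewrite trmx_tens !tensmx_mul (homP f dh) (homP g dh). Qed.

Lemma tens_pow_selfdual X (f : rep_hom (dual_rep X) X) (f' : 'M[K]_(rep_dim X)) : f' *m f = 1%:M -> forall n,
  exists fn : rep_hom (dual_rep (tens_pow X n)) (tens_pow X n), exists fn', fn' *m fn = 1%:M.
Proof.
move=> f'f; elim=> [|n [fn [fn' fnK]]].
  have H : is_equivariant (X := dual_rep (unit_rep K)) (Y := unit_rep K) 1%:M by move=> g _; rewrite /= trmx1.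
  by exists (RepHom H), 1%:M; rewrite mulmx1.
by exists (RepHom (dual_tens_proof f fn)), (f' *t fn'); rewrite /= tensmx_mul f'f fnK tensmx11.
Qed.
End Filtrations.

(** * Symmetric powers: invariant form and endomorphisms *)

Section SymPower.
Variable K : closedFieldType.

(** P + 1 has no root, so over an algebraically closed field it is constant. *)
Lemma poly_eval_eq0 (P : {poly K}) : (forall t, P.[t] = 0) -> P = 0.
Proof.
move=> P0; have s1 : size (P + 1) = 1%N.
  apply/eqP/negPn/negP => /closed_rootP[t]; rewrite rootE hornerD hornerC P0 add0r.
  by rewrite oner_eq0.
have /size_poly1P[c c0 E] : size (P + 1) == 1%N by rewrite s1.
have Ec : P = (c - 1)%:P by rewrite polyCB -E addrK.
by have := P0 0; rewrite Ec hornerC => ->; rewrite polyC0.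
Qed.

Lemma sum_binom_coef n (u v : {poly K}) (t : K) i :
  \sum_(j < n.+1) t ^+ j * 'C(n, j)%:R * (u ^+ (n - j) * v ^+ j)`_i = ((u + t *: v) ^+ n)`_i.
Proof.
rewrite exprDn coef_sum; apply: eq_bigr => j _.
by rewrite coefMn exprZn -scalerAr coefZ -[RHS]mulr_natr mulrAC.
Qed.

Definition binom_mx n : 'M[K]_n.+1 := diag_mx (\row_j 'C(n, j)%:R).

(** For fixed i, both sides are coefficients in t of the coefficient of X^i in ((g00 + t g01) + (g10
    + t g11) X)^n, expanded by the binomial theorem in two ways. *)
Lemma sym_act_tr n (g : 'M[K]_2) :
  sym_act n g *m binom_mx n = binom_mx n *m (sym_act n g^T)^T.
Proof.
apply/matrixP => i j; rewrite /binom_mx mul_mx_diag mul_diag_mx !mxE.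
pose P : {poly K} := \poly_(l < n.+1) ((sym_act n g) i (inord l) * 'C(n, l)%:R).
pose R : {poly K} := 'C(n, i)%:R *: (((g 0 0)%:P + g 0 1 *: 'X) ^+ (n - i) * ((g 1 0)%:P + g 1 1 *: 'X) ^+ i).
have PR : P = R.
  apply/eqP; rewrite -subr_eq0; apply/eqP; apply: poly_eval_eq0 => t; rewrite hornerD hornerN.
  apply/eqP; rewrite subr_eq0; apply/eqP.
  transitivity (\sum_(l < n.+1) t ^+ l * 'C(n, l)%:R * (((g 0 0)%:P + g 1 0 *: 'X) ^+ (n - l) * ((g 0 1)%:P + g 1 1 *: 'X) ^+ l)`_i).
    rewrite horner_poly; apply: eq_bigr => l _; rewrite inord_val mxE.
    by rewrite [RHS]mulrC [t ^+ _ * _]mulrC mulrA.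
  rewrite sum_binom_coef.
  have -> : (g 0 0)%:P + g 1 0 *: 'X + t *: ((g 0 1)%:P + g 1 1 *: 'X) =
     (g 0 0 + t * g 0 1)%:P + (g 1 0 + t * g 1 1) *: 'X.
    by rewrite scalerDr scalerA scale_polyC addrACA -scalerDl -polyCD.
  have iN : (i <= n)%N by rewrite -ltnS.
  rewrite exprDn coef_sum (bigD1 i) //= big1 ?addr0 => [|l li].
    rewrite coefMn exprZn -scalerAr -rmorphXn /= coefZ coefCM coefXn eqxx mulr1.
    rewrite /R hornerZ hornerM !horner_exp !hornerD !hornerZ !hornerC !hornerX mulr_natl.
    by rewrite mulrC ![t * _]mulrC.
  rewrite coefMn exprZn -scalerAr -rmorphXn /= coefZ coefCM coefXn.
  by rewrite (negPf (_ : i != l :> nat)) ?mulr0 ?mul0rn // eq_sym.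
have := congr1 (fun p : {poly K} => p`_j) PR.
rewrite coef_poly ltn_ord inord_val mxE => ->.
by rewrite /R coefZ.
Qed.

Lemma sym_actN n (g : 'M[K]_2) : sym_act n (- g) = (-1) ^+ n *: sym_act n g.
Proof.
apply/matrixP => i j; rewrite !mxE -coefZ; congr (_`_i).
have E (a b : K) : (- a)%:P + (- b) *: 'X = - (a%:P + b *: 'X) by rewrite polyCN scaleNr opprD.
rewrite !E !(exprNn (_ + _)) mulrACA -exprD subnK -1?ltnS // -mul_polyC.
by rewrite rmorphXn rmorphN rmorph1.
Qed.

Definition weyl_elt : 'M[K]_2 := mx2 0 1 (-1) 0.
Lemma mx2E (a b c d : K) : (mx2 a b c d 0 0 = a) * (mx2 a b c d 0 1 = b) * (mx2 a b c d 1 0 = c) * (mx2 a b c d 1 1 = d).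
Proof. by rewrite !mxE. Qed.
Lemma det_mx2 (a b c d : K) : \det (mx2 a b c d) = a * d - b * c.
Proof. by rewrite det2 !mx2E. Qed.
Lemma mx2_mul (a b c d a' b' c' d' : K) : mx2 a b c d *m mx2 a' b' c' d' =
  mx2 (a * a' + b * c') (a * b' + b * d') (c * a' + d * c') (c * b' + d * d').
Proof.
apply/matrixP => i j; rewrite !mxE !big_ord_recl big_ord0 addr0 !mxE.
by case: i => [[|[|]]] // ?; case: j => [[|[|]]].
Qed.
Lemma mx2_eta (g : 'M[K]_2) : g = mx2 (g 0 0) (g 0 1) (g 1 0) (g 1 1).
Proof.
apply/matrixP => i j; rewrite !mxE.
by case: i => [[|[|]]] // ?; case: j => [[|[|]]] // ?; congr (g _ _); apply: val_inj.
Qed.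
Lemma mx2_tr (a b c d : K) : (mx2 a b c d)^T = mx2 a c b d.
Proof.
apply/matrixP => i j; rewrite !mxE.
by case: i => [[|[|]]] // ?; case: j => [[|[|]]].
Qed.
Lemma det_weyl : \det weyl_elt = 1.
Proof. by rewrite det_mx2 mul0r mul1r sub0r opprK. Qed.
Lemma weyl_conj (g : 'M[K]_2) : \det g = 1 -> invmx g *m weyl_elt = weyl_elt *m g^T.
Proof.
move=> dg; have gU : g \in unitmx by rewrite unitmxE dg unitr1.
apply: (can_inj (mulKmx gU)); rewrite mulKVmx // mulmxA.
rewrite [g]mx2_eta in dg *; move: dg; rewrite det_mx2 mx2_tr /weyl_elt !mx2_mul.
move: (g 0 0) (g 0 1) (g 1 0) (g 1 1) => a b c d dg.
congr mx2; first by ring.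
- by rewrite -[LHS]dg; ring.
- by rewrite -[X in - X = _]dg; ring.
by ring.
Qed.

Lemma sym_act_inv n (g : 'M[K]_2) : \det g = 1 ->
  sym_act n (invmx g) *m sym_act n weyl_elt = sym_act n weyl_elt *m sym_act n g^T.
Proof.
move=> dg; have [_ SM _] := sym_rational K n.
rewrite -!SM ?det_tr ?det_weyl ?det_invmx1 //; congr (sym_act n _).
exact: weyl_conj.
Qed.

(** The invariant form of Sym^n as a map from the dual. The Weyl element w satisfies g^-1 w = w g^T
    on SL(2), and the binomial coefficients relate the actions of g and of g^T. *)
Definition gram_mx n := binom_mx n *m (sym_act n weyl_elt)^T.
Lemma gram_proof n : is_equivariant (X := dual_rep (sym_rep K n)) (Y := sym_rep K n) (gram_mx n).
Proof.
move=> g dg; rewrite /= /gram_mx -mulmxA -trmx_mul sym_act_inv // trmx_mul !mulmxA.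
by rewrite sym_act_tr.
Qed.
Definition gram n : rep_hom (dual_rep (sym_rep K n)) (sym_rep K n) := RepHom (@gram_proof n).

(** The sign is that of the action of the scalar -1, since the Weyl element is skew. *)
Lemma gram_tr n : (gram n : 'M_(_, _))^T = (-1) ^+ n *: hom_mx (gram n).
Proof.
rewrite /= /gram_mx trmx_mul trmxK /binom_mx tr_diag_mx -/(binom_mx n) sym_act_tr.
have -> : weyl_elt^T = - weyl_elt.
  rewrite /weyl_elt mx2_tr; apply/matrixP => i j; rewrite !mxE.
  by case: i => [[|[|]]] // ?; case: j => [[|[|]]] // ?; rewrite /= ?oppr0 ?opprK.
by rewrite sym_actN linearZ /= -scalemxAr.
Qed.

Lemma sym_weyl n (i j : 'I_n.+1) : sym_act n weyl_elt i j = (i + j == n)%N%:R * (-1) ^+ (n - j).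
Proof.
have e : (- 'X) ^+ (n - j) = ((-1) ^+ (n - j))%:P * 'X^(n - j) :> {poly K}.
  by rewrite [LHS]exprNn polyC_exp polyCN polyC1.
have jn : (j <= n)%N by rewrite -ltnS.
rewrite mxE /weyl_elt !mx2E add0r scale0r addr0 polyC1 expr1n mulr1 scaleN1r e coefCM coefXn mulrC.
by congr (_%:R * _); congr nat_of_bool; apply/eqP/eqP => h; lia.
Qed.

Lemma gramE n (i j : 'I_n.+1) : gram n i j = 'C(n, i)%:R * ((i + j == n)%N%:R * (-1) ^+ (n - i)).
Proof.
have -> : gram n i j = 'C(n, i)%:R * sym_act n weyl_elt j i.
  by rewrite /= /gram_mx /binom_mx mul_diag_mx mxE [X in X * _]mxE [X in _ * X]mxE.
by rewrite sym_weyl addnC.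
Qed.

Section SmallChar.
Variables (p n : nat).
Hypothesis charK : p \in [pchar K].
Hypothesis np : (n < p)%N.

Lemma pchar_fact_neq0 j : (j <= n)%N -> j`!%:R != 0 :> K.
Proof.
move=> jn; rewrite -(dvdn_pcharf charK); have pr := pcharf_prime charK.
elim: j jn => [|j IHj] jn; first by rewrite dvdn1 neq_ltn (prime_gt1 pr) orbT.
rewrite factS Euclid_dvdM // negb_or IHj ?(ltnW jn) // andbT gtnNdvd //.
exact: leq_ltn_trans jn np.
Qed.
Lemma binom_neq0 j : (j <= n)%N -> 'C(n, j)%:R != 0 :> K.
Proof.
move=> jn; apply/negP => /eqP e; have := pchar_fact_neq0 (leqnn n).
by rewrite -(bin_fact jn) natrM e mul0r eqxx.
Qed.

Lemma gram_linv : exists f, f *m gram n = 1%:M.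
Proof.
have [_ SS] := act_invmx (sym_rep K n) det_weyl.
exists ((sym_act n (invmx weyl_elt))^T *m diag_mx (\row_j ('C(n, j)%:R)^-1)).
rewrite /= /gram_mx -mulmxA (mulmxA (diag_mx _)) /binom_mx mulmx_diag.
have -> : diag_mx (\row_j ((\row_j0 ('C(n, j0)%:R)^-1) 0 j * (\row_j0 'C(n, j0)%:R) 0 j)) = 1%:M :> 'M[K]_n.+1.
  by apply/matrixP => a b; rewrite !mxE mulVf // binom_neq0 // -ltnS.
by rewrite mul1mx -trmx_mul SS trmx1.
Qed.
End SmallChar.

(** The torus has distinct weights, which forces an endomorphism to be diagonal; one unipotent
    element then forces the diagonal entries to agree. No bound on n is involved. *)
Lemma sym_rep_end n (f : rep_hom (sym_rep K n) (sym_rep K n)) : exists c, hom_mx f = c%:M.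
Proof.
have diagf i j : i != j -> f i j = 0.
  move=> ij; apply/eqP/negPn/negP => fij.
  have Ht (t : K) : t != 0 -> sym_act n (mx2 t 0 0 t^-1) = diag_mx (\row_l (t ^+ (n - l) / t ^+ l)).
    move=> t0; apply/matrixP => a b; rewrite [LHS]mxE [RHS]mxE mxE !mx2E scale0r addr0 polyC0 add0r -polyC_exp.
    rewrite coefCM exprZn coefZ coefXn exprVn.
    rewrite mxE; have [->|ab] := eqVneq a b; first by rewrite eqxx mulr1.
    by rewrite -val_eqE /= in ab; rewrite (negPf ab) !mulr0.
  (* Two weights compared after clearing denominators. The extra factor t makes the identity hold at
     t = 0 too, so it is an identity of polynomials. *)
  have Et (t : K) : t ^+ (n - j + i).+1 = t ^+ (n - i + j).+1.
    have [->|t0] := eqVneq t 0; first by rewrite !expr0n.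
    have dt : \det (mx2 t 0 0 t^-1) = 1 by rewrite det_mx2 mulfV // mul0r subr0.
    have := congr1 (fun M : 'M_n.+1 => M i j) (homP f dt); rewrite /= Ht // mul_mx_diag mul_diag_mx !mxE.
    rewrite [RHS]mulrC => /(mulfI fij) /(congr1 (fun x => x * (t ^+ j * t ^+ i))).
    have ti : t ^+ i != 0 by rewrite expf_neq0.
    have tj : t ^+ j != 0 by rewrite expf_neq0.
    have e1 (x y z : K) : y != 0 -> x / y * (y * z) = x * z by move=> y0; rewrite mulrA divfK.
    by rewrite e1 // [t ^+ j * t ^+ i]mulrC e1 // => e; rewrite !exprS !exprD e.
  have : 'X^((n - j + i).+1) - 'X^((n - i + j).+1) = 0 :> {poly K}.
    by apply: poly_eval_eq0 => t; rewrite hornerD hornerN !hornerXn Et subrr.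
  move/eqP; rewrite subr_eq0 => /eqP/(congr1 (fun P : {poly K} => size P)).
  rewrite !size_polyXn => -[] e; move: ij; rewrite -val_eqE /= => /eqP; apply.
  have := ltn_ord i; have := ltn_ord j; rewrite !ltnS => jn iN.
  by lia.
exists (f 0 0); apply/matrixP => i j; rewrite !mxE.
have [<-|ij] := eqVneq i j; last by rewrite diagf.
have d1 : \det (mx2 (1 : K) 1 0 1) = 1 by rewrite det_mx2 mulr0 subr0 mulr1.
(* Row 0 of this unipotent element consists of ones, so it compares the entry i with the entry 0. *)
have := congr1 (fun M : 'M_n.+1 => M 0 i) (homP f d1); rewrite /= !mxE.
have S0 l : sym_act n (mx2 1 1 0 1) 0 l = 1 :> K.
  rewrite mxE !mx2E scale0r addr0 scale1r polyC1 expr1n mul1r.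
  by rewrite -horner_coef0 horner_exp hornerD hornerC hornerX addr0 expr1n.
rewrite (bigD1 0) //= big1 ?addr0 => [|l l0]; last by rewrite diagf ?mul0r // eq_sym.
rewrite S0 mulr1 (bigD1 i) //= big1 ?addr0 => [|l li]; last by rewrite diagf ?mulr0.
by rewrite S0 mul1r => <-.
Qed.
End SymPower.

(** * Tensor powers of Sym^n are tilting for n < p *)

Section SymTilting.
Variable K : closedFieldType.
Notation sym := (sym_rep K).
Notation tidx := (@mxtens_index _ _).

Lemma poly_sum_coef (P : {poly K}) k : (size P <= k)%N -> P = \sum_(a < k) P`_a *: 'X^a.
Proof.
move=> sP; rewrite -poly_def; apply/polyP => i; rewrite coef_poly.
by case: ltnP => // ki; rewrite nth_default // (leq_trans sP).
Qed.

Definition mul_mx m n : 'M[K]_((m + n).+1, m.+1 * n.+1) :=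
  \matrix_(s, l) (val s == (mxtens_unindex l).1 + (mxtens_unindex l).2)%N%:R.

Lemma mul_mx_proof m n : is_equivariant (X := rep_tens (sym m) (sym n)) (Y := sym (m + n)%N) (mul_mx m n).
Proof.
move=> g _; apply/matrixP => s l; case: (mxtens_indexP l) => k k'.
rewrite /= mxE [RHS]mxE sum_tidx.
have h1 : (k < m.+1)%N := ltn_ord k.
have h2 : (k' < n.+1)%N := ltn_ord k'.
have kk : (k + k' < (m + n).+1)%N by lia.
rewrite [RHS](bigD1 (Ordinal kk)) //= [X in _ + X]big1 ?[RHS]addr0; last first.
  by move=> c /negPf; rewrite [X in _ * X]mxE mxtens_indexK -val_eqE /= => ->; rewrite mulr0.
rewrite [X in _ = _ * X]mxE mxtens_indexK /= eqxx mulr1 [RHS]mxE /=.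
set u := _%:P + _; set v := _%:P + _.
have -> : u ^+ (m + n - (k + k')) * v ^+ (k + k') = (u ^+ (m - k) * v ^+ k) * (u ^+ (n - k') * v ^+ k').
  rewrite mulrACA -!exprD; congr (_ ^+ _ * _).
  by lia.
have sz a (b : 'I_a.+1) : (size (u ^+ (a - b) * v ^+ b)%R <= a.+1)%N.
  by have := size_lin_prod (g 0 0) (g 1 0) (g 0 1) (g 1 1) (a - b) b; rewrite subnK // -ltnS.
rewrite (poly_sum_coef (sz m k)) (poly_sum_coef (sz n k')) mulr_suml coef_sum; apply: eq_bigr => a _.
rewrite mulr_sumr coef_sum; apply: eq_bigr => b _.
rewrite -scalerAl -scalerAr -exprD !coefZ coefXn mxE mxtens_indexK /= tensmxE !mxE mulrC.
by rewrite mulrA.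
Qed.
Definition sym_mul m n : rep_hom (rep_tens (sym m) (sym n)) (sym (m + n)%N) := RepHom (@mul_mx_proof m n).

Lemma sym_mulE m n (s : 'I_(m + n).+1) (a : 'I_m.+1) (b : 'I_n.+1) :
  sym_mul m n s (tidx (a, b)) = (val s == a + b)%N%:R.
Proof. by rewrite mxE mxtens_indexK. Qed.

Lemma sym_mul_rank m n : \rank (sym_mul m n) = rep_dim (sym (m + n)%N).
Proof.
pose l (s : 'I_(m + n).+1) := tidx (inord (minn s m) : 'I_m.+1, inord (s - minn s m) : 'I_n.+1).
apply: (rank_rinv (B := \matrix_(a, s) (a == l s)%:R)); apply/matrixP => s s'; rewrite !mxE.
rewrite (bigD1 (l s')) //= [X in _ + X]big1 ?addr0 => [|a /negPf la]; last by rewrite [X in _ * X]mxE la mulr0.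
rewrite [X in _ * X]mxE eqxx mulr1 mxE mxtens_indexK /= !inordK ?ltnS ?geq_minr //; last first.
  by have h : (s' < (m + n).+1)%N := ltn_ord s'; lia.
by rewrite subnKC ?geq_minl // -val_eqE eq_sym [in RHS]eq_sym.
Qed.

Definition xmul m : 'M[K]_(m.+2, m.+1) := \matrix_(i, j) (val i == j)%N%:R.
Definition ymul m : 'M[K]_(m.+2, m.+1) := \matrix_(i, j) (val i == j.+1)%N%:R.

Lemma xmul_coef m (R : {poly K}) (i : 'I_m.+2) : (size R <= m.+1)%N ->
  \sum_(k < m.+1) (val i == k)%N%:R * R`_k = R`_i.
Proof.
move=> sR; rewrite [in RHS](poly_sum_coef sR) coef_sum; apply: eq_bigr => k _.
by rewrite coefZ coefXn mulrC.
Qed.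
Lemma ymul_coef m (R : {poly K}) (i : 'I_m.+2) : (size R <= m.+1)%N ->
  \sum_(k < m.+1) (val i == k.+1)%N%:R * R`_k = ('X * R)`_i.
Proof.
move=> sR; rewrite [in RHS](poly_sum_coef sR) mulr_sumr coef_sum; apply: eq_bigr => k _.
by rewrite -scalerAr -exprS coefZ coefXn mulrC.
Qed.

Lemma lin_coef (a b : K) (R : {poly K}) i : ((a%:P + b *: 'X) * R)`_i = a * R`_i + b * ('X * R)`_i.
Proof. by rewrite mulrDl coefD coefCM -scalerAl coefZ. Qed.

Lemma sym_col_size m (g : 'M[K]_2) (j : 'I_m.+1) :
  (size (((g 0 0)%:P + g 1 0 *: 'X) ^+ (m - j) * ((g 0 1)%:P + g 1 1 *: 'X) ^+ j)%R <= m.+1)%N.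
Proof.
by have := size_lin_prod (g 0 0) (g 1 0) (g 0 1) (g 1 1) (m - j) j; rewrite subnK // -ltnS.
Qed.

Lemma sym_xmul m (g : 'M[K]_2) :
  sym_act m.+1 g *m xmul m = (g 0 0 *: xmul m + g 1 0 *: ymul m) *m sym_act m g.
Proof.
apply/matrixP => i j; rewrite !mxE.
have jm : (j < m.+2)%N := leqW (ltn_ord j).
rewrite (bigD1 (Ordinal jm)) //= [X in _ + X]big1 ?addr0 => [|k /negPf]; last first.
  by rewrite !mxE -val_eqE /= => ->; rewrite mulr0.
rewrite !mxE eqxx mulr1 /= subSn; last by rewrite -ltnS.
rewrite exprS -mulrA lin_coef -(xmul_coef _ (sym_col_size g j)) -(ymul_coef _ (sym_col_size g j)).
by rewrite !mulr_sumr -big_split; apply: eq_bigr => k _; rewrite !mxE /= mulrDl !mulrA.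
Qed.
Lemma sym_ymul m (g : 'M[K]_2) :
  sym_act m.+1 g *m ymul m = (g 0 1 *: xmul m + g 1 1 *: ymul m) *m sym_act m g.
Proof.
apply/matrixP => i j; rewrite !mxE.
have jm : (j.+1 < m.+2)%N := ltn_ord j.
rewrite (bigD1 (Ordinal jm)) //= [X in _ + X]big1 ?addr0 => [|k /negPf]; last first.
  by rewrite !mxE -val_eqE /= => ->; rewrite mulr0.
rewrite !mxE eqxx mulr1 /= subSS exprS mulrCA lin_coef.
rewrite -(xmul_coef _ (sym_col_size g j)) -(ymul_coef _ (sym_col_size g j)).
by rewrite !mulr_sumr -big_split; apply: eq_bigr => k _; rewrite !mxE /= mulrDl !mulrA.
Qed.

(** Multiplication by x (x) y - y (x) x, which g multiplies by its determinant and which SL(2)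
    therefore fixes. *)
Definition wedge_mx m n := xmul m *t ymul n - ymul m *t xmul n.

Lemma wedge_proof m n :
  is_equivariant (X := rep_tens (sym m) (sym n)) (Y := rep_tens (sym m.+1) (sym n.+1)) (wedge_mx m n).
Proof.
move=> g dg; rewrite /= /wedge_mx mulmxBl mulmxBr !tensmx_mul !sym_xmul !sym_ymul -!tensmx_mul -!mulmxBl.
congr (_ *m _); apply: tv_ext => x y; rewrite !mulmxBl !mul_tens_tv !mulmxDl -!scalemxAl.
move: (xmul m *m x) (ymul m *m x) (xmul n *m y) (ymul n *m y) => a b c d.
apply/colP => l; rewrite !mxE; move: dg; rewrite det2.
move: (a _ _) (b _ _) (c _ _) (d _ _) => {}a {}b {}c {}d dg.
rewrite -[LHS]mul1r -dg; ring.
Qed.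
Definition wedge m n : rep_hom (rep_tens (sym m) (sym n)) (rep_tens (sym m.+1) (sym n.+1)) := RepHom (@wedge_proof m n).

Lemma rank_inj m n (A : 'M[K]_(m, n)) : (forall v : 'cV_n, A *m v = 0 -> v = 0) -> \rank A = n.
Proof.
move=> inj; rewrite -mxrank_tr; apply/eqP; rewrite -/(row_free _) -kermx_eq0; apply/eqP/row_matrixP => i.
rewrite row0; apply: trmx_inj; rewrite trmx0; apply: inj.
by rewrite -{1}[A]trmxK -trmx_mul -row_mul mulmx_ker row0 trmx0.
Qed.

Definition wcoef (x y a b : nat) : K :=
  (x == a)%N%:R * (y == b.+1)%N%:R - (x == a.+1)%N%:R * (y == b)%N%:R.

Lemma wedgeE m n (i : 'I_m.+2) (j : 'I_n.+2) (a : 'I_m.+1) (b : 'I_n.+1) :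
  wedge_mx m n (tidx (i, j)) (tidx (a, b)) = wcoef i j a b.
Proof. by rewrite /wedge_mx mxE [X in _ + X]mxE !tensmxE !mxE. Qed.

Lemma wcoef_diag (x y a b : nat) : wcoef x y.+1 a b =
  if x == a then (y == b)%:R else if x == a.+1 then - (y.+1 == b)%:R else 0.
Proof.
rewrite /wcoef eqSS; have [->|_] := eqVneq x a.
  by rewrite (_ : (a == a.+1)%N = false) ?mul0r ?subr0 ?mul1r //; apply/negbTE; rewrite neq_ltn ltnSn.
by rewrite mul0r sub0r; case: eqP => _; rewrite ?mul1r ?mul0r ?oppr0.
Qed.

(** Injectivity. The coordinate (a, b + 1) of the image is v(a, b) - v(a - 1, b + 1), so the
    coordinates of a vector in the kernel vanish by induction on a. *)
Lemma wedge_rank m n : \rank (wedge m n) = rep_dim (rep_tens (sym m) (sym n)).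
Proof.
apply: rank_inj => v wv; apply/colP => l; case: (mxtens_indexP l) => a b; rewrite [RHS]mxE.
have [k ak] : exists k, (a < k)%N by exists a.+1.
elim: k a b ak => // k IHk a b ak.
have am : (a < m.+2)%N := leqW (ltn_ord a).
have bn : (b.+1 < n.+2)%N := ltn_ord b.
have := congr1 (fun u : 'cV_(m.+2 * n.+2) => u (tidx (Ordinal am, Ordinal bn)) 0) wv.
rewrite [LHS]mxE [RHS]mxE sum_tidx => E; rewrite -[RHS]E.
have tE (a' : 'I_m.+1) (b' : 'I_n.+1) : wedge m n (tidx (Ordinal am, Ordinal bn)) (tidx (a', b')) * v (tidx (a', b')) 0 =
    ((a' == a) && (b' == b))%:R * v (tidx (a, b)) 0.
  rewrite [X in X * _](wedgeE (Ordinal am) (Ordinal bn)) wcoef_diag eq_sym val_eqE.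
  have [->|aa] /= := eqVneq a' a.
    rewrite eq_sym val_eqE; by have [->|bb] := eqVneq b' b; rewrite ?mul0r.
  rewrite mul0r; case: eqP => e; last by rewrite mul0r.
  by rewrite IHk ?mulr0 // -ltnS -e.
under eq_bigr => i _ do under eq_bigr => j _ do rewrite tE.
rewrite (bigD1 a) //= (bigD1 b) //= !eqxx mul1r !big1 ?addr0 // => [i /negPf ia|j /negPf jb].
  by rewrite big1 // => j _; rewrite ia mul0r.
by rewrite jb mul0r.
Qed.

Lemma mul_wedge m n : sym_mul m.+1 n.+1 *m wedge m n = 0.
Proof.
apply/matrixP => s l; case: (mxtens_indexP l) => a b; rewrite [LHS]mxE [RHS]mxE sum_tidx.
pose ix (i : 'I_m.+1) : 'I_m.+2 := Ordinal (leqW (ltn_ord i)).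
have E1 (i : 'I_m.+2) (j : 'I_n.+2) : sym_mul m.+1 n.+1 s (tidx (i, j)) * wedge m n (tidx (i, j)) (tidx (a, b)) =
   (val i == a)%N%:R * ((val j == b.+1)%N%:R * (val s == a + b.+1)%N%:R)
   - (val i == a.+1)%N%:R * ((val j == b)%N%:R * (val s == a.+1 + b)%N%:R).
  rewrite sym_mulE [X in _ * X]wedgeE /wcoef mulrBr; congr (_ - _).
    have [->|_] := eqVneq (val i) (val a); last by rewrite !mul0r mulr0.
    by have [->|_] := eqVneq (val j) b.+1; rewrite ?mul1r ?mul0r ?mulr0 ?mulr1.
  have [->|_] := eqVneq (val i) (val a).+1; last by rewrite !mul0r mulr0.
  by have [->|_] := eqVneq (val j) (val b); rewrite ?mul1r ?mul0r ?mulr0 ?mulr1.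
under eq_bigr => i _ do under eq_bigr => j _ do rewrite E1.
have one k (x : nat) : (x < k)%N -> \sum_(i < k) (val i == x)%N%:R = 1 :> K.
  move=> xk; rewrite (bigD1 (Ordinal xk)) //= eqxx big1 ?addr0 // => i /negPf.
  by rewrite -val_eqE /= => ->.
have ha : (a < m.+1)%N := ltn_ord a.
have hb : (b < n.+1)%N := ltn_ord b.
have o1 : \sum_(j < n.+2) (val j == b.+1)%N%:R = 1 :> K := one n.+2 b.+1 hb.
have o2 : \sum_(j < n.+2) (val j == b)%N%:R = 1 :> K := one n.+2 b (leqW hb).
have o3 : \sum_(j < m.+2) (val j == a)%N%:R = 1 :> K := one m.+2 a (leqW ha).
have o4 : \sum_(j < m.+2) (val j == a.+1)%N%:R = 1 :> K := one m.+2 a.+1 ha.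
under eq_bigr => i _ do rewrite sumrB -!mulr_sumr -!mulr_suml o1 o2 !mul1r.
have e : (a + b.+1)%N = (a.+1 + b)%N by lia.
by rewrite sumrB -!mulr_suml o3 o4 !mul1r e subrr.
Qed.

(** The Clebsch-Gordan filtration, valid in every characteristic: multiplication onto Sym^(m+n+2)
    has kernel Sym^m (x) Sym^n, embedded by [wedge]. If one degree is 0 the multiplication is
    bijective. *)
Lemma sym_tens_filtered m n : filtered sym (rep_tens (sym m) (sym n)).
Proof.
have small m' n' : (m' == 0) || (n' == 0) -> filtered sym (rep_tens (sym m') (sym n')).
  move=> mn; apply: (filtered_ext (i := ker_hom (sym_mul m' n')) (q := sym_mul m' n')); last first.
    exact: ker_short_exact (sym_mul_rank _ _).
  apply: filtered_zero; rewrite /= /ker_dim mxrank_ker mxrank_tr sym_mul_rank /=.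
  by case/orP: mn => /eqP->; rewrite ?mul1n ?muln1 ?add0n ?addn0 subnn.
elim: m n => [|m IHm] [|n]; try exact: small.
apply: (filtered_ext (i := wedge m n) (q := sym_mul m.+1 n.+1)) (IHm n) _.
split; [exact: wedge_rank | exact: sym_mul_rank | exact: mul_wedge | rewrite /=; lia].
Qed.

Lemma sym_tens_pow_filtered n k : filtered sym (tens_pow (sym n) k).
Proof.
elim: k => [|k IHk]; last exact: filtered_tens (sym_tens_filtered n) IHk.
have H : is_equivariant (X := sym 0) (Y := unit_rep K) 1%:M.
  move=> g _; apply/matrixP => i j; rewrite /= !mulmx1 mul1mx !mxE !ord1 /= !expr0 mulr1 coef1.
  by [].
apply: (filtered_iso (i := RepHom H)); rewrite ?mxrank1 //; exact: filtered_single.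
Qed.

(** For n < p the invariant form makes Sym^n self-dual, so the filtration by dual Weyl modules
    dualizes to one by Weyl modules. *)
Lemma sym_tens_ver p n : p \in [pchar K] -> (n < p)%N -> in_ver (tens_ind (sym n)).
Proof.
move=> charK np k; split; first exact: sym_tens_pow_filtered.
have [f' f'K] := gram_linv charK np; have [fn [fn' fnK]] := tens_pow_selfdual (X := sym n) (f := gram K n) f'K k.
apply: (filtered_iso (i := fn)) => //; first exact: rank_linv fnK.
exact: filtered_dual (sym_tens_pow_filtered n k).
Qed.
End SymTilting.

(** * Creation and annihilation operators on the spin module *)

Section SpinModule.
Variables (K : closedFieldType) (m : nat).
Notation d := (spin_dim m).
Implicit Types (J L : {set 'I_m}) (b c : bool).

Definition bas J : 'cV[K]_d := ev (enum_rank J).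
Definition flip (i : 'I_m) J := if i \in J then J :\ i else i |: J.
Definition sgn (i : 'I_m) J : K := (-1) ^+ #|[set j in J | (j < i)%N]|.
Definition cr b (i : 'I_m) : 'M[K]_d := if b then (creation K i)^T else creation K i.

Lemma bas_ext q (A A' : 'M[K]_(q, d)) : (forall J, A *m bas J = A' *m bas J) -> A = A'.
Proof.
move=> E; apply/matrixP => i j; have := E (enum_val j); rewrite /bas enum_valK -!colE.
by move/colP/(_ i); rewrite !mxE.
Qed.
Lemma basE (a : 'I_d) J : bas J a 0 = (enum_val a == J)%:R.
Proof.
rewrite mxE eqxx andbT; congr (nat_of_bool _)%:R.
by apply/eqP/eqP => [->|<-]; rewrite ?enum_rankK ?enum_valK.
Qed.

Lemma in_flip i j J : (j \in flip i J) = (j == i) (+) (j \in J).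
Proof.
rewrite /flip; case: ifP => iJ; rewrite !inE; case: eqVneq => [->|] //=; rewrite ?iJ //.
Qed.
Lemma flipK i : involutive (flip i).
Proof. by move=> J; apply/setP => j; rewrite !in_flip addbA addbb. Qed.
Lemma flipC i j J : flip i (flip j J) = flip j (flip i J).
Proof. by apply/setP => l; rewrite !in_flip addbCA. Qed.

Lemma sgn_card_flip i J : (-1) ^+ #|flip i J| = - (-1) ^+ #|J| :> K.
Proof.
rewrite /flip; case: ifP => iJ; last by rewrite cardsU1 iJ exprS mulN1r.
by rewrite [in RHS](cardsD1 i) iJ exprS mulN1r opprK.
Qed.
Lemma sgn_flip i j J : sgn j (flip i J) = if (i < j)%N then - sgn j J else sgn j J.
Proof.
rewrite /sgn; case: ifP => ij.
  rewrite -(sgn_card_flip i); congr (_ ^+ #|pred_of_set _|); apply/setP => l; rewrite !(inE, in_flip).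
  by case: eqVneq => [->|_]; rewrite ?ij ?andbT.
congr (_ ^+ #|pred_of_set _|); apply/setP => l; rewrite !(inE, in_flip).
by case: eqVneq => [->|_]; rewrite ?ij ?andbF.
Qed.
Lemma sgn2 i J : sgn i J * sgn i J = 1.
Proof. by rewrite -expr2 sqrr_sign. Qed.

Lemma crE b i J : cr b i *m bas J = if (i \in J) == b then sgn i J *: bas (flip i J) else 0.
Proof.
have L1 L : (i \notin J) && (L == i |: J) = (i \notin J) && (L == flip i J).
  by rewrite /flip; case: (i \in J).
have L2 L : (i \notin L) && (J == i |: L) = (i \in J) && (L == flip i J).
  rewrite -[J == _](inj_eq (can_inj (flipK i))); have [iL|iL] /= := boolP (i \in L).
    by apply/esym/negbTE/negP => /andP[iJ /eqP e]; rewrite e in_flip eqxx iJ in iL.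
  have -> : i |: L = flip i L by rewrite /flip (negPf iL).
  rewrite flipK eq_sym; have [e|_] := eqVneq L (flip i J); last by rewrite andbF.
  by move: iL; rewrite e in_flip eqxx /= negbK => ->.
rewrite /bas -colE; apply/colP => a; rewrite mxE; case: b => /=; rewrite !mxE /spin_idx enum_rankK.
  rewrite L2; case: (i \in J) => /=; last by rewrite mxE.
  rewrite [RHS]mxE -/(bas _) basE; case: eqP => [->|_]; rewrite ?mulr1 ?mulr0 //.
  by rewrite -/(sgn i _) sgn_flip ltnn.
rewrite L1; case: (i \in J) => /=; first by rewrite mxE.
by rewrite [RHS]mxE -/(bas _) basE; case: eqP => _; rewrite ?mulr1 ?mulr0.
Qed.

Lemma parityE J : parity_op K m *m bas J = (-1) ^+ #|J| *: bas J.
Proof.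
apply/colP => a; rewrite /parity_op mul_diag_mx !mxE eqxx andbT /spin_idx -[a in LHS]enum_valK.
by rewrite -[a in RHS]enum_valK (inj_eq enum_rank_inj) enum_valK; case: eqP => [->|_]; rewrite ?mulr0.
Qed.

Lemma cr_anti b c i j : cr b i *m cr c j + cr c j *m cr b i = ((i == j) && (b != c))%:R%:M.
Proof.
apply: bas_ext => J; rewrite mulmxDl -!mulmxA !crE mul_scalar_mx.
have [<-|ij] /= := eqVneq i j.
  rewrite !(fun_if (mulmx _)) !mulmx0 -!scalemxAr !crE in_flip eqxx flipK !sgn_flip ltnn.
  case: (i \in J) b c => [] [] [] /=; rewrite ?scaler0 ?addr0 ?add0r ?scale0r ?scale1r ?scalerA ?sgn2 ?scale1r //.
rewrite !(fun_if (mulmx _)) !mulmx0 -!scalemxAr !crE !in_flip (negPf ij) [j == i]eq_sym (negPf ij) /= scale0r.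
rewrite !sgn_flip; case: ifP => _; case: ifP => _; rewrite ?scaler0 ?addr0 // flipC !scalerA.
move: ij; rewrite -val_eqE /= neq_ltn => /orP[] lij; rewrite lij ltnNge (ltnW lij) /=.
  by rewrite mulrN scaleNr [sgn j J * _]mulrC subrr.
by rewrite mulrN [sgn j J * _]mulrC scaleNr addrC subrr.
Qed.

Lemma parity_anti b i : cr b i *m parity_op K m + parity_op K m *m cr b i = 0.
Proof.
apply: bas_ext => J; rewrite mulmxDl -!mulmxA parityE -scalemxAr !crE mul0mx.
case: ifP => _; last by rewrite mulmx0 scaler0 addr0.
by rewrite -scalemxAr parityE sgn_card_flip !scalerA mulrN scaleNr [_ * sgn _ _]mulrC subrr.
Qed.
Lemma parity_sq : parity_op K m *m parity_op K m = 1%:M.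
Proof.
apply: bas_ext => J; rewrite -mulmxA !parityE -scalemxAr parityE scalerA mul1mx.
by rewrite -expr2 sqrr_sign scale1r.
Qed.

Notation V := 'cV[K]_(m.*2.+1).
Definition lo (i : 'I_m) : 'I_m.*2.+1 := inord i.
Definition hi (i : 'I_m) : 'I_m.*2.+1 := inord (m.*2 - i).
Definition md : 'I_m.*2.+1 := inord m.
(** Coordinates indexed by [None] for z, [Some (i, false)] for e_i and [Some (i, true)] for f_i, so
    that the gamma matrices are sums over one finite type. *)
Definition cf (v : V) (x : option ('I_m * bool)) : K :=
  match x with None => v md 0 | Some (i, false) => v (lo i) 0 | Some (i, true) => v (hi i) 0 end.
Definition gen_op (x : option ('I_m * bool)) : 'M[K]_d :=
  match x with None => parity_op K m | Some (i, b) => cr b i end.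
Definition gen_h (x y : option ('I_m * bool)) : K :=
  match x, y with
  | None, None => 2%:R
  | Some (i, b), Some (j, c) => ((i == j) && (b != c))%:R
  | _, _ => 0 end.

Lemma big_option (I : finType) (W : zmodType) (F : option I -> W) :
  \sum_x F x = F None + \sum_i F (Some i).
Proof.
rewrite (bigD1 None) //=; congr (_ + _).
rewrite (reindex_omap Some id) //=; last by case.
by apply: eq_bigl => i; rewrite eqxx.
Qed.

Lemma gammaE (v : V) : gamma v = \sum_x cf v x *: gen_op x.
Proof.
rewrite big_option addrC /gamma; congr (_ + _).
transitivity (\sum_(i < m) \sum_(b : bool) cf v (Some (i, b)) *: gen_op (Some (i, b))); last first.
  by rewrite pair_bigA; apply: eq_bigr => -[].
by apply: eq_bigr => i _; rewrite big_bool /= addrC.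
Qed.

Lemma gen_op_anti x y : gen_op x *m gen_op y + gen_op y *m gen_op x = (gen_h x y)%:M.
Proof.
case: x y => [[i b]|] [[j c]|] /=.
- exact: cr_anti.
- by rewrite parity_anti raddf0.
- by rewrite addrC parity_anti raddf0.
by rewrite parity_sq -raddfD.
Qed.

Definition polar (v w : V) := \sum_x \sum_y cf v x * cf w y * gen_h x y.

Lemma gamma_anti (v w : V) : gamma v *m gamma w + gamma w *m gamma v = (polar v w)%:M.
Proof.
rewrite !gammaE mulmx_suml [X in _ + X]mulmx_sumr -big_split /polar rmorph_sum; apply: eq_bigr => x _ /=.
rewrite mulmx_sumr mulmx_suml -big_split rmorph_sum; apply: eq_bigr => y _ /=.
rewrite -!scalemxAl -!scalemxAr !scalerA [cf w y * _]mulrC -scalerDr gen_op_anti.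
by rewrite scale_scalar_mx.
Qed.

Lemma polar_quad (v : V) : polar v v = 2%:R * quad_form v.
Proof.
have E x : \sum_y cf v x * cf v y * gen_h x y =
   match x with None => 2%:R * (v md 0 * v md 0) | Some (i, b) => v (lo i) 0 * v (hi i) 0 end.
  rewrite big_option; case: x => [[i b]|] /=.
    rewrite mulr0 add0r (bigD1 (i, ~~ b)) //= eqxx /= [X in _ + X]big1 ?addr0.
      by case: b => /=; rewrite mulr1 // mulrC.
    move=> [j c]; rewrite xpair_eqE => ne; rewrite -[RHS](mulr0 (cf v (Some (i, b)) * cf v (Some (j, c)))).
    by congr (_ * _); move: ne; case: eqVneq => //= _; case: b c => [] [].
  rewrite big1 ?addr0; first by rewrite mulrC.
  by move=> [j c] _; rewrite mulr0.
rewrite /polar (eq_bigr _ (fun x _ => E x)) big_option /quad_form mulrDr addrC; congr (_ + _).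
transitivity (\sum_(i < m) \sum_(b : bool) v (lo i) 0 * v (hi i) 0).
  by rewrite pair_bigA; apply: eq_bigr => -[].
by rewrite mulr_sumr; apply: eq_bigr => i _; rewrite big_bool /= mulr_natl mulr2n.
Qed.

Lemma gammaD (v w : V) : gamma (v + w) = gamma v + gamma w.
Proof.
rewrite !gammaE -big_split; apply: eq_bigr => x _; rewrite /= -scalerDl; congr (_ *: _).
by case: x => [[i []]|] /=; rewrite mxE.
Qed.
Lemma gammaZ a (v : V) : gamma (a *: v) = a *: gamma v.
Proof.
rewrite !gammaE scaler_sumr; apply: eq_bigr => x _; rewrite scalerA; congr (_ *: _).
by case: x => [[i []]|] /=; rewrite mxE.
Qed.

Definition pos (x : option ('I_m * bool)) : 'I_m.*2.+1 :=
  match x with None => md | Some (i, false) => lo i | Some (i, true) => hi i end.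
Lemma cf_pos v x : cf v x = v (pos x) 0.
Proof. by case: x => [[i []]|]. Qed.
Lemma val_pos x : val (pos x) = match x with None => m | Some (i, false) => val i | Some (i, true) => (m.*2 - i)%N end.
Proof.
have im (i : 'I_m) : (i < m)%N := ltn_ord i.
case: x => [[i []]|] /=; rewrite inordK // -addnn; last by lia.
  by rewrite ltnS leq_subr.
by have := im i; lia.
Qed.
Lemma pos_inj : injective pos.
Proof.
have im (i : 'I_m) : (i < m)%N := ltn_ord i.
move=> x y /(congr1 val); rewrite !val_pos -addnn.
case: x y => [[i []]|] [[j []]|] //= e; first [by have := im i; have := im j; lia
  | by have := im i; lia | by have := im j; lia
  | by have -> : i = j by apply: val_inj => /=; have := im i; have := im j; lia].
Qed.
Lemma pos_bij : bijective pos.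
Proof.
by apply: inj_card_bij pos_inj _; rewrite card_ord card_option card_prod card_ord card_bool muln2.
Qed.
Lemma sum_pos (W : zmodType) (F : 'I_m.*2.+1 -> W) :
  \sum_l F l = F md + \sum_(i < m) (F (lo i) + F (hi i)).
Proof.
rewrite (reindex pos) /=; last exact: onW_bij pos_bij.
rewrite big_option; congr (_ + _); transitivity (\sum_(i < m) \sum_(b : bool) F (pos (Some (i, b)))).
  by rewrite pair_bigA; apply: eq_bigr => -[].
by apply: eq_bigr => i _; rewrite big_bool addrC.
Qed.
Hypothesis two : 2%:R != 0 :> K.

Lemma gamma_sq (v : V) : gamma v *m gamma v = (quad_form v)%:M.
Proof.
have := gamma_anti v v; rewrite polar_quad -mulr2n -scaler_nat => /(congr1 ( *:%R (2%:R^-1))).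
by rewrite scalerA mulVf // scale1r scale_scalar_mx mulrA mulVf // mul1r.
Qed.

(** For q(u) = 1, conjugation by gamma(u) is minus the reflection in u, hence maps gamma matrices to
    gamma matrices; elements of the spin group are products of such gamma(u). *)
Lemma spin_group_vec (s : 'M[K]_(spin_dim m)) : spin_group s -> forall v : V, exists v', s *m gamma v = gamma v' *m s.
Proof.
case=> vs [vs1 _ ->] {s}; elim: vs vs1 => [|u vs IH] /=; first by move=> _ v; exists v; rewrite mul1mx mulmx1.
case/andP => /eqP u1 /IH{}IH v.
have [v' Ev'] := IH v; exists (polar u v' *: u - v').
have uv : gamma u *m gamma v' = gamma (polar u v' *: u - v') *m gamma u.
  have -> : gamma (polar u v' *: u - v') = polar u v' *: gamma u - gamma v'.
    by rewrite gammaD -scaleN1r !gammaZ scaleN1r.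
  rewrite mulmxBl -scalemxAl (gamma_sq u) u1 scale_scalar_mx mulr1 -(gamma_anti u v').
  by rewrite addrK.
by rewrite -mulmxA Ev' mulmxA uv mulmxA.
Qed.

Lemma gamma_ev x : gamma (ev (pos x)) = gen_op x.
Proof.
rewrite gammaE (bigD1 x) //= cf_pos mxE !eqxx scale1r big1 ?addr0 // => y yx.
by rewrite cf_pos mxE (inj_eq pos_inj) (negPf yx) scale0r.
Qed.

Section EvenAlgebra.
Variable good : 'M[K]_d -> Prop.
Hypothesis goodD : forall a a', good a -> good a' -> good (a + a').
Hypothesis goodM : forall a a', good a -> good a' -> good (a *m a').
Hypothesis good2 : forall v w : V, good (gamma v *m gamma w).

Lemma good_scalar (e : K) : good e%:M.
Proof.
have := good2 (e *: ev (pos None)) (ev (pos None)).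
by rewrite gammaZ -scalemxAl !gamma_ev parity_sq scale_scalar_mx mulr1.
Qed.
Lemma good_gen x y : good (gen_op x *m gen_op y).
Proof. by rewrite -!gamma_ev. Qed.

(** The rank-one projector onto the basis vector L is the product over all i of the commuting
    projectors onto the J that agree with L at i. *)
Lemma good_unit_diag L : good (delta_mx (enum_rank L) (enum_rank L)).
Proof.
(* Annihilating i and creating it again, or the reverse: this keeps the basis vectors J with i in J
   exactly when i is in L, and kills the others. *)
pose f i := cr (i \notin L) i *m cr (i \in L) i.
pose prj (s : seq 'I_m) := foldr (fun i M => f i *m M) 1%:M s.
have goodp s : good (prj s).
  elim: s => [|i s IHs]; first exact: good_scalar.
  by apply: goodM IHs; apply: (good_gen (Some (i, _)) (Some (i, _))).
have prjE s J : prj s *m bas J = if all (fun i => (i \in J) == (i \in L)) s then bas J else 0.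
  elim: s => [|i s IHs] /=; first by rewrite mul1mx.
  rewrite -mulmxA IHs; case: ifP => _; last by rewrite mulmx0 andbF.
  rewrite andbT /f -mulmxA crE; case: eqP => [e|_]; last by rewrite mulmx0.
  rewrite -scalemxAr crE in_flip eqxx e /= eqxx flipK sgn_flip ltnn scalerA sgn2 scale1r.
  by [].
have -> : delta_mx (enum_rank L) (enum_rank L) = prj (enum 'I_m); last exact: goodp.
apply: bas_ext => J; rewrite prjE /bas mul_delta_mx_cond (inj_eq enum_rank_inj).
have [->|JL] := eqVneq L J; first by rewrite (introT allP) // => i _; rewrite eqxx.
case: allP => // al; case/eqP: JL; apply/setP => i; apply/esym/eqP/al.
by rewrite mem_enum.
Qed.

(** Induction on the number of elements in which J and L differ. One element is added or removed by
    e_i or f_i; multiplied by z, this is a product of two gammas. The extra vector z is what odd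
    dimension provides. *)
Lemma good_unit J L : good (delta_mx (enum_rank J) (enum_rank L)).
Proof.
have [k] := ubnP #|[set i | (i \in J) != (i \in L)]|; elim: k J => // k IHk J Jk.
have [E0|[i]] := set_0Vmem [set i | (i \in J) != (i \in L)].
  have -> : J = L; last exact: good_unit_diag.
  by apply/setP => i; have := in_set0 i; rewrite -E0 inE => /negbFE/eqP.
rewrite inE => iJ; pose J' := flip i J.
have gJ' : good (delta_mx (enum_rank J') (enum_rank L)).
  apply: IHk; have : [set l | (l \in J') != (l \in L)] = [set l | (l \in J) != (l \in L)] :\ i.
    apply/setP => l; rewrite !inE in_flip; have [->|//] := eqVneq l i.
    by move: iJ; case: (i \in J) (i \in L) => [] [].
  by move=> ->; rewrite -ltnS (leq_trans _ Jk) // ltnS [X in (_ < X)%N](cardsD1 i) inE iJ.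
pose b := i \in J'.
have -> : delta_mx (enum_rank J) (enum_rank L) =
    (sgn i J' * (-1) ^+ #|J|)%:M *m ((gen_op None *m gen_op (Some (i, b))) *m delta_mx (enum_rank J') (enum_rank L)).
  apply: bas_ext => A; rewrite -!mulmxA mul_scalar_mx /bas !mul_delta_mx_cond.
  have [_|_] := eqVneq (enum_rank L) (enum_rank A); rewrite ?mulr1n ?mulr0n ?mulmx0 ?scaler0 //.
  rewrite -/(bas J) -/(bas J') /= crE eqxx -scalemxAr parityE /J' flipK !scalerA -[LHS]scale1r; congr (_ *: _).
  transitivity ((sgn i (flip i J) * sgn i (flip i J)) * ((-1) ^+ #|J| * (-1) ^+ #|J|)); last by ring.
  by rewrite sgn2 -expr2 sqrr_sign mulr1.
by apply: goodM (good_scalar _) (goodM (good_gen _ _) gJ').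
Qed.

(** The even Clifford algebra in odd dimension is the full matrix algebra of the spin module: it
    contains all matrix units. *)
Lemma even_alg_all a : good a.
Proof.
rewrite [a]matrix_sum_delta; have g0 : good 0 by rewrite -(raddf0 (@scalar_mx K d)); apply: good_scalar.
apply: big_ind => // i _; apply: big_ind => // j _.
by rewrite -mul_scalar_mx -[i]enum_valK -[j]enum_valK; apply: goodM (good_scalar _) (good_unit _ _).
Qed.
End EvenAlgebra.

Lemma spin_dimE : spin_dim m = (2 ^ m)%N.
Proof. by rewrite /spin_dim -cardsT -powersetT card_powerset cardsT card_ord. Qed.
Lemma spin_dim_neq0 : (spin_dim m)%:R != 0 :> K.
Proof. by rewrite spin_dimE natrX expf_neq0. Qed.
End SpinModule.

(** * The vector representation carried by the gamma matrices *)

Section SpinVector.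
Variables (K : closedFieldType) (m : nat).
Hypothesis two : 2%:R != 0 :> K.
Variable im : K.
Hypothesis im2 : im * im = -1.
Notation d := (spin_dim m).
Notation N := (m.*2.+1).
Notation V0 := 'cV[K]_N.
Local Notation lo := (@lo m).
Local Notation hi := (@hi m).
Local Notation md := (md m).

(** Coefficients of the passage from an orthonormal to a hyperbolic basis: coordinates a, b in
    paired positions become a + im b and a - im b, with product a^2 + b^2, and the middle one is
    kept. The standard dot product thus becomes [quad_form]. *)
Definition dir (l : 'I_N) : K := if (l < m)%N then 1 else if l == m :> nat then 1 else - im.
Definition rv (l : 'I_N) : K := if (l < m)%N then im else if l == m :> nat then 0 else 1.
Definition orth_mx : 'M[K]_N := \matrix_(l, a) (dir l * (a == l)%:R + rv l * (a == rev_ord l)%:R).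

Lemma orth_mxE (x : V0) l : (orth_mx *m x) l 0 = dir l * x l 0 + rv l * x (rev_ord l) 0.
Proof.
rewrite mxE; under eq_bigr => a _ do rewrite mxE mulrDl -!mulrA.
rewrite big_split -!mulr_sumr; congr (_ * _ + _ * _).
  by rewrite (bigD1 l) //= eqxx mul1r big1 ?addr0 // => a /negPf->; rewrite mul0r.
by rewrite (bigD1 (rev_ord l)) //= eqxx mul1r big1 ?addr0 // => a /negPf->; rewrite mul0r.
Qed.

Lemma val_lo (i : 'I_m) : (lo i : nat) = i.
Proof. exact: (val_pos (Some (i, false))). Qed.
Lemma val_hi (i : 'I_m) : (hi i : nat) = (m.*2 - i)%N.
Proof. exact: (val_pos (Some (i, true))). Qed.
Lemma val_md : (md : nat) = m.
Proof. exact: (val_pos (None : option ('I_m * bool))). Qed.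

Lemma quad_orth (x : V0) : quad_form (orth_mx *m x) = (x^T *m x) 0 0.
Proof.
rewrite mxE sum_pos /quad_form addrC -/md; congr (_ + _).
  have e : rev_ord md = md by apply: val_inj; rewrite /= val_md -addnn; lia.
  by rewrite orth_mxE e /dir /rv val_md ltnn eqxx mul0r addr0 mul1r !mxE expr2.
apply: eq_bigr => i _; rewrite -/(lo i) -/(hi i) !orth_mxE.
have ilt : (i < m)%N := ltn_ord i.
have -> : rev_ord (lo i) = hi i by apply: val_inj; rewrite /= val_lo val_hi subSS.
have -> : rev_ord (hi i) = lo i by apply: val_inj; rewrite /= val_lo val_hi -addnn; lia.
rewrite /dir /rv !val_lo !val_hi ilt ltnNge (_ : (m <= m.*2 - i)%N) /=; last by rewrite -addnn; lia.
rewrite (_ : (m.*2 - i == m)%N = false); last by apply/eqP; rewrite -addnn; lia.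
rewrite !mxE; move: (x (lo i) 0) (x (hi i) 0) => a b.
have -> : (1 * a + im * b) * (- im * b + 1 * a) = a * a - (im * im) * (b * b) by ring.
by rewrite im2 mulN1r opprK.
Qed.

Definition vgam (x : V0) : 'M[K]_d := gamma (orth_mx *m x).
Lemma vgamD x y : vgam (x + y) = vgam x + vgam y.
Proof. by rewrite /vgam mulmxDr gammaD. Qed.
Lemma vgamZ a x : vgam (a *: x) = a *: vgam x.
Proof. by rewrite /vgam -scalemxAr gammaZ. Qed.
Lemma vgam_sum x : vgam x = \sum_a x a 0 *: vgam (ev a).
Proof.
have vsum (I : finType) (F : I -> V0) : vgam (\sum_a F a) = \sum_a vgam (F a).
  by apply: (big_morph vgam vgamD); rewrite -[0 in LHS](scale0r 0) vgamZ scale0r.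
by rewrite {1}[x]cV_sum_delta vsum; apply: eq_bigr => a _; rewrite vgamZ.
Qed.
Lemma vgam_sq x : vgam x *m vgam x = ((x^T *m x) 0 0)%:M.
Proof. by rewrite /vgam gamma_sq // quad_orth. Qed.
Lemma vgam_anti (x y : V0) : vgam x *m vgam y + vgam y *m vgam x = (2%:R * (x^T *m y) 0 0)%:M.
Proof.
pose dd (u v : V0) := (u^T *m v) 0 0.
have dDl u u' v : dd (u + u') v = dd u v + dd u' v by rewrite /dd linearD /= mulmxDl mxE.
have dDr u v v' : dd u (v + v') = dd u v + dd u v' by rewrite /dd mulmxDr mxE.
have dC u v : dd u v = dd v u by rewrite /dd -[u^T *m v]trmxK mxE trmx_mul trmxK.
have -> : vgam x *m vgam y + vgam y *m vgam x =
    vgam (x + y) *m vgam (x + y) - vgam x *m vgam x - vgam y *m vgam y.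
  rewrite vgamD !mulmxDl !mulmxDr.
  move: (vgam x *m vgam x) (vgam x *m vgam y) (vgam y *m vgam x) (vgam y *m vgam y) => a b c e.
  by apply/matrixP => i j; rewrite !mxE; ring.
rewrite (vgam_sq (x + y)) (vgam_sq x) (vgam_sq y) -!raddfB /=; congr (_%:M).
rewrite -/(dd _ _) -/(dd x x) -/(dd y y) -/(dd x y) dDl !dDr (dC y x).
by ring.
Qed.

Lemma trace_vgam (x y : V0) : \tr (vgam x *m vgam y) = d%:R * (x^T *m y) 0 0.
Proof.
have e := congr1 mxtrace (vgam_anti x y); rewrite raddfD /= (mxtrace_mulC (vgam y)) mxtrace_scalar in e.
apply: (mulfI two); transitivity (\tr (vgam x *m vgam y) + \tr (vgam x *m vgam y)).
  by rewrite mulr_natl mulr2n.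
apply: etrans e _; move: ((x^T *m y) 0 0) => z.
by rewrite -(mulr_natr (2%:R * z) d); ring.
Qed.
Lemma vgam_coord (x : V0) a : x a 0 = d%:R^-1 * \tr (vgam (ev a) *m vgam x).
Proof.
rewrite trace_vgam mulKf ?spin_dim_neq0 // trmx_delta -rowE mxE.
by [].
Qed.
Lemma vgam_inj (x y : V0) : vgam x = vgam y -> x = y.
Proof. by move=> e; apply/colP => a; rewrite !vgam_coord e. Qed.
Lemma orth_mx_unit : orth_mx \in unitmx.
Proof.
rewrite -row_free_unit -row_leq_rank; have -> : \rank orth_mx = N; last by [].
apply: rank_inj => v Cv; apply: vgam_inj; rewrite /vgam Cv.
by rewrite mulmx0.
Qed.
Lemma gamma_vgam (v : V0) : exists x, gamma v = vgam x.
Proof. by exists (invmx orth_mx *m v); rewrite /vgam mulKVmx // orth_mx_unit. Qed.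

Variable phi : principal_hom K m.
Local Notation S := (spin_obj phi).

(** Conjugation by [phi g] on the gamma matrices. Its entries are read off by the trace form, which
    makes them visibly regular functions of g. *)
Definition vec_act (g : 'M[K]_2) : 'M[K]_N :=
  \matrix_(a, b) (d%:R^-1 * \tr (vgam (ev a) *m (phi g *m (vgam (ev b) *m phi (invmx g))))).

Lemma phi_inv g : \det g = 1 -> phi (invmx g) *m phi g = 1%:M /\ phi g *m phi (invmx g) = 1%:M.
Proof. exact: (act_invmx S). Qed.

Lemma vec_actE g (x : V0) : \det g = 1 -> phi g *m vgam x = vgam (vec_act g *m x) *m phi g.
Proof.
move=> dg; have [i1 i2] := phi_inv dg.
have [v' Ev'] := spin_group_vec two (principal_spin phi dg) (orth_mx *m x).
have [y Ey] := gamma_vgam v'; rewrite [LHS]Ev' Ey; congr (vgam _ *m _).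
have Ey' : vgam y = phi g *m (vgam x *m phi (invmx g)) by rewrite mulmxA [_ *m vgam x]Ev' Ey -mulmxA i2 mulmx1.
apply/colP => a; rewrite vgam_coord Ey' mxE [vgam x]vgam_sum mulmx_suml !mulmx_sumr raddf_sum /= mulr_sumr.
apply: eq_bigr => b _; rewrite mxE -!scalemxAl -!scalemxAr mxtraceZ -mulrA; congr (_ * _).
by rewrite mulrC.
Qed.

Lemma phi_cancel g (A A' : 'M[K]_d) : \det g = 1 -> A *m phi g = A' *m phi g -> A = A'.
Proof.
by move=> dg e; rewrite -[A]mulmx1 -[A']mulmx1 -(phi_inv dg).2 !mulmxA e.
Qed.

Lemma vec_rational : rational vec_act.
Proof.
have [P1 PM PR] := principal_rational phi; split=> [|g h dg dh|a b].
- apply: cV_ext => x; have d1 : \det (1 : 'M[K]_2) = 1 by rewrite det1.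
  apply: vgam_inj; apply: (phi_cancel d1); rewrite -vec_actE //.
  by rewrite [phi 1]P1 mul1mx mulmx1 mul1mx.
- apply: cV_ext => x; have dgh : \det (g * h) = 1 by rewrite det_mulmx dg dh mulr1.
  apply: vgam_inj; apply: (phi_cancel dgh); rewrite -vec_actE // [phi _]PM //.
  by rewrite -mulmxA vec_actE // mulmxA vec_actE // -mulmxA -[in RHS]mulmxA.
apply: (@regular_ext _ (fun g => d%:R^-1 * \sum_i (vgam (ev a) *m (phi g *m (vgam (ev b) *m phi (invmx g)))) i i)) => [g _|].
  by rewrite mxE.
apply: regularM; first exact: regular_cst.
apply: regular_sum => i; have Rc (M : 'M[K]_d) i1 j1 : regular_fun (fun=> M i1 j1) by exact: regular_cst.
have Ri i1 j1 : regular_fun (fun g => phi (invmx g) i1 j1) by apply: regular_inv (PR i1 j1).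
by do !(apply: regular_mulmx => //); apply: Rc.
Qed.
Definition vec_rep : rep K := Rep vec_rational.

Definition gam_mx0 : 'M[K]_(d, N * d) :=
  \matrix_(s, l) vgam (ev (mxtens_unindex l).1) s (mxtens_unindex l).2.
Lemma gam_mx0E x t : gam_mx0 *m (x *# t) = vgam x *m t.
Proof.
apply/colP => s; rewrite !mxE sum_tidx [vgam x]vgam_sum.
under [RHS]eq_bigr => j _ do rewrite summxE mulr_suml.
rewrite exchange_big; apply: eq_bigr => a _; apply: eq_bigr => j _ /=.
rewrite mxE mxtens_indexK [X in _ * X]mxE mxtens_indexK /= [X in _ = X * _]mxE mulrA.
by rewrite [X in X * _ = _]mulrC.
Qed.

Lemma gam_proof : is_equivariant (X := rep_tens vec_rep S) (Y := S) gam_mx0.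
Proof.
move=> g dg; apply: tens_ext => x t; rewrite -!mulmxA mul_tens_tv !gam_mx0E.
by rewrite mulmxA -vec_actE // mulmxA.
Qed.
Definition gam_hom : rep_hom (rep_tens vec_rep S) S := RepHom gam_proof.
Lemma gam_homE (x : 'cV_(rep_dim vec_rep)) (t : 'cV_(rep_dim S)) : gam_hom *m (x *# t) = vgam x *m t.
Proof. exact: gam_mx0E. Qed.

(** Conjugation preserves anticommutators, and these are the dot products. *)
Lemma vec_orth g : \det g = 1 -> (rep_act vec_rep g)^T *m rep_act vec_rep g = 1%:M.
Proof.
move=> dg /=; apply/matrixP => a b.
have E (x y : V0) : (2%:R * ((vec_act g *m x)^T *m (vec_act g *m y)) 0 0)%:M = (2%:R * (x^T *m y) 0 0)%:M :> 'M[K]_d.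
  rewrite -!vgam_anti; apply: (phi_cancel dg); rewrite mulmxDl -!mulmxA -!vec_actE // !mulmxA -!vec_actE //.
  by rewrite -!mulmxA -mulmxDr vgam_anti mul_scalar_mx mul_mx_scalar.
have d0 : (0 < d)%N by rewrite spin_dimE expn_gt0.
have := congr1 (fun M : 'M[K]_d => M (Ordinal d0) (Ordinal d0)) (E (ev a) (ev b)).
rewrite [LHS]mxE [RHS]mxE eqxx !mulr1n => /(mulfI two).
have -> : (vec_act g *m (ev a : V0))^T *m (vec_act g *m (ev b : V0)) = (ev a : V0)^T *m ((vec_act g)^T *m vec_act g) *m (ev b : V0).
  by rewrite trmx_mul !mulmxA.
have D (A : 'M[K]_N) : ((ev a : V0)^T *m A *m (ev b : V0)) 0 0 = A a b by rewrite trmx_delta -rowE -colE !mxE.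
by rewrite D -[(ev a : V0)^T]mulmx1 D.
Qed.

Lemma gam_cliff v w x : gam_hom *m (v *# (gam_hom *m (w *# x))) + gam_hom *m (w *# (gam_hom *m (v *# x)))
  = (2%:R * dotv (V := vec_rep) v w) *: x.
Proof. by rewrite !gam_homE !mulmxA -mulmxDl vgam_anti mul_scalar_mx. Qed.

(** The matrices whose left multiplication preserves P contain the products of two gammas, hence are
    all matrices by [even_alg_all]; and every element of End(S) is a matrix applied to the unit. *)
Lemma gam_gen (P : 'cV_(rep_dim (inner_hom S S)) -> Prop) :
  (forall c, P (hom_coev S *m c)) -> (forall q q', P q -> P q' -> P (q + q')) ->
  (forall v w q, P q -> P (actE gam_hom *m (v *# (actE gam_hom *m (w *# q))))) -> forall q, P q.
Proof.
move=> P1 PD P2.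
have actm v q : actE gam_hom *m (v *# q) = (vgam v *t 1%:M) *m q.
  elim/(@tens_elim _ S (dual_rep S)): q => [q q' Hq Hq'|x e]; first by rewrite tvDr !mulmxDr Hq Hq'.
  by rewrite actEE gam_homE mul_tens_tv mul1mx.
pose good (a : 'M[K]_d) := forall q : 'cV_(rep_dim (inner_hom S S)), P q -> P ((a *t (1%:M : 'M_d)) *m q).
have all_good a : good a.
  apply: even_alg_all => // [a1 b ga gb q Pq|a1 b ga gb q Pq|v w q Pq].
  - have -> : ((a1 + b) *t 1%:M : 'M_(d * d)) = a1 *t 1%:M + b *t 1%:M.
      by apply: tv_ext => x y; rewrite mulmxDl !mul_tens_tv mulmxDl tvDl.
    by rewrite mulmxDl; apply: PD; [apply: ga|apply: gb].
  - by rewrite -[X in _ *t X](mulmx1 1%:M) -tensmx_mul -mulmxA; apply/ga/gb.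
  have [x ->] := gamma_vgam v; have [y ->] := gamma_vgam w.
  by rewrite -[X in _ *t X](mulmx1 1%:M) -tensmx_mul -mulmxA -!actm; apply: P2.
move=> q; have -> : q = ((\matrix_(i, j) q (mxtens_index (i, j)) 0 : 'M[K]_d) *t (1%:M : 'M_d)) *m (hom_coev S *m 1%:M).
  apply/colP => l; case: (mxtens_indexP l) => i j; rewrite homcoev_E (_ : (1%:M : 'cV[K]_1) 0 0 = 1) ?scale1r; last by rewrite mxE eqxx.
  rewrite mulmx_sumr summxE (bigD1 j) //= big1 => [|a /negPf aj]; rewrite mul_tens_tv mul1mx -colE !mxE mxtens_indexK /=.
    by rewrite eqxx mulr1 addr0.
  by rewrite eq_sym aj mulr0.
exact: all_good.
Qed.
End SpinVector.

(** * Square roots in the base field *)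

Section SquareRoot.
Variable K : closedFieldType.
Lemma sqrt_exists (c : K) : exists s, s * s = c.
Proof.
have : size ('X^2 - c%:P : {poly K}) != 1%N by rewrite size_XnsubC.
move/closed_rootP => [s]; rewrite rootE !hornerE subr_eq0 => /eqP e; exists s.
by rewrite -expr2.
Qed.
End SquareRoot.

(** * Recognizing an object as a line tensored with V *)

Section LineTensor.
Variables (K : closedFieldType) (chi : rep K).
Variables (alpha : rep_hom (rep_tens chi chi) (unit_rep K)) (alpha' : rep_hom (unit_rep K) (rep_tens chi chi)).
Hypothesis alphaK : alpha *m alpha' = 1%:M.
Hypothesis alpha'K : alpha' <o> alpha === hom_id _.
Hypothesis dimchi : (rep_dim chi)%:R != 0 :> K.
Variable V : rep K.
Hypothesis orth : forall g, \det g = 1 -> (rep_act V g)^T *m rep_act V g = 1%:M.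
Hypothesis endV : forall f : rep_hom V V, exists c, hom_mx f = c%:M.
Hypothesis two : 2%:R != 0 :> K.
Hypothesis dimV : (rep_dim V)%:R != 0 :> K.
Variable U : rep K.

Lemma trace_tens1 m n (A : 'M[K]_n) : \tr ((1%:M : 'M_m) *t A) = m%:R * \tr A.
Proof.
rewrite /mxtrace sum_tidx; under eq_bigr => i _.
  under eq_bigr => j _ do rewrite tensmxE mxE eqxx mul1r.
  over.
by rewrite sumr_const card_ord mulr_natl.
Qed.

Section Idempotent.
Variables (r : rep_hom (rep_tens chi V) U) (i : rep_hom U (rep_tens chi V)).
Hypothesis ri : r *m i = 1%:M.
Hypothesis dimU : (rep_dim U)%:R != 0 :> K.

(** Tensoring the idempotent f = i r with chi once more gives an endomorphism of chi (x) chi (x) V,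
    which is V up to negligible maps and has only scalar endomorphisms. So f is a scalar c up to
    negligible maps, and f f = f with trace dim U, which is nonzero, gives c = 1. *)
Lemma line_idem : i <o> r === hom_id _.
Proof.
pose f := i <o> r.
pose P := hom_lunit V <o> (alpha <x> hom_id V) <o> hom_assocV chi chi V.
pose P' := hom_assoc chi chi V <o> (alpha' <x> hom_id V) <o> lunitV V.
have P'P : P' <o> P === hom_id _.
  have e1 : lunitV V <o> hom_lunit V === hom_id _.
    by apply: heq_mx; apply: (@tens_ext _ (unit_rep K) V) => c v; rewrite hom_compE lunitE -scalemxAr lunitVE -tvZl -cV1E hom_idE.
  have e2 : (alpha' <x> hom_id V) <o> (alpha <x> hom_id V) === hom_id _.
    rewrite -heq_tens_comp alpha'K heq_comp_id; apply: heq_mx; exact: tensmx11.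
  have -> : P' <o> P === hom_assoc chi chi V <o> (alpha' <x> hom_id V) <o> (lunitV V <o> hom_lunit V)
      <o> (alpha <x> hom_id V) <o> hom_assocV chi chi V.
    by apply: heq_mx; rewrite /= !mulmxA.
  rewrite e1 heq_comp_id -(heq_compA _ (alpha' <x> hom_id V)) e2 heq_comp_id.
  by apply: heq_mx; apply: tens_extr => x y z; rewrite hom_compE assocVE assocE hom_idE.
have [c Ec] := endV (P <o> (hom_id chi <x> f) <o> P').
have E1 : hom_id chi <x> f === hom_scale c (hom_id _).
  rewrite -(heq_comp_id (hom_id chi <x> f)) -(heq_id_comp (_ <o> hom_id _)) -P'P.
  have -> : P' <o> P <o> ((hom_id chi <x> f) <o> (P' <o> P)) === P' <o> (P <o> (hom_id chi <x> f) <o> P') <o> P.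
    by apply: heq_mx; rewrite /= !mulmxA.
  have -> : P <o> (hom_id chi <x> f) <o> P' === hom_scale c (hom_id V).
    by apply: heq_mx; rewrite Ec /= scalemx1.
  have -> : P' <o> hom_scale c (hom_id V) <o> P === hom_scale c (P' <o> P).
    by apply: heq_mx; rewrite /= -scalemxAr mulmx1 -scalemxAl.
  by rewrite P'P.
(* Testing against id (x) h multiplies both traces by dim chi, which is invertible. *)
have E2 (h : rep_hom (rep_tens chi V) (rep_tens chi V)) : \tr (f *m h) = c * \tr h.
  have /heq_tr/(_ (hom_id chi <x> h)) := E1; rewrite hom_scaleE linearZ /= mul1mx tensmx_mul mulmx1 !trace_tens1.
  by rewrite mulrCA => /(mulfI dimchi).
have trf : \tr f = (rep_dim U)%:R by rewrite mxtrace_mulC ri mxtrace1.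
have ff : f *m f = f by rewrite /f /= mulmxA -(mulmxA (hom_mx i)) ri mulmx1.
have c1 : c = 1.
  have := E2 f; rewrite [X in \tr X]ff trf => e.
  by apply: (mulIf dimU); rewrite mul1r.
apply/heq_tr => h; rewrite hom_idE; have := E2 h; rewrite c1 mul1r.
by [].
Qed.
End Idempotent.

Variable B : rep_hom (rep_tens U U) (unit_rep K).
Hypothesis formU : forall b : rep_hom (rep_tens U U) (unit_rep K), exists c, hom_mx b = c *: hom_mx B.

Lemma dual_id_proof : is_equivariant (X := dual_rep V) (Y := V) 1%:M.
Proof.
move=> g dg /=; rewrite mul1mx mulmx1; apply: trmx_inj; rewrite trmxK.
have [_ e] := act_invmx V dg; rewrite -[LHS]mul1mx -(orth dg) -mulmxA e mulmx1.
by [].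
Qed.
Definition dual_id : rep_hom (dual_rep V) V := RepHom dual_id_proof.
Definition self_coev : rep_hom (unit_rep K) (rep_tens V V) := (hom_id V <x> dual_id) <o> hom_coev V.
Lemma self_coevE (c : 'cV_(rep_dim (unit_rep K))) : self_coev *m c = c 0 0 *: \sum_(a < rep_dim V) ev a *# ev a.
Proof.
rewrite /self_coev (hom_compE (hom_id V <x> dual_id)) homcoev_E -scalemxAr mulmx_sumr; congr (_ *: _).
apply: eq_bigr => a _; transitivity (ev a *# (dual_id *m ev a)); first by rewrite hom_tensE hom_idE.
by congr (_ *# _); apply: mul1mx.
Qed.

(** Forms on U are proportional to [B], so the form carried over from chi (x) V is c times [B]; a
    square root of c, put into r, absorbs the factor. *)
Lemma rescale_form (r0 : rep_hom (rep_tens chi V) U) (i0 : rep_hom U (rep_tens chi V)) :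
  r0 *m i0 = 1%:M -> i0 <o> r0 === hom_id _ ->
  exists (r : rep_hom (rep_tens chi V) U) (i : rep_hom U (rep_tens chi V)),
  [/\ r <o> i = 1%:M :> 'M_(_, _), i <o> r === hom_id _ &
   B <o> (r <x> r) === hom_lunit (unit_rep K) <o> (alpha <x> cliff_form orth) <o> hom_mid chi V chi V].
Proof.
move=> ri ir; set beta := hom_lunit (unit_rep K) <o> (alpha <x> cliff_form orth) <o> hom_mid chi V chi V.
have [c Ec] := formU (beta <o> (i0 <x> i0)).
have E1 : hom_scale c (B <o> (r0 <x> r0)) === beta.
  have e : (i0 <o> r0) <x> (i0 <o> r0) === hom_id _ by rewrite ir; apply: heq_mx; apply: tensmx11.
  rewrite -[X in _ === X](heq_comp_id beta) -e heq_tens_comp heq_compA.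
  have -> : beta <o> (i0 <x> i0) === hom_scale c B by apply: heq_mx; rewrite Ec.
  by apply: heq_mx; rewrite /= -scalemxAl.
have c0 : c != 0.
  (* Composing the form with the coevaluations of chi and of V gives 2 dim V, which is not 0; so c
     cannot vanish. *)
  apply/eqP => c0; pose gm := hom_mid chi chi V V <o> (alpha' <x> self_coev) <o> lunitV (unit_rep K).
  have z : beta <o> gm === hom_zero _ _.
    by rewrite -E1; apply: heq_mx; rewrite /= c0 scale0r mul0mx.
  have ez : (beta <o> gm) *m (1%:M : 'cV_(rep_dim (unit_rep K))) = 0 by rewrite (heq_unit z) [LHS]mul0mx.
  move: ez; rewrite (hom_compE beta) /gm (hom_compE _ (lunitV _)) lunitVE (hom_compE _ (alpha' <x> self_coev)) hom_tensE self_coevE.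
  rewrite mxE eqxx scale1r tv_sumr !mulmx_sumr.
  have step (w : 'cV_(rep_dim (rep_tens chi chi))) (x : 'cV_(rep_dim V)) : beta *m (hom_mid chi chi V V *m (w *# (x *# x))) =
      (alpha *m w) 0 0 *: (2%:R * dotv x x)%:M.
    elim/(@tens_elim _ chi chi): w => [w w' Hw Hw'|s t].
      have e : (alpha *m (w + w')) 0 0 = (alpha *m w) 0 0 + (alpha *m w') 0 0 by rewrite mulmxDr mxE.
      by rewrite e tvDl !mulmxDr Hw Hw' scalerDl.
    by rewrite midE /beta (hom_compE _ (hom_mid _ _ _ _)) midE (hom_compE (hom_lunit _)) hom_tensE lunitE cliff_formE.
  under eq_bigr => a _ do rewrite step [alpha *m (alpha' *m _)]mulmxA alphaK mul1mx mxE eqxx scale1r /dotv trmx_delta -rowE mxE.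
  move/colP/(_ 0); rewrite summxE; under eq_bigr => a _ do rewrite !mxE !eqxx mulr1 mulr1n.
  rewrite sumr_const card_ord mxE -mulr_natr => /eqP.
  by rewrite mul1r -(mulr_natr 2%:R (rep_dim V)) mulf_eq0 (negPf two) (negPf dimV).
have [s ss] := sqrt_exists c.
have s0 : s != 0 by apply: contraNneq c0 => s0; rewrite -ss s0 mul0r.
exists (hom_scale s r0), (hom_scale s^-1 i0); split.
- by rewrite /= -scalemxAl -scalemxAr scalerA mulfV // scale1r ri.
- rewrite -ir; apply: heq_mx; by rewrite /= -scalemxAl -scalemxAr scalerA mulVf // scale1r.
rewrite -E1; apply: heq_mx; apply: tens_ext => x y.
rewrite (hom_compE B) hom_tensE !hom_scaleE tvZl tvZr scalerA ss -scalemxAr (hom_compE B).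
by rewrite hom_tensE.
Qed.
End LineTensor.

Lemma mul_ev (K : closedFieldType) m n (A : 'M[K]_(m, n)) (a : 'I_n) i : (A *m (ev a : 'cV_n)) i 0 = A i a.
Proof. by rewrite -colE mxE. Qed.

(** * Sym^n as a direct summand of Sym^(M+n) (x) V, for V isomorphic to Sym^M *)

Section SymLine.
Variables (K : closedFieldType) (M n : nat).
Notation sym := (sym_rep K).
Notation L := (sym n).
Notation chi := (sym (M + n)).
Variable V : rep K.
Hypothesis orth : forall g, \det g = 1 -> (rep_act V g)^T *m rep_act V g = 1%:M.
Variables (T' : rep_hom V (sym M)) (T : 'M[K]_(rep_dim V, rep_dim (sym M))).
Hypothesis TK : T' *m T = 1%:M.
Variables (G' : rep_hom chi (dual_rep chi)).
Hypothesis G'K : G' *m gram K (M + n) = 1%:M.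
Hypothesis TK2 : T *m T' = 1%:M.
Variable G'M : rep_hom (sym M) (dual_rep (sym M)).
Hypothesis G'MK : G'M *m gram K M = 1%:M.
Hypothesis dimchi : (M + n).+1%:R != 0 :> K.
Hypothesis dimV : (rep_dim V)%:R != 0 :> K.

(** The multiplication Sym^M (x) Sym^n -> Sym^(M+n) with its factor V moved to the target by
    self-duality: l goes to the sum over an orthonormal basis of (e_a l) (x) e_a. *)
Definition line_i : rep_hom L (rep_tens chi V) :=
  ((sym_mul K M n <o> (T' <x> hom_id L)) <x> hom_id V)
  <o> hom_assocV V L V <o> (hom_id V <x> hom_braid V L) <o> hom_assoc V V L
  <o> (self_coev orth <x> hom_id L) <o> lunitV L.

Lemma line_iE l : line_i *m l = \sum_(a < rep_dim V) (sym_mul K M n *m ((T' *m ev a) *# l)) *# ev a.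
Proof.
rewrite /line_i (hom_compE _ (lunitV L)) lunitVE (hom_compE _ (self_coev orth <x> _)) hom_tensE hom_idE.
rewrite self_coevE mxE eqxx scale1r tv_suml mulmx_sumr; apply: eq_bigr => a _.
by rewrite !elE.
Qed.
Lemma line_i_entry (k : 'I_(M + n).+1) (a : 'I_(rep_dim V)) (l : 'I_n.+1) :
  line_i (mxtens_index (k, a)) l = \sum_(b < M.+1) T' b a * (val k == b + l)%N%:R.
Proof.
transitivity ((line_i *m (ev l : 'cV_(rep_dim L))) (mxtens_index (k, a)) 0); first exact/esym/mul_ev.
rewrite line_iE summxE (bigD1 a) //= big1 ?addr0 => [|c /negPf ca]; last first.
  by rewrite mxE mxtens_indexK /= [X in _ * X]mxE (eq_sym a c) ca mulr0.
rewrite mxE mxtens_indexK /= [X in _ * X]mxE !eqxx mulr1 mxE sum_tidx; apply: eq_bigr => b _.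
have e c : (T' *m ev a *# (ev l : 'cV_(n.+1))) (mxtens_index (b, c)) 0 = T' b a * (c == l)%:R.
  by rewrite mxE mxtens_indexK /= mul_ev mxE andbT.
rewrite (bigD1 l) //= big1 ?addr0 => [|c /negPf cl].
  by rewrite [X in _ * X]e eqxx mulr1 mxE mxtens_indexK /= mulrC.
by rewrite [X in _ * X]e cl !mulr0.
Qed.

Lemma line_pair_proof : is_equivariant (X := rep_tens chi V) (Y := dual_rep (rep_tens chi V)) (G' *t 1%:M).
Proof.
move=> g dg /=; rewrite trmx_tens !tensmx_mul (homP G' dg); congr (_ *t _).
by rewrite mul1mx mulmx1; have := homP (dual_id orth) dg; rewrite /= mul1mx mulmx1.
Qed.
Definition line_pair := RepHom line_pair_proof.
(** The adjoint of [line_i] for the invariant forms on both sides. *)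
Definition line_r : rep_hom (rep_tens chi V) L := gram K n <o> hom_dual line_i <o> line_pair.

Lemma line_rE : hom_mx line_r = gram K n *m ((line_i : 'M_(_, _))^T *m (G' *t 1%:M)).
Proof. exact: esym (mulmxA (hom_mx (gram K n)) (line_i : 'M_(_, _))^T (G' *t 1%:M)). Qed.

Lemma gramG : gram K (M + n) *m G' = 1%:M.
Proof. exact: mulmx1C G'K. Qed.
Lemma gram_row0 q (j : 'I_q.+1) : gram K q ord0 j = (val j == q)%:R * (-1) ^+ q.
Proof. by rewrite gramE bin0 mul1r add0n subn0. Qed.
Lemma G'0 : G' ord_max ord0 != 0.
Proof.
apply/eqP => g0; have := congr1 (fun A : 'M_((M + n).+1) => A 0 0) gramG; rewrite !mxE eqxx.
rewrite (bigD1 ord_max) //= g0 mulr0 add0r big1 => [|j /negPf jm].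
  by move/esym/eqP; rewrite oner_eq0.
by rewrite gram_row0 -[(val j == _)]/(j == ord_max) jm !mul0r.
Qed.

(** The dot product of V, carried to Sym^M, is an invariant form; scalarity of endomorphisms makes
    it a multiple of [gram], and it is invertible. *)
Lemma vec_gram : exists2 c, c != 0 & T' *m (T' : 'M_(_, _))^T = c *: hom_mx (gram K M).
Proof.
pose f := T' <o> dual_id orth <o> hom_dual T'.
have fE : hom_mx f = T' *m (T' : 'M_(_, _))^T by rewrite /= mulmx1.
have [c Ec] := sym_rep_end (f <o> G'M).
have Ef : hom_mx f = c *: hom_mx (gram K M).
  transitivity (hom_mx f *m (G'M *m gram K M)); first by rewrite G'MK mulmx1.
  by rewrite -mul_scalar_mx -Ec mulmxA.
exists c; last by rewrite -fE.
apply: contraNneq dimV => c0; rewrite -(mxtrace1 K) -TK2 -[T *m T']mulmx1 -[X in _ *m X]trmx1 -TK2.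
by rewrite trmx_mul !mulmxA -(mulmxA T) -fE Ef c0 scale0r mulmx0 mul0mx mxtrace0.
Qed.

(** The composite r i is a scalar c on L, and the partial trace of i r over V is a scalar e on chi.
    It is enough to show that e is not 0, since both scalars compute the same trace. *)
Lemma sym_line : exists (r : rep_hom (rep_tens chi V) L) (i : rep_hom L (rep_tens chi V)), r *m i = 1%:M.
Proof.
have [c Ec] := sym_rep_end (line_r <o> line_i).
have [e Ee] := sym_rep_end (hom_ptrace (line_i <o> line_r)).
(* The trace of r i on L equals that of i r on chi (x) V, taken over V and then over chi. *)
have tr : c * n.+1%:R = e * (M + n).+1%:R.
  have -> : e * (M + n).+1%:R = \tr (e%:M : 'M_((M + n).+1)) by rewrite mxtrace_scalar mulr_natr.
  have -> : c * n.+1%:R = \tr (c%:M : 'M_n.+1) by rewrite mxtrace_scalar mulr_natr.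
  by rewrite -Ee -Ec [LHS]mxtrace_mulC [LHS]trace_ptrace.
(* The scalar e is read off at the entry (0, 0). There [line_i] only sees l = 0, and since the
   invariant forms are antidiagonal a single product of nonzero entries survives. *)
have e0 : e != 0.
  have [ka ka0 Eka] := vec_gram.
  have -> : e = ptrace (line_i *m line_r) ord0 ord0.
    have := congr1 (fun A : 'M_((M + n).+1) => A ord0 ord0) Ee; rewrite [RHS]mxE eqxx mulr1n => <-.
    by [].
  rewrite line_rE; move: (hom_mx line_i) line_i_entry => li liE.
  have iE a (l : 'I_n.+1) : li (mxtens_index (ord0, a)) l = T' ord0 a * (l == ord0)%:R.
    rewrite liE (bigD1 ord0) //= [X in _ + X]big1 ?addr0 => [|b b0]; last first.
      rewrite (_ : (0 == b + l)%N = false) ?mulr0 //; apply/negbTE; move: b0; rewrite -val_eqE /=; lia.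
    by rewrite add0n eq_sym.
  have rE a : (gram K n *m (li^T *m (G' *t 1%:M))) ord0 (mxtens_index (ord0, a)) = (-1) ^+ n * \sum_(b < M.+1) T' b a * G' (inord (b + n)) ord0.
    have Gn0 := @gram_row0 n; move: (gram K n) Gn0 => Gn Gn0.
    rewrite mxE (bigD1 ord_max) // [X in _ + X = _]big1 => [|l /negPf lm]; last first.
      by rewrite Gn0 -[(val l == n)]/(l == ord_max) lm !mul0r.
    rewrite [LHS]addr0 Gn0 eqxx mul1r; congr (_ * _); rewrite mxE sum_tidx.
    transitivity (\sum_(k < (M + n).+1) li (mxtens_index (k, a)) ord_max * G' k ord0).
      apply: eq_bigr => k _; rewrite (bigD1 a) //= big1 ?addr0 => [|b /negPf ba].
        by rewrite [X in X * _]mxE tensmxE [X in _ * (_ * X)]mxE eqxx mulr1.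
      by rewrite tensmxE [X in _ * (_ * X)]mxE ba !mulr0.
    under eq_bigr => k _ do rewrite liE mulr_suml.
    rewrite exchange_big; apply: eq_bigr => b _ /=.
    have bn : (b + n < (M + n).+1)%N by rewrite ltnS leq_add2r -ltnS.
    rewrite (bigD1 (inord (b + n))) //= inordK // eqxx mulr1 big1 ?addr0 // => k /negPf kb.
    rewrite (_ : (k == b + n :> nat)%N = false) ?mulr0 ?mul0r //.
    by apply/negbTE; apply: contraFneq kb => kb; apply/eqP/val_inj; rewrite /= inordK.
  move: rE; move: (gram K n *m (li^T *m (G' *t 1%:M))) => lr rE.
  have -> : ptrace (li *m lr) ord0 ord0 = (-1) ^+ n * (ka * ((-1) ^+ M * G' ord_max ord0)).
    transitivity (\sum_a T' ord0 a * ((-1) ^+ n * \sum_(b < M.+1) T' b a * G' (inord (b + n)) ord0)).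
      rewrite mxE; apply: eq_bigr => a _; rewrite mxE (bigD1 ord0) //= big1 ?addr0 => [|l /negPf l0].
        by rewrite iE eqxx mulr1 rE.
      by rewrite iE l0 mulr0 mul0r.
    transitivity ((-1) ^+ n * \sum_(b < M.+1) (T' *m (T' : 'M_(_, _))^T) ord0 b * G' (inord (b + n)) ord0).
      under eq_bigr => a _ do rewrite mulrCA mulr_sumr.
      rewrite -mulr_sumr exchange_big; congr (_ * _); apply: eq_bigr => b _.
      by rewrite mxE mulr_suml; apply: eq_bigr => a _; rewrite mxE mulrA.
    congr (_ * _); rewrite Eka (bigD1 ord_max) //= big1 ?addr0 => [|b /negPf bM]; rewrite mxE gram_row0.
      by rewrite eqxx mul1r -mulrA; congr (_ * (_ * G' _ _)); apply: val_inj; rewrite /= inordK.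
    by rewrite -[(val b == M)]/(b == ord_max) bM !(mul0r, mulr0).
  by rewrite !mulf_neq0 ?signr_eq0 // G'0.
have c0 : c != 0.
  by apply: contraNneq e0 => c0; move: tr; rewrite c0 mul0r => /esym/eqP; rewrite mulf_eq0 (negPf dimchi) orbF.
exists (hom_scale c^-1 line_r), line_i; rewrite hom_scaleE.
have E : line_r *m line_i = c%:M := Ec.
by rewrite E scale_scalar_mx mulVf.
Qed.
End SymLine.

(** * Uniqueness and symmetry of the invariant form on Sym^n *)

Section SymForm.
Variables (K : closedFieldType) (p n : nat).
Hypothesis charK : p \in [pchar K].
Hypothesis np : (n < p)%N.
Notation X := (sym_rep K n).

Definition form_mx (b : rep_hom (rep_tens X X) (unit_rep K)) : 'M[K]_n.+1 :=
  \matrix_(j, i) b 0 (mxtens_index (i, j)).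
Lemma form_mxE (b : rep_hom (rep_tens X X) (unit_rep K)) (x y : 'cV_n.+1) : (b *m (x *# y)) 0 0 = (y^T *m (form_mx b *m x)) 0 0.
Proof.
rewrite [LHS]mxE [RHS]mxE sum_tidx exchange_big; apply: eq_bigr => j _ /=.
rewrite [(_ *m x) _ _]mxE mulr_sumr; apply: eq_bigr => i _.
by rewrite [form_mx b j i]mxE [(x *# y) _ 0]mxE mxtens_indexK /= [y^T _ _]mxE; ring.
Qed.
Lemma form_mx_proof (b : rep_hom (rep_tens X X) (unit_rep K)) : is_equivariant (X := X) (Y := dual_rep X) (form_mx b).
Proof.
move=> g dg; apply: cV_ext => x; apply/colP => j.
have E (A : 'cV[K]_n.+1) : A j 0 = ((ev j : 'cV[K]_n.+1)^T *m A) 0 0.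
  rewrite mxE (bigD1 (j : 'I_n.+1)) //= !mxE !eqxx mul1r big1 ?addr0 // => i /negPf ij.
  by rewrite !mxE ij mul0r.
have [e1 e2] := act_invmx X dg.
have -> : rep_act (dual_rep X) g = (rep_act X (invmx g))^T by [].
rewrite !E -!mulmxA -form_mxE (mulmxA (_^T) (_^T)) -trmx_mul -form_mxE.
have -> : rep_act X g *m x *# ev j = rep_act (rep_tens X X) g *m (x *# (rep_act X (invmx g) *m ev j)).
  by rewrite mul_tens_tv (mulmxA (rep_act X g) (rep_act X (invmx g))) e2 mul1mx.
by rewrite mulmxA (homP b dg) mul1mx.
Qed.
(** Composed with the inverse form [gram], both forms become scalar endomorphisms. *)
Lemma sym_form (B b : rep_hom (rep_tens X X) (unit_rep K)) : hom_mx B != 0 -> exists c, hom_mx b = c *: hom_mx B.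
Proof.
move=> B0; have [c Ec] := sym_rep_end (gram K n <o> RepHom (form_mx_proof b)).
have [c' Ec'] := sym_rep_end (gram K n <o> RepHom (form_mx_proof B)).
have [f fK] := gram_linv charK np.
have Eb b' u : hom_mx (gram K n <o> RepHom (form_mx_proof b')) = u%:M -> form_mx b' = u *: f.
  by move=> e; rewrite -[LHS]mul1mx -fK -mulmxA [X in _ *m X]e mul_mx_scalar.
have c'0 : c' != 0.
  apply: contraNneq B0 => c'0; have := Eb _ _ Ec'; rewrite c'0 scale0r => z.
  apply/eqP/matrixP => i l; case: (mxtens_indexP l) => a e; rewrite ord1.
  by have := congr1 (fun A : 'M_n.+1 => A e a) z; rewrite !mxE.
exists (c / c'); apply/matrixP => i l; case: (mxtens_indexP l) => a e; rewrite ord1 [RHS]mxE.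
have := congr1 (fun A : 'M_n.+1 => A e a) (Eb _ _ Ec); rewrite !mxE => ->.
by have := congr1 (fun A : 'M_n.+1 => A e a) (Eb _ _ Ec'); rewrite !mxE => ->; rewrite mulrA divfK.
Qed.
(** Every invariant form is a multiple of the inverse of [gram], whose transpose carries the sign
    (-1)^n. *)
Lemma sym_form_braid (b : rep_hom (rep_tens X X) (unit_rep K)) :
  b <o> hom_braid X X = (-1) ^+ n *: hom_mx b :> 'M_(_, _).
Proof.
have [c Ec] := sym_rep_end (gram K n <o> RepHom (form_mx_proof b)).
have [f fK] := gram_linv charK np.
have Eb : form_mx b = c *: f by rewrite -[LHS]mul1mx -fK -mulmxA [X in _ *m X]Ec mul_mx_scalar.
have ft : f^T = (-1) ^+ n *: f.
  have gf : (-1) ^+ n *: (gram K n *m f^T) = 1%:M.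
    by rewrite scalemxAl -gram_tr -trmx_mul fK trmx1.
  rewrite -[f in RHS]mulmx1 -gf -scalemxAr scalerA -expr2 sqrr_sign scale1r mulmxA fK.
  by rewrite mul1mx.
apply: tens_ext => x y; rewrite (hom_compE b) braidE; apply/colP => z; rewrite !ord1 -scalemxAl [RHS]mxE !form_mxE.
have -> : (x^T *m (form_mx b *m y)) 0 0 = (y^T *m ((form_mx b)^T *m x)) 0 0.
  by rewrite -[x^T *m _]trmxK mxE !trmx_mul trmxK mulmxA.
by rewrite Eb linearZ /= ft scalerA mulrC -scalerA -scalemxAl -scalemxAr [LHS]mxE.
Qed.
End SymForm.

(** * Generation of SL(2) by unipotent elements *)

Section SL2.
Variable K : closedFieldType.
Lemma sl2_gen (P : 'M[K]_2 -> Prop) :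
  (forall g h, \det g = 1 -> \det h = 1 -> P g -> P h -> P (g *m h)) ->
  (forall a, P (mx2 1 a 0 1)) -> (forall a, P (mx2 1 0 a 1)) -> forall g, \det g = 1 -> P g.
Proof.
move=> PM PU PL.
have dU a : \det (mx2 (1 : K) a 0 1) = 1 by rewrite det_mx2 mulr0 subr0 mulr1.
have dL a : \det (mx2 (1 : K) 0 a 1) = 1 by rewrite det_mx2 mul0r subr0 mulr1.
(* For c nonzero the matrix is a product upper, lower, upper of unipotent elements. *)
have step a b c d : c != 0 -> a * d - b * c = 1 -> P (mx2 a b c d).
  move=> c0 dt; have -> : mx2 a b c d = mx2 1 ((a - 1) / c) 0 1 *m mx2 1 0 c 1 *m mx2 1 ((d - 1) / c) 0 1.
    rewrite !mx2_mul; congr mx2; rewrite ?(mulr0, mul0r, mulr1, mul1r, addr0, add0r).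
    - by rewrite divfK // addrC subrK.
    - rewrite divfK // [1 + _]addrC subrK; apply: (mulIf c0).
      by rewrite mulrDl mulrA !divfK // mulrBr mulr1 addrA subrK -dt opprB addrC subrK.
    - by [].
    - by rewrite mulrC divfK // subrK.
  by apply: (PM) => //; rewrite ?det_mulmx ?dU ?dL ?mulr1 //; apply: PM.
move=> g; rewrite [g]mx2_eta det_mx2; move: (g 0 0) (g 0 1) (g 1 0) (g 1 1) => a b c d dt.
have [c0|] := eqVneq c 0; last by move=> c0; apply: step.
have d0 : d != 0 by apply: contra_eq_neq dt => ->; rewrite c0 !mulr0 subrr eq_sym oner_neq0.
(* For c = 0, splitting off a lower unipotent element leaves a matrix with d, which is not 0, in the
   lower left corner. *)
have -> : mx2 a b c d = mx2 (a + b) b (c + d) d *m mx2 1 0 (-1) 1.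
  by rewrite mx2_mul !mulr1 !mulrN1 !mulr0 !addrK !add0r.
apply: PM => //; first by rewrite det_mx2 -[RHS]dt; ring.
by apply: step; rewrite ?c0 ?add0r // -[RHS]dt c0; ring.
Qed.

Lemma coef_lin_pow (a b : K) n i : ((a%:P + b *: 'X) ^+ n)`_i = a ^+ (n - i) * b ^+ i * 'C(n, i)%:R.
Proof.
rewrite exprDn coef_sum; have [iN|iN] := leqP i n; last first.
  rewrite bin_small // mulr0 big1 // => l _; rewrite coefMn exprZn -scalerAr -polyC_exp coefZ coefCM coefXn.
  by rewrite (_ : (i == l)%N = false) ?mulr0 ?mul0rn //; apply/negbTE; have := ltn_ord l; lia.
have iN' : (i < n.+1)%N by [].
rewrite (bigD1 (Ordinal iN')) //= big1 ?addr0 => [|l]; rewrite ?coefMn exprZn -scalerAr -polyC_exp coefZ coefCM coefXn.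
  by rewrite eqxx mulr1 [RHS]mulr_natr [b ^+ i * _]mulrC.
by rewrite -val_eqE /= eq_sym => /negPf->; rewrite !mulr0 mul0rn.
Qed.
End SL2.

(** * The principal homomorphism makes the vector representation Sym^(2m) *)

Section Intertwiner.
Variables (K : closedFieldType) (m p : nat).
Hypothesis charK : p \in [pchar K].
Hypothesis mp : (m.*2 < p)%N.
Hypothesis two : 2%:R != 0 :> K.
Variable im : K.
Hypothesis im2 : im * im = -1.
Variable phi : principal_hom K m.
Notation N := (m.*2.+1).

Definition eps_at (i : nat) : K := if (i.+1 < m)%N then 1 else if i.+1 == m then 2%:R else -1.
Lemma eps_at0 i : eps_at i != 0.
Proof. by rewrite /eps_at; case: ifP => _; [apply: oner_neq0|case: ifP => _ //; rewrite oppr_eq0 oner_neq0]. Qed.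
(** Diagonal rescaling with tw(i+1)/tw(i) = (i+1)/eps(i). It conjugates [principal_e] into [Emx],
    and [principal_f] into [Fmx] because the products of opposite entries agree. *)
Definition tw (i : nat) : K := \prod_(j < i) (j.+1%:R / eps_at j).
Lemma twS i : tw i.+1 = tw i * (i.+1%:R / eps_at i).
Proof. by rewrite /tw big_ord_recr. Qed.
Definition twm : 'M[K]_N := diag_mx (\row_i tw i).
(** [Emx] and [Fmx] are the derivations y -> x and x -> y on the monomials of degree 2m. *)
Definition Emx : 'M[K]_N := \matrix_(i, j) if j == i.+1 :> nat then i.+1%:R else 0.
Definition Fmx : 'M[K]_N := \matrix_(i, j) if i == j.+1 :> nat then (m.*2 - j)%:R else 0.

Lemma e_twm : principal_e K m *m twm = twm *m Emx.
Proof.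
apply/matrixP => i j; rewrite mul_mx_diag mul_diag_mx !mxE; case: eqP => [->|_]; last by rewrite mul0r mulr0.
by rewrite -/(eps_at i) twS mulrCA [eps_at i * _]mulrC divfK ?eps_at0.
Qed.
Lemma f_twm : principal_f K m *m twm = twm *m Fmx.
Proof.
apply/matrixP => i j; rewrite mul_mx_diag mul_diag_mx !mxE; case: eqP => [e|_]; last by rewrite mul0r mulr0.
rewrite e -/(eps_at j) twS natrM; move: (eps_at j) (eps_at0 j) => x x0.
by field.
Qed.

Lemma nilp_exp_conj (A A' D : 'M[K]_N) a : A *m D = D *m A' -> nilp_exp (a *: A) *m D = D *m nilp_exp (a *: A').
Proof.
move=> AD; rewrite /nilp_exp mulmx_suml mulmx_sumr; apply: eq_bigr => r _.
rewrite -scalemxAl -scalemxAr; congr (_ *: _); elim: (val r) => [|k IHk].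
  by rewrite !expr0 mul1mx mulmx1.
have aAD : (a *: A) *m D = D *m (a *: A') by rewrite -scalemxAl AD scalemxAr.
by rewrite !exprS -!mulmxE -mulmxA IHk mulmxA aAD -mulmxA.
Qed.

Lemma Emx_pow r i j : (Emx ^+ r) i j = if j == (i + r)%N :> nat then (j ^_ r)%:R else 0.
Proof.
elim: r i => [|r IHr] i; first by rewrite expr0 mxE addn0 -val_eqE eq_sym /=; case: eqP.
rewrite exprS -mulmxE mxE; have [iN|iN] := ltnP i.+1 N.
  rewrite (bigD1 (Ordinal iN)) //= big1 ?addr0 => [|k]; last first.
    by rewrite mxE -val_eqE /= => /negPf->; rewrite mul0r.
  rewrite mxE eqxx IHr /= addSnnS; case: eqP => [e|_]; last by rewrite mulr0.
  by rewrite ffactnSr natrM mulrC e; congr (_ * _%:R); lia.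
rewrite big1 => [|k _].
  by case: eqP => // e; have := ltn_ord j; lia.
by rewrite mxE; case: eqP => [e|_]; rewrite ?mul0r //; have := ltn_ord k; lia.
Qed.
Lemma Fmx_pow r i j : (Fmx ^+ r) i j = if i == (j + r)%N :> nat then ((m.*2 - j) ^_ r)%:R else 0.
Proof.
elim: r j => [|r IHr] j; first by rewrite expr0 mxE addn0 -val_eqE /=; case: eqP.
rewrite exprSr -mulmxE mxE; have [jN|jN] := ltnP j.+1 N.
  rewrite (bigD1 (Ordinal jN)) //= big1 ?addr0 => [|k]; last first.
    by rewrite [X in _ * X]mxE -val_eqE /= => /negPf->; rewrite mulr0.
  rewrite [X in _ * X]mxE eqxx IHr /= addSnnS; case: eqP => [e|_]; last by rewrite mul0r.
  by rewrite ffactnS natrM mulrC subnS.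
rewrite big1 => [|k _].
  by case: eqP => // e; have := ltn_ord i; lia.
by rewrite [X in _ * X]mxE; case: eqP => [e|_]; rewrite ?mulr0 //; have := ltn_ord k; lia.
Qed.

Lemma nilp_expE (A : 'M[K]_N) a i j : nilp_exp (a *: A) i j = \sum_(r < N) (r`!%:R)^-1 * (a ^+ r * (A ^+ r) i j).
Proof. by rewrite /nilp_exp summxE; apply: eq_bigr => r _; rewrite exprZn !mxE. Qed.

Lemma ffact_div n r : (r <= m.*2)%N -> (r`!%:R)^-1 * (n ^_ r)%:R = 'C(n, r)%:R :> K.
Proof.
move=> rM; rewrite -bin_ffact natrM mulrC mulfK //; exact: pchar_fact_neq0 charK mp _ rM.
Qed.

(** Powers of [Emx] have falling factorials as entries; divided by r! they become the binomial
    coefficients of the group action. Here r <= 2m < p makes r! invertible. *)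
Lemma exp_Emx a : nilp_exp (a *: Emx) = sym_act m.*2 (mx2 1 a 0 1).
Proof.
apply/matrixP => i j; rewrite nilp_expE mxE !mx2E scale0r addr0 polyC1 expr1n mul1r coef_lin_pow expr1n mulr1.
have [ij|ij] := leqP i j; last first.
  rewrite bin_small // mulr0 big1 // => r _; rewrite Emx_pow.
  by rewrite (_ : (j == i + r :> nat)%N = false) ?mulr0 //; apply/negbTE; lia.
have jN : (j - i < N)%N by have := ltn_ord j; lia.
rewrite (bigD1 (Ordinal jN)) //= big1 ?addr0 => [|r]; rewrite Emx_pow.
  by rewrite subnKC // eqxx mulrCA ffact_div ?bin_sub //; have := ltn_ord j; lia.
rewrite -val_eqE /= => rj; rewrite (_ : (j == i + r :> nat)%N = false) ?mulr0 //; apply/negbTE.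
by apply: contraNneq rj => ->; rewrite addKn.
Qed.
Lemma exp_Fmx a : nilp_exp (a *: Fmx) = sym_act m.*2 (mx2 1 0 a 1).
Proof.
apply/matrixP => i j; rewrite nilp_expE mxE !mx2E polyC0 add0r scale1r coefMXn.
case: ltnP => [ij|ij].
  rewrite big1 // => r _; rewrite Fmx_pow.
  by rewrite (_ : (i == j + r :> nat)%N = false) ?mulr0 //; apply/negbTE; lia.
rewrite coef_lin_pow expr1n mul1r.
have iN : (i - j < N)%N by have := ltn_ord i; lia.
rewrite (bigD1 (Ordinal iN)) //= big1 ?addr0 => [|r]; rewrite Fmx_pow.
  by rewrite subnKC // eqxx mulrCA ffact_div //; have := ltn_ord i; lia.
rewrite -val_eqE /= => rj; rewrite (_ : (i == j + r :> nat)%N = false) ?mulr0 //; apply/negbTE.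
by apply: contraNneq rj => ->; rewrite addKn.
Qed.

Notation C := (orth_mx m im).
Notation V := (vec_rep two im2 phi).

(** A lift of G conjugates the gamma matrices by G, which is how [vec_act] is characterized, up to
    the change of basis [C]. *)
Lemma vec_lift g G : \det g = 1 -> spin_lifts (phi g) G -> C *m vec_act im phi g = G *m C.
Proof.
move=> dg lift; apply: cV_ext => x; rewrite -!mulmxA.
have e : vgam im (vec_act im phi g *m x) = gamma (G *m (C *m x)).
  by apply: (phi_cancel (phi := phi) dg); rewrite -(vec_actE two im2) // [LHS]lift.
have [y Ey] := gamma_vgam two im2 (G *m (C *m x)).
rewrite Ey in e; rewrite (vgam_inj two im2 e).
have Cu : C \in unitmx by apply: orth_mx_unit.
have e2 : vgam im y = vgam im (invmx C *m (G *m (C *m x))).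
  by rewrite -Ey /vgam mulKVmx.
by rewrite (vgam_inj two im2 e2) mulKVmx.
Qed.

Definition inter_mx : 'M[K]_N := invmx C *m twm.
(** Equivariance is multiplicative in g, so it is checked on unipotent elements, where [phi] is
    prescribed and the exponentials can be compared. *)
Lemma inter_proof : is_equivariant (X := sym_rep K m.*2) (Y := V) inter_mx.
Proof.
have Cu : C \in unitmx by apply: orth_mx_unit.
have key g G H : \det g = 1 -> spin_lifts (phi g) G -> G *m twm = twm *m H -> H = sym_act m.*2 g ->
    inter_mx *m sym_act m.*2 g = vec_act im phi g *m inter_mx.
  move=> dg lift GH <-; rewrite /inter_mx -mulmxA -GH; apply: (can_inj (mulKmx Cu)).
  by rewrite (mulKVmx Cu) mulmxA (vec_lift dg lift) -mulmxA (mulKVmx Cu).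
have dU a : \det (mx2 (1 : K) a 0 1) = 1 by rewrite det_mx2 mulr0 subr0 mulr1.
have dL a : \det (mx2 (1 : K) 0 a 1) = 1 by rewrite det_mx2 mul0r subr0 mulr1.
apply: sl2_gen => [g h dg dh Hg Hh|a|a].
- have [_ SM _] := actP (sym_rep K m.*2); have [_ VM _] := actP V.
  by rewrite [rep_act _ (g *m h)]SM // [rep_act V (g *m h)]VM // mulmxA Hg -(mulmxA (rep_act V g)) Hh mulmxA.
- apply: (key _ _ _ (dU a) (principal_upper phi a) (nilp_exp_conj a e_twm)); exact: exp_Emx.
apply: (key _ _ _ (dL a) (principal_lower phi a) (nilp_exp_conj a f_twm)); exact: exp_Fmx.
Qed.
Definition inter : rep_hom (sym_rep K m.*2) V := RepHom inter_proof.

Lemma tw_neq0 i : (i <= m.*2)%N -> tw i != 0.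
Proof.
elim: i => [|i IHi] iM; first by rewrite /tw big_ord0 oner_neq0.
rewrite twS mulf_neq0 ?IHi ?(ltnW iM) // mulf_neq0 ?invr_eq0 ?eps_at0 //.
have := pchar_fact_neq0 charK mp iM; rewrite factS natrM mulf_eq0 negb_or => /andP[].
by [].
Qed.
Lemma inter_inv : exists T' : rep_hom V (sym_rep K m.*2), T' *m inter = 1%:M /\ inter *m T' = 1%:M.
Proof.
apply: hom_inverse => //; apply: (rank_linv (B := diag_mx (\row_i (tw i)^-1) *m C)).
have Cu : C \in unitmx by apply: orth_mx_unit.
rewrite /= /inter_mx mulmxA -(mulmxA _ C) mulmxV // mulmx1 /twm mulmx_diag.
apply/matrixP => i j; rewrite !mxE mulVf ?tw_neq0 //.
by rewrite -ltnS.
Qed.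
End Intertwiner.

(** * Direct sums of ind-objects *)

Section SumObjects.
Variable K : closedFieldType.
Implicit Types X Y Z W : ind K.

Lemma comp_point X Y Z (g : mor Y Z) (f : mor X Y) i l j0 :
  (forall j, j = j0) -> (g <oo> f) i l = g j0 l *m f i j0 :> 'M_(_, _).
Proof. by move=> all; apply: comp_monoR => j; rewrite (all j) eqxx. Qed.

Lemma copair_inl X Y Z (f : mor X Z) (g : mor Y Z) : mor_copair f g <oo> mor_inl X Y =m f.
Proof.
apply: meq_mx => i l.
by rewrite (comp_maps_to _ _ (@maps_to_map K X (ind_sum X Y) inl (fun i => hom_id (X i)) i)) mulmx1.
Qed.
Lemma copair_inr X Y Z (f : mor X Z) (g : mor Y Z) : mor_copair f g <oo> mor_inr X Y =m g.
Proof.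
apply: meq_mx => i l.
by rewrite (comp_maps_to _ _ (@maps_to_map K Y (ind_sum X Y) inr (fun i => hom_id (Y i)) i)) mulmx1.
Qed.
Lemma copair_add X Y Z (f : mor X Z) (g : mor Y Z) :
  mor_copair f g =m mor_add (f <oo> mor_prl X Y) (g <oo> mor_prr X Y).
Proof.
apply: meq_mx => -[] i l.
  have H1 : maps_to (mor_prl X Y) (i := inl i) (j := i) 1%:M by have [] := maps_to_id i.
  transitivity (hom_mx ((f <oo> mor_prl X Y) (inl i) l) + hom_mx ((g <oo> mor_prr X Y) (inl i) l)); last by [].
  by rewrite (comp_maps_to _ _ H1) mulmx1 [X in _ + X](_ : _ = 0) ?addr0.
have H1 : maps_to (mor_prr X Y) (i := inr i) (j := i) 1%:M by have [] := maps_to_id i.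
transitivity (hom_mx ((f <oo> mor_prl X Y) (inr i) l) + hom_mx ((g <oo> mor_prr X Y) (inr i) l)); last by [].
by rewrite (comp_maps_to _ _ H1) mulmx1 [X in X + _](_ : _ = 0) ?add0r.
Qed.
Lemma sum_id X Y : mor_add (mor_inl X Y <oo> mor_prl X Y) (mor_inr X Y <oo> mor_prr X Y) =m mor_id (ind_sum X Y).
Proof.
rewrite -copair_add; apply: meq_mx => -[] i l.
  transitivity (hom_mx (mor_inl X Y i l)); first by [].
  have [->|ne] := eqVneq l (inl i : idx (ind_sum X Y)).
    by rewrite (mor_mapE (X := X) (Y := ind_sum X Y) (u := inl) (fun i => hom_id (X i)) i) mor_idE.
  refine (etrans (mor_map0 (X := X) (Y := ind_sum X Y) (u := inl) (fun i => hom_id (X i)) ne) _).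
  exact: (esym (@mor_id0 K (ind_sum X Y) (inl i) l ne)).
transitivity (hom_mx (mor_inr X Y i l)); first by [].
have [->|ne] := eqVneq l (inr i : idx (ind_sum X Y)).
  by rewrite (mor_mapE (X := Y) (Y := ind_sum X Y) (u := inr) (fun i => hom_id (Y i)) i) mor_idE.
refine (etrans (mor_map0 (X := Y) (Y := ind_sum X Y) (u := inr) (fun i => hom_id (Y i)) ne) _).
  exact: (esym (@mor_id0 K (ind_sum X Y) (inr i) l ne)).
Qed.
Lemma meq_opp_eq0 X Y (f : mor X Y) : 2%:R != 0 :> K -> f =m mor_opp f -> f =m mor_zero _ _.
Proof.
move=> two E i j; apply/heq_tr => h; have /heq_tr/(_ h) := E i j.
rewrite hom_zeroE mxtrace0 hom_oppE raddfN /= => /eqP; rewrite -subr_eq0 opprK -mulr2n -mulr_natl.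
by rewrite mulf_eq0 (negPf two) => /eqP.
Qed.
Lemma mor_add0 X Y (f : mor X Y) : mor_add f (mor_zero _ _) =m f.
Proof. by apply: meq_mx => i j /=; rewrite addr0. Qed.
Lemma mor_0add X Y (f : mor X Y) : mor_add (mor_zero _ _) f =m f.
Proof. by apply: meq_mx => i j /=; rewrite add0r. Qed.
Lemma comp_mid X Y Z W (f : mor Y W) (g : mor Z Y) (h : mor Y Z) (k : mor X Y) (id_ : mor X W) :
  g <oo> h =m mor_id _ -> f <oo> k =m id_ -> (f <oo> g) <oo> (h <oo> k) =m id_.
Proof. by move=> gh <-; rewrite -!mor_compA (mor_compA g) gh mor_compIdf. Qed.
Lemma comp_mid0 X Y Z Y' W (f : mor Y W) (k : mor X Y') (g : mor Z Y) (h : mor Y' Z) :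
  g <oo> h =m mor_zero _ _ -> (f <oo> g) <oo> (h <oo> k) =m mor_zero _ _.
Proof. by move=> gh; rewrite -!mor_compA (mor_compA g) gh mor_zerol mor_zeror. Qed.
Lemma copair_iso X Y Z (f : mor X Z) (g : mor Y Z) (f' : mor Z X) (g' : mor Z Y) :
  f' <oo> f =m mor_id _ -> g' <oo> g =m mor_id _ -> f' <oo> g =m mor_zero _ _ -> g' <oo> f =m mor_zero _ _ ->
  mor_add (f <oo> f') (g <oo> g') =m mor_id _ -> mor_iso (mor_copair f g).
Proof.
move=> ff gg fg gf fgid; exists (mor_add (mor_inl X Y <oo> f') (mor_inr X Y <oo> g')); split; last first.
  by rewrite mor_addr !mor_compA copair_inl copair_inr.
rewrite copair_add mor_addr !mor_addl !mor_compA.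
rewrite -!(mor_compA _ _ f) -!(mor_compA _ _ g) ff gg fg gf !mor_compfId !mor_zeror !mor_zerol.
by rewrite mor_add0 mor_0add sum_id.
Qed.
Lemma comp_tens_reassoc X Y Z T U V W Q (f : mor (ind_tens Z T) Q) (a : mor Y Z) (m : mor X Y) (c : mor X Z)
    (h1 : mor U (ind_tens X T)) (h2 : mor V U) (h3 : mor W V) :
  a <oo> m =m c ->
  (f <oo> (a <xx> mor_id T)) <oo> ((m <xx> mor_id T) <oo> h1 <oo> h2 <oo> h3) =m
  (f <oo> (c <xx> mor_id T)) <oo> (h1 <oo> (h2 <oo> h3)).
Proof.
move=> <-; have -> : (a <oo> m) <xx> mor_id T =m (a <xx> mor_id T) <oo> (m <xx> mor_id T).
  by rewrite -mor_tens_comp mor_compfId.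
by rewrite !mor_compA.
Qed.
End SumObjects.

(** * The queer algebra as End(S) + End(S) (x) chi *)

Section QueerLine.
Variables (K : closedFieldType) (chi : rep K) (alpha : rep_hom (rep_tens chi chi) (unit_rep K)) (S : rep K).
Local Notation E := (inner_hom S S).
Local Notation Ec := (inner_hom S (rep_tens S chi)).
Local Notation Q := (queer_obj chi S).
Local Notation mQ := (queer_mult alpha S).
Local Notation ec := (end_comp S).

(** The same decomposition as [qin], with the line placed behind End(S) to match the odd summand of
    the twisted algebra. *)
Definition qj0 : rep_hom E Q := hom_inl E Ec.
Definition qj1 : rep_hom (rep_tens E chi) Q := qin chi S true <o> hom_braid E chi.
Definition qp0 : rep_hom Q E := hom_prl E Ec.
Definition qp1 : rep_hom Q (rep_tens E chi) := hom_braid chi E <o> qpr chi S true.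

Lemma qj0E (q : 'cV_(rep_dim E)) : qj0 *m q = qin chi S false *m ((1%:M : 'cV_1) *# q).
Proof. by rewrite qinE0 mxE eqxx scale1r. Qed.
Lemma qj1E (q : 'cV_(rep_dim E)) (s : 'cV_(rep_dim chi)) : qj1 *m (q *# s) = qin chi S true *m (s *# q).
Proof. by rewrite (hom_compE (qin chi S true)) braidE. Qed.

Lemma qin_mult b b' (c : 'cV_(rep_dim (chib chi b))) (c' : 'cV_(rep_dim (chib chi b'))) (q q' : 'cV_(rep_dim E)) :
  mQ *m ((qin chi S b *m (c *# q)) *# (qin chi S b' *m (c' *# q'))) =
  qin chi S (b (+) b') *m ((mu2 alpha b b' *m (c *# c')) *# (ec *m (q *# q'))).
Proof.
have := congr1 (fun A : 'M_(_, rep_dim (rep_tens (rep_tens (chib chi b) E) (rep_tens (chib chi b') E))) =>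
  A *m ((c *# q) *# (c' *# q'))) (queer_mult_qin S alpha b b').
rewrite (hom_compE mQ) hom_tensE => ->.
by rewrite (hom_compE _ (hom_mid _ _ _ _)) midE (hom_compE (qin chi S _)) hom_tensE.
Qed.

Lemma mu2_0 b' (c' : 'cV_(rep_dim (chib chi b'))) : mu2 alpha false b' *m ((1%:M : 'cV[K]_1) *# c') = c'.
Proof. by transitivity ((1%:M : 'cV[K]_1) 0 0 *: c'); [exact: lunitE | rewrite mxE eqxx scale1r]. Qed.
Lemma mu2_10 (c : 'cV_(rep_dim chi)) : mu2 alpha true false *m (c *# (1%:M : 'cV[K]_1)) = c.
Proof. by transitivity ((1%:M : 'cV[K]_1) 0 0 *: c); [exact: runitE | rewrite mxE eqxx scale1r]. Qed.

Lemma q00 (q q' : 'cV_(rep_dim E)) : mQ *m ((qj0 *m q) *# (qj0 *m q')) = qj0 *m (ec *m (q *# q')).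
Proof. by rewrite !qj0E (qin_mult (b := false) (b' := false)) mu2_0. Qed.
Lemma q01 (q q' : 'cV_(rep_dim E)) (s : 'cV_(rep_dim chi)) :
  mQ *m ((qj0 *m q) *# (qj1 *m (q' *# s))) = qj1 *m ((ec *m (q *# q')) *# s).
Proof. by rewrite qj0E !qj1E (qin_mult (b := false) (b' := true)) mu2_0. Qed.
Lemma q10 (q q' : 'cV_(rep_dim E)) (s : 'cV_(rep_dim chi)) :
  mQ *m ((qj1 *m (q *# s)) *# (qj0 *m q')) = qj1 *m ((ec *m (q *# q')) *# s).
Proof. by rewrite qj0E !qj1E (qin_mult (b := true) (b' := false)) mu2_10. Qed.
Lemma q11 (q q' : 'cV_(rep_dim E)) (s t : 'cV_(rep_dim chi)) :
  mQ *m ((qj1 *m (q *# s)) *# (qj1 *m (q' *# t))) = (alpha *m (s *# t)) 0 0 *: (qj0 *m (ec *m (q *# q'))).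
Proof. by rewrite !qj1E (qin_mult (b := true) (b' := true)) [LHS]qinE0. Qed.

(** The four products for arbitrary maps A, B into End(S), in the shape in which the components of
    the twisted multiplication present them. *)
Lemma c00 (X Y : rep K) (A : 'M_(rep_dim E, rep_dim X)) (B : 'M_(rep_dim E, rep_dim Y)) :
  qj0 *m (ec *m (A *t B)) = mQ *m ((qj0 *m A) *t (qj0 *m B)).
Proof.
have := q00; move: (hom_mx mQ) (hom_mx qj0) (hom_mx ec) => q j e H.
by apply: tv_ext => x y; rewrite -!mulmxA !mul_tens_tv -!mulmxA H.
Qed.
Lemma c01 (X Y : rep K) (A : 'M_(rep_dim E, rep_dim X)) (B : 'M_(rep_dim E, rep_dim Y)) :
  qj1 *m ((ec *m (A *t B)) *t 1%:M) *m hom_assocV X Y chi = mQ *m ((qj0 *m A) *t (qj1 *m (B *t 1%:M))).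
Proof.
have := q01; move: (hom_mx mQ) (hom_mx qj0) (hom_mx qj1) (hom_mx ec) => q j j' e H.
apply: (@tens_extr _ X Y chi) => x y s; rewrite -!mulmxA assocVE !mul_tens_tv -!mulmxA !mul_tens_tv.
by rewrite !mul1mx H.
Qed.
Lemma c10 (X Y : rep K) (A : 'M_(rep_dim E, rep_dim X)) (B : 'M_(rep_dim E, rep_dim Y)) :
  qj1 *m ((ec *m (A *t B)) *t 1%:M) *m (hom_assocV X Y chi *m ((1%:M *t hom_braid chi Y) *m hom_assoc X chi Y))
  = mQ *m ((qj1 *m (A *t 1%:M)) *t (qj0 *m B)).
Proof.
have := q10; move: (hom_mx mQ) (hom_mx qj0) (hom_mx qj1) (hom_mx ec) => q j j' e H.
apply: (@tens_extl _ X chi Y) => x s y; rewrite -!mulmxA assocE !mul_tens_tv braidE !mul1mx assocVE !mul_tens_tv -!mulmxA !mul_tens_tv.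
by rewrite !mul1mx H.
Qed.
Lemma c11 (X Y : rep K) (A : 'M_(rep_dim E, rep_dim X)) (B : 'M_(rep_dim E, rep_dim Y)) h :
  (forall (x : 'cV_(rep_dim X)) (s : 'cV_(rep_dim chi)) (y : 'cV_(rep_dim Y)) (t : 'cV_(rep_dim chi)),
    h *m (x *# s *# (y *# t)) = (alpha *m (s *# t)) 0 0 *: (x *# y)) ->
  qj0 *m (ec *m (A *t B)) *m h = mQ *m ((qj1 *m (A *t 1%:M)) *t (qj1 *m (B *t 1%:M))).
Proof.
have := q11; move: (hom_mx mQ) (hom_mx qj0) (hom_mx qj1) (hom_mx ec) => q j j' e H hE.
apply: (@tens_ext22 _ X chi Y chi) => x s y t; rewrite -!mulmxA hE -!scalemxAr !mul_tens_tv -!mulmxA !mul_tens_tv.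
by rewrite !mul1mx H.
Qed.

Lemma qp0_qj0 : qp0 <o> qj0 = 1%:M :> 'M_(_, _).
Proof. by rewrite /= mul_row_col mul1mx mul0mx addr0. Qed.
Lemma qp0_qj1 : qp0 <o> qj1 = 0 :> 'M_(_, _).
Proof.
transitivity ((hom_prl E Ec *m hom_inr E Ec) *m (line_end chi S *m hom_braid E chi)).
  by rewrite /= !mulmxA.
by rewrite /= mul_row_col mul1mx mul0mx addr0 mul0mx.
Qed.
Lemma qp1_qj0 : qp1 <o> qj0 = 0 :> 'M_(_, _).
Proof. by rewrite /= -!mulmxA mul_row_col mul0mx mulmx0 addr0 !mulmx0. Qed.
Lemma qp1_qj1 : qp1 <o> qj1 = 1%:M :> 'M_(_, _).
Proof.
apply: tens_ext => q s; rewrite (hom_compE qp1) qj1E /qp1 (hom_compE (hom_braid chi E)) mul1mx.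
have := congr1 (fun A : 'M_(rep_dim (rep_tens chi E)) => A *m (s *# q)) (qpr_qin chi S true).
by rewrite (hom_compE (qpr chi S true)) mul1mx => ->; rewrite braidE.
Qed.
Lemma qj_qp : hom_add (qj0 <o> qp0) (qj1 <o> qp1) = 1%:M :> 'M_(_, _).
Proof.
apply: cV_ext => z; rewrite hom_addE mul1mx -[RHS](hom_dsum z); congr (_ + _).
  by rewrite (hom_compE qj0).
have bb (w : 'cV_(rep_dim (rep_tens chi E))) : hom_braid E chi *m (hom_braid chi E *m w) = w.
  elim/(@tens_elim _ chi E): w => [w w' Hw Hw'|s q]; first by rewrite !mulmxDr Hw Hw'.
  by rewrite !braidE.
rewrite (hom_compE qj1) /qj1 /qp1 (hom_compE (qin chi S true)) (hom_compE (hom_braid chi E)) bb.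
have := congr1 (fun A : 'M_(rep_dim Q) => A *m (hom_inr E Ec *m (hom_prr E Ec *m z))) (qin_qpr chi S).
rewrite hom_addE mul1mx (hom_compE (qin chi S true) (qpr chi S true)) => e; rewrite -[RHS]e.
have pl : hom_prl E Ec *m (hom_inr E Ec *m (hom_prr E Ec *m z)) = 0.
  by rewrite mulmxA mul_row_col mul1mx mul0mx addr0 mul0mx.
have pr : hom_prr E Ec *m (hom_inr E Ec *m (hom_prr E Ec *m z)) = hom_prr E Ec *m z.
  by rewrite mulmxA mul_row_col mul1mx mul0mx add0r mul1mx.
rewrite (hom_compE (qin chi S false)) [qpr chi S false *m _](hom_compE (lunitV E)) pl !mulmx0 add0r.
by congr (_ *m _); rewrite [LHS](hom_compE (end_line chi S)) [RHS](hom_compE (end_line chi S)) pr.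
Qed.
End QueerLine.

(** * Parity twist of an algebra isomorphic to the queer algebra of the unit line *)

Section Twist.
Variables (K : closedFieldType) (psi : rep K) (alpha : rep_hom (rep_tens psi psi) (unit_rep K)) (S : rep K).
Hypothesis two : 2%:R != 0 :> K.
Local Notation one := (unit_rep K).
Local Notation alpha1 := (hom_lunit one).
Local Notation E := (inner_hom S S).
Local Notation Q1 := (queer_algebra alpha1 S).
Local Notation QA := (queer_algebra alpha S).
Variables (U : rep K) (Z : ind K) (R : mor Z (tens_alg U)) (A : quotient_algebra R) (D : parity_decomposition A).
Variables (eta : mor A Q1) (etai : mor Q1 A).
Hypothesis eta_alg : alg_morphism eta.
Hypothesis etaK : etai <oo> eta =m mor_id A.
Hypothesis etaiK : eta <oo> etai =m mor_id Q1.

(** For the unit line the queer algebra is two copies of End(S); [y_] and [x_] are the inclusions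
    and projections, and [sg] is -1 on the second copy. *)
Definition y_ (b : bool) : rep_hom E (queer_obj one S) := if b then qj1 one S <o> hom_runitV E else qj0 one S.
Definition x_ (b : bool) : rep_hom (queer_obj one S) E := if b then hom_runit E <o> qp1 one S else qp0 one S.
Definition sg : rep_hom (queer_obj one S) (queer_obj one S) := hom_sub (y_ false <o> x_ false) (y_ true <o> x_ true).
Hypothesis eta_sg : eta <oo> parity_aut D =m mor_of sg <oo> eta.

Lemma runitK : hom_runit E <o> hom_runitV E = 1%:M :> 'M_(_, _).
Proof. by apply: cV_ext => q; rewrite (hom_compE (hom_runit E)) runitVE runitE mxE eqxx scale1r mul1mx. Qed.
Lemma x_y b b' : x_ b <o> y_ b' = (b == b')%:R%:M :> 'M_(_, _).
Proof.
case: b b' => [] []; rewrite /x_ /y_.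
- transitivity (hom_runit E *m hom_mx (qp1 one S <o> qj1 one S) *m hom_runitV E); first by rewrite /= !mulmxA.
  by rewrite qp1_qj1 mulmx1; apply: runitK.
- transitivity (hom_runit E *m hom_mx (qp1 one S <o> qj0 one S)); first by rewrite /= !mulmxA.
  by rewrite qp1_qj0 mulmx0 raddf0.
- transitivity (hom_mx (qp0 one S <o> qj1 one S) *m hom_runitV E); first by rewrite /= !mulmxA.
  by rewrite qp0_qj1 mul0mx raddf0.
exact: qp0_qj0.
Qed.
Lemma y_x : hom_add (y_ false <o> x_ false) (y_ true <o> x_ true) = 1%:M :> 'M_(_, _).
Proof.
have rV : hom_runitV E *m hom_runit E = 1%:M.
  apply: (@tens_ext _ E one) => q c; rewrite -mulmxA runitE -scalemxAr runitVE -tvZr -cV1E mul1mx.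
  by [].
rewrite -[RHS](qj_qp one S) /=; congr (_ + _); rewrite -!mulmxA; congr (_ *m (_ *m _)).
by rewrite (mulmxA (hom_mx (hom_runitV E))) rV mul1mx.
Qed.
Lemma x_sg b : x_ b <o> sg = (if b then -1 else 1) *: hom_mx (x_ b) :> 'M_(_, _).
Proof.
transitivity (hom_mx (x_ b <o> y_ false) *m x_ false - hom_mx (x_ b <o> y_ true) *m x_ true).
  by rewrite /= mulmxBr !mulmxA.
by rewrite !x_y; case: b; rewrite /= ?mul1mx ?mul0mx ?raddf0 ?mul0mx ?subr0 ?sub0r ?scale1r ?scaleN1r.
Qed.
Lemma y_mult b b' (q q' : 'cV_(rep_dim E)) :
  queer_mult alpha1 S *m ((y_ b *m q) *# (y_ b' *m q')) = y_ (b (+) b') *m (end_comp S *m (q *# q')).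
Proof.
have yE c (w : 'cV_(rep_dim E)) : y_ c *m w = if c then qj1 one S *m (w *# 1%:M) else qj0 one S *m w.
  by case: c; rewrite // /y_ (hom_compE (qj1 one S)) runitVE.
rewrite !yE; case: b b' => [] []; rewrite ?q00 ?q01 ?q10 ?q11 //.
have a11 : (alpha1 *m ((1%:M : 'cV_(rep_dim one)) *# 1%:M)) 0 0 = 1 by rewrite lunitE !mxE ?eqxx ?mulr1 ?mul1r.
by rewrite a11 scale1r.
Qed.

Definition part b : ind K := if b then odd_part D else even_part D.
Definition incl b : mor (part b) A := if b as c return mor (part c) A then odd_incl D else even_incl D.
Definition prj b : mor A (part b) := if b as c return mor A (part c) then odd_proj D else even_proj D.
Definition ecM : mor (ind_tens (ind_of E) (ind_of E)) (ind_of E) :=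
  mor_map (X := ind_tens (ind_of E) (ind_of E)) (Y := ind_of E) (u := fun=> tt) (fun=> end_comp S).
(** With [ai_], the identification of each parity part of A with a copy of End(S). *)
Definition a_ b : mor (part b) (ind_of E) := mor_of (x_ b) <oo> eta <oo> incl b.
Definition ai_ b : mor (ind_of E) (part b) := prj b <oo> etai <oo> mor_of (y_ b).

Lemma point_of (X : rep K) (j : idx (ind_of X)) : j = tt. Proof. by case: j. Qed.
Lemma mor_of_id (X : rep K) (f : rep_hom X X) : hom_mx f = 1%:M -> mor_of f =m mor_id (ind_of X).
Proof. by move=> e; apply: meq_mx => -[] []; rewrite mor_ofE mor_idE. Qed.

(** The parity automorphism acts on the part b by one sign, and after [eta] the projection [x_ c]
    sees the other sign; the composite is thus its own opposite. *)
Lemma x_eta_incl b c : b != c -> mor_of (x_ c) <oo> eta <oo> incl b =m mor_zero _ _.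
Proof.
move=> bc; apply: meq_opp_eq0 => //.
have e1 : mor_of (x_ c) <oo> eta <oo> (parity_aut D <oo> incl b) =m
    if b then mor_opp (mor_of (x_ c) <oo> eta <oo> incl b) else mor_of (x_ c) <oo> eta <oo> incl b.
  case: (b); last by rewrite even_eigen.
  by rewrite odd_eigen mor_oppr.
have e2 : mor_of (x_ c) <oo> mor_of sg =m if c then mor_opp (mor_of (x_ c)) else mor_of (x_ c).
  rewrite mor_of_comp; apply: meq_mx => -[] []; rewrite mor_ofE x_sg.
  by case: (c); rewrite ?scaleN1r ?scale1r /= ?mor_ofE //; rewrite [in RHS]mor_ofE.
have e3 : mor_of (x_ c) <oo> eta <oo> (parity_aut D <oo> incl b) =m
    if c then mor_opp (mor_of (x_ c) <oo> eta <oo> incl b) else mor_of (x_ c) <oo> eta <oo> incl b.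
  rewrite mor_compA -(mor_compA (mor_of (x_ c))) eta_sg (mor_compA (mor_of (x_ c))) e2.
  by case: (c); rewrite ?mor_oppl.
move: e1 e3 bc; clear e2; case: b c => [] [] //= e1 e3 _; first by rewrite -e1 e3.
by rewrite -e3 e1.
Qed.

Lemma eta_incl b : eta <oo> incl b =m mor_of (y_ b) <oo> a_ b.
Proof.
have e : mor_add (mor_of (y_ false) <oo> mor_of (x_ false)) (mor_of (y_ true) <oo> mor_of (x_ true)) =m mor_id Q1.
  rewrite !mor_of_comp; apply: meq_mx => -[] []; rewrite [RHS](mor_idE (X := ind_of (queer_obj one S)) tt) -[RHS]y_x.
  transitivity (hom_mx (mor_of (y_ false <o> x_ false) tt tt) + hom_mx (mor_of (y_ true <o> x_ true) tt tt)); first by [].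
  by rewrite !mor_ofE.
rewrite -{1}(mor_compIdf eta) -e -mor_compA mor_addl -!mor_compA /a_ -!mor_compA.
case: b; rewrite [X in mor_of (x_ _) <oo> X]/= ?(mor_compA (mor_of (x_ false)) eta) ?(mor_compA (mor_of (x_ true)) eta).
  by rewrite (@x_eta_incl true false) // mor_zeror mor_0add.
by rewrite (@x_eta_incl false true) // mor_zeror mor_add0.
Qed.
Lemma incl_prj : mor_add (incl false <oo> prj false) (incl true <oo> prj true) =m mor_id A.
Proof. exact: (@parity_sum _ _ _ _ _ D). Qed.
Lemma a_prj b : a_ b <oo> prj b =m mor_of (x_ b) <oo> eta.
Proof.
rewrite -[X in _ =m X](mor_compfId (mor_of (x_ b) <oo> eta)) -incl_prj mor_addr !mor_compA /a_.
case: b.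
  by rewrite (@x_eta_incl false true) // mor_zerol mor_0add.
by rewrite (@x_eta_incl true false) // mor_zerol mor_add0.
Qed.
Lemma a_ai b : a_ b <oo> ai_ b =m mor_id (ind_of E).
Proof.
rewrite /ai_ !mor_compA a_prj -(mor_compA (mor_of (x_ b)) eta) etaiK mor_compfId mor_of_comp.
by apply: mor_of_id; rewrite x_y eqxx.
Qed.
Lemma ai_a b : ai_ b <oo> a_ b =m mor_id (part b).
Proof.
rewrite /ai_ -(mor_compA _ (mor_of (y_ b))) -eta_incl mor_compA -(mor_compA _ etai) etaK mor_compfId.
by case: b; [apply: odd_inclK | apply: even_inclK].
Qed.
Lemma y_multM b b' : alg_mult Q1 <oo> (mor_of (y_ b) <xx> mor_of (y_ b')) =m mor_of (y_ (b (+) b')) <oo> ecM.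
Proof.
have pt (j : unit * unit) : j = (tt, tt) by case: j => [[] []].
apply: meq_mx => -[[] []] []; rewrite (comp_point _ _ _ _ (j0 := (tt, tt) : idx (ind_tens (ind_of _) (ind_of _))) pt).
rewrite (comp_point _ _ _ _ (j0 := tt : idx (ind_of E)) (@point_of E)).
have m1 : alg_mult Q1 (tt, tt) tt = queer_mult alpha1 S :> 'M_(_, _).
  exact: (congr1 (@hom_mx _ _ _) (@mor_mapE K (ind_tens (ind_of _) (ind_of _)) (ind_of _) (fun=> tt) (fun=> queer_mult alpha1 S) (tt, tt))).
have m2 : ecM (tt, tt) tt = end_comp S :> 'M_(_, _).
  exact: (congr1 (@hom_mx _ _ _) (@mor_mapE K (ind_tens (ind_of _) (ind_of _)) (ind_of _) (fun=> tt) (fun=> end_comp S) (tt, tt))).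
transitivity (queer_mult alpha1 S *m hom_mx (y_ b <x> y_ b')).
  rewrite m1; congr (_ *m _); transitivity (hom_mx (mor_of (y_ b) tt tt) *t hom_mx (mor_of (y_ b') tt tt)); first by [].
  by rewrite !mor_ofE.
transitivity (y_ (b (+) b') *m hom_mx (end_comp S)); last by rewrite m2 mor_ofE.
apply: (@tens_ext _ E E) => q q'; rewrite -[LHS]mulmxA hom_tensE y_mult.
by rewrite -[RHS]mulmxA.
Qed.
(** Each of the four products of parity parts becomes composition in End(S); only the line
    distinguishes them in the twisted algebra. *)
Lemma a_mult b b' : a_ (b (+) b') <oo> (prj (b (+) b') <oo> alg_mult A <oo> (incl b <xx> incl b')) =m
  ecM <oo> (a_ b <xx> a_ b').
Proof.
have [_ em] := eta_alg.
rewrite !mor_compA a_prj -(mor_compA _ eta) em -!mor_compA -mor_tens_comp !eta_incl mor_tens_comp.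
rewrite (mor_compA (alg_mult Q1)) y_multM !mor_compA mor_of_comp.
rewrite (mor_of_id (f := x_ (b (+) b') <o> y_ (b (+) b'))) ?mor_compIdf //.
by rewrite x_y eqxx.
Qed.
Local Notation Psi := (ind_of psi).
Local Notation Qpsi := (queer_obj psi S).
Definition J0 : mor (ind_of E) QA := mor_of (qj0 psi S).
Definition J1 : mor (ind_tens (ind_of E) Psi) QA :=
  mor_map (X := ind_tens (ind_of E) Psi) (Y := ind_of Qpsi) (u := fun=> tt) (fun=> qj1 psi S).
Definition P0 : mor QA (ind_of E) := mor_of (qp0 psi S).
Definition P1 : mor QA (ind_tens (ind_of E) Psi) :=
  mor_map (X := ind_of Qpsi) (Y := ind_tens (ind_of E) Psi) (u := fun=> (tt, tt)) (fun=> qp1 psi S).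

Lemma pt2 (j : idx (ind_tens (ind_of E) Psi)) : j = (tt, tt). Proof. by case: j => [[] []]. Qed.
Lemma pt1 (j : idx QA) : j = tt. Proof. by case: j. Qed.
Lemma ptE (j : idx (ind_of E)) : j = tt. Proof. by case: j. Qed.
Lemma ptEE (j : idx (ind_tens (ind_of E) (ind_of E))) : j = (tt, tt). Proof. by case: j => [[] []]. Qed.
Lemma J0E : J0 tt tt = qj0 psi S :> 'M_(_, _). Proof. exact: mor_ofE. Qed.
Lemma P0E : P0 tt tt = qp0 psi S :> 'M_(_, _). Proof. exact: mor_ofE. Qed.
Lemma J1E : J1 (tt, tt) tt = qj1 psi S :> 'M_(_, _).
Proof. exact: (congr1 (@hom_mx _ _ _) (@mor_mapE K (ind_tens (ind_of E) Psi) (ind_of Qpsi) (fun=> tt) (fun=> qj1 psi S) (tt, tt))). Qed.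
Lemma P1E : P1 tt (tt, tt) = qp1 psi S :> 'M_(_, _).
Proof. exact: (congr1 (@hom_mx _ _ _) (@mor_mapE K (ind_of Qpsi) (ind_tens (ind_of E) Psi) (fun=> (tt, tt)) (fun=> qp1 psi S) tt)). Qed.

Lemma P0J0 : P0 <oo> J0 =m mor_id _.
Proof.
apply: meq_mx => -[] []; rewrite (comp_point _ _ _ _ pt1) J0E P0E (mor_idE (X := ind_of E) tt); exact: qp0_qj0.
Qed.
Lemma P0J1 : P0 <oo> J1 =m mor_zero _ _.
Proof. apply: meq_mx => -[[] []] []; rewrite (comp_point _ _ _ _ pt1) J1E P0E; exact: qp0_qj1. Qed.
Lemma P1J0 : P1 <oo> J0 =m mor_zero _ _.
Proof. apply: meq_mx => -[] [[] []]; rewrite (comp_point _ _ _ _ pt1) J0E P1E; exact: qp1_qj0. Qed.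
Lemma P1J1 : P1 <oo> J1 =m mor_id _.
Proof.
apply: meq_mx => -[[] []] [[] []]; rewrite (comp_point _ _ _ _ pt1) J1E P1E.
rewrite (mor_idE (X := ind_tens (ind_of E) Psi) (tt, tt)); exact: qp1_qj1.
Qed.
Lemma J_P : mor_add (J0 <oo> P0) (J1 <oo> P1) =m mor_id QA.
Proof.
apply: meq_mx => -[] []; rewrite (mor_idE (X := ind_of Qpsi) tt) -[RHS](qj_qp psi S).
transitivity (hom_mx ((J0 <oo> P0) tt tt) + hom_mx ((J1 <oo> P1) tt tt)); first by [].
by rewrite (comp_point _ _ _ _ ptE) (comp_point _ _ _ _ pt2) J0E P0E J1E P1E.
Qed.

Local Notation Ap := (part false).
Local Notation Am := (part true).
Definition F0 : mor Ap QA := J0 <oo> a_ false.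
Definition F1 : mor (ind_tens Am Psi) QA := J1 <oo> (a_ true <xx> mor_id Psi).
Definition twist_map : mor (ind_sum Ap (ind_tens Am Psi)) QA := mor_copair F0 F1.

Lemma F0_ai : F0 <oo> ai_ false =m J0.
Proof. by rewrite /F0 -mor_compA a_ai mor_compfId. Qed.
Lemma F1_ai : F1 <oo> (ai_ true <xx> mor_id Psi) =m J1.
Proof. by rewrite /F1 -mor_compA -mor_tens_comp a_ai mor_compfId mor_tens_id mor_compfId. Qed.
Lemma aiP_F0 : ai_ false <oo> P0 <oo> F0 =m mor_id _.
Proof. exact: (comp_mid P0J0 (ai_a (b := false))). Qed.
Lemma aiP_F1 : (ai_ true <xx> mor_id Psi) <oo> P1 <oo> F1 =m mor_id _.
Proof.
rewrite /F1 -!mor_compA (mor_compA P1) P1J1 mor_compIdf -mor_tens_comp ai_a mor_compfId.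
exact: mor_tens_id.
Qed.

Lemma twist_map_iso : mor_iso twist_map.
Proof.
apply: (copair_iso aiP_F0 aiP_F1 (comp_mid0 _ _ P0J1) (comp_mid0 _ _ P1J0)).
by rewrite (mor_compA F0) (mor_compA F1) F0_ai F1_ai J_P.
Qed.

Lemma maps_assoc (X Y W : ind K) i j l : maps_to (mor_assoc X Y W) (i := (i, j, l)) (j := (i, (j, l))) (hom_assoc (X i) (Y j) (W l)).
Proof. exact: (@maps_to_map K (ind_tens (ind_tens X Y) W) (ind_tens X (ind_tens Y W)) (fun i => (i.1.1, (i.1.2, i.2))) (fun i => hom_assoc _ _ _) (i, j, l)). Qed.
Lemma maps_assocV (X Y W : ind K) i j l : maps_to (mor_assocV X Y W) (i := (i, (j, l))) (j := (i, j, l)) (hom_assocV (X i) (Y j) (W l)).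
Proof. exact: (@maps_to_map K (ind_tens X (ind_tens Y W)) (ind_tens (ind_tens X Y) W) (fun i => (i.1, i.2.1, i.2.2)) (fun i => hom_assocV _ _ _) (i, (j, l))). Qed.
Lemma maps_braid (X Y : ind K) i j : maps_to (mor_braid X Y) (i := (i, j)) (j := (j, i)) (hom_braid (X i) (Y j)).
Proof. exact: (@maps_to_map K (ind_tens X Y) (ind_tens Y X) (fun i => (i.2, i.1)) (fun i => hom_braid _ _) (i, j)). Qed.
Lemma maps_runit (X : ind K) i : maps_to (mor_runit X) (i := (i, tt)) (j := i) (hom_runit (X i)).
Proof. exact: (@maps_to_map K (ind_tens X (ind_unit K)) X fst (fun i => hom_runit _) (i, tt)). Qed.

Lemma F0E i : F0 i tt = qj0 psi S *m a_ false i tt :> 'M_(_, _).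
Proof. by rewrite (comp_point _ _ _ _ ptE) J0E. Qed.
Lemma J1h (X : ind K) (h : mor X (ind_of E)) x : (J1 <oo> (h <xx> mor_id Psi)) (x, tt) tt = qj1 psi S *m (h x tt *t 1%:M) :> 'M_(_, _).
Proof.
rewrite (comp_point _ _ _ _ pt2) J1E; congr (_ *m _).
transitivity (hom_mx (h x tt) *t hom_mx (mor_id Psi tt tt)); first by [].
by rewrite (mor_idE (X := Psi) tt).
Qed.
Lemma multE (X Y : ind K) (f : mor X QA) (g : mor Y QA) i j :
  (alg_mult QA <oo> (f <xx> g)) (i, j) tt = queer_mult alpha S *m (f i tt *t g j tt) :> 'M_(_, _).
Proof.
have pt (l : idx (ind_tens QA QA)) : l = (tt, tt) by case: l => [[] []].
rewrite (comp_point _ _ _ _ pt); congr (_ *m _).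
exact: (congr1 (@hom_mx _ _ _) (@mor_mapE K (ind_tens (ind_of Qpsi) (ind_of Qpsi)) (ind_of Qpsi) (fun=> tt) (fun=> queer_mult alpha S) (tt, tt))).
Qed.
Lemma ecE b b' i j : (ecM <oo> (a_ b <xx> a_ b')) (i, j) tt = end_comp S *m (a_ b i tt *t a_ b' j tt) :> 'M_(_, _).
Proof.
rewrite (comp_point _ _ _ _ ptEE); congr (_ *m _).
exact: (congr1 (@hom_mx _ _ _) (@mor_mapE K (ind_tens (ind_of E) (ind_of E)) (ind_of E) (fun=> tt) (fun=> end_comp S) (tt, tt))).
Qed.

Definition mult_ b b' : mor (ind_tens (part b) (part b')) (part (b (+) b')) :=
  prj (b (+) b') <oo> alg_mult A <oo> (incl b <xx> incl b').

Lemma twist_pp : F0 <oo> mult_ false false =m alg_mult QA <oo> (F0 <xx> F0).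
Proof.
rewrite /F0 -mor_compA (a_mult (b := false) (b' := false)); apply: meq_mx => -[i j] [].
rewrite multE !F0E (comp_point _ _ _ _ ptE) J0E ecE; exact: c00.
Qed.

Lemma twist_pm : F1 <oo> ((mult_ false true <xx> mor_id Psi) <oo> mor_assocV Ap Am Psi) =m
  alg_mult QA <oo> (F0 <xx> F1).
Proof.
rewrite mor_compA /F1 -(mor_compA J1) -mor_tens_comp (a_mult (b := false) (b' := true)) mor_compfId.
apply: meq_mx => -[i [j []]] []; rewrite (comp_maps_to _ _ (maps_assocV _ _ _)) J1h ecE multE F0E J1h.
exact: c01.
Qed.

Lemma twist_mp : F1 <oo> ((mult_ true false <xx> mor_id Psi) <oo> mor_assocV Am Ap Psi
    <oo> (mor_id Am <xx> mor_braid Psi Ap) <oo> mor_assoc Am Psi Ap) =m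
  alg_mult QA <oo> (F1 <xx> F0).
Proof.
set br := _ <xx> mor_braid _ _; set aV := mor_assocV _ _ _; set as_ := mor_assoc _ _ _.
have -> : F1 <oo> ((mult_ true false <xx> mor_id Psi) <oo> aV <oo> br <oo> as_) =m
    (J1 <oo> ((ecM <oo> (a_ true <xx> a_ false)) <xx> mor_id Psi)) <oo> (aV <oo> (br <oo> as_)).
  exact: (comp_tens_reassoc _ _ _ _ (a_mult (b := true) (b' := false))).
apply: meq_mx => -[[i []] j] [].
have H := maps_to_comp (maps_to_comp (maps_assoc i (tt : idx Psi) j) (maps_to_tens (maps_to_id i) (maps_braid (X := Psi) (Y := even_part D) tt j)))
  (maps_assocV (X := odd_part D) (Y := even_part D) (W := Psi) i j tt).
rewrite (comp_maps_to _ _ H) J1h ecE multE F0E J1h.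
exact: c10.
Qed.

Let mor_alpha : mor (ind_tens Psi Psi) (ind_unit K) :=
  mor_map (X := ind_tens Psi Psi) (Y := ind_unit K) (u := fun=> tt) (fun=> alpha).

Definition mm_shuffle : mor (ind_tens (ind_tens Am Psi) (ind_tens Am Psi)) (ind_tens Am Am) :=
  mor_runit (ind_tens Am Am) <oo> ((mor_id (ind_tens Am Am) <xx> mor_alpha)
    <oo> (mor_assocV Am Am (ind_tens Psi Psi)
    <oo> ((mor_id Am <xx> (mor_assoc Am Psi Psi
                          <oo> (mor_braid Psi Am <xx> mor_id Psi)
                          <oo> mor_assocV Psi Am Psi))
    <oo> mor_assoc Am Psi (ind_tens Am Psi)))).

(** All structural isomorphisms in the product of two odd elements amount to sending (x s)(y t) to
    alpha(s, t) x y. Only this value is retained, not the matrix. *)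
Lemma mm_shuffle_to i j : exists2 h : 'M_(rep_dim (rep_tens (Am i) (Am j)), rep_dim (rep_tens (rep_tens (Am i) psi) (rep_tens (Am j) psi))),
  maps_to mm_shuffle (i := ((i, tt), (j, tt))) (j := (i, j)) h &
  forall (x : 'cV_(rep_dim (Am i))) (s : 'cV_(rep_dim psi)) (y : 'cV_(rep_dim (Am j))) (t : 'cV_(rep_dim psi)),
    h *m (x *# s *# (y *# t)) = (alpha *m (s *# t)) 0 0 *: (x *# y).
Proof.
have Ha := @maps_to_map K (ind_tens Psi Psi) (ind_unit K) (fun=> tt) (fun=> alpha) (tt, tt).
have H1 := maps_to_comp (maps_assocV (X := Psi) (Y := Am) (W := Psi) tt j tt)
   (maps_to_comp (maps_to_tens (maps_braid (X := Psi) (Y := Am) tt j) (maps_to_id (tt : idx Psi))) (maps_assoc (X := Am) (Y := Psi) (W := Psi) j tt tt)).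
have H2 := maps_to_comp (maps_assoc (X := Am) (Y := Psi) (W := ind_tens Am Psi) i tt (j, tt)) (maps_to_tens (maps_to_id i) H1).
have H3 := maps_to_comp H2 (maps_assocV (X := Am) (Y := Am) (W := ind_tens Psi Psi) i j (tt, tt)).
have H4 := maps_to_comp H3 (maps_to_tens (maps_to_id ((i, j) : idx (ind_tens Am Am))) Ha).
have H5 := maps_to_comp H4 (maps_runit (X := ind_tens Am Am) (i, j)).
eexists; first exact: H5.
move=> x s y t; rewrite -!mulmxA assocE mul_tens_tv mul1mx -!mulmxA assocVE mul_tens_tv braidE mul1mx assocE assocVE.
by rewrite mul_tens_tv mul1mx runitE.
Qed.

Lemma twist_mm : F0 <oo> (mult_ true true <oo> mm_shuffle) =m alg_mult QA <oo> (F1 <xx> F1).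
Proof.
rewrite mor_compA {1}/F0 -(mor_compA J0) (a_mult (b := true) (b' := true)); apply: meq_mx => -[[i []] [j []]] [].
have [h H hE] := mm_shuffle_to i j.
rewrite (comp_maps_to _ _ H) (comp_point _ _ _ _ ptE) J0E ecE multE /F1 !J1h.
exact: c11.
Qed.

Let inl_ := mor_inl Ap (ind_tens Am Psi).
Let inr_ := mor_inr Ap (ind_tens Am Psi).
Let prl_ := mor_prl Ap (ind_tens Am Psi).
Let prr_ := mor_prr Ap (ind_tens Am Psi).
Let tpm : mor (ind_tens Ap (ind_tens Am Psi)) (ind_tens Am Psi) :=
  (mult_ false true <xx> mor_id Psi) <oo> mor_assocV Ap Am Psi.
Let tmp : mor (ind_tens (ind_tens Am Psi) Ap) (ind_tens Am Psi) :=
  (mult_ true false <xx> mor_id Psi) <oo> mor_assocV Am Ap Psi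
    <oo> (mor_id Am <xx> mor_braid Psi Ap) <oo> mor_assoc Am Psi Ap.
Let tmm : mor (ind_tens (ind_tens Am Psi) (ind_tens Am Psi)) Ap :=
  mult_ true true <oo> mor_runit (ind_tens Am Am) <oo> (mor_id (ind_tens Am Am) <xx> mor_alpha)
    <oo> mor_assocV Am Am (ind_tens Psi Psi)
    <oo> (mor_id Am <xx> (mor_assoc Am Psi Psi
                          <oo> (mor_braid Psi Am <xx> mor_id Psi)
                          <oo> mor_assocV Psi Am Psi))
    <oo> mor_assoc Am Psi (ind_tens Am Psi).
(** Convertible with [twist_mult], but with the parts indexed by Booleans so that [a_mult] covers
    the four products at once. *)
Definition twist_mul : mor (ind_tens (ind_sum Ap (ind_tens Am Psi)) (ind_sum Ap (ind_tens Am Psi))) (ind_sum Ap (ind_tens Am Psi)) :=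
  mor_add (inl_ <oo> mor_add (mult_ false false <oo> (prl_ <xx> prl_)) (tmm <oo> (prr_ <xx> prr_)))
    (inr_ <oo> mor_add (tpm <oo> (prl_ <xx> prr_)) (tmp <oo> (prr_ <xx> prl_))).

Lemma mor_add4 (X Y : ind K) (a b c e : mor X Y) :
  mor_add (mor_add a b) (mor_add c e) =m mor_add (mor_add a c) (mor_add e b).
Proof. by apply: meq_mx => i j /=; rewrite addrACA [X in _ + X]addrC. Qed.

Lemma twist_map_mult : twist_map <oo> twist_mul =m alg_mult QA <oo> (twist_map <xx> twist_map).
Proof.
have E1 : twist_map <oo> twist_mul =m
   mor_add (mor_add (F0 <oo> mult_ false false <oo> (prl_ <xx> prl_)) (F0 <oo> tmm <oo> (prr_ <xx> prr_)))
     (mor_add (F1 <oo> tpm <oo> (prl_ <xx> prr_)) (F1 <oo> tmp <oo> (prr_ <xx> prl_))).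
  rewrite /twist_mul mor_addr (mor_compA twist_map inl_) (mor_compA twist_map inr_) /inl_ /inr_ copair_inl copair_inr.
  by rewrite !mor_addr !(mor_compA F0) !(mor_compA F1).
have E2 : alg_mult QA <oo> (twist_map <xx> twist_map) =m
   mor_add (mor_add (alg_mult QA <oo> (F0 <xx> F0) <oo> (prl_ <xx> prl_)) (alg_mult QA <oo> (F0 <xx> F1) <oo> (prl_ <xx> prr_)))
     (mor_add (alg_mult QA <oo> (F1 <xx> F0) <oo> (prr_ <xx> prl_)) (alg_mult QA <oo> (F1 <xx> F1) <oo> (prr_ <xx> prr_))).
  by rewrite /twist_map copair_add mor_tens_addl !mor_tens_addr !mor_tens_comp !mor_addr !(mor_compA (alg_mult QA)).
have mm : F0 <oo> tmm =m alg_mult QA <oo> (F1 <xx> F1).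
  rewrite -twist_mm /mm_shuffle /tmm; by rewrite !mor_compA.
by rewrite E1 E2 twist_pp mm twist_pm twist_mp mor_add4.
Qed.

Lemma twist_map_unit : twist_map <oo> (inl_ <oo> prj false <oo> alg_unit A) =m alg_unit QA.
Proof.
have [eu _] := eta_alg.
rewrite !mor_compA copair_inl /F0 -(mor_compA J0) a_prj -(mor_compA J0) -(mor_compA _ eta) eu.
apply: meq_mx => -[] []; rewrite (comp_point _ _ _ _ ptE) (comp_point (Y := Q1) _ _ _ _ (j0 := tt) (@point_of _)) J0E !mor_ofE.
apply: (@cV_ext K _ (rep_dim one)) => c; rewrite -(mulmxA (hom_mx (qj0 psi S))) -(mulmxA (hom_mx (x_ false))) !queer_unitE.
have e := qp0_qj0 one S; congr (_ *m _).
transitivity (hom_mx (qp0 one S <o> qj0 one S) *m (hom_coev S *m c)); first by rewrite [RHS]hom_compE.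
by rewrite e mul1mx.
Qed.

Theorem twist_iso : alg_isomorphic (twist_algebra alpha D) QA.
Proof.
exists twist_map; split; last exact: twist_map_iso.
by split; [exact: twist_map_unit | exact: twist_map_mult].
Qed.
End Twist.

(** * The parity automorphism under the multiplication maps *)

Section Parity.
Variables (K : closedFieldType) (V S : rep K) (gam : rep_hom (rep_tens V S) S).
Variables (U : rep K) (i : rep_hom U (rep_tens (unit_rep K) V)).
Local Notation one := (unit_rep K).
Local Notation alpha1 := (hom_lunit one).

Lemma tens_pow_opp n : tens_pow_hom (hom_opp (hom_id U)) n = (-1) ^+ n *: 1%:M :> 'M_(_, _).
Proof.
elim: n => [|n IHn]; first by rewrite expr0 scale1r.
transitivity (hom_mx (hom_opp (hom_id U)) *t hom_mx (tens_pow_hom (hom_opp (hom_id U)) n)); first by [].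
rewrite IHn; apply: (@tens_ext _ U (tens_pow U n)) => x y.
by rewrite mul_tens_tv hom_oppE hom_idE -!scalemxAl !mul1mx tvNl tvZr exprS mulN1r scaleNr.
Qed.

Lemma sg_qin : sg S = qin one S false *m qpr one S false - qin one S true *m qpr one S true :> 'M_(_, _).
Proof.
have e0 : hom_mx (y_ S false <o> x_ S false) = qin one S false *m qpr one S false.
  apply: cV_ext => z; rewrite (hom_compE (y_ S false)) [y_ _ _ *m _]qj0E -mulmxA; congr (_ *m _).
  by rewrite [qpr one S false *m z]hom_compE lunitVE.
have := y_x S; rewrite -[RHS](qin_qpr one S) /sg => e1.
have {e1} : hom_mx (y_ S false <o> x_ S false) + hom_mx (y_ S true <o> x_ S true) =
  qin one S false *m qpr one S false + qin one S true *m qpr one S true := e1.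
rewrite e0 => /addrI e1.
by transitivity (hom_mx (y_ S false <o> x_ S false) - hom_mx (y_ S true <o> x_ S true)); rewrite // e0 e1.
Qed.

(** On the n-th tensor power -id acts by (-1)^n, and [piU] lands in the summand whose parity is that
    of n, where [sg] is the same sign. *)
Lemma piU_parity n : piU alpha1 gam i n <o> tens_pow_hom (hom_opp (hom_id U)) n = sg S <o> piU alpha1 gam i n :> 'M_(_, _).
Proof.
transitivity ((-1) ^+ n *: hom_mx (piU alpha1 gam i n)).
  by rewrite /= tens_pow_opp -scalemxAr mulmx1.
pose w b := (hom_id (chib one b) <x> gam_prod gam n) <o> kappa_pow alpha1 i b n.
have pE : hom_mx (piU alpha1 gam i n) = qin one S false *m w false + qin one S true *m w true.
  by rewrite /piU /pib /w /= !mulmxA.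
have w0 b : odd n != b -> hom_mx (w b) = 0 by move=> ob; rewrite /w /= kappa_pow0 // mulmx0.
transitivity (hom_mx (sg S) *m hom_mx (piU alpha1 gam i n)); last by [].
have q1 b := qpr_qin one S b; have q0 b b' := @qpr_qin0 _ one S b b'.
have qq b b' : hom_mx (qin one S b) *m qpr one S b *m (qin one S b' *m w b') = if b == b' then qin one S b' *m w b' else 0.
  have [<-|bb] := eqVneq b b'.
    by rewrite -mulmxA (mulmxA (hom_mx (qpr one S b))) [X in _ *m (X *m _)](q1 b) mul1mx.
  by rewrite -mulmxA (mulmxA (hom_mx (qpr one S b))) [X in _ *m (X *m _)](q0 _ _ bb) mul0mx mulmx0.
have qff : hom_mx (qin one S false) *m qpr one S false *m (qin one S false *m w false) = qin one S false *m w false := qq false false.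
have qft : hom_mx (qin one S false) *m qpr one S false *m (qin one S true *m w true) = 0 := qq false true.
have qtf : hom_mx (qin one S true) *m qpr one S true *m (qin one S false *m w false) = 0 := qq true false.
have qtt : hom_mx (qin one S true) *m qpr one S true *m (qin one S true *m w true) = qin one S true *m w true := qq true true.
rewrite sg_qin pE mulmxBl !mulmxDr qff qft qtf qtt addr0 add0r.
rewrite -signr_odd; case: (boolP (odd n)) => on.
  by rewrite (w0 false) ?on // mulmx0 !add0r expr1 scaleN1r.
by rewrite (w0 true) ?(negPf on) // mulmx0 addr0 subr0 expr0 scale1r.
Qed.
End Parity.

Lemma scalar_char (K : closedFieldType) (p i : nat) :
  p \in [pchar K] -> (0 < i < p)%N -> i%:R != 0 :> K.
Proof. by move=> charK /andP[i0 ip]; rewrite -(dvdn_pcharf charK) gtnNdvd. Qed.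

(** If B were 0, the identity of U would be negligible, contradicting that its trace dim U is not
    0. *)
Lemma nondegenerate_neq0 (K : closedFieldType) (U : rep K) (B : rep_hom (rep_tens U U) (unit_rep K)) :
  (rep_dim U)%:R != 0 :> K -> nondegenerate_pairing B -> hom_mx B != 0.
Proof.
move=> dU [g [Bg _]]; apply: contraNneq dU => B0.
have /heq_tr/(_ (hom_id U)) := Bg; rewrite /= B0 tens0mx !mul0mx mulmx0 mul0mx mulmx1 mxtrace0 mxtrace1.
by move=> <-.
Qed.

Lemma conj_invK (K : fieldType) n q (i : 'M[K]_(n, q)) (t : 'M_(q, n)) (f : 'M_n) :
  i *m t = 1%:M -> i *m (t *m f *m i) *m t = f.
Proof. by move=> it; rewrite !mulmxA it mul1mx -mulmxA it mulmx1. Qed.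

(** * The two isomorphisms in terms of symmetric powers *)

Section Assembly.
Variables (K : closedFieldType) (p m : nat).
Hypothesis charK : p \in [pchar K].
Hypothesis mp : (m.*2.+2 < p)%N.
Variable phi : principal_hom K m.
Local Notation S := (spin_obj phi).
Local Notation one := (unit_rep K).

Lemma char_two : 2%:R != 0 :> K.
Proof. by apply: (scalar_char charK); apply: leq_ltn_trans mp. Qed.

Lemma sym_inverse n : (n < p)%N -> exists G' : rep_hom (sym_rep K n) (dual_rep (sym_rep K n)), G' *m gram K n = 1%:M.
Proof.
move=> np; have [f fK] := gram_linv charK np.
by have [G' [G'K _]] := hom_inverse (i := gram K n) (rank_linv fK) erefl; exists G'.
Qed.

(** The line is Sym^(p-2), of odd highest weight, so its form is skew and eps = -1; the relation 1 +
    eps c is then the Weyl relation. *)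
Lemma weyl_queer n (nE : (m.*2 + n).+2 = p)
    (alpha : rep_hom (rep_tens (sym_rep K (m.*2 + n)) (sym_rep K (m.*2 + n))) one) (alpha_iso : hom_iso alpha)
    (B : rep_hom (rep_tens (sym_rep K n) (sym_rep K n)) one) (B_nondeg : nondegenerate_pairing B) (A : weyl_algebra B) :
  odd (m.*2 + n) -> alg_isomorphic A (queer_algebra alpha S).
Proof.
move=> oddP; have two := char_two; have [im im2] := sqrt_exists (- 1 : K).
have np : (n < p)%N by lia.
have Mp : (m.*2 < p)%N by lia.
have Pp : (m.*2 + n < p)%N by lia.
have [alpha' [alpha'K aa]] := alpha_iso.
have alphaK : alpha *m alpha' = 1%:M by exact: (heq_unit aa).
have alphaC : alpha <o> hom_braid _ _ = (-1) *: hom_mx alpha :> 'M_(_, _).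
  by rewrite (sym_form_braid charK Pp) -signr_odd oddP expr1.
have orth := vec_orth two im2 phi.
have [T' [TK TK2]] := inter_inv charK Mp two im2 phi.
have [G' G'K] := sym_inverse Pp; have [G'M G'MK] := sym_inverse Mp.
have dimP : (m.*2 + n).+1%:R != 0 :> K by apply: (scalar_char charK); lia.
have dimV : (m.*2.+1)%:R != 0 :> K by apply: (scalar_char charK); lia.
have dimL : (n.+1)%:R != 0 :> K by apply: (scalar_char charK); lia.
have endV (f : rep_hom (vec_rep two im2 phi) (vec_rep two im2 phi)) : exists c, hom_mx f = c%:M.
  have [c Ec] := sym_rep_end (T' <o> f <o> inter charK Mp two im2 phi).
  exists c; rewrite -(conj_invK (hom_mx f) TK2).
  have -> : T' *m hom_mx f *m inter charK Mp two im2 phi = c%:M := Ec.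
  by rewrite mul_mx_scalar -scalemxAl TK2 scalemx1.
(* The sum of the highest weights 2m of V and n of L is p - 2, so the multiplication lands in the
   line. *)
have [r0 [i0 ri0]] := sym_line orth G'K TK2 G'MK dimP dimV.
have ir0 := line_idem alpha'K dimP endV ri0 (dimL : (rep_dim (sym_rep K n))%:R != 0).
have B0 := nondegenerate_neq0 (dimL : (rep_dim (sym_rep K n))%:R != 0) B_nondeg.
have [r [i [ri ir formB]]] := rescale_form alphaK orth two dimV (fun b => sym_form charK np b B0) ri0 ir0.
have charN (j : nat) : (0 < j <= (rep_dim (vec_rep two im2 phi)).+1)%N -> j%:R != 0 :> K.
  by move=> /= jN; apply: (scalar_char charK); lia.
have oddN : odd (rep_dim (vec_rep two im2 phi)) by rewrite /= odd_double.
have eps2 : (-1) * (-1) = 1 :> K by rewrite mulrNN mulr1.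
have relE : hom_mx (hom_sub (hom_id (rep_tens (sym_rep K n) (sym_rep K n))) (hom_braid (sym_rep K n) (sym_rep K n))) =
   1%:M + (-1) *: hom_mx (hom_braid _ _) by rewrite scaleN1r.
have [eta [alg_eta _] [e1 e2]] := twisted_iso alphaK alpha'K eps2 alphaC (@gam_cliff K m two im im2 phi)
  charN oddN (spin_dim_neq0 m two) (@gam_gen K m two im im2 phi) ri ir formB relE A (sym_tens_ver charK np).
by exists eta; split=> //; eexists; split; [exact: e1 | exact: e2].
Qed.

(** The general isomorphism applies with the unit line and eps = 1; to twist it, it must carry the
    parity automorphism of [A] to [sg]. *)
Lemma clifford_queer (psi : rep K) (alpha : rep_hom (rep_tens psi psi) one)
    (B : rep_hom (rep_tens (sym_rep K m.*2) (sym_rep K m.*2)) one) (B_nondeg : nondegenerate_pairing B)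
    (A : clifford_algebra B) (D : parity_decomposition A) :
  alg_isomorphic (twist_algebra alpha D) (queer_algebra alpha S).
Proof.
have two := char_two; have [im im2] := sqrt_exists (- 1 : K).
have Mp : (m.*2 < p)%N by lia.
have orth := vec_orth two im2 phi.
have [T' [TK TK2]] := inter_inv charK Mp two im2 phi.
have dimV : (m.*2.+1)%:R != 0 :> K by apply: (scalar_char charK); lia.
pose V := vec_rep two im2 phi; pose alpha1 := hom_lunit one; pose alpha1' := lunitV one.
have alphaK : alpha1 *m alpha1' = 1%:M.
  apply: (@cV_ext K _ (rep_dim one)) => c; rewrite -mulmxA lunitVE [alpha1 *m _]lunitE mul1mx mxE eqxx.
  exact: scale1r.
have alpha'K : alpha1' <o> alpha1 === hom_id _.
  apply: heq_mx; apply: (@tens_ext _ one one) => c e.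
  by rewrite hom_compE [alpha1 *m _]lunitE -scalemxAr lunitVE -tvZl -cV1E hom_idE.
have alphaC : alpha1 <o> hom_braid one one = 1 *: hom_mx alpha1 :> 'M_(_, _).
  apply: (@tens_ext _ one one) => c e; rewrite scale1r hom_compE braidE [LHS]lunitE [RHS]lunitE.
  by rewrite (cV1E c) (cV1E e) !mxE !scalerA !eqxx !mulr1 mulrC.
pose r0 : rep_hom (rep_tens one V) (sym_rep K m.*2) := T' <o> hom_lunit V.
pose i0 : rep_hom (sym_rep K m.*2) (rep_tens one V) := lunitV V <o> inter charK Mp two im2 phi.
have lK : hom_lunit V *m lunitV V = 1%:M.
  by apply: (@cV_ext K _ (rep_dim V)) => x; rewrite -mulmxA lunitVE lunitE mul1mx mxE eqxx scale1r.
have Kl : lunitV V *m hom_lunit V = 1%:M.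
  apply: (@tens_ext _ one V) => c x; rewrite -mulmxA lunitE -scalemxAr lunitVE -tvZl -cV1E mul1mx.
  by [].
have ri0 : r0 *m i0 = 1%:M.
  have -> : r0 *m i0 = T' *m (hom_lunit V *m lunitV V) *m inter charK Mp two im2 phi by rewrite /r0 /i0 [LHS]mulmxA -!(mulmxA (hom_mx T')).
  by rewrite lK mulmx1 TK.
have ir0 : i0 <o> r0 === hom_id _.
  apply: heq_mx; transitivity (lunitV V *m (inter charK Mp two im2 phi *m T') *m hom_lunit V).
    by rewrite [LHS]mulmxA -!(mulmxA (hom_mx (lunitV V))).
  by rewrite TK2 mulmx1 Kl.
have B0 := nondegenerate_neq0 (dimV : (rep_dim (sym_rep K m.*2))%:R != 0) B_nondeg.
have [r [i [ri ir formB]]] := rescale_form alphaK orth two dimV (fun b => sym_form charK Mp b B0) ri0 ir0.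
have charN (j : nat) : (0 < j <= (rep_dim (vec_rep two im2 phi)).+1)%N -> j%:R != 0 :> K.
  by move=> /= jN; apply: (scalar_char charK); lia.
have oddN : odd (rep_dim (vec_rep two im2 phi)) by rewrite /= odd_double.
have eps2 : 1 * 1 = 1 :> K by rewrite mulr1.
have relE : hom_mx (hom_add (hom_id (rep_tens (sym_rep K m.*2) (sym_rep K m.*2))) (hom_braid (sym_rep K m.*2) (sym_rep K m.*2))) =
   1%:M + 1 *: hom_mx (hom_braid _ _) by rewrite scale1r.
have [eta [alg_eta etaP] [e1 e2]] := twisted_iso alphaK alpha'K eps2 alphaC (@gam_cliff K m two im im2 phi)
  charN oddN (spin_dim_neq0 m two) (@gam_gen K m two im im2 phi) ri ir formB relE A (sym_tens_ver charK Mp).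
apply: (twist_iso alpha two (eta := eta) alg_eta e1 e2).
(* Compatibility with parity is checked on T(U), degree by degree; the projection to [A] is then
   cancelled, being split by the composite of [eta] and the section. *)
have E3 : eta <oo> parity_aut D <oo> quot_proj A =m mor_of (sg S) <oo> eta <oo> quot_proj A.
  rewrite -!mor_compA etaP (@parity_autP _ _ _ _ _ D) mor_compA etaP.
  apply: meq_mx => n [].
  rewrite (comp_maps_to _ _ (@maps_to_map K (tens_ind _) (tens_ind _) id (tens_pow_hom _) n)).
  rewrite (comp_maps_to _ _ (piM_to alpha1 (gam_hom two im2 phi) i n)) mor_ofE.
  have [_ pE] := piM_to alpha1 (gam_hom two im2 phi) i n.
  transitivity (hom_mx (piU alpha1 (gam_hom two im2 phi) i n) *m
    hom_mx (tens_pow_hom (hom_opp (hom_id (sym_rep K m.*2))) n)); first by congr (_ *m _); exact: pE.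
  transitivity (hom_mx (sg S) *m hom_mx (piU alpha1 (gam_hom two im2 phi) i n)); first exact: piU_parity.
  by congr (_ *m _); first [exact: (esym (mor_ofE _)) | symmetry; exact: mor_ofE | exact: mor_ofE].
move: e1; set sM := secM _ _ _ _ _ => e1.
rewrite -(mor_compfId (eta <oo> _)) -(mor_compfId (mor_of _ <oo> eta)) -e1 !mor_compA E3.
by [].
Qed.
End Assembly.

Theorem proposition3p8 (K : closedFieldType) (p : nat)
    (charK : p \in [pchar K]) (p_gt2 : (2 < p)%N)
    (k : nat) (k_range : (1 <= k <= p.-1./2)%N)
    (psi : rep K) (def_psi : psi = simple_obj K p.-1)
    (alpha : rep_hom (rep_tens psi psi) (unit_rep K)) (alpha_iso : hom_iso alpha)
    (phi : principal_hom K k.-1)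
    (S : rep K) (def_S : S = spin_obj phi)
    (L : rep K) (def_L : L = simple_obj K (p - 2 * k + 1)%N)
    (B : rep_hom (rep_tens L L) (unit_rep K))
    (B_nondeg : nondegenerate_pairing B) (B_skew : skew_pairing B)
    (L' : rep K) (def_L' : L' = simple_obj K (2 * k - 1)%N)
    (B' : rep_hom (rep_tens L' L') (unit_rep K))
    (B'_nondeg : nondegenerate_pairing B') (B'_sym : symmetric_pairing B')
    (A : weyl_algebra B) (A' : clifford_algebra B')
    (D : parity_decomposition A') :
  alg_isomorphic A (queer_algebra alpha S) /\
  alg_isomorphic (twist_algebra alpha D) (queer_algebra alpha S).
Proof.
have pr := pcharf_prime charK.
have podd : odd p by case/even_prime: pr p_gt2 => [->|].
move: k_range => /andP[k1 kp].
have kp2 : (2 * k < p)%N by move: kp p_gt2; rewrite -divn2; lia.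
(* With m = k - 1 this is N + 1 = 2k < p, the bound under which all the integers up to N + 1 are
   invertible. *)
have m2 : (k.-1.*2.+2 < p)%N by lia.
(* psi is Sym^(p-2) and L is Sym^n with n = p - 2k, so the weights add up as p - 2 = 2(k - 1) +
   n. *)
have e1 : p.-1.-1 = (k.-1.*2 + (p - 2 * k))%N by lia.
have e2 : (p - 2 * k + 1).-1 = (p - 2 * k)%N by rewrite addn1.
have e3 : (2 * k - 1).-1 = k.-1.*2 by lia.
rewrite /simple_obj e1 in def_psi; rewrite /simple_obj e2 in def_L; rewrite /simple_obj e3 in def_L'.
subst psi S L L'; split; last exact: (clifford_queer charK m2 phi alpha B'_nondeg D).
apply: (weyl_queer charK m2 phi _ alpha_iso B_nondeg A); last by rewrite -e1; move: podd; lia.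
by lia.
Qed.
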